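(* Let $E$ be a real or complex infinite-dimensional separable Banach space of stable type $\alpha \in (0,2]$. Let $(T_s)_{s \geq 0}$ be a $\mathcal{C}_0$-semigroup of operators on $E$. Suppose that there exists a family $(u_t)_{t \in \mathbb{R}}$ in $E$, with $t \mapsto u_t$ in $L^\alpha(\mathbb{R};E)$, such that $T_s u_t = u_{t-s}$ for every $t \in \mathbb{R}$ and $s \geq 0$. Assume moreover that $\operatorname{span}\{ u_t : t \in \mathbb{R} \setminus N \}$ is dense in $E$ for every Borel subset $N \subset \mathbb{R}$ with $m(N) = 0$, where $m$ is the Lebesgue measure. Let $M$ be either a real symmetric $\alpha$-stable random measure on $(\mathbb{R},\mathcal{B}_{\mathbb{R}})$ if $E$ is real, or a complex isotropic $\alpha$-stable random measure on $(\mathbb{R},\mathcal{B}_{\mathbb{R}})$ if $E$ is complex, with the Lebesgue measure $m$ as control measure. Then the distribution of the $E$-valued random vector $$v:= \int_{\mathbb{R}} u_t \, M(dt)$$ is invariant and strongly mixing with full support under $(T_s)_{s \geq 0}$, and $v$ is a symmetric $\alpha$-stable random vector in $E$.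
   Context: All random variables are defined on a suitable probability space $(\Omega,\mathcal{F},\mathbb{P})$. Random measures. Let $(J,\Sigma,m)$ be a $\sigma$-finite measure space and $\Sigma_0=\{A\in\Sigma: m(A)<\infty\}$. A real (complex) random measure on it is a map $M$ from $\Sigma_0$ to real (complex) random variables such that $M(A_1),\dots,M(A_n)$ are independent for pairwise disjoint $A_1,\dots,A_n\in\Sigma_0$, and for pairwise disjoint $(A_k)_{k\ge1}\subset\Sigma_0$ with $\bigcup_k A_k\in\Sigma_0$ the series $\sum_k M(A_k)$ converges in probability and equals $M(\bigcup_k A_k)$ a.s. It is real symmetric $\alpha$-stable with control measure $m$ if it is real and $\mathbb{E}(e^{itM(A)})=\exp(-m(A)|t|^\alpha)$ for all $A\in\Sigma_0$, $t\in\mathbb{R}$. It is complex isotropic $\alpha$-stable with control measure $m$ if it is complex and $\mathbb{E}(e^{i(\theta_1\operatorname{Re}M(A)+\theta_2\operatorname{Im}M(A))})=\exp\left(-m(A)\int_{\mathbb{S}_2}|\theta_1 s_1+\theta_2 s_2|^\alpha\gamma(ds)\right)$ for all $A\in\Sigma_0$, $\theta_1,\theta_2\in\mathbb{R}$, where $\gamma$ is the uniform probability measure on the unit circle $\mathbb{S}_2\subset \mathbb{R}^2$. Stable type. $E$ is of stable type $\alpha\in(0,2]$ if for every sequence $(x_n)_{n\ge1}$ in $E$ with $\sum_n\|x_n\|^\alpha<\infty$ the series $\sum_n\theta_n x_n$ converges a.s. in $E$, where $(\theta_n)$ are i.i.d. real random variables with $\mathbb{E}(e^{it\theta_n})=\exp(-|t|^\alpha)$.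 Integral. $L^\alpha(J;E)$ is the space of measurable $f:J\to E$ with $\int_J\|f\|^\alpha dm<\infty$. If $E$ is of stable type $\alpha$, put $\int_J f\,dM=\sum_j x_jM(A_j)$ for a simple function $f=\sum_{j=1}^n x_j\mathbf{1}_{A_j}$ ($x_j\in E$, $A_j\in\Sigma_0$ disjoint); for general $f\in L^\alpha(J;E)$, $\int_J f\,dM$ is the limit in $L^q(\Omega;E)$, $0<q<\alpha$ (hence in probability), of $\int_J f_n\,dM$ for any simple $f_n\to f$ in $L^\alpha(J;E)$. Stable vectors. An $E$-valued random vector $X$ is $\alpha$-stable if for all $a,b>0$ there is $z\in E$ such that $aX^{(1)}+bX^{(2)}$ has the same distribution as $z+(a^\alpha+b^\alpha)^{1/\alpha}X$, with $X^{(1)},X^{(2)}$ independent copies of $X$; it is symmetric $\alpha$-stable if moreover $X$ and $-X$ have the same distribution. Dynamics. A Borel probability measure $\mu$ on $E$ is invariant under $(T_s)_{s\ge0}$ if $\mu(T_s^{-1}(A))=\mu(A)$ for all Borel $A$ and $s\ge0$; an invariant $\mu$ is strongly mixing if $\lim_{s\to\infty}\mu(A\cap T_s^{-1}(B))=\mu(A)\mu(B)$ for all Borel $A,B$; $\mu$ has full support if $\mu(U)>0$ for every nonempty open $U\subset E$. *)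

(* Defs.v *)
From HB Require Import structures.
From mathcomp Require Import all_boot all_order all_algebra.
From mathcomp Require Import complex.
From mathcomp Require Import all_classical all_reals all_analysis.
From mathcomp Require Import measurable_realfun.

Set Implicit Arguments.
Unset Strict Implicit.
Unset Printing Implicit Defensive.

Import Order.TTheory GRing.Theory Num.Theory.
Import numFieldNormedType.Exports.

Local Open Scope classical_set_scope.
Local Open Scope ring_scope.

Variant scalar_kind := RealScalars | ComplexScalars.

Definition scalar_field (R : realType) (k : scalar_kind) : numFieldType :=
  match k with
  | RealScalars => R
  | ComplexScalars => R[i]
  end.

Definition scalar_of_real (R : realType) (k : scalar_kind) : R -> scalar_field R k :=
  match k with
  | RealScalars => fun x => x
  | ComplexScalars => fun x => (x%:C)%C
  end.

Definition scalar_Re (R : realType) (k : scalar_kind) : scalar_field R k -> R :=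
  match k with
  | RealScalars => fun z => z
  | ComplexScalars => fun z => complex.Re z
  end.

(* The library norm of a space over R[i] takes its values in R[i], where it is
   real and nonnegative; rnorm is the corresponding real number. *)
Definition rnorm (R : realType) (k : scalar_kind)
  (V : normedZmodType (scalar_field R k)) (x : V) : R := scalar_Re `|x|.

Notation borelType T := (g_sigma_algebraType (@open T)).

Section BanachSpaces.
Context (R : realType) (k : scalar_kind).
Local Notation K := (scalar_field R k).
Implicit Type E : completeNormedModType K.

Definition separable_space (T : topologicalType) : Prop :=
  exists2 D : set T, countable D & dense D.

Definition linear_span E (S : set E) : set E :=
  [set x | exists (n : nat) (c : 'I_n -> K) (y : 'I_n -> E),
     (forall i, S (y i)) /\ x = \sum_(i < n) c i *: y i].

Definition infinite_dimensional E : Prop :=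
  forall S : set E, finite_set S -> linear_span S <> [set: E].

(* The values T s with s < 0 are junk: no condition is imposed on them. *)
Definition C0_semigroup E (T : R -> {linear E -> E}) : Prop :=
  [/\ forall s, 0 <= s -> continuous (T s),
      forall x, T 0 x = x,
      forall s t, 0 <= s -> 0 <= t -> forall x, T (s + t) x = T s (T t x)
    & forall x, T s x @[s --> 0^'+] --> x].

End BanachSpaces.

Section Probability.
Context (R : realType) d (Omega : measurableType d) (P : probability Omega R).

Definition mutually_independent (I : eqType) d' (T : measurableType d')
    (X : I -> Omega -> T) : Prop :=
  forall (s : seq I) (B : I -> set T), uniq s ->
    (forall i, measurable (B i)) ->
    P (\big[setI/setT]_(i <- s) (X i @^-1` B i)) =
    (\prod_(i <- s) P (X i @^-1` B i))%E.

(* E(e^{iY}) *)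
Definition expectation_expi (Y : Omega -> R) : R[i] :=
  Complex (\int[P]_w cos (Y w)) (\int[P]_w sin (Y w)).

Definition cvg_in_probability (k : scalar_kind)
    (V : normedZmodType (scalar_field R k)) (X : nat -> Omega -> V) (Y : Omega -> V) :
    Prop :=
  forall eps : R, 0 < eps ->
    P [set w | eps <= rnorm (X n w - Y w)] @[n --> \oo] --> 0%E.

End Probability.

Definition stable_type (R : realType) (k : scalar_kind) (alpha : R)
    (E : completeNormedModType (scalar_field R k)) : Prop :=
  forall x : nat -> E,
    (\sum_(0 <= n <oo) (rnorm (x n) `^ alpha)%:E < +oo)%E ->
  forall d (Omega : measurableType d) (P : probability Omega R)
    (theta : nat -> {RV P >-> R}),
    mutually_independent P (fun n => theta n : Omega -> R) ->
    (forall n t, expectation_expi P (fun w => t * theta n w) =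
       (expR (- `|t| `^ alpha))%:C%C) ->
    {ae P, forall w,
       cvgn (fun n => \sum_(j < n) scalar_of_real k (theta j w) *: x j)}.

Section CircleMeasure.
Context (R : realType).

Definition circle_point (phi : measurableTypeR R) :
  measurableTypeR R * measurableTypeR R := (cos phi, sin phi).

Lemma measurable_circle_point : measurable_fun setT circle_point.
Proof.
apply: measurable_fun_pair.
- apply: continuous_measurable_fun; exact: continuous_cos.
- apply: continuous_measurable_fun; exact: continuous_sin.
Qed.

HB.instance Definition _ := @isMeasurableFun.Build _ _ _ _ circle_point
  measurable_circle_point.

Lemma two_pi_gt0 : (0 : R) < 2 * pi.
Proof. by rewrite mulr_gt0 // pi_gt0. Qed.

Definition circle_uniform :
    probability (measurableTypeR R * measurableTypeR R)%type R :=
  distribution (uniform_prob two_pi_gt0) circle_point.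

End CircleMeasure.

Section RandomMeasures.
Context (R : realType) d (Omega : measurableType d) (P : probability Omega R).
Context d' (J : measurableType d') (m : {measure set J -> \bar R}).

Definition finite_measure_set (A : set J) : Prop :=
  measurable A /\ (m A < +oo)%E.

Definition random_measure (k : scalar_kind)
    (M : set J -> Omega -> scalar_field R k) : Prop :=
  [/\ forall A, finite_measure_set A ->
        measurable_fun setT (M A : Omega -> borelType (scalar_field R k)),
      forall (n : nat) (A : 'I_n -> set J),
        (forall i, finite_measure_set (A i)) -> trivIset setT A ->
        mutually_independent P
          (fun i => M (A i) : Omega -> borelType (scalar_field R k))
    & forall A : nat -> set J,
        (forall i, finite_measure_set (A i)) -> trivIset setT A ->
        finite_measure_set (\bigcup_i A i) ->
        cvg_in_probability P (fun n w => \sum_(i < n) M (A i) w)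
          (M (\bigcup_i A i))].

Definition real_symmetric_stable_measure (alpha : R)
    (M : set J -> Omega -> scalar_field R RealScalars) : Prop :=
  random_measure M /\
  forall A, finite_measure_set A -> forall t : R,
    expectation_expi P (fun w => t * (M A w : R)) =
    (expR (- (fine (m A) * `|t| `^ alpha)))%:C%C.

Definition complex_isotropic_stable_measure (alpha : R)
    (M : set J -> Omega -> scalar_field R ComplexScalars) : Prop :=
  random_measure M /\
  forall A, finite_measure_set A -> forall t1 t2 : R,
    expectation_expi P
      (fun w => t1 * complex.Re (M A w) + t2 * complex.Im (M A w)) =
    (expR (- (fine (m A) *
      \int[@circle_uniform R]_s `|t1 * s.1 + t2 * s.2| `^ alpha)))%:C%C.

Definition stable_random_measure (k : scalar_kind) (alpha : R) :
    (set J -> Omega -> scalar_field R k) -> Prop :=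
  match k with
  | RealScalars => @real_symmetric_stable_measure alpha
  | ComplexScalars => @complex_isotropic_stable_measure alpha
  end.

Section Integral.
Context (k : scalar_kind) (E : completeNormedModType (scalar_field R k)).

(* A presentation sum_j x_j 1_{A_j} of a simple function. *)
Record simple_function := SimpleFunction {
  sf_size : nat;
  sf_val : 'I_sf_size -> E;
  sf_set : 'I_sf_size -> set J;
  sf_fin : forall j, finite_measure_set (sf_set j);
  sf_disj : trivIset setT sf_set }.

Definition sf_eval (f : simple_function) (t : J) : E :=
  \sum_(j < sf_size f) (\1_(sf_set j) t : scalar_field R k) *: sf_val j.

Definition sf_integral (M : set J -> Omega -> scalar_field R k)
    (f : simple_function) (w : Omega) : E :=
  \sum_(j < sf_size f) M (sf_set j) w *: sf_val j.

Definition in_Lspace (alpha : R) (f : J -> E) : Prop :=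
  measurable_fun setT (f : J -> borelType E) /\
  (\int[m]_t (rnorm (f t) `^ alpha)%:E < +oo)%E.

Definition is_stable_integral (alpha : R)
    (M : set J -> Omega -> scalar_field R k) (f : J -> E)
    (v : {RV P >-> borelType E}) : Prop :=
  forall phi : nat -> simple_function,
    (\int[m]_t (rnorm (sf_eval (phi n) t - f t) `^ alpha)%:E)%E
      @[n --> \oo] --> 0%E ->
  forall q : R, 0 < q < alpha ->
    (\int[P]_w (rnorm (sf_integral M (phi n) w - (v w : E)) `^ q)%:E)%E
      @[n --> \oo] --> 0%E.

(* The integral of f with respect to M, which is determined up to almost sure
   equality; the value is 0 when there is no limit. *)
Definition stable_integral (alpha : R)
    (M : set J -> Omega -> scalar_field R k) (f : J -> E) : {RV P >-> borelType E} :=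
  xget (cst (0 : E) : {mfun Omega >-> borelType E})
    [set v | is_stable_integral alpha M f v].

End Integral.
End RandomMeasures.

Section StableVectors.
Context (R : realType) (k : scalar_kind).
Context (E : completeNormedModType (scalar_field R k)).
Context d (Omega : measurableType d) (P : probability Omega R).

Definition same_distribution d1 (O1 : measurableType d1)
    (P1 : probability O1 R) d2 (O2 : measurableType d2)
    (P2 : probability O2 R) (X : O1 -> E) (Y : O2 -> E) : Prop :=
  forall B : set (borelType E), measurable B ->
    P1 (X @^-1` B) = P2 (Y @^-1` B).

Definition stable_vector (alpha : R) (X : {RV P >-> borelType E}) : Prop :=
  forall a b : R, 0 < a -> 0 < b -> exists z : E,
  forall d' (O' : measurableType d') (P' : probability O' R)
    (X' : bool -> {RV P' >-> borelType E}),
    mutually_independent P' (fun i => X' i : O' -> borelType E) ->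
    (forall i, same_distribution P' P (X' i) X) ->
    same_distribution P' P
      (fun w => scalar_of_real k a *: (X' false w : E) +
                scalar_of_real k b *: (X' true w : E))
      (fun w => z + scalar_of_real k ((a `^ alpha + b `^ alpha) `^ alpha^-1)
                    *: (X w : E)).

Definition symmetric_stable_vector (alpha : R)
    (X : {RV P >-> borelType E}) : Prop :=
  stable_vector alpha X /\
  same_distribution P P (X : Omega -> E) (fun w => - (X w : E)).

End StableVectors.

Section Dynamics.
Context (R : realType) (k : scalar_kind).
Context (E : completeNormedModType (scalar_field R k)).
Implicit Types (T : R -> {linear E -> E}) (mu : probability (borelType E) R).

Definition invariant_measure T mu : Prop :=
  forall (A : set (borelType E)) s, measurable A -> 0 <= s ->
    mu (T s @^-1` A) = mu A.

Definition strongly_mixing T mu : Prop :=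
  invariant_measure T mu /\
  forall A B : set (borelType E), measurable A -> measurable B ->
    mu (A `&` T s @^-1` B) @[s --> +oo%R] --> (mu A * mu B)%E.

Definition full_support mu : Prop :=
  forall U : set E, open U -> U !=set0 -> (0 < mu U)%E.

End Dynamics.

(* Main.v *)
Require Import Defs.
From HB Require Import structures.
From mathcomp Require Import all_boot all_order all_algebra.
From mathcomp Require Import complex ring lra.
From mathcomp Require Import all_classical all_reals all_analysis.
From mathcomp Require Import measurable_realfun.

Set Implicit Arguments.
Unset Strict Implicit.
Unset Printing Implicit Defensive.

Import Order.TTheory GRing.Theory Num.Theory.
Import numFieldNormedType.Exports.

Local Open Scope classical_set_scope.
Local Open Scope ring_scope.

(* Stable type and a blocking argument show that sums
   \sum_j theta_j x_j are small in probability when \sum_j |x_j|^alpha is; comparing a sum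
   with N of its independent copies, whose sum is N^(1/alpha) times the original in law,
   upgrades this to the tail bound P(|\int f dM| > t) <= C t^(-alpha) \int |f|^alpha. Hence
   the integral exists, and everything about it can be tested on simple functions, where
   laws and independence are read off the characteristic functions of finite families.
   - Since T_s v = \int u_(t-s) M(dt), invariance is the shift invariance of m, and mixing
     holds because u, up to a small error, has bounded support, which a large shift makes
     disjoint from itself.
   - The support S of v is closed, contains 0, and satisfies
     p S + q S <= (p^alpha + q^alpha)^(1/alpha) S. For almost every t the set B where u is
     e-close to u_t has positive measure, and v is M(B) u_t plus an error of size O(e |M(B)|)
     on a set of positive probability: this uses that M(B) has a tail no lighter than
     t^(-alpha) at some arbitrarily large t if alpha < 2, and at a single t if alpha > 1, when
     S is a cone. Therefore S contains every multiple of almost every u_t, hence their span. *)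

(** * Expectations of bounded functions *)

(** Stable type speaks of almost sure convergence and gives no estimate by itself; the blocking
    argument makes it uniform. The exact power t^(-alpha) matters: it yields moments of every order
    q < alpha, and in the support argument it is compared with the lower tail of M(B), where the
    measure of B and the power of the level cancel on both sides. The lower tail is treated in two
    overlapping ranges because neither argument covers all alpha. For alpha <= 1 one has (p^alpha +
    q^alpha)^(1/alpha) >= p + q, so combining points of S never enlarges them, and large multiples
    must come from large values of M(B). For alpha = 2, M(B) is Gaussian and has no heavy tail, but
    S is a cone. Real and complex scalars are treated together: on disjoint sets A_i, the variable
    Re (sum z_i M(A_i)) has characteristic exponent sum c m(A_i) |z_i|^alpha in both cases, and the
    laws of simple integrals are read off this formula. Independent copies are the coordinates of a
    product space, since the given probability space may carry none. *)

Section BoundedMeasurable.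
Context (R : realType) d (T : measurableType d).
Implicit Types f g : T -> R.

Definition bounded_measurable f :=
  measurable_fun setT f /\ exists c, forall w, `|f w| <= c.

Lemma bdm_measurable f : bounded_measurable f -> measurable_fun setT f.
Proof. by case. Qed.

Lemma bdmD f g : bounded_measurable f -> bounded_measurable g ->
  bounded_measurable (fun w => f w + g w).
Proof.
move=> [mf [c fc]] [mg [e ge]]; split; first exact: measurable_funD.
by exists (c + e) => w; rewrite (le_trans (ler_normD _ _))// lerD.
Qed.

Lemma bdmM f g : bounded_measurable f -> bounded_measurable g ->
  bounded_measurable (fun w => f w * g w).
Proof.
move=> [mf [c fc]] [mg [e ge]]; split; first exact: measurable_funM.
by exists (c * e) => w; rewrite normrM ler_pM.
Qed.

Lemma bdm_cst c : bounded_measurable (fun=> c).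
Proof. by split; [exact: measurable_cst|exists `|c|]. Qed.

Lemma bdmZ c f : bounded_measurable f -> bounded_measurable (fun w => c * f w).
Proof. by move=> bf; apply: bdmM => //; exact: bdm_cst. Qed.

Lemma bdmB f g : bounded_measurable f -> bounded_measurable g ->
  bounded_measurable (fun w => f w - g w).
Proof.
move=> [mf [c fc]] [mg [e ge]]; split; first exact: measurable_funB.
by exists (c + e) => w; rewrite (le_trans (ler_normB _ _))// lerD.
Qed.

Lemma bdm_norm f : bounded_measurable f -> bounded_measurable (fun w => `|f w|).
Proof.
move=> [mf [c fc]]; split; first exact: measurableT_comp.
by exists c => w; rewrite normr_id.
Qed.

Lemma bdm_indic (A : set T) : measurable A -> bounded_measurable (\1_A : T -> R).
Proof.
move=> mA; split; first exact: measurable_indic.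
by exists 1 => w; rewrite indicE; case: (_ \in _); rewrite ?normr1 ?normr0.
Qed.

Lemma bdm_comp d' (U : measurableType d') (h : U -> R) (X : T -> U) :
  measurable_fun setT h -> (exists c, forall w, `|h w| <= c) ->
  measurable_fun setT X -> bounded_measurable (fun w => h (X w)).
Proof.
move=> mh [c hc] mX; split; first exact: measurableT_comp.
by exists c => w; exact: hc.
Qed.

Lemma bdm_indic_comp d' (U : measurableType d') (B : set U) (X : T -> U) :
  measurable B -> measurable_fun setT X -> bounded_measurable (fun w => \1_B (X w) : R).
Proof.
move=> mB mX; apply: (@bdm_comp _ _ (\1_B : U -> R)) => //.
by exists 1 => w; rewrite indicE; case: (_ \in _); rewrite ?normr1 ?normr0.
Qed.

Lemma bdm_cos f : measurable_fun setT f -> bounded_measurable (fun w => cos (f w)).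
Proof.
move=> mf; apply: (@bdm_comp _ _ (@cos R)) => //.
  by apply: continuous_measurable_fun; exact: continuous_cos.
by exists 1 => w; exact: cos_max.
Qed.

Lemma bdm_sin f : measurable_fun setT f -> bounded_measurable (fun w => sin (f w)).
Proof.
move=> mf; apply: (@bdm_comp _ _ (@sin R)) => //.
  by apply: continuous_measurable_fun; exact: continuous_sin.
by exists 1 => w; exact: sin_max.
Qed.

End BoundedMeasurable.

Definition mfun_of d (T : measurableType d) d' (U : measurableType d') (X : T -> U)
    (mX : measurable_fun setT X) : {mfun T >-> U} :=
  HB.pack X (@isMeasurableFun.Build _ _ _ _ X mX).

Section LevelSets.
Context (R : realType) d (T : measurableType d) (f : T -> R).
Hypothesis mf : measurable_fun setT f.

Lemma measurable_set_lt (r : R) : measurable [set w | f w < r].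
Proof.
rewrite -[X in measurable X]setTI.
have -> : [set w | f w < r] = f @^-1` `]-oo, r[%classic.
  by apply/seteqP; split => w /=; rewrite in_itv.
by apply: mf => //; exact: measurable_itv.
Qed.

Lemma measurable_set_ge (r : R) : measurable [set w | r <= f w].
Proof.
have -> : [set w | r <= f w] = ~` [set w | f w < r].
  by apply/seteqP; split => w /=; rewrite leNgt => /negP.
by apply: measurableC; exact: measurable_set_lt.
Qed.

Lemma measurable_set_gt (r : R) : measurable [set w | r < f w].
Proof.
rewrite -[X in measurable X]setTI.
have -> : [set w | r < f w] = f @^-1` `]r, +oo[%classic.
  by apply/seteqP; split => w /=; rewrite in_itv /= andbT.
by apply: mf => //; exact: measurable_itv.
Qed.

Lemma measurable_set_le (r : R) : measurable [set w | f w <= r].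
Proof.
have -> : [set w | f w <= r] = ~` [set w | r < f w].
  by apply/seteqP; split => w /=; rewrite leNgt => /negP.
by apply: measurableC; exact: measurable_set_gt.
Qed.

End LevelSets.

Section Expectations.
Context (R : realType) d (T : measurableType d) (P : probability T R).
Implicit Types f g : T -> R.

Local Notation Ex f := (\int[P]_w f w)%R.

Lemma bdm_integrable f : bounded_measurable f -> P.-integrable setT (EFin \o f).
Proof.
move=> [mf [c fc]]; apply: measurable_bounded_integrable => //.
- by rewrite (@le_lt_trans _ _ 1%E) ?ltry//; exact: probability_le1.
- exists c; split; first exact: num_real.
  by move=> x cx w _; apply: (le_trans (fc w)); exact: ltW.
Qed.

Lemma ExD f g : bounded_measurable f -> bounded_measurable g ->
  \int[P]_w (f w + g w) = Ex f + Ex g.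
Proof. by move=> bf bg; rewrite RintegralD//; exact: bdm_integrable. Qed.

Lemma ExB f g : bounded_measurable f -> bounded_measurable g ->
  \int[P]_w (f w - g w) = Ex f - Ex g.
Proof. by move=> bf bg; rewrite RintegralB//; exact: bdm_integrable. Qed.

Lemma ExZ c f : bounded_measurable f -> \int[P]_w (c * f w) = c * Ex f.
Proof. by move=> bf; rewrite RintegralZl//; exact: bdm_integrable. Qed.

Lemma Ex_cst c : \int[P]_w c = c.
Proof.
rewrite Rintegral_cst// (_ : fine _ = 1) ?mulr1//.
exact: (congr1 fine (probability_setT P)).
Qed.

Lemma le_Ex f g : bounded_measurable f -> bounded_measurable g ->
  (forall w, f w <= g w) -> Ex f <= Ex g.
Proof. by move=> bf bg fg; apply: le_Rintegral => //; exact: bdm_integrable. Qed.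

Lemma eq_Ex f g : f =1 g -> Ex f = Ex g.
Proof. by move=> fg; apply: eq_Rintegral => w _; exact: fg. Qed.

Lemma normr_Ex f : bounded_measurable f -> `|Ex f| <= \int[P]_w `|f w|.
Proof. by move=> bf; apply: le_normr_Rintegral => //; exact: bdm_integrable. Qed.

Lemma Ex_EFin f : bounded_measurable f -> (Ex f)%:E = (\int[P]_w (f w)%:E)%E.
Proof. by move=> bf; rewrite fineK//; apply: integrable_fin_num => //; exact: bdm_integrable. Qed.

Lemma probability_fin (A : set T) : measurable A -> P A \is a fin_num.
Proof. by move=> mA; exact: fin_num_measure. Qed.

Lemma Ex_indic (A : set T) : measurable A -> \int[P]_w (\1_A w : R) = fine (P A).
Proof. by move=> mA; rewrite /Rintegral integral_indic// setIT. Qed.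

Lemma fine_prob_ge0 (A : set T) : 0 <= fine (P A).
Proof. exact: fine_ge0. Qed.

Lemma fine_prob_le1 (A : set T) : measurable A -> fine (P A) <= 1.
Proof. by move=> mA; rewrite -lee_fin fineK ?probability_fin//; exact: probability_le1. Qed.

Lemma fine_prob_le (A B : set T) : measurable A -> measurable B -> A `<=` B ->
  fine (P A) <= fine (P B).
Proof. by move=> mA mB AB; rewrite fine_le ?probability_fin//; apply: le_measure; rewrite ?inE. Qed.

Lemma fine_prob_setU (A B : set T) : measurable A -> measurable B ->
  fine (P (A `|` B)) <= fine (P A) + fine (P B).
Proof.
move=> mA mB; rewrite -fineD ?probability_fin// fine_le ?probability_fin//.
- exact: measurableU.
- by rewrite fin_numD !probability_fin.
- exact: measureU2.
Qed.

Lemma fine_prob_setT : fine (P setT) = 1.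
Proof. exact: (congr1 fine (probability_setT P)). Qed.

Lemma Ex_cvg (f_ : nat -> T -> R) f c :
  (forall n, measurable_fun setT (f_ n)) ->
  (forall n w, `|f_ n w| <= c) -> (forall w, f_ ^~ w @ \oo --> f w) ->
  (fun n => \int[P]_w f_ n w) @ \oo --> Ex f.
Proof.
move=> mf fc ff.
have mf' : measurable_fun setT f by apply: (measurable_fun_cvg mf) => w _; exact: ff.
have fc' w : `|f w| <= c.
  have cn : (fun n => `|f_ n w|) @ \oo --> `|f w| by apply: cvg_norm; exact: ff.
  rewrite -(cvg_lim _ cn)//; apply: limr_le; first by apply/cvg_ex; exists `|f w|.
  by apply: nearW => n; exact: fc.
have bf : bounded_measurable f by split => //; exists c.
have [//|||||_ _ h] := @dominated_convergence _ T R P setT measurableT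
    (fun n => EFin \o f_ n) (EFin \o f) (fun=> c%:E).
- by move=> n; exact/measurable_EFinP.
- exact/measurable_EFinP.
- by apply: aeW => w _; apply: cvg_EFin => //; [exact: nearW|exact: ff].
- apply: (@bdm_integrable (fun=> c)); exact: bdm_cst.
- by apply: aeW => w n _; rewrite lee_fin fc.
rewrite -Ex_EFin// in h.
exact: (fine_cvg h).
Qed.

End Expectations.

Lemma eq_prob_fine (R : realType) d (T : measurableType d) (P : probability T R)
    d' (T' : measurableType d') (P' : probability T' R) (A : set T) (A' : set T') :
  measurable A -> measurable A' -> fine (P A) = fine (P' A') -> P A = P' A'.
Proof.
by move=> mA mA' h; rewrite -(fineK (probability_fin P mA)) h fineK// probability_fin.
Qed.

Notation Ex P f := (\int[P]_w f w)%R (only parsing).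

(** * Uniqueness of characteristic functions *)

Section PoissonKernel.
Context (R : realType).
Implicit Types a b c e : R.

Let G e b (t : R) : R :=
  expR (- e * t) * (- e^-1 + (b * sin (b * t) - e * cos (b * t)) / (e ^+ 2 + b ^+ 2)).

Let is_derive_G e b (t : R) : 0 < e ->
  is_derive t (1 : R) (G e b) (expR (- e * t) * (1 + cos (b * t))).
Proof.
move=> e0.
have eb : e ^+ 2 + b ^+ 2 != 0 by rewrite gt_eqF// ltr_pwDl ?exprn_gt0// sqr_ge0.
have scl c : is_derive t (1:R) (fun x : R => c * x) c.
  have := @is_deriveZ R R R id c t 1 1 (is_derive_id t 1).
  by rewrite /GRing.scale /= mulr1.
have dexp : is_derive t (1:R) (fun t => expR (- e * t)) (- e * expR (- e * t)).
  by rewrite mulrC; apply: (is_derive1_comp (f := expR) (g := fun t => - e * t)).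
have dsin : is_derive t (1:R) (fun t => sin (b * t)) (b * cos (b * t)).
  by rewrite mulrC; apply: (is_derive1_comp (f := sin) (g := fun t => b * t)).
have dcos : is_derive t (1:R) (fun t => cos (b * t)) (b * - sin (b * t)).
  by rewrite mulrC; apply: (is_derive1_comp (f := cos) (g := fun t => b * t)).
have h := is_deriveM dexp (is_deriveD (is_derive_cst (- e^-1 : R) t (1 : R))
  (is_deriveM (is_deriveB (is_deriveZ b dsin) (is_deriveZ e dcos))
     (is_derive_cst ((e ^+ 2 + b ^+ 2)^-1 : R) t (1 : R)))).
apply: (is_derive_eq h).
rewrite !fctE /GRing.scale /=.
change (b *: sin (b * t)) with (b * sin (b * t)); change (e *: cos (b * t)) with (e * cos (b * t)).
by field; rewrite eb gt_eqF.
Qed.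

(** The summand 1 makes the integrand nonnegative, so that the improper fundamental theorem and
    Tonelli apply without integrability. It only costs the term e^-1, which cancels when two laws of
    equal mass are compared. *)
Lemma integral_poisson_kernel e b : 0 < e ->
  (\int[lebesgue_measure]_(t in `[0%R, +oo[) (expR (- e * t) * (1 + cos (b * t)))%:E
   = (e^-1 + e / (e ^+ 2 + b ^+ 2))%:E)%E.
Proof.
move=> e0.
have eb : 0 < e ^+ 2 + b ^+ 2 by rewrite ltr_pwDl ?exprn_gt0// sqr_ge0.
have cont (F F' : R -> R) : (forall t, is_derive t (1:R) F (F' t)) -> continuous F.
  move=> dF t; apply: differentiable_continuous; apply/derivable1_diffP.
  by have [] := dF t.
have cG : continuous (G e b) by apply: cont => t; exact: is_derive_G.
rewrite (ge0_continuous_FTC2y (F := G e b) (l := 0)).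
- rewrite /G !mulr0 expR0 sin0 cos0 mulr0 sub0r mulr1 mul1r sub0e.
  by congr (_%:E); rewrite mulNr opprD !opprK.
- by move=> t t0; rewrite mulr_ge0 ?expR_ge0// -lerBlDl sub0r cos_geN1.
- apply: continuous_subspaceT => t.
  apply: (@continuousM _ _ (fun t => expR (- e * t)) (fun t => 1 + cos (b * t))).
  + apply: continuous_comp; last exact: continuous_expR.
    exact: mulrl_continuous.
  + apply: continuousD; first exact: cst_continuous.
    apply: continuous_comp; last exact: continuous_cos.
    exact: mulrl_continuous.
- pose M := e^-1 + (`|b| + e) / (e ^+ 2 + b ^+ 2).
  have ei : 0 <= e^-1 by rewrite invr_ge0 ltW.
  have ebi : 0 <= (e ^+ 2 + b ^+ 2)^-1 by rewrite invr_ge0 ltW.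
  have GM t : `|G e b t| <= expR (- e * t) * M.
    rewrite /G normrM (ger0_norm (expR_ge0 _)) ler_wpM2l ?expR_ge0//.
    rewrite (le_trans (ler_normD _ _))// normrN (ger0_norm ei) lerD2l normrM (ger0_norm ebi).
    rewrite ler_wpM2r// (le_trans (ler_normB _ _))// !normrM lerD//.
      by rewrite ler_piMr// sin_max.
    by rewrite (ger0_norm (ltW e0)) ler_piMr ?cos_max// ltW.
  have M0 : 0 <= M by rewrite addr_ge0// mulr_ge0// addr_ge0// ltW.
  apply/cvgr0Pnorm_le => eps eps0; near=> t.
  rewrite (le_trans (GM t))// mulNr expRN mulrC ler_pdivrMr ?expR_gt0//.
  rewrite -ler_pdivrMl// (le_trans _ (expR_ge1Dx _))// (@le_trans _ _ (e * t))//.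
    by rewrite -ler_pdivrMl//; near: t; apply: nbhs_pinfty_ge; exact: num_real.
  by rewrite lerDr.
- by move=> t _; have [] := is_derive_G b t e0.
- by apply: cvg_at_right_filter; exact: cG.
- by move=> t _; have h := is_derive_G b t e0; rewrite derive1E derive_val.
Unshelve. all: by end_near. Qed.

Lemma continuous_cauchy_kernel e : 0 < e -> continuous (fun x : R => e / (e ^+ 2 + x ^+ 2)).
Proof.
move=> e0 a; apply: cvgM; first exact: cvg_cst.
apply: cvgV; first by rewrite gt_eqF// ltr_pwDl ?exprn_gt0// sqr_ge0.
by apply: cvgD; [exact: cvg_cst|exact: exprn_continuous].
Qed.

(** As e tends to 0 the right side, as a function of y, becomes pi times the indicator of [c, d] up
    to the end points. This is how intervals are reached from the Cauchy kernel. *)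
Lemma integral_cauchy_kernel e y c d : 0 < e -> c < d ->
  (\int[lebesgue_measure]_(a in `[c, d]) (e / (e ^+ 2 + (y - a) ^+ 2))%:E
   = (atan ((d - y) / e) - atan ((c - y) / e))%:E)%E.
Proof.
move=> e0 cd.
pose F a := atan ((a - y) / e).
have dF a : is_derive a (1:R) F (e / (e ^+ 2 + (y - a) ^+ 2)).
  have dg : is_derive a (1:R) (fun a => (a - y) / e) e^-1.
    have h := is_deriveM (is_deriveB (is_derive_id a (1 : R)) (is_derive_cst y a (1 : R)))
      (is_derive_cst (e^-1 : R) a (1 : R)).
    apply: (is_derive_eq h).
    by rewrite /GRing.scale /= mulr0 add0r subr0 mulr1.
  have h : is_derive a (1:R) F ((1 + ((a - y) / e) ^+ 2)^-1 * e^-1).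
    by apply: (is_derive1_comp (f := atan) (g := fun a => (a - y) / e)).
  apply: (is_derive_eq h).
  have ? : e ^+ 2 + (y - a) ^+ 2 != 0.
    by rewrite gt_eqF// ltr_pwDl ?exprn_gt0// sqr_ge0.
  have ? : 1 + ((a - y) / e) ^+ 2 != 0.
    by rewrite gt_eqF// ltr_pwDl// sqr_ge0.
  have ? : e != 0 by rewrite gt_eqF.
  have -> : 1 + ((a - y) / e) ^+ 2 = (e ^+ 2 + (y - a) ^+ 2) / e ^+ 2 by field.
  by rewrite invf_div; field; apply/andP.
have cont (f : R -> R) (f' : R -> R) : (forall t, is_derive t (1:R) f (f' t)) -> continuous f.
  move=> df t; apply: differentiable_continuous; apply/derivable1_diffP.
  by have [] := df t.
have cF := cont _ _ dF.
rewrite (continuous_FTC2 (F := F))//.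
- apply: continuous_subspaceT => a.
  apply: (@continuous_comp _ _ _ (fun a => y - a) (fun x => e / (e ^+ 2 + x ^+ 2))).
    by apply: continuousB; [exact: cst_continuous|by move=> ?; exact: cvg_id].
  exact: continuous_cauchy_kernel.
- split.
  + by move=> a _; have [] := dF a.
  + by apply: cvg_at_right_filter; exact: cF.
  + by apply: cvg_at_left_filter; exact: cF.
- by move=> a _; have h := dF a; rewrite derive1E derive_val.
Qed.

End PoissonKernel.

Section FourierUniqueness.
Context (R : realType).

(** The weight is there for joint laws: it carries the indicators of the coordinates already treated
    while the next coordinate Y is tested. *)
Definition same_weighted_fourier d (T : measurableType d) (P : probability T R)
    (W Y : T -> R) d' (T' : measurableType d') (P' : probability T' R)
    (W' Y' : T' -> R) :=
  forall t, Ex P (fun w => W w * cos (t * Y w)) = Ex P' (fun w => W' w * cos (t * Y' w)) /\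
            Ex P (fun w => W w * sin (t * Y w)) = Ex P' (fun w => W' w * sin (t * Y' w)).

Section OneSpace.
Context d (T : measurableType d) (P : probability T R) (W Y : T -> R).
Hypothesis bW : bounded_measurable W.
Hypothesis W0 : forall w, 0 <= W w.
Hypothesis mY : measurable_fun setT Y.

Let mW : measurable_fun setT W := bdm_measurable bW.

Lemma weighted_tonelli (D : set R) (g : measurableTypeR R -> measurableTypeR R -> R) :
  measurable D ->
  measurable_fun setT (fun p : measurableTypeR R * measurableTypeR R => g p.1 p.2) ->
  (forall y t, 0 <= g y t) ->
  (\int[P]_w \int[lebesgue_measure]_(t in D) (W w * g (Y w) t)%:E =
   \int[lebesgue_measure]_(t in D) \int[P]_w (W w * g (Y w) t)%:E)%E.
Proof.
move=> mD mg g0.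
pose f (p : T * measurableTypeR R) := (W p.1 * g (Y p.1) p.2 * \1_D p.2)%:E.
have mf : measurable_fun setT f.
  apply/measurable_EFinP/measurable_funM; last first.
    by apply: measurableT_comp => //; exact: measurable_indic.
  apply: measurable_funM; first exact: measurableT_comp.
  apply: (measurableT_comp mg
    (g := fun p : T * measurableTypeR R => (Y p.1 : measurableTypeR R, p.2))).
  by apply: measurable_fun_pair => //; exact: measurableT_comp.
have f0 p : (0 <= f p)%E by rewrite lee_fin !mulr_ge0.
have h := fubini_tonelli (m1 := P) (m2 := @lebesgue_measure R) f mf f0.
transitivity (\int[P]_w \int[lebesgue_measure]_t f (w, t))%E.
  apply: eq_integral => w _; rewrite integral_mkcond; apply: eq_integral => t _.
  by rewrite /f/= patchE indicE; case: (t \in D); rewrite ?mulr1 ?mulr0.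
rewrite h [RHS]integral_mkcond; apply: eq_integral => t _.
rewrite patchE /f /=; case: ifPn => tD.
  by apply: eq_integral => w _; rewrite indicE tD mulr1.
rewrite integral0_eq// => w _; rewrite indicE (negbTE tD) mulr0//.
Qed.

Let cos_sub t a w : W w * (1 + cos (t * (Y w - a))) =
  W w * cos (0 * Y w) + (cos (t * a) * (W w * cos (t * Y w)) + sin (t * a) * (W w * sin (t * Y w))).
Proof. by rewrite mul0r cos0 mulrBr cosB; ring. Qed.

(** Abel summation of the inverse Fourier integral: the law of Y smoothed by a Cauchy kernel of
    width e is expressed through the transform alone. *)
Lemma weighted_poisson (e a : R) : 0 < e ->
  (\int[P]_w (W w * (e^-1 + e / (e ^+ 2 + (Y w - a) ^+ 2)))%:E =
   \int[lebesgue_measure]_(t in `[0%R, +oo[)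
     (expR (- e * t) * (Ex P (fun w => W w * cos (0 * Y w)) +
       (cos (t * a) * Ex P (fun w => W w * cos (t * Y w)) +
        sin (t * a) * Ex P (fun w => W w * sin (t * Y w)))))%:E)%E.
Proof.
move=> e0.
have mtY t : measurable_fun setT (fun w => t * Y w).
  by apply: measurable_funM => //; exact: measurable_cst.
transitivity (\int[P]_w \int[lebesgue_measure]_(t in `[0%R, +oo[)
    (W w * (expR (- e * t) * (1 + cos (t * (Y w - a)))))%:E)%E.
  apply: eq_integral => w _; rewrite EFinM -integral_poisson_kernel//.
  rewrite -ge0_integralZl//.
  - by apply: eq_integral => t _; rewrite -EFinM (mulrC t).
  - apply: measurable_funTS; apply/measurable_EFinP; apply: continuous_measurable_fun => t.
    apply: (@continuousM _ _ (fun t => expR (- e * t)) (fun t => 1 + cos ((Y w - a) * t))).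
    + apply: continuous_comp; last exact: continuous_expR.
      exact: mulrl_continuous.
    + apply: continuousD; first exact: cst_continuous.
      apply: continuous_comp; last exact: continuous_cos.
      exact: mulrl_continuous.
  - by rewrite lee_fin.
rewrite (@weighted_tonelli `[0%R, +oo[ (fun y t => expR (- e * t) * (1 + cos (t * (y - a)))))//.
- apply: eq_integral => t _.
  under eq_integral do rewrite mulrCA cos_sub.
  rewrite -Ex_EFin; last first.
    by apply: bdmZ; apply: bdmD; [|apply: bdmD; apply: bdmZ]; apply: bdmM => //;
      [exact: bdm_cos|exact: bdm_cos|exact: bdm_sin].
  congr (_%:E); rewrite ExZ; last first.
    by apply: bdmD; [|apply: bdmD; apply: bdmZ]; apply: bdmM => //;
      [exact: bdm_cos|exact: bdm_cos|exact: bdm_sin].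
  have bc s : bounded_measurable (fun w => W w * cos (s * Y w)).
    by apply: bdmM => //; exact: bdm_cos.
  have bs s : bounded_measurable (fun w => W w * sin (s * Y w)).
    by apply: bdmM => //; exact: bdm_sin.
  rewrite ExD ?ExD ?ExZ//; [exact: bdmZ|exact: bdmZ|].
  by apply: bdmD; exact: bdmZ.
- apply: measurable_funM.
    apply: measurableT_comp => //; apply: measurable_funM => //; exact: measurable_cst.
  apply: measurable_funD; first exact: measurable_cst.
  apply: (measurableT_comp (f := cos)).
    by apply: continuous_measurable_fun; exact: continuous_cos.
  apply: measurable_funM => //; apply: measurable_funB => //; exact: measurable_cst.
Qed.

Lemma weighted_atan (e c b : R) : 0 < e -> c < b ->
  ((Ex P (fun w => W w * (atan ((b - Y w) / e) - atan ((c - Y w) / e))))%:E =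
   \int[lebesgue_measure]_(a in `[c, b])
     \int[P]_w (W w * (e / (e ^+ 2 + (Y w - a) ^+ 2)))%:E)%E.
Proof.
move=> e0 cd.
have k0 y a : 0 <= e / (e ^+ 2 + (y - a) ^+ 2).
  by rewrite divr_ge0// ?addr_ge0 ?sqr_ge0// ltW.
have mk : measurable_fun setT (fun x : R => e / (e ^+ 2 + x ^+ 2)).
  by apply: continuous_measurable_fun; exact: continuous_cauchy_kernel.
rewrite -(@weighted_tonelli `[c, b] (fun y a => e / (e ^+ 2 + (y - a) ^+ 2)))//.
- rewrite Ex_EFin.
    apply: eq_integral => w _; rewrite EFinM -integral_cauchy_kernel//.
    rewrite -ge0_integralZl//.
    + apply: measurable_funTS; apply/measurable_EFinP.
      apply: (measurableT_comp mk (g := (fun x => Y w - x) : measurableTypeR R -> R)).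
      by apply: measurable_funB => //; exact: measurable_cst.
    + by move=> a _; rewrite lee_fin.
    + by rewrite lee_fin.
  have batan x : bounded_measurable (fun w => atan ((x - Y w) / e)).
    apply: (@bdm_comp _ _ _ _ _ (@atan R)).
    + apply: continuous_measurable_fun => ?; exact: continuous_atan.
    + exists (pi / 2) => y; rewrite ler_norml.
      by rewrite (ltW (atan_gtNpi2 _)) (ltW (atan_ltpi2 _)).
    + apply: measurable_funM; last exact: measurable_cst.
      by apply: measurable_funB => //; exact: measurable_cst.
  by apply: bdmM => //; exact: bdmB.
- apply: (measurableT_comp mk
    (g := fun p : measurableTypeR R * measurableTypeR R => p.1 - p.2)).
  exact: measurable_funB.
Qed.

(** The weighted law is packaged as a measure so that two of them can be compared on a generating
    pi-system. *)
Lemma weighted_law_exists : exists nu : {measure set (measurableTypeR R) -> \bar R},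
  forall B, measurable B -> nu B = (Ex P (fun w => W w * \1_B (Y w)))%:E.
Proof.
pose nu (B : set (measurableTypeR R)) := (\int[P]_(w in Y @^-1` B) (W w)%:E)%E.
have mYB B : measurable B -> measurable (Y @^-1` B).
  by move=> mB; rewrite -[X in measurable X]setTI; exact: mY.
have nu0 : nu set0 = 0%E by rewrite /nu preimage_set0 integral_set0.
have nu_ge0 B : (0 <= nu B)%E by apply: integral_ge0 => w _; rewrite lee_fin.
have nu_add : semi_sigma_additive nu.
  move=> F mF tF mUF; rewrite /nu preimage_bigcup ge0_integral_bigcup//.
  - apply: is_cvg_nneseries => // n _ _; exact: nu_ge0.
  - by move=> k; exact: (mYB _ (mF k)).
  - by apply: measurable_funTS; exact/measurable_EFinP.
  - by move=> w _; rewrite lee_fin.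
  - apply/trivIsetP => /= i j _ _ ij; rewrite -preimage_setI.
    by move/trivIsetP : tF => /(_ _ _ _ _ ij) ->//; rewrite preimage_set0.
pose m := isMeasure.Build _ _ _ nu nu0 nu_ge0 nu_add.
pose nuM : {measure set (measurableTypeR R) -> \bar R} := HB.pack nu m.
exists nuM => B mB.
change (nu B = (Ex P (fun w => W w * \1_B (Y w)))%:E).
rewrite Ex_EFin.
  rewrite /nu integral_mkcond; apply: eq_integral => w _.
  have YB : (w \in Y @^-1` B) = (Y w \in B) by apply/idP/idP; rewrite !inE.
  by rewrite patchE indicE YB; case: ifP; rewrite ?mulr1 ?mulr0.
by apply: bdmM => //; apply: (bdm_comp (h := \1_B)) => //; have [] := bdm_indic R mB.
Qed.

End OneSpace.

Section TwoSpaces.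
Context d (T : measurableType d) (P : probability T R) (W Y : T -> R).
Context d' (T' : measurableType d') (P' : probability T' R) (W' Y' : T' -> R).
Hypothesis bW : bounded_measurable W.
Hypothesis W0 : forall w, 0 <= W w.
Hypothesis mY : measurable_fun setT Y.
Hypothesis bW' : bounded_measurable W'.
Hypothesis W0' : forall w, 0 <= W' w.
Hypothesis mY' : measurable_fun setT Y'.
Hypothesis same : same_weighted_fourier P W Y P' W' Y'.

Let EW : Ex P W = Ex P' W'.
Proof.
have [+ _] := same 0.
by under eq_Ex do rewrite mul0r cos0 mulr1; under [in RHS]eq_Ex do rewrite mul0r cos0 mulr1.
Qed.

(** The transforms at t = 0 give equal total masses, which removes the e^-1 term brought in by the
    nonnegative kernel. *)
Let same_cauchy (e a : R) : 0 < e ->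
  (\int[P]_w (W w * (e / (e ^+ 2 + (Y w - a) ^+ 2)))%:E =
   \int[P']_w (W' w * (e / (e ^+ 2 + (Y' w - a) ^+ 2)))%:E)%E.
Proof.
move=> e0.
have k0 x : 0 <= e / (e ^+ 2 + x ^+ 2).
  by rewrite divr_ge0// ?addr_ge0 ?sqr_ge0// ltW.
have bk d1 (T1 : measurableType d1) (W1 Y1 : T1 -> R) : bounded_measurable W1 ->
    measurable_fun setT Y1 ->
    bounded_measurable (fun w => W1 w * (e / (e ^+ 2 + (Y1 w - a) ^+ 2))).
  move=> bW1 mY1; apply: bdmM => //.
  apply: (@bdm_comp _ _ _ _ (measurableTypeR R) (fun x => e / (e ^+ 2 + x ^+ 2)) (fun w => Y1 w - a)).
  - by apply: continuous_measurable_fun; exact: continuous_cauchy_kernel.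
  - exists (e / e ^+ 2) => x; rewrite ger0_norm// (ler_wpM2l (ltW e0))//.
    by rewrite lef_pV2 ?posrE ?exprn_gt0 ?ltr_pwDl ?exprn_gt0 ?sqr_ge0// lerDl sqr_ge0.
  - by apply: measurable_funB => //; exact: measurable_cst.
have split_kernel d1 (T1 : measurableType d1) (P1 : probability T1 R) (W1 Y1 : T1 -> R) :
    bounded_measurable W1 -> measurable_fun setT Y1 ->
    (\int[P1]_w (W1 w * (e^-1 + e / (e ^+ 2 + (Y1 w - a) ^+ 2)))%:E =
    (e^-1 * Ex P1 W1 + Ex P1 (fun w => W1 w * (e / (e ^+ 2 + (Y1 w - a) ^+ 2))))%:E)%E.
  move=> bW1 mY1; have b1 := bdmZ e^-1 bW1; have b2 := bk _ _ _ _ bW1 mY1.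
  rewrite -ExZ// -ExD// Ex_EFin; last exact: bdmD.
  by apply: eq_integral => w _; rewrite mulrDr (mulrC (W1 w) e^-1).
have := weighted_poisson P bW W0 mY a e0.
rewrite split_kernel//.
under [in RHS]eq_integral do rewrite !(same _).1 !(same _).2.
rewrite -weighted_poisson// split_kernel// EW => -[] /addrI.
by rewrite -!Ex_EFin; [move=> ->|exact: bk|exact: bk].
Qed.

Let same_atan (e c b : R) : 0 < e -> c < b ->
  Ex P (fun w => W w * (atan ((b - Y w) / e) - atan ((c - Y w) / e))) =
  Ex P' (fun w => W' w * (atan ((b - Y' w) / e) - atan ((c - Y' w) / e))).
Proof.
move=> e0 cb; apply: EFin_inj; rewrite !weighted_atan//.
by apply: eq_integral => a _; exact: same_cauchy.
Qed.

(* atan ((b + 1/(n+1) - y) / (n+1)^-2) tends to pi/2 for y <= b and to -pi/2 for y > b *)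
Let atan_lim b y : (fun n : nat => atan ((b + n.+1%:R^-1 - y) / (n.+1%:R ^- 2))) @ \oo -->
  (if y <= b then pi / 2 else - (pi / 2) : R).
Proof.
have nE n : (b + n.+1%:R^-1 - y) / (n.+1%:R ^- 2) = (b - y) * n.+1%:R ^+ 2 + n.+1%:R :> R.
  have ? : n.+1%:R != 0 :> R by [].
  by field.
under eq_fun do rewrite nE.
case: ifPn => yb.
  apply: (@cvg_comp _ _ _ (fun n : nat => (b - y) * n.+1%:R ^+ 2 + n.+1%:R) (@atan R) _ +oo);
    last exact: cvgy_atan.
  apply/cvgryPge => A; near=> n.
  rewrite (@le_trans _ _ n%:R)//; first by near: n; exact: nbhs_infty_ger.
  rewrite (@le_trans _ _ n.+1%:R) ?ler_nat// lerDr mulr_ge0 ?sqr_ge0// subr_ge0//.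
rewrite -ltNge in yb.
under eq_fun do rewrite -[_ + _]opprK atanN.
apply: cvgN.
apply: (@cvg_comp _ _ _ (fun n : nat => - ((b - y) * n.+1%:R ^+ 2 + n.+1%:R)) (@atan R) _ +oo);
  last exact: cvgy_atan.
apply/cvgryPge => A; near=> n.
have y0 : 0 < y - b by rewrite subr_gt0.
have h1 : 2 / (y - b) <= n.+1%:R.
  rewrite (@le_trans _ _ n%:R)// ?ler_nat//; near: n; exact: nbhs_infty_ger.
have h2 : A <= n.+1%:R.
  rewrite (@le_trans _ _ n%:R)// ?ler_nat//; near: n; exact: nbhs_infty_ger.
rewrite ler_pdivrMr// in h1.
have n0 : 0 <= n.+1%:R :> R by [].
by move: h1 h2 n0; set x := n.+1%:R => *; nra.
Unshelve. all: by end_near. Qed.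

(** The shift 1/(n+1) is large against the width (n+1)^-2, so at y = b the arctangent tends to pi/2
    and not to 0. This decides both end points, and the limit is pi times the indicator of a
    half-open interval. *)
Let same_le (b c : R) : c < b ->
  Ex P (fun w => W w * \1_`]c, b] (Y w)) = Ex P' (fun w => W' w * \1_`]c, b] (Y' w)).
Proof.
move=> cb.
pose k (b y : R) : R := if y <= b then pi / 2 else - (pi / 2).
have kE y : k b y - k c y = pi * \1_`]c, b] y.
  rewrite /k indicE mem_setE in_itv /=; case: (leP y c) => yc; case: (leP y b) => yb //=.
  - by rewrite subrr mulr0.
  - by move: (lt_le_trans yb yc) => /ltW; rewrite leNgt cb.
  - by rewrite mulr1; field.
  - by rewrite subrr mulr0.
have lim d1 (T1 : measurableType d1) (P1 : probability T1 R) (W1 Y1 : T1 -> R) :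
    bounded_measurable W1 -> measurable_fun setT Y1 ->
    (fun n : nat => Ex P1 (fun w => W1 w *
      (atan ((b + n.+1%:R^-1 - Y1 w) / n.+1%:R ^- 2) - atan ((c + n.+1%:R^-1 - Y1 w) / n.+1%:R ^- 2))))
    @ \oo --> pi * Ex P1 (fun w => W1 w * \1_`]c, b] (Y1 w)).
  move=> [mW1 [C W1C]] mY1.
  have b1 : bounded_measurable (fun w => W1 w * \1_`]c, b] (Y1 w)).
    apply: bdmM; first by split => //; exists C.
    by apply: bdm_indic_comp => //; exact: measurable_itv.
  rewrite -ExZ//.
  under [X in _ --> X]eq_Ex do rewrite mulrCA -kE.
  apply: (@Ex_cvg _ _ _ _ _ _ (C * (pi + pi))).
  - move=> n; apply: measurable_funM => //.
    have mat x : measurable_fun setT (fun w => atan ((x - Y1 w) / n.+1%:R ^- 2)).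
      apply: (measurableT_comp (f := @atan R)).
        by apply: continuous_measurable_fun => ?; exact: continuous_atan.
      apply: measurable_funM; last exact: measurable_cst.
      by apply: measurable_funB => //; exact: measurable_cst.
    exact: measurable_funB.
  - move=> n w; rewrite normrM ler_pM//.
    have at_le x : `|atan x| <= pi :> R.
      rewrite ler_norml (le_trans _ (ltW (atan_gtNpi2 x)))/= ?(le_trans (ltW (atan_ltpi2 x)))//.
        by have := pi_gt0 R => ?; lra.
      by have := pi_gt0 R => ?; lra.
    by rewrite (le_trans (ler_normB _ _))// lerD.
  - by move=> w; apply: cvgM; [exact: cvg_cst|apply: cvgB; exact: atan_lim].
have h' := lim _ _ P' _ _ bW' mY'.
rewrite (_ : (fun _ => _) = (fun n : nat => Ex P (fun w => W w *
  (atan ((b + n.+1%:R^-1 - Y w) / n.+1%:R ^- 2) -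
   atan ((c + n.+1%:R^-1 - Y w) / n.+1%:R ^- 2))))) in h'; last first.
  by apply/funext => n; rewrite same_atan ?invr_gt0 ?exprn_gt0 ?ltrD2r.
have /mulfI := lt0r_neq0 (pi_gt0 R); apply.
exact: (cvg_unique _ (lim _ _ P _ _ bW mY) h').
Qed.

Lemma fourier_unique (B : set (measurableTypeR R)) : measurable B ->
  Ex P (fun w => W w * \1_B (Y w)) = Ex P' (fun w => W' w * \1_B (Y' w)).
Proof.
move=> mB; apply: EFin_inj.
have [nu nuE] := weighted_law_exists P bW W0 mY.
have [nu' nuE'] := weighted_law_exists P' bW' W0' mY'.
rewrite -nuE// -nuE'//.
pose g n : set (measurableTypeR R) := `](- n%:R), n%:R]%classic.
have mg (x : R * R) : measurable (`]x.1, x.2]%classic : set (measurableTypeR R)).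
  exact: measurable_itv.
apply: (@measure_unique _ _ (measurableTypeR R) (@ocitv R) g) => //.
- exact: ocitvI.
- by move=> n; exists (- n%:R, n%:R).
- apply/seteqP; split => // y _; exists (Num.bound `|y|) => //=.
  have := archi_boundP (normr_ge0 y); rewrite ltr_norml => /andP[h1 h2].
  by rewrite /g /= in_itv /= h1 ltW.
- move=> A /ocitvP[->|[x x12 ->]]; first by rewrite !measure0.
  by rewrite nuE// nuE'// same_le.
- by move=> n; rewrite nuE ?ltry//; exact: (mg (_, _)).
Qed.

End TwoSpaces.

End FourierUniqueness.

(** * Joint laws of finite families of real variables *)

Section JointLaw.
Context (R : realType) (I : finType).

Definition box (B : I -> set (measurableTypeR R)) : set (I -> R) :=
  [set f | forall i, B i (f i)].

Definition boxes : set (set (I -> R)) :=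
  [set box B | B in [set B | forall i, measurable (B i)]].

(** The product sigma-algebra, over an arbitrary finite index type: index types are later summed,
    multiplied and reindexed. *)
Definition coordinates := g_sigma_algebraType boxes.

Lemma measurable_coordinate i : measurable_fun setT (fun f : coordinates => f i : R).
Proof.
move=> _ B mB; rewrite setTI; apply: sub_sigma_algebra.
exists (fun j => if j == i then B else setT).
  by move=> j /=; case: ifP.
apply/seteqP; split => f; first by move/(_ i); rewrite eqxx.
by move=> fB j; case: ifPn => // /eqP ->.
Qed.

Definition same_char_fun d (T : measurableType d) (P : probability T R) (Y : I -> T -> R)
    d' (T' : measurableType d') (P' : probability T' R) (Y' : I -> T' -> R) :=
  forall t : I -> R,
    Ex P (fun w => cos (\sum_i t i * Y i w)) = Ex P' (fun w => cos (\sum_i t i * Y' i w)) /\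
    Ex P (fun w => sin (\sum_i t i * Y i w)) = Ex P' (fun w => sin (\sum_i t i * Y' i w)).

Context d (T : measurableType d) (P : probability T R) (Y : I -> T -> R).
Context d' (T' : measurableType d') (P' : probability T' R) (Y' : I -> T' -> R).
Hypothesis mY : forall i, measurable_fun setT (Y i).
Hypothesis mY' : forall i, measurable_fun setT (Y' i).
Hypothesis same : same_char_fun P Y P' Y'.

Let shift_sum (t : I -> R) a tau (y : I -> R) :
  \sum_i (t i + tau *+ (i == a)) * y i = \sum_i t i * y i + tau * y a.
Proof.
under eq_bigr do rewrite mulrDl.
rewrite big_split /=; congr (_ + _).
rewrite (bigD1 a)//= eqxx mulr1n big1 ?addr0// => i /negbTE ->.
by rewrite mulr0n mul0r.
Qed.

Let bsum d1 (T1 : measurableType d1) (Y1 : I -> T1 -> R) (t : I -> R) :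
  (forall i, measurable_fun setT (Y1 i)) ->
  measurable_fun setT (fun w => \sum_i t i * Y1 i w).
Proof.
move=> mY1; apply: measurable_sum => i.
by apply: measurable_funM => //; exact: measurable_cst.
Qed.

Let bprod d1 (T1 : measurableType d1) (Y1 : I -> T1 -> R) (s : seq I)
    (B : I -> set (measurableTypeR R)) :
  (forall i, measurable_fun setT (Y1 i)) -> (forall i, measurable (B i)) ->
  bounded_measurable (fun w => \prod_(i <- s) \1_(B i) (Y1 i w) : R).
Proof.
move=> mY1 mB; elim: s => [|a s IH].
  by under eq_fun do rewrite big_nil; exact: bdm_cst.
under eq_fun do rewrite big_cons.
by apply: bdmM => //; exact: (bdm_indic_comp R (mB a) (mY1 a)).
Qed.

(** Coordinates are added one at a time, each by the one-dimensional uniqueness. All frequencies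
    stay free in the induction, because testing coordinate a shifts its frequency. *)
Let step s (B : I -> set (measurableTypeR R)) : (forall i, measurable (B i)) -> forall t,
  Ex P (fun w => \prod_(i <- s) \1_(B i) (Y i w) * cos (\sum_i t i * Y i w)) =
  Ex P' (fun w => \prod_(i <- s) \1_(B i) (Y' i w) * cos (\sum_i t i * Y' i w)) /\
  Ex P (fun w => \prod_(i <- s) \1_(B i) (Y i w) * sin (\sum_i t i * Y i w)) =
  Ex P' (fun w => \prod_(i <- s) \1_(B i) (Y' i w) * sin (\sum_i t i * Y' i w)).
Proof.
move=> mB; elim: s => [|a s IH] t.
  have [h1 h2] := same t.
  by split; under eq_Ex do rewrite big_nil mul1r; under [in RHS]eq_Ex do rewrite big_nil mul1r.
have bc d1 (T1 : measurableType d1) (Y1 : I -> T1 -> R) t1 :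
    (forall i, measurable_fun setT (Y1 i)) -> bounded_measurable
      (fun w => \prod_(i <- s) \1_(B i) (Y1 i w) * cos (\sum_i t1 i * Y1 i w)).
  by move=> mY1; apply: bdmM; [exact: bprod|apply: bdm_cos; exact: bsum].
have bs d1 (T1 : measurableType d1) (Y1 : I -> T1 -> R) t1 :
    (forall i, measurable_fun setT (Y1 i)) -> bounded_measurable
      (fun w => \prod_(i <- s) \1_(B i) (Y1 i w) * sin (\sum_i t1 i * Y1 i w)).
  by move=> mY1; apply: bdmM; [exact: bprod|apply: bdm_sin; exact: bsum].
pose sh (t1 : I -> R) tau i := t1 i + tau *+ (i == a).
(* The one-dimensional uniqueness asks for nonnegative weights; 1 + cos and 1 + sin are nonnegative,
   and the contribution of 1 is subtracted again in [prodE]. *)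
pose Z d1 (T1 : measurableType d1) (Y1 : I -> T1 -> R) tr w : R :=
  \prod_(i <- s) \1_(B i) (Y1 i w) * (1 + tr (\sum_i t i * Y1 i w)).
have prod_ge0 d1 (T1 : measurableType d1) (Y1 : I -> T1 -> R) w :
    0 <= \prod_(i <- s) \1_(B i) (Y1 i w) :> R.
  by apply: prodr_ge0 => i _; rewrite indicE.
have prodE d1 (T1 : measurableType d1) (P1 : probability T1 R) (Y1 : I -> T1 -> R) (tr : R -> R) :
    (forall i, measurable_fun setT (Y1 i)) ->
    measurable_fun setT tr -> (forall x : R, `|tr x| <= 1) ->
    Ex P1 (fun w => \prod_(i <- a :: s) \1_(B i) (Y1 i w) * tr (\sum_i t i * Y1 i w)) =
    Ex P1 (fun w => Z _ _ Y1 tr w * \1_(B a) (Y1 a w)) -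
    Ex P1 (fun w => \prod_(i <- s) \1_(B i) (Y1 i w) * \1_(B a) (Y1 a w)).
  move=> mY1 mtr tr1.
  have bB : bounded_measurable (fun w => \1_(B a) (Y1 a w) : R).
    exact: (bdm_indic_comp R (mB a) (mY1 a)).
  rewrite -ExB.
  - by apply: eq_Ex => w; rewrite big_cons /Z; ring.
  - apply: bdmM => //; apply: bdmM; first exact: bprod.
    apply: bdmD; first exact: bdm_cst.
    apply: (bdm_comp (h := tr)) => //; first by exists 1.
    exact: bsum.
  - by apply: bdmM => //; exact: bprod.
have plain : Ex P (fun w => \prod_(i <- s) \1_(B i) (Y i w) * \1_(B a) (Y a w)) =
             Ex P' (fun w => \prod_(i <- s) \1_(B i) (Y' i w) * \1_(B a) (Y' a w)).
  apply: fourier_unique => //; [exact: bprod|exact: bprod|].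
  move=> tau; have := IH (sh (fun=> 0) tau).
  have E (y : I -> R) : \sum_i sh (fun=> 0) tau i * y i = tau * y a.
    by rewrite shift_sum big1 ?add0r// => i _; rewrite mul0r.
  by split; [move: (IH (sh (fun=> 0) tau)).1|move: (IH (sh (fun=> 0) tau)).2];
    under eq_Ex do rewrite E; under [in RHS]eq_Ex do rewrite E.
have weighted (tr : R -> R) : measurable_fun setT tr -> (forall x : R, `|tr x| <= 1) ->
    same_weighted_fourier P (Z _ _ Y tr) (Y a) P' (Z _ _ Y' tr) (Y' a) ->
    Ex P (fun w => \prod_(i <- a :: s) \1_(B i) (Y i w) * tr (\sum_i t i * Y i w)) =
    Ex P' (fun w => \prod_(i <- a :: s) \1_(B i) (Y' i w) * tr (\sum_i t i * Y' i w)).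
  move=> mtr tr1 sameZ; rewrite !prodE// plain; congr (_ - _).
  have bZ d1 (T1 : measurableType d1) (Y1 : I -> T1 -> R) :
      (forall i, measurable_fun setT (Y1 i)) -> bounded_measurable (Z _ _ Y1 tr).
    move=> mY1; apply: bdmM; first exact: bprod.
    apply: bdmD; first exact: bdm_cst.
    apply: (bdm_comp (h := tr)) => //; first by exists 1.
    exact: bsum.
  have Z0 d1 (T1 : measurableType d1) (Y1 : I -> T1 -> R) w : 0 <= Z _ _ Y1 tr w.
    rewrite mulr_ge0// -lerBlDl sub0r.
    by have := tr1 (\sum_i t i * Y1 i w); rewrite ler_norml => /andP[].
  by apply: fourier_unique => //; exact: bZ.
have mcos : measurable_fun setT (@cos R).
  by apply: continuous_measurable_fun; exact: continuous_cos.
have msin : measurable_fun setT (@sin R).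
  by apply: continuous_measurable_fun; exact: continuous_sin.
have shift0 d1 (T1 : measurableType d1) (Y1 : I -> T1 -> R) tau w :
    \sum_i sh (fun=> 0) tau i * Y1 i w = tau * Y1 a w.
  by rewrite shift_sum big1 ?add0r// => i _; rewrite mul0r.
(* product-to-sum: multiplying by cos or sin of tau * Y a only shifts the a-th frequency *)
have comb (tr tr' f g : R -> R) tau c c' :
    (f = cos \/ f = sin) -> (g = cos \/ g = sin) ->
    (forall V U, (1 + tr V) * tr' U = f U + (c * g (V + U) + c' * g (V - U))) ->
    Ex P (fun w => Z _ _ Y tr w * tr' (tau * Y a w)) =
    Ex P' (fun w => Z _ _ Y' tr w * tr' (tau * Y' a w)).
  move=> fcs gcs trE.
  pose p d1 (T1 : measurableType d1) (Y1 : I -> T1 -> R) w : R := \prod_(i <- s) \1_(B i) (Y1 i w).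
  pose F d1 (T1 : measurableType d1) (Y1 : I -> T1 -> R) (h : R -> R) t1 w : R :=
    p _ _ Y1 w * h (\sum_i t1 i * Y1 i w).
  have ZE d1 (T1 : measurableType d1) (Y1 : I -> T1 -> R) w :
      Z _ _ Y1 tr w * tr' (tau * Y1 a w) =
      F _ _ Y1 f (sh (fun=> 0) tau) w + (c * F _ _ Y1 g (sh t tau) w + c' * F _ _ Y1 g (sh t (- tau)) w).
    rewrite /Z -mulrA trE /F shift0 !shift_sum mulNr /p; ring.
  under eq_Ex do rewrite ZE; under [in RHS]eq_Ex do rewrite ZE.
  have bF d1 (T1 : measurableType d1) (Y1 : I -> T1 -> R) h t1 :
      (forall i, measurable_fun setT (Y1 i)) -> (h = cos \/ h = sin) ->
      bounded_measurable (F _ _ Y1 h t1).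
    by move=> mY1 [] ->; [exact: bc|exact: bs].
  have EF h t1 : (h = cos \/ h = sin) -> Ex P (F _ _ Y h t1) = Ex P' (F _ _ Y' h t1).
    by move=> [] ->; [exact: (IH t1).1|exact: (IH t1).2].
  have ExF d1 (T1 : measurableType d1) (P1 : probability T1 R) (Y1 : I -> T1 -> R) :
      (forall i, measurable_fun setT (Y1 i)) ->
      Ex P1 (fun w => F _ _ Y1 f (sh (fun=> 0) tau) w +
        (c * F _ _ Y1 g (sh t tau) w + c' * F _ _ Y1 g (sh t (- tau)) w)) =
      Ex P1 (F _ _ Y1 f (sh (fun=> 0) tau)) +
      (c * Ex P1 (F _ _ Y1 g (sh t tau)) + c' * Ex P1 (F _ _ Y1 g (sh t (- tau)))).
    move=> mY1.
    have b1 := bF _ _ _ f (sh (fun=> 0) tau) mY1 fcs.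
    have b2 := bF _ _ _ g (sh t tau) mY1 gcs.
    have b3 := bF _ _ _ g (sh t (- tau)) mY1 gcs.
    by rewrite ExD//; [rewrite ExD ?ExZ//; exact: bdmZ|apply: bdmD; exact: bdmZ].
  by rewrite !ExF// !EF.
have cc : @cos R = cos \/ @cos R = sin by left.
have ss : @sin R = cos \/ @sin R = sin by right.
split; apply: weighted => //; [exact: cos_max| |exact: sin_max|] => tau; split.
- by apply: (@comb cos cos cos cos tau 2^-1 2^-1) => // V U; rewrite cosD cosB; field.
- by apply: (@comb cos sin sin sin tau 2^-1 (- 2^-1)) => // V U; rewrite sinD sinB; field.
- by apply: (@comb sin cos cos sin tau 2^-1 2^-1) => // V U; rewrite sinD sinB; field.
- by apply: (@comb sin sin sin cos tau (- 2^-1) 2^-1) => // V U; rewrite cosD cosB; field.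
Qed.

Lemma measurable_family d1 (T1 : measurableType d1) (Y1 : I -> T1 -> R) :
  (forall i, measurable_fun setT (Y1 i)) ->
  measurable_fun setT (fun w => (fun i => Y1 i w) : coordinates).
Proof.
move=> mY1; apply: (@measurability _ _ T1 coordinates setT _ boxes) => // _ [_ [B mB <-] <-].
rewrite setTI.
have -> : (fun w i => Y1 i w) @^-1` box B = \bigcap_(i in [set: I]) (Y1 i @^-1` B i).
  by apply/seteqP; split => w; [move=> h i _; exact: h|move=> h i; exact: h].
apply: fin_bigcap_measurable => // i _.
by rewrite -[X in measurable X]setTI; exact: (mY1 i measurableT _ (mB i)).
Qed.

Let box_prod d1 (T1 : measurableType d1) (P1 : probability T1 R) (Y1 : I -> T1 -> R)
    (B : I -> set (measurableTypeR R)) :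
  (forall i, measurable_fun setT (Y1 i)) -> (forall i, measurable (B i)) ->
  fine (P1 [set w | box B (fun i => Y1 i w)]) =
  Ex P1 (fun w => \prod_(i <- index_enum I) \1_(B i) (Y1 i w) * cos (\sum_i 0 * Y1 i w)).
Proof.
move=> mY1 mB.
have mbox : measurable [set w | box B (fun i => Y1 i w)].
  rewrite -[X in measurable X]setTI.
  apply: (measurable_family mY1) => //; apply: sub_sigma_algebra.
  by exists B.
rewrite -Ex_indic//; apply: eq_Ex => w.
rewrite (_ : \sum_i _ = 0); last by rewrite big1// => i _; rewrite mul0r.
rewrite cos0 mulr1 indicE; case: (boolP (w \in _)) => [|/negP]; rewrite inE => wB.
  by rewrite big1// => i _; rewrite indicE mem_set//; exact: wB.
have [i nB] : exists i, ~ B i (Y1 i w) by apply/existsNP.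
by rewrite (bigD1 i)//= indicE memNset// mul0r.
Qed.

Theorem char_fun_unique (C : set coordinates) : measurable C ->
  P [set w | C (fun i => Y i w)] = P' [set w | C (fun i => Y' i w)].
Proof.
move=> mC.
have m1 := measurable_family mY; have m2 := measurable_family mY'.
pose X : {mfun T >-> coordinates} := mfun_of m1.
pose X' : {mfun T' >-> coordinates} := mfun_of m2.
have setTbox : boxes [set: coordinates].
  by exists (fun=> setT) => //; apply/seteqP; split.
apply: (@measure_unique _ _ coordinates boxes (fun=> setT) _ _ _ _
  (distribution P X) (distribution P' X')) => //.
- move=> _ _ [B mB <-] [B' mB' <-]; exists (fun i => B i `&` B' i).
    by move=> i; exact: measurableI.
  apply/seteqP; split => f; first by move=> h; split => i; have [] := h i.
  by move=> [h h'] i; split; [exact: h|exact: h'].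
- by apply/seteqP; split => // f _; exists 0%N.
- move=> _ [B mB <-]; rewrite /distribution /pushforward /=.
  have mb d1 (T1 : measurableType d1) (Y1 : I -> T1 -> R) :
      (forall i, measurable_fun setT (Y1 i)) -> measurable [set w | box B (fun i => Y1 i w)].
    move=> mY1; rewrite -[X in measurable X]setTI.
    by apply: (measurable_family mY1) => //; apply: sub_sigma_algebra; exists B.
  change (P [set w | box B (fun i => Y i w)] = P' [set w | box B (fun i => Y' i w)]).
  by apply: eq_prob_fine; [exact: mb|exact: mb|rewrite !box_prod// (step _ mB (fun=> 0)).1].
- by move=> _; rewrite ltey_eq probability_fin.
Qed.

End JointLaw.

(** * Characteristic functions of independent families *)

Section IndependentProducts.
Context (R : realType) d (T : measurableType d) (P : probability T R).

(** The sum is the integer part of y, written with indicators of level sets. *)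
Let layer_sum (N : nat) (y : R) : 0 <= y -> y <= N%:R ->
  y - 1 <= \sum_(k < N) ((k.+1%:R <= y)%R%:R : R) <= y.
Proof.
elim: N => [|N IH] y0 yN.
  by rewrite big_ord0 y0 andbT; lra.
rewrite big_ord_recr /=; have [yN'|yN'] := leP y N%:R.
  rewrite (_ : (N.+1%:R <= y) = false) ?addr0 ?IH//.
  by apply/negbTE; rewrite -ltNge (le_lt_trans yN')// ltr_nat.
have -> : \sum_(k < N) (k.+1%:R <= y)%R%:R = N%:R :> R.
  rewrite (eq_bigr (fun=> 1)) ?sumr_const ?card_ord// => k _.
  by rewrite (_ : _ <= y)// (le_trans _ (ltW yN'))// ler_nat.
rewrite -natr1 in yN *.
by case: (leP (N%:R + 1) y) => h /=; apply/andP; split; lra.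
Qed.

(** [hn n] rounds h down to a multiple of 1/(n+1). It is a finite sum of indicators of level sets,
    for which the factorization is assumed, and it converges uniformly to h. *)
Lemma independent_weight (W Z : T -> R) (h : R -> R) (c : R) :
  bounded_measurable W -> measurable_fun setT Z ->
  (forall B : set (measurableTypeR R), measurable B ->
    Ex P (fun w => W w * \1_B (Z w)) = Ex P W * fine (P (Z @^-1` B))) ->
  measurable_fun setT h -> (forall x, 0 <= h x <= c) ->
  Ex P (fun w => W w * h (Z w)) = Ex P W * Ex P (fun w => h (Z w)).
Proof.
move=> bW mZ WZ mh h0c.
pose A n k : set (measurableTypeR R) := [set x | k.+1%:R <= n.+1%:R * h x].
have mA n k : measurable (A n k).
  rewrite -[A n k]setTI.
  apply: (@measurable_fun_le _ (measurableTypeR R) _ setT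
    (fun=> k.+1%:R) (fun x => n.+1%:R * h x)) => //; apply: measurable_funM => //.
pose N n := Num.bound (n.+1%:R * c).
pose hn n x : R := n.+1%:R^-1 * \sum_(k < N n) \1_(A n k) x.
have c0 : 0 <= c by have /andP[h1 h2] := h0c 0; exact: le_trans h2.
have hnE n x : `|hn n x - h x| <= n.+1%:R^-1.
  have /andP[hx0 hxc] := h0c x.
  have n0 : 0 < n.+1%:R :> R by [].
  have := @layer_sum (N n) (n.+1%:R * h x).
  rewrite mulr_ge0// => /(_ isT); have -> : n.+1%:R * h x <= (N n)%:R.
    rewrite (@le_trans _ _ (n.+1%:R * c)) ?ler_wpM2l// ltW// archi_boundP// mulr_ge0//.
  move=> /(_ isT).
  rewrite (eq_bigr (fun k : 'I_(N n) => \1_(A n k) x)); last first.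
    by move=> k _; rewrite indicE /A mem_setE /=.
  rewrite /hn; set S := \sum_(k < N n) _ => /andP[h1 h2].
  have -> : n.+1%:R^-1 * S - h x = n.+1%:R^-1 * (S - n.+1%:R * h x) by field; rewrite gt_eqF.
  rewrite normrM ger0_norm ?invr_ge0//.
  by rewrite ler_piMr ?invr_ge0// ler_norml; apply/andP; split; lra.
have bh : bounded_measurable (fun w => h (Z w)).
  apply: (bdm_comp (h := h)) => //; exists c => x.
  by have /andP[h1 h2] := h0c x; rewrite ger0_norm.
have bhn n : bounded_measurable (fun w => hn n (Z w)).
  apply: bdmZ; elim: (N n) => [|m IH].
    by under eq_fun do rewrite big_ord0; exact: bdm_cst.
  under eq_fun do rewrite big_ord_recr/=.
  by apply: bdmD => //; exact: (bdm_indic_comp R (mA n m) mZ).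
have step n : Ex P (fun w => W w * hn n (Z w)) = Ex P W * Ex P (fun w => hn n (Z w)).
  have bA k : bounded_measurable (fun w => \1_(A n k) (Z w) : R).
    exact: (bdm_indic_comp R (mA n k) mZ).
  have bS m : bounded_measurable (fun w => \sum_(k < m) \1_(A n k) (Z w) : R).
    elim: m => [|m IH]; first by under eq_fun do rewrite big_ord0; exact: bdm_cst.
    by under eq_fun do rewrite big_ord_recr/=; exact: bdmD.
  rewrite /hn; under eq_Ex do rewrite mulrCA.
  rewrite !ExZ//; last exact: bdmM.
  rewrite mulrCA; congr (_ * _); elim: (N n) => [|m IH].
    under eq_Ex do rewrite big_ord0 mulr0; under [X in _ * X]eq_Ex do rewrite big_ord0.
    by rewrite Ex_cst mulr0.
  under eq_Ex do rewrite big_ord_recr/= mulrDr.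
  under [X in _ * X]eq_Ex do rewrite big_ord_recr/=.
  rewrite (ExD P (bdmM bW (bS m)) (bdmM bW (bA m))) (ExD P (bS m) (bA m)) IH mulrDr.
  congr (_ + _); rewrite WZ//; congr (_ * _).
  have mZA : measurable (Z @^-1` A n m) by rewrite -[X in measurable X]setTI; exact: (mZ measurableT _ (mA n m)).
  by rewrite -Ex_indic//; exact: eq_Ex.
have hn_cvg x : hn ^~ x @ \oo --> h x.
  apply/cvgrPdist_le => e e0; near=> n; rewrite distrC (le_trans (hnE n x))//.
  by apply: ltW; near: n; apply: (near_infty_natSinv_lt (PosNum e0)).
have hn_le n x : `|hn n x| <= c + 1.
  have /andP[hx0 hxc] := h0c x.
  rewrite -[hn n x](subrK (h x)) (le_trans (ler_normD _ _))// addrC lerD//.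
    by rewrite ger0_norm.
  by rewrite (le_trans (hnE n x))// invf_le1// ler1n.
have [mW [cW Wc]] := bW.
have lim1 : (fun n => Ex P (fun w => W w * hn n (Z w))) @ \oo --> Ex P (fun w => W w * h (Z w)).
  apply: (@Ex_cvg _ _ _ _ _ _ (cW * (c + 1))).
  - by move=> n; apply: measurable_funM => //; exact: bdm_measurable.
  - by move=> n w; rewrite normrM ler_pM.
  - by move=> w; apply: cvgM; [exact: cvg_cst|exact: hn_cvg].
have lim2 : (fun n => Ex P (fun w => W w * hn n (Z w))) @ \oo --> Ex P W * Ex P (fun w => h (Z w)).
  rewrite (_ : (fun n => _) = fun n => Ex P W * Ex P (fun w => hn n (Z w))); last first.
    by apply/funext => n; exact: step.
  apply: cvgM; first exact: cvg_cst.
  apply: (@Ex_cvg _ _ _ _ _ _ (c + 1)) => //.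
  by move=> n; exact: bdm_measurable.
exact: (cvg_unique _ lim1 lim2).
Unshelve. all: by end_near. Qed.

Lemma independent_char_fun (I : eqType) (Z : I -> T -> R) (phi : I -> R) :
  (forall i, measurable_fun setT (Z i)) -> mutually_independent P Z ->
  (forall i, Ex P (fun w => cos (Z i w)) = phi i) ->
  (forall i, Ex P (fun w => sin (Z i w)) = 0) ->
  forall s : seq I, uniq s ->
    Ex P (fun w => cos (\sum_(i <- s) Z i w)) = \prod_(i <- s) phi i /\
    Ex P (fun w => sin (\sum_(i <- s) Z i w)) = 0.
Proof.
move=> mZ indZ cphi sphi.
have mpre i (B : set (measurableTypeR R)) : measurable B -> measurable (Z i @^-1` B).
  by move=> mB; rewrite -[X in measurable X]setTI; exact: mZ.
have bp (r : seq I) (B : I -> set (measurableTypeR R)) : (forall i, measurable (B i)) ->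
    bounded_measurable (fun w => \prod_(i <- r) \1_(B i) (Z i w) : R).
  move=> mB; elim: r => [|a r IH]; first by under eq_fun do rewrite big_nil; exact: bdm_cst.
  under eq_fun do rewrite big_cons.
  by apply: bdmM => //; exact: (bdm_indic_comp R (mB a) (mZ a)).
have Ep (r : seq I) (B : I -> set (measurableTypeR R)) : uniq r -> (forall i, measurable (B i)) ->
    Ex P (fun w => \prod_(i <- r) \1_(B i) (Z i w)) = \prod_(i <- r) fine (P (Z i @^-1` B i)).
  move=> ur mB; have := indZ r B ur mB.
  have mcap : measurable (\big[setI/setT]_(i <- r) (Z i @^-1` B i)).
    by apply: bigsetI_measurable => i _; exact: mpre.
  move=> /(congr1 (@fine R)); rewrite -Ex_indic// => h.
  transitivity (Ex P (\1_(\big[setI/setT]_(i <- r) (Z i @^-1` B i)) : T -> R)).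
    apply: eq_Ex => w; elim: (r) => [|a r' IH]; first by rewrite !big_nil indicE in_setT.
    by rewrite !big_cons IH !indicE in_setI -mulnb natrM.
  rewrite h; elim: (r) => [|a r' IH]; first by rewrite !big_nil.
  rewrite !big_cons fineM ?IH//; first by apply: probability_fin; exact: mpre.
  elim: (r') => [|b r'' IH']; first by rewrite big_nil.
  by rewrite big_cons fin_numM// probability_fin//; exact: mpre.
have msum (s : seq I) : measurable_fun setT (fun w => \sum_(i <- s) Z i w).
  by apply: measurable_sum => i.
(* The indicators over a second, disjoint list r are what makes the induction work: splitting off
   the term of index a requires its independence from the remaining sum, and this is the same
   statement with a moved from s to r. *)
have main (s : seq I) : forall (r : seq I) (B : I -> set (measurableTypeR R)), uniq (s ++ r) -> (forall i, measurable (B i)) ->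
    Ex P (fun w => \prod_(i <- r) \1_(B i) (Z i w) * cos (\sum_(i <- s) Z i w)) =
      \prod_(i <- r) fine (P (Z i @^-1` B i)) * \prod_(i <- s) phi i /\
    Ex P (fun w => \prod_(i <- r) \1_(B i) (Z i w) * sin (\sum_(i <- s) Z i w)) = 0.
  elim: s => [|a s IH] r B usr mB.
    under eq_Ex do rewrite big_nil cos0 mulr1; under [X in _ /\ X = _]eq_Ex do rewrite big_nil sin0 mulr0.
    by rewrite Ex_cst big_nil mulr1 Ep.
  have [usr1 [ar usr2]] : uniq (s ++ a :: r) /\ a \notin r /\ uniq (s ++ r).
    move: usr; rewrite /= !cat_uniq mem_cat => /andP[/norP[as_ ar] /and3P[us hs ur]].
    by rewrite us ur /= negb_or as_ hs ar.
  pose B' (C : set (measurableTypeR R)) i := if i == a then C else B i.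
  have mB' C : measurable C -> forall i, measurable (B' C i).
    by move=> mC i; rewrite /B'; case: ifP.
  have prodB' C w : \prod_(i <- a :: r) \1_(B' C i) (Z i w) =
      \prod_(i <- r) \1_(B i) (Z i w) * \1_C (Z a w) :> R.
    rewrite big_cons {1}/B' eqxx mulrC; congr (_ * _).
    rewrite big_seq [RHS]big_seq; apply: eq_bigr => i ir.
    by rewrite /B'; case: eqVneq => // ia; move: ar; rewrite -ia ir.
  have PprodB' C : \prod_(i <- a :: r) fine (P (Z i @^-1` B' C i)) =
      \prod_(i <- r) fine (P (Z i @^-1` B i)) * fine (P (Z a @^-1` C)).
    rewrite big_cons {1}/B' eqxx mulrC; congr (_ * _).
    rewrite big_seq [RHS]big_seq; apply: eq_bigr => i ir.
    by rewrite /B'; case: eqVneq => // ia; move: ar; rewrite -ia ir.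
  pose p w : R := \prod_(i <- r) \1_(B i) (Z i w); pose V w := \sum_(i <- s) Z i w.
  have [EC ES] := IH r B usr2 mB.
  have bpV : bounded_measurable (fun w => p w * cos (V w)).
    by apply: bdmM; [exact: bp|apply: bdm_cos; exact: msum].
  have bpS : bounded_measurable (fun w => p w * sin (V w)).
    by apply: bdmM; [exact: bp|apply: bdm_sin; exact: msum].
  have weight tr : (tr = cos \/ tr = sin) -> forall h, (h = cos \/ h = sin) ->
      Ex P (fun w => (p w * tr (V w)) * h (Z a w)) =
      Ex P (fun w => p w * tr (V w)) * Ex P (fun w => h (Z a w)).
    move=> trcs h hcs.
    have bptr : bounded_measurable (fun w => p w * tr (V w)) by case: trcs => ->.
    have mh : measurable_fun setT h.
      case: hcs => ->; apply: continuous_measurable_fun;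
        [exact: continuous_cos|exact: continuous_sin].
    (* [independent_weight] needs a nonnegative function, so 1 is added to cos or sin and cancelled
       afterwards. *)
    have h1 x : 0 <= h x + 1 <= 2.
      case: hcs => ->; apply/andP; [move: (cos_geN1 x) (cos_le1 x)|move: (sin_geN1 x) (sin_le1 x)];
        by split; lra.
    have bh : bounded_measurable (fun w => h (Z a w)).
      by case: hcs => ->; [exact: bdm_cos|exact: bdm_sin].
    have := @independent_weight (fun w => p w * tr (V w)) (Z a) (fun x => h x + 1) 2 bptr (mZ a).
    move=> H; have {H} := H _ _ h1.
    have -> : Ex P (fun w => p w * tr (V w) * (h (Z a w) + 1)) =
        Ex P (fun w => p w * tr (V w) * h (Z a w)) + Ex P (fun w => p w * tr (V w)).
      by rewrite -ExD//; [apply: eq_Ex => w; ring|exact: bdmM].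
    rewrite ExD//; last exact: bdm_cst.
    rewrite Ex_cst mulrDr mulr1 => H; apply: (addIr (Ex P (fun w => p w * tr (V w)))); apply: H.
    - move=> C mC.
      have [EC' ES'] := IH (a :: r) (B' C) usr1 (mB' C mC).
      have reord : Ex P (fun w => p w * tr (V w) * \1_C (Z a w)) =
          Ex P (fun w => \prod_(i <- a :: r) \1_(B' C i) (Z i w) * tr (V w)).
        by apply: eq_Ex => w; rewrite prodB' /p; ring.
      rewrite reord; case: trcs => -> in reord *.
        by rewrite EC' EC PprodB'; ring.
      by rewrite ES' ES mul0r.
    - by apply: measurable_funD => //; exact: measurable_cst.
  have cc : @cos R = cos \/ @cos R = sin by left.
  have ss : @sin R = cos \/ @sin R = sin by right.
  have b1 tr h : (tr = cos \/ tr = sin) -> (h = cos \/ h = sin) ->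
      bounded_measurable (fun w => (p w * tr (V w)) * h (Z a w)).
    move=> trcs hcs; apply: bdmM; first by case: trcs => ->.
    by case: hcs => ->; [exact: bdm_cos|exact: bdm_sin].
  split.
  - transitivity (Ex P (fun w => (p w * cos (V w)) * cos (Z a w) - (p w * sin (V w)) * sin (Z a w))).
      by apply: eq_Ex => w; rewrite big_cons cosD /p /V; ring.
    rewrite ExB; [|exact: b1|exact: b1].
    by rewrite !weight// EC ES mul0r subr0 cphi big_cons; ring.
  - transitivity (Ex P (fun w => (p w * cos (V w)) * sin (Z a w) + (p w * sin (V w)) * cos (Z a w))).
      by apply: eq_Ex => w; rewrite big_cons sinD /p /V; ring.
    rewrite ExD; [|exact: b1|exact: b1].
    by rewrite !weight// EC ES sphi mul0r mulr0 addr0.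
move=> s us; have := main s [::] (fun=> setT); rewrite cats0 => /(_ us) [] //.
rewrite !big_nil mul1r => EC ES; split; [rewrite -EC|rewrite -[RHS]ES];
  by apply: eq_Ex => w; rewrite big_nil mul1r.
Qed.

End IndependentProducts.

(** * The real-valued norm *)

Section Scalars.
Context (R : realType) (k : scalar_kind).
Local Notation K := (scalar_field R k).
Local Notation sor := (@scalar_of_real R k).

Definition scalar_Im : scalar_field R k -> R :=
  match k return scalar_field R k -> R with
  | RealScalars => fun=> 0
  | ComplexScalars => fun z => complex.Im z
  end.

(* the imaginary unit in the complex case, junk value 0 in the real case *)
Definition scalar_i : scalar_field R k :=
  match k return scalar_field R k with
  | RealScalars => 0
  | ComplexScalars => 'i%C
  end.

Lemma scalar_ReIm (z : K) : z = sor (scalar_Re z) + sor (scalar_Im z) * scalar_i.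
Proof.
rewrite /scalar_Im /scalar_i; case: (k) z => [z|[x y]] /=; first by rewrite mul0r addr0.
by apply/eqP; rewrite eq_complex /=; apply/andP; split; apply/eqP; ring.
Qed.

Lemma scalar_of_realD x y : sor (x + y) = sor x + sor y.
Proof. by case: k => //=; rewrite rmorphD. Qed.

Lemma scalar_of_realM x y : sor (x * y) = sor x * sor y.
Proof. by case: k => //=; rewrite rmorphM. Qed.

Lemma scalar_of_realN x : sor (- x) = - sor x.
Proof. by case: k => //=; rewrite rmorphN. Qed.

Lemma scalar_of_real0 : sor 0 = 0.
Proof. by case: k. Qed.

Lemma scalar_of_real1 : sor 1 = 1.
Proof. by case: k. Qed.

Lemma scalar_of_realK : cancel sor (@scalar_Re R k).
Proof. by case: k. Qed.

Lemma scalar_Im_of_real x : scalar_Im (sor x) = 0.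
Proof. by rewrite /scalar_Im; case: k. Qed.

Lemma scalar_ReD (x y : K) : scalar_Re (x + y) = scalar_Re x + scalar_Re y.
Proof. by case: k x y => //= -[a b] [c d]. Qed.

Lemma scalar_ImD (x y : K) : scalar_Im (x + y) = scalar_Im x + scalar_Im y.
Proof. by rewrite /scalar_Im; case: k x y => [|[a b] [c d]] //=; rewrite addr0. Qed.

Lemma scalar_ge0P (e : K) : 0 <= e -> e = sor (scalar_Re e) /\ 0 <= scalar_Re e.
Proof.
case: (k) e => [e //|[x y]] /=; rewrite lecE /= => /andP[/eqP -> ->]; by [].
Qed.

Lemma scalar_of_real_le x y : (sor x <= sor y) = (x <= y).
Proof. by case: k => //=; rewrite lecR. Qed.

Lemma scalar_of_real_lt x y : (sor x < sor y) = (x < y).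
Proof. by case: k => //=; rewrite ltcR. Qed.

End Scalars.

Section RealNorm.
Context (R : realType) (k : scalar_kind).
Local Notation K := (scalar_field R k).
Local Notation sor := (@scalar_of_real R k).

Section Normed.
Context (V : normedZmodType K).
Implicit Types x y : V.

Lemma normE x : `|x| = sor (rnorm x).
Proof. by have [] := scalar_ge0P (normr_ge0 x). Qed.

Lemma rnorm_ge0 x : 0 <= rnorm x.
Proof. by have [] := scalar_ge0P (normr_ge0 x). Qed.

Lemma rnormD x y : rnorm (x + y) <= rnorm x + rnorm y.
Proof.
rewrite -(@scalar_of_real_le R k) scalar_of_realD -!normE; exact: ler_normD.
Qed.

Lemma rnormN x : rnorm (- x) = rnorm x.
Proof. by rewrite /rnorm normrN. Qed.

Lemma rnormB x y : rnorm (x - y) <= rnorm x + rnorm y.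
Proof. by rewrite -[rnorm y]rnormN; exact: rnormD. Qed.

Lemma rdistC x y : rnorm (x - y) = rnorm (y - x).
Proof. by rewrite -opprB rnormN. Qed.

Lemma rnorm0 : rnorm (0 : V) = 0.
Proof. by rewrite /rnorm normr0 -(scalar_of_real0 R k) scalar_of_realK. Qed.

Lemma rnorm_eq0 x : rnorm x = 0 -> x = 0.
Proof. by move=> x0; apply/eqP; rewrite -normr_eq0 normE x0 scalar_of_real0. Qed.

Lemma rdist_triangle x y z : rnorm (x - z) <= rnorm (x - y) + rnorm (y - z).
Proof. by rewrite (_ : x - z = (x - y) + (y - z)) ?rnormD// addrA subrK. Qed.

Lemma rdist_rnorm x y : `|rnorm x - rnorm y| <= rnorm (x - y).
Proof.
have h (u v : V) : rnorm u - rnorm v <= rnorm (u - v).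
  by rewrite lerBlDr -{1}[u](subrK v) rnormD.
by rewrite ler_norml lerNl opprB h/= andbT rdistC h.
Qed.

End Normed.

Lemma rnorm_of_real (x : R) : rnorm (sor x : K) = `|x|.
Proof.
have : `|sor x| = sor `|x| :> K by case: k => //=; rewrite normc_def /= expr0n addr0 sqrtr_sqr.
by rewrite /rnorm => ->; rewrite scalar_of_realK.
Qed.

Section Module.
Context (V : normedModType K).
Implicit Types x y : V.

Lemma rnormZ (c : K) x : rnorm (c *: x) = rnorm c * rnorm x.
Proof.
by rewrite -[LHS](scalar_of_realK k) -normE normrZ !normE -scalar_of_realM scalar_of_realK.
Qed.

Lemma rnormZr (r : R) x : rnorm (sor r *: x) = `|r| * rnorm x.
Proof. by rewrite rnormZ rnorm_of_real. Qed.

Lemma nbhs_rnorm x (U : set V) :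
  nbhs x U <-> exists2 e : R, 0 < e & forall y, rnorm (y - x) < e -> U y.
Proof.
split.
  move=> /nbhs_normP[e /= e0 eU]; have [eE sRe0] := scalar_ge0P (ltW e0).
  exists (scalar_Re e).
    by rewrite -(@scalar_of_real_lt R k) -eE scalar_of_real0.
  move=> y yx; apply: eU => /=.
  by rewrite distrC normE eE scalar_of_real_lt.
move=> [e e0 eU]; apply/nbhs_normP; exists (sor e).
  by rewrite /= -(scalar_of_real0 R k) scalar_of_real_lt.
by move=> y /=; rewrite distrC normE scalar_of_real_lt; exact: eU.
Qed.

Lemma open_rnorm (U : set V) :
  open U <-> forall x, U x -> exists2 e : R, 0 < e & forall y, rnorm (y - x) < e -> U y.
Proof.
rewrite openE; split.
  by move=> oU x Ux; apply/nbhs_rnorm; exact: oU.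
by move=> h x Ux; apply/nbhs_rnorm; exact: h.
Qed.

Lemma open_rball x (r : R) : open [set y : V | rnorm (y - x) < r].
Proof.
apply/open_rnorm => y /= yx; exists (r - rnorm (y - x)); first by rewrite subr_gt0.
by move=> z zy; rewrite (le_lt_trans (rdist_triangle z y x))// -ltrBrDr.
Qed.

Lemma cvg_rnorm (u : nat -> V) (l : V) :
  u @ \oo --> l <-> (fun n => rnorm (u n - l)) @ \oo --> (0 : R).
Proof.
split.
- move=> ul; apply/cvgr0Pnorm_lt => e e0.
  have : nbhs l [set y | rnorm (y - l) < e] by apply/nbhs_rnorm; exists e.
  move=> /ul ul'; near=> n; rewrite ger0_norm ?rnorm_ge0//.
  by near: n; exact: ul'.
- move=> /cvgr0Pnorm_lt h U /nbhs_rnorm[e e0 eU].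
  have := h _ e0; apply: filterS => n /= hn; apply: eU.
  by rewrite ger0_norm// in hn; exact: rnorm_ge0.
Unshelve. all: by end_near. Qed.

End Module.

End RealNorm.

Section Complete.
Context (R : realType) (k : scalar_kind) (E : completeNormedModType (scalar_field R k)).
Local Notation sor := (@scalar_of_real R k).

Lemma rnorm_complete (u : nat -> E) :
  (forall e : R, 0 < e -> exists N, forall m n, (N <= m)%N -> (N <= n)%N -> rnorm (u m - u n) < e) ->
  exists l, (fun n => rnorm (u n - l)) @ \oo --> (0 : R).
Proof.
move=> cu.
have : cvgn u.
  apply: cauchy_cvg; apply/cauchy_ballP => e e0.
  have [eE sRe0] := scalar_ge0P (ltW e0).
  have sRe1 : 0 < scalar_Re e by rewrite -(@scalar_of_real_lt R k) -eE scalar_of_real0.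
  have [N hN] := cu _ sRe1.
  exists ([set x | exists2 n, (N <= n)%N & x = u n], [set x | exists2 n, (N <= n)%N & x = u n]).
    by split; exists N => // n /= Nn; exists n.
  move=> [_ _] /= [[m Nm ->] [n Nn ->]].
  by rewrite -ball_normE /ball_ /= normE eE scalar_of_real_lt; exact: hN.
by move=> cvu; exists (lim (u @ \oo)); apply/cvg_rnorm.
Qed.

Lemma linear_bounded (f : {linear E -> E}) : continuous f ->
  exists2 C : R, 0 < C & forall x, rnorm (f x) <= C * rnorm x.
Proof.
move=> cf.
have [a a0 fa] : exists2 a : R, 0 < a & forall y, rnorm y < a -> rnorm (f y) < 1.
  have /cf : nbhs (f 0) [set z : E | rnorm z < 1].
    by apply/nbhs_rnorm; exists 1 => // y; rewrite linear0 subr0.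
  by move=> /nbhs_rnorm[a a0 ha]; exists a => // y ya; apply: ha; rewrite subr0.
exists (2 / a); first by rewrite divr_gt0.
move=> x; have [x0|x0] := eqVneq (rnorm x) 0.
  by rewrite (rnorm_eq0 x0) linear0 !rnorm0 mulr0.
have xp : 0 < rnorm x by rewrite lt_neqAle eq_sym x0 rnorm_ge0.
have r0 : 0 < a / (2 * rnorm x) by rewrite divr_gt0// mulr_gt0.
have := fa (sor (a / (2 * rnorm x)) *: x).
rewrite linearZ /= !rnormZr (gtr0_norm r0).
have -> : a / (2 * rnorm x) * rnorm x = a / 2 by field.
rewrite ltr_pdivrMr// ltr_pMr// ltr1n => /(_ isT) /ltW.
by rewrite -ler_pdivlMl// mulr1 invf_div mulrAC.
Qed.

End Complete.

(** * Laws on a separable Banach space *)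

Lemma measurable_lt_const (R : realType) d (T : measurableType d) (f : T -> R) :
  (forall r, measurable [set w | f w < r]) -> measurable_fun setT f.
Proof.
move=> mf; apply: (measurability _ (RGenInftyO.measurableE R)).
move=> /= _ [_ [a ->] <-]; rewrite setTI.
by have -> : f @^-1` `]-oo, a[%classic = [set w | f w < a] by
  apply/seteqP; split => w /=; rewrite in_itv.
Qed.

Section SeparableMeasurability.
Context (R : realType) (k : scalar_kind) (E : completeNormedModType (scalar_field R k)).
Local Notation sor := (@scalar_of_real R k).

Lemma separable_dense_seq : separable_space E ->
  exists a : nat -> E, forall x (e : R), 0 < e -> exists n, rnorm (x - a n) < e.
Proof.
move=> [D cD dD].
have [x0 Dx0] : D !=set0.
  by have [x [_ Dx]] := dD setT (ex_intro _ 0 I) openT; exists x.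
have [a Da] : exists a : nat -> E, D `<=` range a.
  have /pfcard_geP[D0|[f]] := cD; first by rewrite D0 in Dx0.
  by exists f => x Dx; have [n _ <-] := @surj _ _ _ _ f _ Dx; exists n.
exists a => x e e0.
have [y [/= yx /Da[n _ anE]]] := dD [set y : E | rnorm (y - x) < e]
   (ex_intro _ x (eq_ind_r (fun z => is_true (z < e)) e0
     (eq_ind_r (fun z => rnorm z = 0) (rnorm0 E) (subrr x)))) (@open_rball _ _ E x e).
by exists n; rewrite anE rdistC.
Qed.

Lemma measurable_lipschitz (F : E -> R) (L : R) :
  (forall x y, `|F x - F y| <= L * rnorm (x - y)) ->
  measurable_fun setT (F : borelType E -> R).
Proof.
move=> FL; apply: measurable_lt_const => r; apply: sub_sigma_algebra.
apply/open_rnorm => x /= xr.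
have L0 : 0 < `|L| + 1 by rewrite ltr_wpDl.
exists ((r - F x) / (`|L| + 1)); first by rewrite divr_gt0// subr_gt0.
move=> y; rewrite ltr_pdivlMr// => yx.
have h1 := FL y x; have h2 : F y - F x <= `|F y - F x| by exact: ler_norm.
have h3 : L * rnorm (y - x) <= (`|L| + 1) * rnorm (y - x).
  by rewrite ler_wpM2r ?rnorm_ge0// (le_trans (ler_norm _))// lerDl.
lra.
Qed.

Lemma measurable_rdist (x : E) : measurable_fun setT ((fun y => rnorm (y - x)) : borelType E -> R).
Proof.
apply: (@measurable_lipschitz (fun y => rnorm (y - x)) 1) => y z.
by rewrite mul1r (le_trans (rdist_rnorm _ _))// opprB addrA subrK.
Qed.

Variable a : nat -> E.
Hypothesis aP : forall x (e : R), 0 < e -> exists n, rnorm (x - a n) < e.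

Context d (T : measurableType d).
Implicit Types X Y : T -> E.
Local Notation mE X := (measurable_fun setT (X : T -> borelType E)).

Lemma measurable_rnormB X x : mE X -> measurable_fun setT (fun w => rnorm (X w - x)).
Proof. by move=> mX; apply: (measurableT_comp (measurable_rdist x)). Qed.

Lemma measurable_rnorm X : mE X -> measurable_fun setT (fun w => rnorm (X w)).
Proof. by move=> /(measurable_rnormB 0); under eq_fun do rewrite subr0. Qed.

(** Separability enters here: an open set is the countable union of those balls of radius 1/(m+1)
    around some [a n] that it contains, so it is enough to measure distances. *)
Lemma measurable_to_E X : (forall x, measurable_fun setT (fun w => rnorm (X w - x))) -> mE X.
Proof.
move=> mX; apply: (@measurability _ _ T (borelType E) setT X (@open E)) => // _ [U oU <-].
rewrite setTI.
pose B n m := [set w | rnorm (X w - a n) < m.+1%:R^-1].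
pose I n := [set m : nat | forall y, rnorm (y - a n) < m.+1%:R^-1 -> U y].
have -> : X @^-1` U = \bigcup_n \bigcup_(m in I n) B n m.
  apply/seteqP; split => w /=; last by move=> [n _ [m /= h Bw]]; exact: h.
  move=> UX; have [e e0 eU] := (open_rnorm U).1 oU _ UX.
  have [m me] : exists m : nat, 2 * m.+1%:R^-1 < e.
    have e2 : 0 < e / 2 by rewrite divr_gt0.
    have [m _ hm] := near_infty_natSinv_lt (PosNum e2).
    by exists m; rewrite -ltr_pdivlMl// mulrC; exact: (hm m (leqnn m)).
  have m0 : 0 < m.+1%:R^-1 :> R by rewrite invr_gt0.
  have [n hn] := aP (X w) m0.
  exists n => //; exists m => //= y yn; apply: eU.
  rewrite (le_lt_trans (rdist_triangle y (a n) (X w)))// (rdistC (a n)).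
  by move: me hn yn => /=; set q := m.+1%:R^-1; lra.
by apply: bigcup_measurable => n _; apply: bigcup_measurable => m _; exact: measurable_set_lt.
Qed.

(** X + Y is within r of x if and only if, for some n, the distances from X to [a n] and from Y to
    [x - a n] add up to less than r. This avoids comparing the Borel sets of E x E with the product
    sigma-algebra. *)
Lemma measurable_addE X Y : mE X -> mE Y -> mE (fun w => X w + Y w).
Proof.
move=> mX mY; apply: measurable_to_E => x; apply: measurable_lt_const => r.
have splitE w n : X w + Y w - x = (X w - a n) + (Y w - (x - a n)).
  by rewrite opprB addrACA addKr.
have -> : [set w | rnorm (X w + Y w - x) < r] =
    \bigcup_n [set w | rnorm (X w - a n) + rnorm (Y w - (x - a n)) < r].
  apply/seteqP; split => w /=; last first.
    by move=> [n _ /=]; apply: le_lt_trans; rewrite (splitE w n) rnormD.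
  move=> h; have e0 : 0 < (r - rnorm (X w + Y w - x)) / 2 by rewrite divr_gt0// subr_gt0.
  have [n hn] := aP (X w) e0; exists n => //=.
  have -> : Y w - (x - a n) = (X w + Y w - x) - (X w - a n) by rewrite (splitE w n) addrAC subrr add0r.
  by have := rnormB (X w + Y w - x) (X w - a n); lra.
apply: bigcup_measurable => n _; apply: measurable_set_lt.
by apply: measurable_funD; exact: measurable_rnormB.
Qed.

Lemma measurable_contE (F : E -> E) X : continuous F -> mE X -> mE (fun w => F (X w)).
Proof.
move=> cF mX; apply: (measurableT_comp (f := F : borelType E -> borelType E)) => //.
apply: (@measurability _ _ (borelType E) (borelType E) setT F (@open E)) => // _ [U oU <-].
by rewrite setTI; apply: sub_sigma_algebra; move/continuousP: cF; exact.
Qed.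

Lemma measurable_scaleE (c : scalar_field R k) X : mE X -> mE (fun w => c *: X w).
Proof. by apply: measurable_contE; exact: scaler_continuous. Qed.

Lemma measurable_oppE X : mE X -> mE (fun w => - X w).
Proof. by move=> /(measurable_scaleE (-1)); under eq_fun do rewrite scaleN1r. Qed.

Lemma measurable_subE X Y : mE X -> mE Y -> mE (fun w => X w - Y w).
Proof. by move=> mX mY; apply: measurable_addE => //; exact: measurable_oppE. Qed.

Lemma measurable_scalerE (z : T -> R) (x : E) :
  measurable_fun setT z -> mE (fun w => sor (z w) *: x).
Proof.
move=> mz; apply: measurable_to_E => y.
apply: (measurableT_comp (f := fun r : R => rnorm (sor r *: x - y))) => //.
apply: continuous_measurable_fun => r; apply/cvgrPdist_le => e e0.
have L0 : 0 < rnorm x + 1 by rewrite ltr_wpDl// rnorm_ge0.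
near=> s; rewrite (le_trans (rdist_rnorm _ _))// opprB addrA subrK -scalerBl.
rewrite -scalar_of_realN -scalar_of_realD rnormZr.
rewrite (@le_trans _ _ (`|r - s| * (rnorm x + 1)))// ?ler_wpM2l// ?lerDl//.
rewrite -ler_pdivlMr//; near: s.
by apply: cvgr_dist_le; [exact: cvg_id|rewrite divr_gt0].
Unshelve. all: by end_near. Qed.

Lemma measurable_sumE (I : Type) (s : seq I) (X : I -> T -> E) :
  (forall i, mE (X i)) -> mE (fun w => \sum_(i <- s) X i w).
Proof.
move=> mX; elim: s => [|i s IH]; first by under eq_fun do rewrite big_nil; exact: measurable_cst.
by under eq_fun do rewrite big_cons; exact: measurable_addE.
Qed.

Lemma measurable_limE (X : nat -> T -> E) Y : (forall n, mE (X n)) ->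
  (forall w, (fun n => rnorm (X n w - Y w)) @ \oo --> (0 : R)) -> mE Y.
Proof.
move=> mX XY; apply: measurable_to_E => x.
apply: (measurable_fun_cvg (h := fun n w => rnorm (X n w - x))).
  by move=> n; exact: measurable_rnormB.
move=> w _; apply/cvgrPdist_le => e e0.
have /cvgr0Pnorm_le/(_ _ e0) := XY w; apply: filterS => n /=.
rewrite ger0_norm ?rnorm_ge0// => h; rewrite (le_trans (rdist_rnorm _ _))//.
by rewrite opprB addrA subrK rdistC.
Qed.

End SeparableMeasurability.

(** * Lipschitz test functions *)

Section LipschitzLaws.
Context (R : realType) (k : scalar_kind) (E : completeNormedModType (scalar_field R k)).

(** These test functions determine a law and tolerate small errors in probability, which is what
    limits of simple integrals require. *)
Definition lipschitz01 (L : R) (F : E -> R) :=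
  (forall x, 0 <= F x <= 1) /\ forall x y, `|F x - F y| <= L * rnorm (x - y).

Lemma bdm_lipschitz01 d (T : measurableType d) (X : T -> E) F L :
  lipschitz01 L F -> measurable_fun setT (X : T -> borelType E) ->
  bounded_measurable (fun w => F (X w)).
Proof.
move=> [F01 FL] mX; apply: (@bdm_comp _ _ _ _ (borelType E) F) => //.
  exact: (measurable_lipschitz FL).
by exists 1 => x; have /andP[h1 h2] := F01 x; rewrite ger0_norm.
Qed.

(** [depth] is the distance to the complement of U capped at 1. As a supremum of radii it makes
    sense even when the complement is empty. *)
Let inner_radii (U : set E) x : set R :=
  [set r | 0 <= r <= 1 /\ forall y, rnorm (y - x) < r -> U y].

Let depth (U : set E) x : R := sup (inner_radii U x).

Let has_sup_radii U x : has_sup (inner_radii U x).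
Proof.
split; first by exists 0; split; rewrite ?lexx ?ler01// => y; rewrite ltNge rnorm_ge0.
by exists 1 => r [/andP[]].
Qed.

Let depth_ge0 U x : 0 <= depth U x.
Proof.
apply: ub_le_sup; first by have [] := has_sup_radii U x.
by split; rewrite ?lexx ?ler01// => y; rewrite ltNge rnorm_ge0.
Qed.

Let depth_lip U x y : depth U x - depth U y <= rnorm (x - y).
Proof.
rewrite lerBlDr; apply: ge_sup; first by have [] := has_sup_radii U x.
move=> r [/andP[r0 r1] rU]; have [h|h] := leP r (rnorm (x - y)).
  by rewrite (le_trans h)// lerDl depth_ge0.
rewrite -lerBlDl; apply: ub_le_sup; first by have [] := has_sup_radii U y.
split; first by have := rnorm_ge0 (x - y) => ?; apply/andP; split; lra.
move=> z zy; apply: rU; have := rdist_triangle z y x; rewrite (rdistC y x); lra.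
Qed.

Let depth_gt0 U x : open U -> U x -> 0 < depth U x.
Proof.
move=> /open_rnorm oU /oU[e e0 eU].
have m0 : 0 < Num.min e 1 by rewrite lt_min e0 ltr01.
apply: (lt_le_trans m0); apply: ub_le_sup; first by have [] := has_sup_radii U x.
split; first by rewrite (ltW m0) ge_min lexx orbT.
by move=> y; rewrite lt_min => /andP[ye _]; exact: eU.
Qed.

Let depth_notin (U : set E) x : ~ U x -> depth U x = 0.
Proof.
move=> Ux; apply/eqP; rewrite eq_le depth_ge0 andbT.
apply: ge_sup; first by have [] := has_sup_radii U x.
move=> r [_ rU]; rewrite leNgt; apply/negP => r0; apply: Ux; apply: rU.
by rewrite subrr rnorm0.
Qed.

Lemma open_lipschitz_approx (U : set E) : open U ->
  exists F : nat -> E -> R, [/\ forall n, lipschitz01 n%:R (F n),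
    (forall n x, F n x <= \1_U x) & forall x, F ^~ x @ \oo --> (\1_U x : R)].
Proof.
move=> oU; exists (fun n x => Num.min 1 (n%:R * depth U x)); split.
- move=> n; split.
    by move=> x; rewrite le_min ler01 mulr_ge0// ge_min lexx.
  have h x y : Num.min 1 (n%:R * depth U x) - Num.min 1 (n%:R * depth U y) <= n%:R * rnorm (x - y).
    have n0 : 0 <= n%:R * rnorm (x - y) by rewrite mulr_ge0// rnorm_ge0.
    have : n%:R * (depth U x - depth U y) <= n%:R * rnorm (x - y).
      by rewrite ler_wpM2l// depth_lip.
    by rewrite mulrBr; case: (leP 1 (n%:R * depth U x)); case: (leP 1 (n%:R * depth U y)) => *; lra.
  by move=> x y; rewrite ler_norml lerNl opprB h andbT rdistC h.
- move=> n x; rewrite indicE; case: (boolP (x \in U)) => [_|/negP]; first by rewrite ge_min lexx.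
  by rewrite inE => /depth_notin ->; rewrite mulr0 ge_min lexx orbT.
- move=> x; rewrite indicE; case: (boolP (x \in U)) => [|/negP]; rewrite inE => Ux.
    have d0 := depth_gt0 oU Ux.
    apply/cvgrPdist_le => e e0; near=> n.
    rewrite (_ : Num.min _ _ = 1) ?subrr ?normr0 ?(ltW e0)//.
    apply/min_idPl; rewrite -ler_pdivrMr//; near: n; exact: nbhs_infty_ger.
  by under eq_fun do rewrite depth_notin// mulr0 min_r//; exact: cvg_cst.
Unshelve. all: by end_near. Qed.

(** Open sets are stable under intersection and generate the Borel sets, and their indicators are
    bounded pointwise limits of test functions. *)
Lemma lipschitz_law d (T : measurableType d) (P : probability T R)
    d' (T' : measurableType d') (P' : probability T' R) (X : T -> E) (X' : T' -> E) :
  measurable_fun setT (X : T -> borelType E) -> measurable_fun setT (X' : T' -> borelType E) ->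
  (forall F L, lipschitz01 L F -> Ex P (fun w => F (X w)) = Ex P' (fun w => F (X' w))) ->
  same_distribution P P' X X'.
Proof.
move=> mX mX' FXX' B mB.
apply: (@measure_unique _ _ (borelType E) (@open E) (fun=> setT) _ _ _ _
  (distribution P (mfun_of mX)) (distribution P' (mfun_of mX'))) => //.
- exact: openI.
- by move=> _; exact: openT.
- by apply/seteqP; split => // f _; exists 0%N.
- move=> U oU.
  have mU : measurable (U : set (borelType E)) by exact: sub_sigma_algebra.
  have [F [FL FU Fcvg]] := open_lipschitz_approx oU.
  have lim d1 (T1 : measurableType d1) (P1 : probability T1 R) (X1 : T1 -> E) :
      measurable_fun setT (X1 : T1 -> borelType E) ->
      (fun n => Ex P1 (fun w => F n (X1 w))) @ \oo --> fine (P1 (X1 @^-1` U)).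
    move=> mX1.
    have mXU : measurable (X1 @^-1` U) by rewrite -[X in measurable X]setTI; exact: mX1.
    rewrite -Ex_indic//; apply: (@Ex_cvg _ _ _ _ _ _ 1).
    + by move=> n; apply: bdm_measurable; exact: (bdm_lipschitz01 (FL n)).
    + by move=> n w; have [/(_ (X1 w))/andP[h1 h2] _] := FL n; rewrite ger0_norm.
    + by move=> w; exact: (Fcvg (X1 w)).
  have e : fine (P (X @^-1` U)) = fine (P' (X' @^-1` U)).
    have l1 := lim _ _ P _ mX; have l2 := lim _ _ P' _ mX'.
    rewrite (_ : (fun n => _) = (fun n => Ex P (fun w => F n (X w)))) in l2.
      exact: (cvg_unique _ l1 l2).
    by apply/funext => n; rewrite (FXX' _ _ (FL n)).
  apply: (eq_prob_fine _ _ e).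
  + by rewrite -[X in measurable X]setTI; exact: mX.
  + by rewrite -[X in measurable X]setTI; exact: mX'.
- by move=> _; rewrite ltey_eq fin_num_measure.
Qed.

Lemma lipschitz_close d (T : measurableType d) (P : probability T R) (X Y : T -> E) F L (e : R) :
  lipschitz01 L F -> measurable_fun setT (X : T -> borelType E) ->
  measurable_fun setT (Y : T -> borelType E) ->
  measurable_fun setT (fun w => rnorm (X w - Y w)) ->
  0 <= L -> 0 <= e ->
  Ex P (fun w => `|F (X w) - F (Y w)|) <= L * e + fine (P [set w | e <= rnorm (X w - Y w)]).
Proof.
move=> FL mX mY mXY L0 e0.
have mA : measurable [set w | e <= rnorm (X w - Y w)].
  exact: measurable_set_ge.
have bX := bdm_lipschitz01 FL mX; have bY := bdm_lipschitz01 FL mY.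
rewrite -Ex_indic// -[L * e](Ex_cst P) -ExD; [|exact: bdm_cst|exact: bdm_indic].
apply: le_Ex.
- by apply: bdm_norm; exact: bdmB.
- by apply: bdmD; [exact: bdm_cst|exact: bdm_indic].
move=> w; have [F01 Flip] := FL; rewrite indicE.
have [h|h] := leP e (rnorm (X w - Y w)).
  rewrite mem_set// (@le_trans _ _ 1)// ?lerDr ?mulr_ge0//.
  have /andP[? ?] := F01 (X w); have /andP[? ?] := F01 (Y w).
  by rewrite ler_norml; apply/andP; split; lra.
rewrite memNset /=; last by apply/negP; rewrite -ltNge.
by rewrite addr0 (le_trans (Flip _ _))// ler_wpM2l// ltW.
Qed.

Let max_indic_dist (b c : bool) (x y : R) : 0 <= x <= 1 -> 0 <= y <= 1 ->
  `|(b || c)%:R - Num.max x y| <= `|b%:R - x| + `|c%:R - y|.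
Proof.
have n1 (z : R) : 0 <= z <= 1 -> `|1 - z| = 1 - z.
  by move=> /andP[? ?]; rewrite ger0_norm// subr_ge0.
have n0 (z : R) : 0 <= z <= 1 -> `|0 - z| = z.
  by move=> /andP[? ?]; rewrite sub0r normrN ger0_norm.
move=> x01 y01; have m01 : 0 <= Num.max x y <= 1 by case: (leP x y).
move: b c => [] [] /=; rewrite !(n1, n0)//; move: x01 y01 {m01} => /andP[? ?] /andP[? ?];
  by case: (leP x y) => *; lra.
Qed.

(** The sets whose indicator can be approximated in mean form a sigma-algebra containing the open
    sets: complements are handled by 1 - F, finite unions by maxima, countable unions by dominated
    convergence. *)
Lemma lipschitz_L1_dense d (T : measurableType d) (P : probability T R) (X : T -> E)
    (B : set (borelType E)) (e : R) :
  measurable_fun setT (X : T -> borelType E) -> measurable B -> 0 < e ->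
  exists L F, [/\ 0 <= L, lipschitz01 L F & Ex P (fun w => `|\1_B (X w) - F (X w)|) <= e].
Proof.
move=> mX mB; move: e.
pose approx (A : set E) := forall e : R, 0 < e ->
  exists L F, [/\ 0 <= L, lipschitz01 L F & Ex P (fun w => `|\1_A (X w) - F (X w)|) <= e].
suff : sigma_algebra setT [set A : set (borelType E) | measurable A /\ approx A].
  move=> sa; have : [set A : set (borelType E) | measurable A /\ approx A] B.
    move: B mB; apply: smallest_sub => // U oU; split; first exact: sub_sigma_algebra.
    have mU : measurable (U : set (borelType E)) by exact: sub_sigma_algebra.
    move=> e e0; have [F [FL FU Fcvg]] := open_lipschitz_approx oU.
    have bU : bounded_measurable (fun w => \1_U (X w) : R).
      exact: (@bdm_indic_comp _ _ _ _ (borelType E)).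
    have : (fun n => Ex P (fun w => `|\1_U (X w) - F n (X w)|)) @ \oo --> Ex P (fun w : T => 0 : R).
      apply: (@Ex_cvg _ _ _ _ _ _ 2).
      - move=> n; apply: bdm_measurable; apply: bdm_norm; apply: bdmB => //.
        exact: (bdm_lipschitz01 (FL n)).
      - move=> n w; rewrite normr_id; have [/(_ (X w))/andP[h1 h2] _] := FL n.
        by rewrite indicE ler_norml; case: (_ \in _) => /=; apply/andP; split; lra.
      - move=> w; have := Fcvg (X w) => /cvgrPdist_le h; apply/cvgr0Pnorm_le => eps eps0.
        by have := h _ eps0; apply: filterS => n /=; rewrite normr_id.
    rewrite Ex_cst => /cvgr0Pnorm_le/(_ _ e0)[n _ /(_ n (leqnn n)) hn].
    exists n%:R, (F n); split => //.
    by rewrite (le_trans (ler_norm _)).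
  by case.
have bI (A : set (borelType E)) : measurable A -> bounded_measurable (fun w => \1_A (X w) : R).
  by move=> mA; exact: (@bdm_indic_comp _ _ _ _ (borelType E)).
have approxU (A A' : set (borelType E)) : measurable A -> measurable A' ->
    approx A -> approx A' -> approx (A `|` A').
  move=> mA mA' aA aA' e e0.
  have e2 : 0 < e / 2 by rewrite divr_gt0.
  have [L [F [L0 FL hF]]] := aA _ e2; have [L' [F' [L0' FL' hF']]] := aA' _ e2.
  have FF : lipschitz01 (L + L') (fun x => Num.max (F x) (F' x)).
    have [F01 Flip] := FL; have [F01' Flip'] := FL'; split.
      move=> x; have /andP[h1 h2] := F01 x; have /andP[h1' h2'] := F01' x.
      by rewrite le_max h1 ge_max h2 h2'.
    move=> x y; have := Flip x y; have := Flip' x y.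
    have := rnorm_ge0 (x - y) => r0.
    have h1 : 0 <= L * rnorm (x - y) by rewrite mulr_ge0.
    have h2 : 0 <= L' * rnorm (x - y) by rewrite mulr_ge0.
    rewrite mulrDl !ler_norml => /andP[? ?] /andP[? ?].
    by case: (leP (F x) (F' x)); case: (leP (F y) (F' y)) => *; apply/andP; split; lra.
  exists (L + L'), (fun x => Num.max (F x) (F' x)); split => //; first by rewrite addr_ge0.
  have b1 : bounded_measurable (fun w => `|\1_A (X w) - F (X w)|).
    by apply: bdm_norm; apply: bdmB; [exact: bI|exact: (bdm_lipschitz01 FL)].
  have b2 : bounded_measurable (fun w => `|\1_A' (X w) - F' (X w)|).
    by apply: bdm_norm; apply: bdmB; [exact: bI|exact: (bdm_lipschitz01 FL')].
  rewrite (@le_trans _ _ (Ex P (fun w => `|\1_A (X w) - F (X w)| + `|\1_A' (X w) - F' (X w)|)))//.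
    apply: le_Ex; last 1 first.
    - move=> w; rewrite !indicE in_setU.
      have [/(_ (X w))/andP[? ?] _] := FL; have [/(_ (X w))/andP[? ?] _] := FL'.
      by apply: max_indic_dist; apply/andP.
    - apply: bdm_norm; apply: bdmB; last exact: (bdm_lipschitz01 FF).
      by apply: bI; exact: measurableU.
    - exact: bdmD.
  by rewrite ExD// [leRHS](splitr e) lerD.
split.
- split; first exact: measurable0.
  move=> e e0; exists 0, (fun=> 0); split => //.
    by split => x; rewrite ?lexx ?ler01// => y; rewrite subrr normr0 mul0r.
  under eq_Ex do rewrite indic0 subrr normr0.
  by rewrite Ex_cst ltW.
- move=> A [mA aA]; rewrite setTD; split; first exact: measurableC.
  move=> e /aA[L [F [L0 [F01 Flip] hF]]]; exists L, (fun x => 1 - F x); split => //.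
    split; first by move=> x; have /andP[? ?] := F01 x; apply/andP; split; lra.
    move=> x y; rewrite (_ : 1 - F x - (1 - F y) = F y - F x); last by ring.
    by rewrite distrC Flip.
  rewrite (le_trans _ hF)// le_eqVlt; apply/orP; left; apply/eqP; apply: eq_Ex => w.
  by rewrite !indicE in_setC; case: (_ \in A) => /=; rewrite distrC; congr `|_|; ring.
- move=> A mA; split; first by apply: bigcupT_measurable => n; have [] := mA n.
  move=> e e0; have e2 : 0 < e / 2 by rewrite divr_gt0.
  pose S n := \big[setU/set0]_(i < n) A i.
  have mS n : measurable (S n : set (borelType E)).
    by apply: bigsetU_measurable => i _; have [] := mA i.
  have aS n : approx (S n).
    rewrite /S; elim: n => [|n IH].
      rewrite big_ord0; move=> e' e0'; exists 0, (fun=> 0); split => //.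
        by split => x; rewrite ?lexx ?ler01// => y; rewrite subrr normr0 mul0r.
      under eq_Ex do rewrite indic0 subrr normr0.
      by rewrite Ex_cst ltW.
    rewrite big_ord_recr /=; apply: approxU => //; first exact: mS.
    by have [] := mA n.
    by have [] := mA n.
  have mU : measurable (\bigcup_n A n : set (borelType E)).
    by apply: bigcupT_measurable => n; have [] := mA n.
  have : (fun n => Ex P (fun w => `|\1_(\bigcup_n A n) (X w) - \1_(S n) (X w)|)) @ \oo -->
      Ex P (fun w : T => 0 : R).
    apply: (@Ex_cvg _ _ _ _ _ _ 1).
    + move=> n; apply: bdm_measurable; apply: bdm_norm; apply: bdmB; exact: bI.
    + move=> n w; rewrite normr_id !indicE; case: (_ \in _); case: (_ \in _) => /=;
      by rewrite ?subrr ?subr0 ?sub0r ?normrN ?normr0 ?normr1.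
    + move=> w; rewrite !indicE; case: (boolP (X w \in \bigcup_n A n)) => [|/negP]; rewrite inE => AX.
        have [N _ AN] := AX; apply/cvgr0Pnorm_le => eps eps0; near=> n.
        rewrite indicE mem_set; first by rewrite subrr !normr0 ltW.
        rewrite /S -bigcup_mkord; exists N => //=; near: n; exact: nbhs_infty_gt.
      rewrite (_ : (fun n => _) = fun=> 0); first exact: cvg_cst.
      apply/funext => n; rewrite indicE memNset ?subrr ?normr0//.
      rewrite /S -bigcup_mkord => -[m _ Am]; apply: AX; exists m => //.
  rewrite Ex_cst => /cvgr0Pnorm_le/(_ _ e2)[n _ /(_ n (leqnn n)) hn].
  have [L [F [L0 FL hF]]] := aS n _ e2.
  exists L, F; split => //.
  have b1 : bounded_measurable (fun w => `|\1_(\bigcup_n A n) (X w) - \1_(S n) (X w) : R|).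
    by apply: bdm_norm; apply: bdmB; exact: bI.
  have b2 : bounded_measurable (fun w => `|\1_(S n) (X w) - F (X w)|).
    by apply: bdm_norm; apply: bdmB; [exact: bI|exact: (bdm_lipschitz01 FL)].
  rewrite (@le_trans _ _ (Ex P (fun w => `|\1_(\bigcup_n A n) (X w) - \1_(S n) (X w)| +
    `|\1_(S n) (X w) - F (X w)|)))//.
    apply: le_Ex.
    + by apply: bdm_norm; apply: bdmB; [exact: bI|exact: (bdm_lipschitz01 FL)].
    + exact: bdmD.
    + by move=> w; rewrite (le_trans _ (ler_normD _ _))// addrA subrK.
  by rewrite ExD// [leRHS](splitr e) lerD// (le_trans (ler_norm _)).
Unshelve. all: by end_near. Qed.

End LipschitzLaws.

(** * Product spaces and stable families *)

Section ProductProbability.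
Context (R : realType) d1 (T1 : measurableType d1) d2 (T2 : measurableType d2).
Variables (P1 : probability T1 R) (P2 : probability T2 R).

Definition prod_prob : set (T1 * T2) -> \bar R := (P1 \x P2)%E.

HB.instance Definition _ := Measure.on prod_prob.

Let prod_prob_setT : prod_prob setT = 1%E.
Proof.
rewrite /prod_prob -setXTT product_measure1E//.
exact: (etrans (congr2 mule (probability_setT P1) (probability_setT P2)) (mule1 _)).
Qed.

HB.instance Definition _ := Measure_isProbability.Build _ _ _ prod_prob prod_prob_setT.

Lemma Ex_prod (f : T1 -> R) (g : T2 -> R) : bounded_measurable f -> bounded_measurable g ->
  Ex prod_prob (fun w => f w.1 * g w.2) = Ex P1 f * Ex P2 g.
Proof.
move=> bf bg.
have bfst : bounded_measurable (fun w : T1 * T2 => f w.1).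
  have [mf [c fc]] := bf; split; first exact: measurableT_comp.
  by exists c => w.
have bsnd : bounded_measurable (fun w : T1 * T2 => g w.2).
  have [mg [c gc]] := bg; split; first exact: measurableT_comp.
  by exists c => w.
have bfg := bdmM bfst bsnd.
apply: EFin_inj; rewrite (Ex_EFin prod_prob bfg).
rewrite -(@integral12_prod_meas1 _ _ _ _ _ P1 P2 (fun w => (f w.1 * g w.2)%:E)); last first.
  exact: (bdm_integrable prod_prob bfg).
rewrite EFinM (Ex_EFin P1 bf).
transitivity (\int[P1]_x ((f x)%:E * (Ex P2 g)%:E))%E.
  by apply: eq_integral => x _; rewrite /fubini_F -EFinM -ExZ// Ex_EFin//; exact: bdmZ.
rewrite (Ex_EFin P2 bg) -Ex_EFin// integralZr//.
exact: (bdm_integrable P1 bf).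
Qed.

Lemma prod_prob_setX (A : set T1) (B : set T2) : measurable A -> measurable B ->
  prod_prob [set w | A w.1 /\ B w.2] = (P1 A * P2 B)%E.
Proof. by move=> mA mB; rewrite -product_measure1E. Qed.

End ProductProbability.

Section IndependentGroups.
Context (R : realType) d (T : measurableType d) (P : probability T R).
Context (I1 I2 : finType) (Y1 : I1 -> T -> R) (Y2 : I2 -> T -> R).
Hypothesis mY1 : forall i, measurable_fun setT (Y1 i).
Hypothesis mY2 : forall i, measurable_fun setT (Y2 i).

Let U (t : I1 -> R) w := \sum_i t i * Y1 i w.
Let V (t : I2 -> R) w := \sum_i t i * Y2 i w.

Hypothesis sinU : forall t, Ex P (fun w => sin (U t w)) = 0.
Hypothesis sinV : forall t, Ex P (fun w => sin (V t w)) = 0.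
Hypothesis sinUV : forall t s, Ex P (fun w => sin (U t w + V s w)) = 0.
Hypothesis cosUV : forall t s,
  Ex P (fun w => cos (U t w + V s w)) = Ex P (fun w => cos (U t w)) * Ex P (fun w => cos (V s w)).

(* Y1 and Y2 have the joint law of independent copies living on the two factors of T * T *)
Lemma independent_groups (C1 : set (coordinates R I1)) (C2 : set (coordinates R I2)) :
  measurable C1 -> measurable C2 ->
  P [set w | C1 (fun i => Y1 i w) /\ C2 (fun i => Y2 i w)] =
  (P [set w | C1 (fun i => Y1 i w)] * P [set w | C2 (fun i => Y2 i w)])%E.
Proof.
move=> mC1 mC2.
have mpre1 : measurable [set w | C1 (fun i => Y1 i w)].
  by rewrite -[X in measurable X]setTI; apply: (measurable_family mY1).
have mpre2 : measurable [set w | C2 (fun i => Y2 i w)].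
  by rewrite -[X in measurable X]setTI; apply: (measurable_family mY2).
rewrite -prod_prob_setX//.
pose Y (i : I1 + I2) w := match i with inl i => Y1 i w | inr i => Y2 i w end.
pose Y' (i : I1 + I2) (w : T * T) := match i with inl i => Y1 i w.1 | inr i => Y2 i w.2 end.
pose C : set (coordinates R (I1 + I2)%type) :=
  [set f | C1 (fun i => f (inl i)) /\ C2 (fun i => f (inr i))].
have mU t : measurable_fun setT (U t).
  by apply: measurable_sum => i; apply: measurable_funM => //; exact: measurable_cst.
have mV t : measurable_fun setT (V t).
  by apply: measurable_sum => i; apply: measurable_funM => //; exact: measurable_cst.
apply: (@char_fun_unique _ _ _ _ P Y _ _ (prod_prob P P) Y' _ _ _ C).
- by case.
- by move=> [i|i]; apply: (measurableT_comp (f := Y1 i)) || apply: (measurableT_comp (f := Y2 i)).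
- move=> t; pose t1 i := t (inl i); pose t2 i := t (inr i).
  have YE w : \sum_i t i * Y i w = U t1 w + V t2 w by rewrite big_sumType.
  have YE' w : \sum_i t i * Y' i w = U t1 w.1 + V t2 w.2 by rewrite big_sumType.
  have bcU := bdm_cos (mU t1); have bsU := bdm_sin (mU t1).
  have bcV := bdm_cos (mV t2); have bsV := bdm_sin (mV t2).
  have bprod (f g : T -> R) : bounded_measurable f -> bounded_measurable g ->
      bounded_measurable (fun w : T * T => f w.1 * g w.2).
    move=> [mf [c fc]] [mg [c' gc]]; apply: bdmM.
      by split; [exact: measurableT_comp|exists c => w].
    by split; [exact: measurableT_comp|exists c' => w].
  under eq_Ex do rewrite YE; under [X in _ /\ X = _]eq_Ex do rewrite YE.
  under [X in _ = X /\ _]eq_Ex do rewrite YE' cosD.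
  under [X in _ /\ _ = X]eq_Ex do rewrite YE' sinD.
  rewrite (ExB (prod_prob P P) (bprod _ _ bcU bcV) (bprod _ _ bsU bsV)).
  rewrite (ExD (prod_prob P P) (bprod _ _ bsU bcV) (bprod _ _ bcU bsV)).
  rewrite (Ex_prod P P bcU bcV) (Ex_prod P P bsU bsV) (Ex_prod P P bsU bcV) (Ex_prod P P bcU bsV).
  by rewrite !sinU !sinV cosUV sinUV !mul0r mulr0 subr0 addr0.
- apply: measurableI.
  + rewrite -[X in measurable X]setTI.
    apply: (@measurable_family _ _ _ (coordinates R (I1 + I2)%type) (fun i f => f (inl i))) => //.
    by move=> i; exact: measurable_coordinate.
  + rewrite -[X in measurable X]setTI.
    apply: (@measurable_family _ _ _ (coordinates R (I1 + I2)%type) (fun i f => f (inr i))) => //.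
    by move=> i; exact: measurable_coordinate.
Qed.

End IndependentGroups.

Section StableFamilies.
Context (R : realType) (alpha : R) (alpha_gt0 : 0 < alpha).

(** Independence and the symmetric stable marginals are encoded together in one joint characteristic
    function. It determines the law, whatever the construction of the variables. *)
Definition stable_family d (T : measurableType d) (P : probability T R) (I : finType)
    (Y : I -> T -> R) (c : I -> R) :=
  (forall i, measurable_fun setT (Y i)) /\
  forall t : I -> R,
    Ex P (fun w => cos (\sum_i t i * Y i w)) = expR (- \sum_i c i * `|t i| `^ alpha) /\
    Ex P (fun w => sin (\sum_i t i * Y i w)) = 0.

Lemma stable_family_scale d (T : measurableType d) (P : probability T R) (I : finType)
    (Y : I -> T -> R) (c r : I -> R) : stable_family P Y c ->
  stable_family P (fun i w => r i * Y i w) (fun i => c i * `|r i| `^ alpha).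
Proof.
move=> [mY cY]; split; first by move=> i; apply: measurable_funM => //; exact: measurable_cst.
move=> t; have [h1 h2] := cY (fun i => t i * r i).
have E i : c i * `|r i| `^ alpha * `|t i| `^ alpha = c i * `|t i * r i| `^ alpha.
  by rewrite normrM powRM// -mulrA (mulrC (`|t i| `^ _)).
under eq_Ex do under eq_bigr do rewrite mulrA.
under [X in _ /\ X = _]eq_Ex do under eq_bigr do rewrite mulrA.
by under eq_bigr do rewrite E.
Qed.

Lemma stable_family_law (I : finType)
    d (T : measurableType d) (P : probability T R) (Y : I -> T -> R)
    d' (T' : measurableType d') (P' : probability T' R) (Y' : I -> T' -> R)
    (c : I -> R) (C : set (coordinates R I)) :
  stable_family P Y c -> stable_family P' Y' c -> measurable C ->
  P [set w | C (fun i => Y i w)] = P' [set w | C (fun i => Y' i w)].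
Proof.
move=> [mY cY] [mY' cY'] mC; apply: char_fun_unique => // t.
by have [-> ->] := cY t; have [-> ->] := cY' t.
Qed.

(** The exponent is a sum over [I1 + I2], so the characteristic function is a product over the two
    groups. *)
Lemma stable_groups d (T : measurableType d) (P : probability T R) (I1 I2 : finType)
    (Y : I1 + I2 -> T -> R) (c : I1 + I2 -> R)
    (C1 : set (coordinates R I1)) (C2 : set (coordinates R I2)) :
  stable_family P Y c -> measurable C1 -> measurable C2 ->
  P [set w | C1 (fun i => Y (inl i) w) /\ C2 (fun i => Y (inr i) w)] =
  (P [set w | C1 (fun i => Y (inl i) w)] * P [set w | C2 (fun i => Y (inr i) w)])%E.
Proof.
move=> [mY cY] mC1 mC2.
pose z1 (t : I1 -> R) (i : I1 + I2) := match i with inl i => t i | inr i => 0 end.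
pose z2 (t : I2 -> R) (i : I1 + I2) := match i with inl i => 0 | inr i => t i end.
pose z t s (i : I1 + I2) : R := match i with inl i => t i | inr i => s i end.
have e1 t w : \sum_i z1 t i * Y i w = \sum_i t i * Y (inl i) w.
  by rewrite big_sumType /= [X in _ + X]big1 ?addr0// => i _; rewrite mul0r.
have e2 t w : \sum_i z2 t i * Y i w = \sum_i t i * Y (inr i) w.
  by rewrite big_sumType /= big1 ?add0r// => i _; rewrite mul0r.
have e3 t s w : \sum_i z t s i * Y i w = \sum_i t i * Y (inl i) w + \sum_i s i * Y (inr i) w.
  by rewrite big_sumType.
have a0 : alpha != 0 by rewrite gt_eqF.
apply: independent_groups => //.
- by move=> t; rewrite -[RHS](cY (z1 t)).2; apply: eq_Ex => w; rewrite e1.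
- by move=> t; rewrite -[RHS](cY (z2 t)).2; apply: eq_Ex => w; rewrite e2.
- by move=> t s; rewrite -[RHS](cY (z t s)).2; apply: eq_Ex => w; rewrite e3.
- move=> t s.
  have -> : Ex P (fun w => cos (\sum_i t i * Y (inl i) w + \sum_i s i * Y (inr i) w)) =
      Ex P (fun w => cos (\sum_i z t s i * Y i w)) by apply: eq_Ex => w; rewrite e3.
  have -> : Ex P (fun w => cos (\sum_i t i * Y (inl i) w)) =
      Ex P (fun w => cos (\sum_i z1 t i * Y i w)) by apply: eq_Ex => w; rewrite e1.
  have -> : Ex P (fun w => cos (\sum_i s i * Y (inr i) w)) =
      Ex P (fun w => cos (\sum_i z2 s i * Y i w)) by apply: eq_Ex => w; rewrite e2.
  rewrite !(cY _).1 -expRD !big_sumType /=; congr expR.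
  under [X in _ = - (_ + X) + _]eq_bigr do rewrite normr0 powR0// mulr0.
  under [X in _ = _ + - (X + _)]eq_bigr do rewrite normr0 powR0// mulr0.
  by rewrite !big1_eq addr0 add0r opprD.
Qed.

Lemma iid_stable_family d (T : measurableType d) (P : probability T R) (J : eqType)
    (theta : J -> T -> R) (c : J -> R) (I : finType) (f : I -> J) :
  (forall n, measurable_fun setT (theta n)) -> mutually_independent P theta ->
  (forall n t, expectation_expi P (fun w => t * theta n w) =
     (expR (- (c n * `|t| `^ alpha)))%:C%C) ->
  injective f -> stable_family P (fun i => theta (f i)) (fun i => c (f i)).
Proof.
move=> mth ind cth injf; split => // t.
pose Z i w := t i * theta (f i) w.
have mZ i : measurable_fun setT (Z i).
  by apply: measurable_funM => //; exact: measurable_cst.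
have indZ : mutually_independent P Z.
  move=> s B us mB.
  (* Independence of theta concerns families of sets over all of J, so the sets are carried along f
     and completed by [setT] off its range; this is where f must be injective. *)
  pose B' n : set (measurableTypeR R) :=
    if [pick i | f i == n] is Some i then [set x | B i (t i * x)] else setT.
  have B'f i : B' (f i) = [set x | B i (t i * x)].
    rewrite /B'; case: pickP => [j /eqP /injf -> //|/(_ i)].
    by rewrite eqxx.
  have mB' n : measurable (B' n).
    rewrite /B'; case: pickP => [i _|_]; last exact: measurableT.
    rewrite -[X in measurable X]setTI.
    have mm : measurable_fun setT (fun x : measurableTypeR R => t i * x).
      by apply: measurable_funM => //; exact: measurable_cst.
    exact: (mm measurableT _ (mB i)).
  have ufs : uniq (map f s) by rewrite map_inj_uniq.
  have := ind (map f s) B' ufs mB'; rewrite !big_map.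
  under eq_bigr do rewrite B'f.
  by under [in RHS]eq_bigr do rewrite B'f.
have := @independent_char_fun _ _ _ P I Z (fun i => expR (- (c (f i) * `|t i| `^ alpha))) mZ indZ.
move=> /(_ _ _ (index_enum I) (index_enum_uniq I)) [].
- by move=> i; have := cth (f i) (t i) => -[].
- by move=> i; have := cth (f i) (t i) => -[].
by move=> -> ->; rewrite -sumrN expR_sum.
Qed.

End StableFamilies.

(** * The tail bound from stable type *)

Section Combinations.
Context (R : realType) (k : scalar_kind) (E : completeNormedModType (scalar_field R k)).
Local Notation sor := (@scalar_of_real R k).

Definition comb (I : finType) (x : I -> E) (y : I -> R) : E := \sum_i sor (y i) *: x i.

Variable a : nat -> E.
Hypothesis aP : forall x (e : R), 0 < e -> exists n, rnorm (x - a n) < e.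

Lemma measurable_comb (I : finType) (x : I -> E) :
  measurable_fun setT (comb x : coordinates R I -> borelType E).
Proof.
apply: (measurable_sumE aP) => i; apply: (measurable_scalerE aP).
exact: measurable_coordinate.
Qed.

Lemma measurable_comb_gt (I : finType) (x : I -> E) (t : R) :
  measurable ([set f | t < rnorm (comb x f)] : set (coordinates R I)).
Proof. by apply: measurable_set_gt; apply: measurable_rnorm; exact: measurable_comb. Qed.

Lemma measurable_comb_family (I : finType) (x : I -> E) d (T : measurableType d) (Y : I -> T -> R) :
  (forall i, measurable_fun setT (Y i)) ->
  measurable_fun setT ((fun w => comb x (Y ^~ w)) : T -> borelType E).
Proof.
move=> mY; apply: (measurableT_comp (f := comb x : coordinates R I -> borelType E)).
  exact: measurable_comb.
exact: measurable_family.
Qed.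

Lemma comb_scale (I : finType) (x : I -> E) (r y : I -> R) :
  comb x (fun i => r i * y i) = comb (fun i => sor (r i) *: x i) y.
Proof. by apply: eq_bigr => i _; rewrite scalerA -scalar_of_realM mulrC. Qed.

End Combinations.

Section Bonferroni.
Context (R : realType) d (T : measurableType d) (P : probability T R).

(** Removing from each A i its overlap with the earlier sets leaves disjoint pieces of S. The
    version relative to S is made for [levy], which bounds the probability of A i by that of its
    part inside S. *)
Lemma bonferroni (A : nat -> set T) (S : set T) (N : nat) :
  (forall i, measurable (A i)) -> measurable S ->
  \sum_(i < N) fine (P (A i `&` S)) <=
  fine (P S) + \sum_(i < N) \sum_(j < i) fine (P (A i `&` A j)).
Proof.
move=> mA mS.
pose U n := \big[setU/set0]_(i < n) A i.
have mU n : measurable (U n) by apply: bigsetU_measurable.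
have AU n m : fine (P (A m `&` U n)) <= \sum_(j < n) fine (P (A m `&` A j)).
  elim: n => [|n IH]; first by rewrite /U !big_ord0 setI0 measure0.
  rewrite /U !big_ord_recr /= setIUr (le_trans (fine_prob_setU P _ _))//.
  - by apply: measurableI => //; exact: mU.
  - exact: measurableI.
  - by rewrite lerD2r.
have main : \sum_(i < N) fine (P (A i `&` S)) <=
    fine (P (U N `&` S)) + \sum_(i < N) \sum_(j < i) fine (P (A i `&` A j)).
  elim: N => [|N IH]; first by rewrite !big_ord0 addr0 fine_prob_ge0.
  rewrite !big_ord_recr /=.
  have h1 : fine (P (A N `&` S)) <= fine (P ((A N `&` S) `\` U N)) + fine (P (A N `&` U N)).
    rewrite (le_trans _ (fine_prob_setU P _ _))//.
    - apply: fine_prob_le; [exact: measurableI| |].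
        by apply: measurableU; [apply: measurableD => //; exact: measurableI|exact: measurableI].
      by move=> w [Aw Sw]; have [Uw|Uw] := pselect (U N w); [right|left].
    - by apply: measurableD => //; exact: measurableI.
    - exact: measurableI.
  have h2 : fine (P (U N.+1 `&` S)) = fine (P (U N `&` S)) + fine (P ((A N `&` S) `\` U N)).
    rewrite -fineD ?probability_fin//; try by [apply: measurableI|apply: measurableD => //; exact: measurableI].
    rewrite -measureU//.
    - congr (fine (P _)); rewrite /U big_ord_recr /=; apply/seteqP; split => w.
        move=> [[Uw|Aw] Sw]; first by left.
        by have [Uw|Uw] := pselect (U N w); [left|right].
      by move=> [[Uw Sw]|[[Aw Sw] _]]; split => //; [left|right].
    - exact: measurableI.
    - by apply: measurableD => //; exact: measurableI.
    - by apply/seteqP; split => // w [[Uw _] [_ nUw]].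
  have h3 := AU N N; lra.
apply: (le_trans main); rewrite lerD2r; apply: fine_prob_le => //; exact: measurableI.
Qed.

End Bonferroni.

Section StableType.
Context (R : realType) (k : scalar_kind) (E : completeNormedModType (scalar_field R k)).
Local Notation sor := (@scalar_of_real R k).
Variable a : nat -> E.
Hypothesis aP : forall x (e : R), 0 < e -> exists n, rnorm (x - a n) < e.
Variables (alpha : R) (alpha_gt0 : 0 < alpha).
Hypothesis stE : stable_type alpha E.
Context d (T : measurableType d) (P : probability T R) (theta : nat -> T -> R).
Hypothesis mth : forall n, measurable_fun setT (theta n).
Hypothesis ind_th : mutually_independent P theta.
Hypothesis char_th : forall n t,
  expectation_expi P (fun w => t * theta n w) = (expR (- `|t| `^ alpha))%:C%C.

Lemma theta_stable_family (I : finType) (f : I -> nat) : injective f ->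
  stable_family alpha P (fun i => theta (f i)) (fun=> 1).
Proof.
move=> injf; apply: (@iid_stable_family _ _ _ _ P _ theta (fun=> 1)) => //.
by move=> n t; rewrite mul1r.
Qed.

Lemma stable_type_cvg (x : nat -> E) : (\sum_(0 <= n <oo) (rnorm (x n) `^ alpha)%:E < +oo)%E ->
  {ae P, forall w, cvgn (fun n => \sum_(j < n) sor (theta j w) *: x j)}.
Proof.
by move=> sx; apply: (stE sx (theta := fun n => mfun_of (mth n))).
Qed.

Let block (X : seq E) (n : nat) w := \sum_(j < size X) sor (theta (n + j) w) *: nth 0 X j.

Let mblock X n : measurable_fun setT (block X n : T -> borelType E).
Proof. by apply: (measurable_sumE aP) => j; exact: (measurable_scalerE aP). Qed.

Let block_law X n n' (t : R) :
  P [set w | t < rnorm (block X n w)] = P [set w | t < rnorm (block X n' w)].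
Proof.
have inj m : injective (fun j : 'I_(size X) => (m + j)%N) by move=> i j /addnI/val_inj.
exact: (stable_family_law (theta_stable_family (inj n)) (theta_stable_family (inj n'))
  (measurable_comb_gt aP (fun j : 'I_(size X) => nth 0 X j) t)).
Qed.

(* the blocks X 0, X 1, ... are concatenated into one summable sequence *)
Let blocks_contra (X : nat -> seq E) (e : R) : 0 < e ->
  (forall n, \sum_(x <- X n) rnorm x `^ alpha <= 2^-1 ^+ n) ->
  (forall n, (0 < size (X n))%N) ->
  ~ (forall n, e < fine (P [set w | e < rnorm (block (X n) 0 w)])).
Proof.
move=> e0 sX X0 eX.
pose L n := flatten [seq X i | i <- iota 0 n].
have LS n : L n.+1 = L n ++ X n by rewrite /L -addn1 iotaD map_cat flatten_cat /= cats0.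
pose N n := size (L n).
have NS n : N n.+1 = (N n + size (X n))%N by rewrite /N LS size_cat.
(* Since the blocks are nonempty, their starting points N n go to infinity, as the Cauchy criterion
   requires. *)
have Nge n : (n <= N n)%N.
  by elim: n => // n IH; rewrite NS -addn1 leq_add.
have Nmono p n : (N n <= N (p + n))%N.
  by elim: p => // p IHp; rewrite addSn NS (leq_trans IHp)// leq_addr.
pose x n := nth 0 (L n.+1) n.
have nthL n m j : (n <= m)%N -> (j < N n)%N -> nth 0 (L m) j = nth 0 (L n) j.
  move=> /subnK <-; elim: (m - n)%N => [|p IH] jn //.
  rewrite addSn LS nth_cat -/(N (p + n)) (leq_trans jn) ?IH//.
have xE n j : (j < N n)%N -> x j = nth 0 (L n) j.
  move=> jn; have [h|h] := leqP n j.+1; first exact: nthL.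
  by rewrite (nthL j.+1 n)// ltnW.
have sumx n : \sum_(j < N n) rnorm (x j) `^ alpha = \sum_(i < n) \sum_(y <- X i) rnorm y `^ alpha.
  transitivity (\sum_(y <- L n) rnorm y `^ alpha).
    rewrite (big_nth 0) big_mkord; apply: eq_bigr => j _; by rewrite (xE n).
  rewrite /L big_flatten big_map /= -[X in iota X]/(0%N) -{1}[n]subn0 big_mkord.
  by [].
have cvx : (\sum_(0 <= n <oo) (rnorm (x n) `^ alpha)%:E < +oo)%E.
  apply: (@le_lt_trans _ _ 2%:E); last by rewrite ltry.
  apply: lime_le; first by apply: is_cvg_nneseries => n _ _; rewrite lee_fin powR_ge0.
  apply: nearW => n; rewrite big_mkord sumEFin lee_fin.
  rewrite (@le_trans _ _ (\sum_(j < N n) rnorm (x j) `^ alpha))//.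
    rewrite -!(big_mkord xpredT (fun j => rnorm (x j) `^ alpha)).
    rewrite (big_cat_nat (n := n) _ (Nge n))//= lerDl.
    by apply: sumr_ge0 => j _; rewrite powR_ge0.
  rewrite sumx (@le_trans _ _ (\sum_(i < n) 2^-1 ^+ i))//; first exact: ler_sum.
  have geo m : \sum_(i < m) 2^-1 ^+ i = 2 - 2 * 2^-1 ^+ m :> R.
    elim: m => [|m IH]; first by rewrite big_ord0 expr0; ring.
    by rewrite big_ord_recr /= IH exprS; field.
  by rewrite geo gerBl mulr_ge0// exprn_ge0.
have [Z [mZ Z0 cvZ]] := stable_type_cvg cvx.
pose S n w := \sum_(j < n) sor (theta j w) *: x j.
have SN n w : S (N n.+1) w - S (N n) w = block (X n) (N n) w.
  rewrite /S -!(big_mkord xpredT (fun j => sor (theta j w) *: x j)).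
  rewrite (big_cat_nat (n := N n))//= ?NS ?leq_addr// addrAC subrr add0r.
  rewrite -{1}[N n]add0n big_addn addKn big_mkord; apply: eq_bigr => j _.
  rewrite addnC (xE n.+1) ?NS ?ltn_add2l// LS nth_cat -/(N n).
  by rewrite ltnNge leq_addr /= addKn.
pose B n := [set w | e < rnorm (block (X n) (N n) w)].
have mB n : measurable (B n).
  by apply: measurable_set_gt; apply: measurable_rnorm; exact: mblock.
(* Off the null set Z the partial sums are Cauchy, so a point lies in only finitely many B n. By
   dominated convergence P(B n) tends to 0, although each of these probabilities exceeds e. *)
have : (fun n => Ex P (\1_(B n `&` ~` Z) : T -> R)) @ \oo --> Ex P (fun=> 0 : R).
  apply: (@Ex_cvg _ _ _ _ _ _ 1).
  - by move=> n; apply: measurable_indic; apply: measurableI => //; exact: measurableC.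
  - by move=> n w; rewrite indicE; case: (_ \in _); rewrite ?normr1 ?normr0.
  - move=> w; have [Zw|Zw] := pselect (Z w).
      rewrite (_ : (fun n => _) = fun=> 0); first exact: cvg_cst.
      by apply/funext => n; rewrite indicE memNset// => -[_]; exact.
    have /cvg_rnorm cS : cvgn (S ^~ w) by apply: contrapT => h; apply: Zw; exact: cvZ.
    have e2 : 0 < e / 2 by rewrite divr_gt0.
    have [M _ hM] := (cvgr0Pnorm_le _).1 cS _ e2.
    apply/cvgr0Pnorm_le => eps eps0; near=> n.
    rewrite indicE memNset ?normr0 ?ltW// => -[+ _].
    rewrite /B /= -SN ltNge => /negP; apply.
    have Mn : (M <= n)%N by near: n; exact: nbhs_infty_ge.
    have := hM _ (leq_trans Mn (Nge n)); have := hM _ (leq_trans Mn (leq_trans (leqnSn n) (Nge n.+1))).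
    rewrite /= !ger0_norm ?rnorm_ge0// => h1 h2.
    by rewrite (le_trans (rdist_triangle _ (lim (S ^~ w @ \oo)) _))// (rdistC (lim _)); lra.
rewrite Ex_cst => /cvgr0Pnorm_le/(_ _ e0)[n _ /(_ n (leqnn n))] /=.
rewrite Ex_indic ?ger0_norm ?fine_prob_ge0//; last first.
  by apply: measurableI => //; exact: measurableC.
rewrite (_ : P _ = P (B n)).
  by rewrite leNgt /B (block_law _ _ 0) eX.
rewrite [in RHS](_ : B n = (B n `&` ~` Z) `|` (B n `&` Z)); last by rewrite -setIUr setvU setIT.
rewrite measureU0//; first by apply: measurableI => //; exact: measurableC.
  exact: measurableI.
by apply: (subset_measure0 _ mZ _ Z0); [exact: measurableI|exact: subIsetr].
Unshelve. all: by end_near. Qed.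

(** By contradiction: if delta = 2^-n fails for every n, each counterexample becomes a block of
    vectors. Since the law of a combination is the same for all stable families, the blocks can be
    put on disjoint stretches of theta, and together they form a series that stable type forces to
    converge. *)
Lemma small_tail (e : R) : 0 < e -> exists2 delta : R, 0 < delta &
  forall (I : finType) d' (T' : measurableType d') (P' : probability T' R) (Y : I -> T' -> R)
    (x : I -> E), stable_family alpha P' Y (fun=> 1) -> \sum_i rnorm (x i) `^ alpha <= delta ->
    fine (P' [set w | e < rnorm (comb x (Y ^~ w))]) <= e.
Proof.
move=> e0; apply: contrapT => H.
have HX (n : nat) : exists X : seq E, [/\ \sum_(x <- X) rnorm x `^ alpha <= 2^-1 ^+ n,
    (0 < size X)%N & e < fine (P [set w | e < rnorm (block X 0 w)])].
  apply: contrapT => HX; apply: H; exists (2^-1 ^+ n); first by rewrite exprn_gt0.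
  move=> I d' T' P' Y x sY sx; rewrite leNgt; apply/negP => eP; apply: HX.
  exists [seq x i | i <- enum I].
  have injr : injective (fun i : I => enum_rank i : nat) by move=> i j /val_inj/enum_rank_inj.
  have lawE : P' [set w | e < rnorm (comb x (Y ^~ w))] =
              P [set w | e < rnorm (block [seq x i | i <- enum I] 0 w)].
    rewrite (stable_family_law sY (theta_stable_family injr) (measurable_comb_gt aP x e)).
    congr (P _); apply/funext => w /=; congr (e < rnorm _).
    rewrite /block /comb size_map -cardE.
    rewrite (reindex (@enum_val I predT)) /=; last by apply: onW_bij; exact: enum_val_bij.
    apply: eq_bigr => j _; rewrite add0n enum_valK (nth_map (enum_val j)) -?cardE//.
    by congr (_ *: x _); exact: enum_val_nth.
  split; last by rewrite -lawE.
    by rewrite big_map big_enum.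
  rewrite lt0n size_eq0; apply/eqP => X0; move: eP; rewrite lawE X0.
  rewrite (_ : [set w | _] = set0) ?measure0 /=; first by rewrite ltNge ltW.
  by apply/seteqP; split => // w /=; rewrite /block big_ord0 rnorm0 ltNge ltW.
have [X XP] := choice HX.
apply: (@blocks_contra X e e0).
- by move=> n; have [] := XP n.
- by move=> n; have [] := XP n.
- by move=> n; have [] := XP n.
Qed.

(** This value closes the estimate in [copies_bound]: y <= 2 (1/64 + y^2) and y <= 1/8 give y <=
    1/24, which is below 1/16. *)
Let e0 : R := 64^-1.
Let root (n : nat) : R := n%:R `^ alpha^-1.

Let powr_root n : (0 < n)%N -> root n `^ alpha = n%:R.
Proof. by move=> n0; rewrite /root -powRrM mulVf ?powRr1 ?gt_eqF. Qed.

Section Copies.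
Context (n : nat) (x : 'I_n -> E) (N : nat) (t : R).

(* N independent copies of sum_j theta_j x_j *)
Let X (i : nat) w := \sum_(j < n) sor (theta (i * n + j) w) *: x j.
Let A i := [set w | t < rnorm (X i w)].
Let S m := [set w | t < rnorm (\sum_(i < m) X i w)].

Let mX i : measurable_fun setT (X i : T -> borelType E).
Proof. by apply: (measurable_sumE aP) => j; exact: (measurable_scalerE aP). Qed.

Let mA i : measurable (A i).
Proof. by apply: measurable_set_gt; exact: measurable_rnorm. Qed.

Let mS m : measurable (S m).
Proof.
by apply: measurable_set_gt; apply: measurable_rnorm; exact: (measurable_sumE aP).
Qed.

Let inj_row i : injective (fun j : 'I_n => (i * n + j)%N).
Proof. by move=> j j' /addnI/val_inj. Qed.

Let inj_grid m : injective (fun p : 'I_m * 'I_n => (p.1 * n + p.2)%N).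
Proof.
move=> [i j] [i' j'] /= h.
have n0 : (0 < n)%N by apply: leq_ltn_trans (ltn_ord j).
have hi : i = i'.
  apply/val_inj; move: (congr1 (fun z => z %/ n)%N h).
  by rewrite !divnMDl// !divn_small// !addn0.
by rewrite hi in h *; move/addnI/val_inj: h => ->.
Qed.

Let sum_grid m w (y : 'I_m -> R) :
  \sum_(i < m) sor (y i) *: X i w =
  comb (fun p : 'I_m * 'I_n => x p.2) (fun p => y p.1 * theta (p.1 * n + p.2) w).
Proof.
rewrite /comb -(pair_bigA _ (fun (i : 'I_m) (j : 'I_n) => sor (y i * theta (i * n + j)%N w) *: x j)) /=.
apply: eq_bigr => i _; rewrite scaler_sumr; apply: eq_bigr => j _.
by rewrite scalerA -scalar_of_realM.
Qed.

Let lawA i : fine (P (A i)) = fine (P (A 0)).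
Proof.
congr fine; exact: (stable_family_law (theta_stable_family (@inj_row i))
  (theta_stable_family (@inj_row 0)) (measurable_comb_gt aP x t)).
Qed.

Let indA i j : (i != j)%N -> fine (P (A i `&` A j)) = fine (P (A 0)) ^+ 2.
Proof.
move=> ij.
have inj2 : injective (fun s : 'I_n + 'I_n => match s with
    inl p => (i * n + p)%N | inr p => (j * n + p)%N end).
  have n0 (p : 'I_n) : (0 < n)%N by apply: leq_ltn_trans (ltn_ord p).
  have neq (p q : 'I_n) : (i * n + p)%N <> (j * n + q)%N.
    move=> h; move/eqP: ij; apply; move: (congr1 (fun z => z %/ n)%N h).
    by rewrite !divnMDl ?(n0 p)// !divn_small// !addn0.
  move=> [p|p] [q|q] h.
  - by move/addnI/val_inj: h => ->.
  - by case: (neq _ _ h).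
  - by case: (neq _ _ (esym h)).
  - by move/addnI/val_inj: h => ->.
have := stable_groups alpha_gt0 (theta_stable_family inj2)
  (measurable_comb_gt aP x t) (measurable_comb_gt aP x t).
rewrite (_ : [set w | _ /\ _] = A i `&` A j)// => ->.
by rewrite fineM ?probability_fin//; [rewrite -/(A i) -/(A j) !lawA expr2|exact: mA|exact: mA].
Qed.

(* flipping the signs of all copies but the i-th one preserves the joint law *)
Let levy m i : (i < m)%N -> fine (P (A i)) <= 2 * fine (P (A i `&` S m)).
Proof.
move=> im; pose i0 := Ordinal im.
pose s (p : 'I_m * 'I_n) : R := if p.1 == i0 then 1 else - 1.
pose F (f : 'I_m * 'I_n -> R) := t < rnorm (comb x (fun j => f (i0, j))) /\
  t < rnorm (comb (fun p : 'I_m * 'I_n => x p.2) f).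
have mF : measurable ([set f | F f] : set (coordinates R ('I_m * 'I_n)%type)).
  apply: measurableI; last exact: (measurable_comb_gt aP).
  apply: measurable_set_gt; apply: measurable_rnorm.
  apply: (measurable_comb_family aP x (T := coordinates R ('I_m * 'I_n)%type)
    (Y := fun j f => f (i0, j))) => j.
  exact: measurable_coordinate.
have st := theta_stable_family (@inj_grid m).
have st' : stable_family alpha P (fun p w => s p * theta (p.1 * n + p.2) w) (fun=> 1).
  have := stable_family_scale s st.
  rewrite (_ : (fun _ => _) = fun=> 1)//; apply/funext => p.
  by rewrite /s; case: ifP; rewrite ?normrN normr1 powR1 mulr1.
have law := stable_family_law st st' mF.
have XE w : comb x (fun j => theta (i0 * n + j) w) = X i w by [].
have SE w : comb (fun p : 'I_m * 'I_n => x p.2) (fun p => theta (p.1 * n + p.2) w) = \sum_(l < m) X l w.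
  transitivity (\sum_(l < m) sor 1 *: X l w).
    by rewrite sum_grid; apply: eq_bigr => p _; rewrite mul1r.
  by apply: eq_bigr => l _; rewrite scalar_of_real1 scale1r.
have eS : P (A i `&` S m) = P [set w | F (fun p => theta (p.1 * n + p.2) w)].
  congr (P _); apply/seteqP; split => w; rewrite /A /S /F /=.
    by rewrite XE SE.
  by rewrite XE SE.
(* After the flip the sum is X i minus all the other copies. *)
pose S' := [set w | t < rnorm (X i w *+ 2 - \sum_(l < m) X l w)].
have mS' : measurable S'.
  apply: measurable_set_gt; apply: measurable_rnorm; apply: (measurable_subE aP).
    by under eq_fun do rewrite mulr2n; exact: (measurable_addE aP).
  exact: (measurable_sumE aP).
have eS' : P (A i `&` S') = P [set w | F (fun p => s p * theta (p.1 * n + p.2) w)].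
  congr (P _); apply/funext => w; rewrite /A /S' /F /=; apply/propext.
  have -> : comb x (fun j => s (i0, j) * theta (i0 * n + j) w) = X i w.
    by apply: eq_bigr => j _; rewrite /s eqxx mul1r.
  have -> : comb (fun p : 'I_m * 'I_n => x p.2) (fun p => s p * theta (p.1 * n + p.2) w) =
      X i w *+ 2 - \sum_(l < m) X l w.
    rewrite -(sum_grid w (fun l => if l == i0 then 1 else -1)).
    rewrite (bigD1 i0)//= eqxx scalar_of_real1 scale1r [in RHS](bigD1 i0)//=.
    rewrite opprD addrA mulr2n addrK; congr (_ + _).
    rewrite -sumrN; apply: eq_bigr => l /negbTE ->.
    by rewrite scalar_of_realN scalar_of_real1 scaleN1r.
  by [].
(* Twice X i is the sum of the original and the flipped sum, so where X i has norm above t, so has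
   one of these two. *)
have sub : A i `<=` (A i `&` S m) `|` (A i `&` S').
  move=> w Aw; have [Sw|Sw] := pselect (S m w); [by left|right; split => //].
  rewrite /S' /= ltNge; apply/negP => h; move: Aw Sw; rewrite /A /S /=.
  move/negP: (h) => _ h1 /negP; rewrite -leNgt => h2.
  have : rnorm (X i w *+ 2) <= rnorm (X i w *+ 2 - \sum_(l < m) X l w) + rnorm (\sum_(l < m) X l w).
    by rewrite -{1}[X i w *+ 2](subrK (\sum_(l < m) X l w)) rnormD.
  have -> : rnorm (X i w *+ 2) = 2 * rnorm (X i w).
    by rewrite -[X i w *+ 2]scaler_nat rnormZ -[2%:R : scalar_field R k](_ : sor 2 = _) ?rnorm_of_real ?ger0_norm//
      -[2%:R in LHS]/(1 + 1 : R) scalar_of_realD scalar_of_real1.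
  move: h h1 h2; lra.
have le1 : fine (P (A i)) <= fine (P (A i `&` S m)) + fine (P (A i `&` S')).
  rewrite (le_trans _ (fine_prob_setU P _ _))//; [|exact: measurableI|exact: measurableI].
  by apply: fine_prob_le => //; apply: measurableU; exact: measurableI.
move: le1; rewrite eS' -law -eS; lra.
Qed.

(** With y = m P(A 0), Levy's inequality and Bonferroni give y <= 2 (1/64 + y^2), which large y
    satisfy too. They are excluded by increasing m one step at a time: y grows by P(A 0) <= 1/64,
    and 1/16 + 1/64 stays below 1/8, where the inequality improves itself to y <= 1/16. *)
Lemma copies_bound : (0 < N)%N -> (forall m, (m <= N)%N -> fine (P (S m)) <= e0) ->
  N%:R * fine (P (A 0)) <= 16^-1.
Proof.
move=> N0 hS.
have main m : (0 < m)%N -> (m <= N)%N -> m%:R * fine (P (A 0)) <= 8^-1 ->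
    m%:R * fine (P (A 0)) <= 16^-1.
  move=> m0 mN hm; set y := m%:R * _ in hm *.
  have F0 := fine_prob_ge0 P (A 0).
  have h1 : y <= 2 * \sum_(i < m) fine (P (A i `&` S m)).
    rewrite /y mulr_natl -[m in _ *+ m]card_ord -sumr_const mulr_sumr ler_sum// => i _.
    by rewrite -(lawA i); exact: levy.
  have h2 := bonferroni P m mA (mS m).
  have h3 : \sum_(i < m) \sum_(j < i) fine (P (A i `&` A j)) <= y ^+ 2.
    rewrite /y exprMn (@le_trans _ _ (\sum_(i < m) m%:R * fine (P (A 0)) ^+ 2))//.
      apply: ler_sum => i _; rewrite (eq_bigr (fun=> fine (P (A 0)) ^+ 2)).
        rewrite sumr_const card_ord -[leLHS]mulr_natl ler_wpM2r ?sqr_ge0// ler_nat; exact: ltnW.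
      by move=> j _; rewrite indA// gtn_eqF.
    by rewrite sumr_const card_ord -[leLHS]mulr_natl expr2 mulrA.
  have h4 := hS m mN; have y0 : 0 <= y by rewrite mulr_ge0.
  have h5 : y ^+ 2 <= y * 8^-1 by rewrite expr2 ler_wpM2l.
  by move: h1 h2 h3 h4 h5; rewrite /e0; lra.
have F1 : fine (P (A 0)) <= 64^-1.
  rewrite (le_trans _ (hS 1%N N0))//.
  have -> // : A 0 = S 1; by rewrite /A /S; apply/seteqP; split => w /=; rewrite big_ord1.
have step m : (0 < m)%N -> (m <= N)%N -> m%:R * fine (P (A 0)) <= 16^-1.
  elim: m => // m IH _ mN; apply: main => //.
  have [->|m0] := posnP m; first by rewrite mul1r; lra.
  have := IH m0 (ltnW mN); rewrite -[m.+1%:R]natr1 mulrDl mul1r; lra.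
exact: step.
Qed.

(** Divided by N^(1/alpha), the sum of m <= N copies has m/N times the alpha-mass of x, hence at
    most delta, so [small] controls every partial sum of copies. *)
Lemma copies_tail (delta : R) :
  (forall (I : finType) d' (T' : measurableType d') (P' : probability T' R) (Y : I -> T' -> R)
    (z : I -> E), stable_family alpha P' Y (fun=> 1) -> \sum_i rnorm (z i) `^ alpha <= delta ->
    fine (P' [set w | e0 < rnorm (comb z (Y ^~ w))]) <= e0) ->
  \sum_i rnorm (x i) `^ alpha <= delta -> (0 < N)%N -> t = e0 * root N ->
  N%:R * fine (P [set w | t < rnorm (comb x (fun i => theta i w))]) <= 16^-1.
Proof.
move=> small sx N0 tE; apply: copies_bound => // m mN.
have r0 : 0 < root N by rewrite powR_gt0// ltr0n.
have -> : S m = [set w | e0 < rnorm (comb (fun p : 'I_m * 'I_n => sor (root N)^-1 *: x p.2)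
    (fun p => theta (p.1 * n + p.2)%N w))].
  apply/funext => w; rewrite /S /=; apply/propext.
  rewrite -comb_scale.
  have -> : comb (fun p : 'I_m * 'I_n => x p.2) (fun p => (root N)^-1 * theta (p.1 * n + p.2)%N w) =
      sor (root N)^-1 *: \sum_(i < m) X i w.
    by rewrite -(sum_grid w (fun=> (root N)^-1)) scaler_sumr.
  by rewrite rnormZr ger0_norm ?invr_ge0 1?ltW// mulrC ltr_pdivlMr// tE.
apply: small; first exact: (theta_stable_family (@inj_grid m)).
rewrite -(pair_bigA _ (fun (i : 'I_m) (j : 'I_n) => rnorm (sor (root N)^-1 *: x j) `^ alpha)) /=.
have Ej j : rnorm (sor (root N)^-1 *: x j) `^ alpha = N%:R^-1 * rnorm (x j) `^ alpha.
  rewrite rnormZr ger0_norm ?invr_ge0 1?ltW// powRM ?invr_ge0 ?rnorm_ge0 1?ltW//.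
  congr (_ * _); rewrite -powR_inv1 1?ltW// -powRrM mulN1r powRN powr_root//.
under eq_bigr do under eq_bigr do rewrite Ej.
under eq_bigr do rewrite -mulr_sumr.
rewrite sumr_const card_ord -[leLHS]mulr_natl mulrA (le_trans _ sx)// ler_piMl//.
  by apply: sumr_ge0 => j _; rewrite powR_ge0.
by rewrite ler_pdivrMr ?ltr0n// mul1r ler_nat.
Qed.

End Copies.

Lemma comb_enum (I : finType) (x : I -> E) (y : nat -> R) :
  comb x (fun i => y (enum_rank i)) = comb (fun j : 'I_#|I| => x (enum_val j)) (fun j => y j).
Proof.
rewrite /comb (reindex (@enum_val I predT)) /=; last by apply: onW_bij; exact: enum_val_bij.
by apply: eq_bigr => j _; rewrite enum_valK.
Qed.

(** [copies_tail] gives the bound at the levels e0 N^(1/alpha) for vectors of mass at most delta.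
    Homogeneity brings the mass to delta, and going down to the next available level loses only a
    constant factor. *)
Lemma weak_tail : exists2 C : R, 0 < C &
  forall (I : finType) d' (T' : measurableType d') (P' : probability T' R) (Y : I -> T' -> R)
    (c : I -> R) (x : I -> E) (t : R), stable_family alpha P' Y c -> (forall i, 0 <= c i) -> 0 < t ->
    fine (P' [set w | t < rnorm (comb x (Y ^~ w))]) <=
    C * (\sum_i c i * rnorm (x i) `^ alpha) / t `^ alpha.
Proof.
have e00 : 0 < e0 by rewrite /e0 invr_gt0.
have [delta d0 small] := small_tail e00.
exists (e0 `^ alpha / delta); first by rewrite divr_gt0// powR_gt0.
move=> I d' T' P' Y c x t sY c0 t0.
have injr : injective (fun i : I => enum_rank i : nat) by move=> i j /val_inj/enum_rank_inj.
pose r i := c i `^ alpha^-1.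
have r0 i : 0 <= r i by rewrite powR_ge0.
have ra i : r i `^ alpha = c i by rewrite /r -powRrM mulVf ?powRr1 ?gt_eqF.
have st : stable_family alpha P (fun i w => r i * theta (enum_rank i) w) c.
  have := stable_family_scale r (theta_stable_family injr).
  rewrite (_ : (fun _ => _) = c)//; apply/funext => i.
  by rewrite ger0_norm// ra mul1r.
rewrite (stable_family_law sY st (measurable_comb_gt aP x t)).
pose z (j : 'I_#|I|) : E := sor (r (enum_val j)) *: x (enum_val j).
have -> : [set w | [set f | t < rnorm (comb x f)] (fun i => r i * theta (enum_rank i) w)] =
    [set w | t < rnorm (comb z (fun j => theta j w))].
  apply/funext => w /=; congr (is_true (t < rnorm _)).
  by rewrite comb_scale (comb_enum _ (fun j => theta j w)).
set v := \sum_i _.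
have vE : v = \sum_j rnorm (z j) `^ alpha.
  rewrite /v (reindex (@enum_val I predT)) /=; last by apply: onW_bij; exact: enum_val_bij.
  by apply: eq_bigr => j _; rewrite /z rnormZr ger0_norm// powRM ?rnorm_ge0// ra.
have v_ge0 : 0 <= v by rewrite vE; apply: sumr_ge0 => j _; rewrite powR_ge0.
have [v0|v0] := eqVneq v 0.
  rewrite v0 mulr0 mul0r (_ : [set w | _] = set0) ?measure0//.
  apply/seteqP; split => // w /=; rewrite /comb big1 ?rnorm0 ?ltNge ?(ltW t0)// => j _.
  have : rnorm (z j) `^ alpha = 0.
    apply/eqP; rewrite eq_le powR_ge0 andbT -v0 vE (bigD1 j)//= lerDl.
    by apply: sumr_ge0 => *; rewrite powR_ge0.
  by move=> /powR_eq0_eq0/rnorm_eq0 ->; rewrite scaler0.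
have vp : 0 < v by rewrite lt_neqAle eq_sym v0.
pose l := (delta / v) `^ alpha^-1.
have l0 : 0 < l by rewrite powR_gt0// divr_gt0.
have la : l `^ alpha = delta / v by rewrite /l -powRrM mulVf ?powRr1 ?gt_eqF// ltW// divr_gt0.
pose s := l * t; have s0 : 0 < s by rewrite mulr_gt0.
have -> : [set w | t < rnorm (comb z (fun j => theta j w))] =
    [set w | s < rnorm (comb (fun j => sor l *: z j) (fun j => theta j w))].
  apply/funext => w /=; congr is_true.
  rewrite -(comb_scale z (fun=> l) (fun j : 'I_#|I| => theta j w)).
  have -> : comb z (fun j => l * theta j w) = sor l *: comb z (fun j => theta j w).
    by rewrite /comb scaler_sumr; apply: eq_bigr => j _; rewrite scalerA -scalar_of_realM.
  by rewrite rnormZr gtr0_norm// /s ltr_pM2l.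
(* The number of copies, not yet an integer, whose level is s; its inverse is the bound to be
   proved. *)
pose q := (s / e0) `^ alpha.
have q0 : 0 < q by rewrite powR_gt0// divr_gt0.
have -> : e0 `^ alpha / delta * v / t `^ alpha = q^-1.
  rewrite /q /s !powRM ?invr_ge0 ?mulr_ge0// ?(ltW l0) ?(ltW t0) ?(ltW e00)// la.
  have -> : e0^-1 `^ alpha = (e0 `^ alpha)^-1.
    by rewrite -powR_inv1 1?ltW// -powRrM mulN1r powRN.
  have ? : t `^ alpha != 0 by rewrite gt_eqF// powR_gt0.
  have ? : e0 `^ alpha != 0 by rewrite gt_eqF// powR_gt0.
  have ? : delta != 0 by rewrite gt_eqF.
  field; rewrite v0; repeat (apply/andP; split => //).
have mS : measurable [set w | s < rnorm (comb (fun j => sor l *: z j) (fun j => theta j w))].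
  by apply: measurable_set_gt; apply: measurable_rnorm; exact: (measurable_comb_family aP).
have [q1|q1] := ltP q 1.
  by rewrite (le_trans (fine_prob_le1 P mS))// invf_ge1// ltW.
(* N is the integer part of q, so that q < N + 1 <= 16 N and the bound 1/(16 N) is at most 1/q. *)
have [N N0 /andP[Nq qN]] : exists2 N, (0 < N)%N & N%:R <= q < N.+1%:R.
  exists (Num.truncn q); last exact: (truncn_itv (ltW q0)).
  by rewrite (truncn_ge_nat _ (ltW q0)).
have Nr : 0 < N%:R :> R by rewrite ltr0n.
have tail : fine (P [set w | e0 * root N < rnorm (comb (fun j => sor l *: z j) (fun j => theta j w))]) <=
    (16 * N%:R)^-1.
  have := @copies_tail _ (fun j => sor l *: z j) N (e0 * root N) delta small _ N0 erefl.
  rewrite invfM ler_pdivlMr// mulrC; apply.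
  have Ej j : rnorm (sor l *: z j) `^ alpha = delta / v * rnorm (z j) `^ alpha.
    by rewrite rnormZr gtr0_norm// powRM ?rnorm_ge0// ?la// ltW.
  under eq_bigr do rewrite Ej.
  by rewrite -mulr_sumr -vE divfK.
rewrite (@le_trans _ _ (16 * N%:R)^-1)//.
  rewrite (le_trans _ tail)//; apply: fine_prob_le => //.
    by apply: measurable_set_gt; apply: measurable_rnorm; exact: (measurable_comb_family aP).
  move=> w /=; apply: le_lt_trans; rewrite -ler_pdivlMl// mulrC.
  have -> : s / e0 = q `^ alpha^-1.
    by rewrite /q -powRrM mulfV ?powRr1 ?gt_eqF// divr_ge0 ?ltW.
  by apply: ge0_ler_powR => //; rewrite ?nnegrE ?invr_ge0 ?ltW.
rewrite lef_pV2 ?posrE ?mulr_gt0// (le_trans (ltW qN))// -[N.+1%:R]natr1.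
by have : 1 <= N%:R :> R by [rewrite ler1n]; lra.
Qed.

End StableType.

(** * Isotropic families *)

Section IsotropicFamilies.
Context (R : realType) (k : scalar_kind) (alpha : R) (alpha_gt0 : 0 < alpha).
Local Notation K := (scalar_field R k).
Local Notation sor := (@scalar_of_real R k).

Lemma scalar_Re_ofM (t : R) (y : K) : scalar_Re (sor t * y) = t * scalar_Re y.
Proof. by case: (k) y => //= -[a b] /=; rewrite mul0r subr0. Qed.

Lemma scalar_Re_iM (y : K) : scalar_Re (scalar_i R k * y) = - scalar_Im y.
Proof. by case: (k) y => /= [y|[a b]] /=; rewrite ?mul0r ?oppr0// mul1r sub0r. Qed.

Lemma rnorm_mul (y z : K) : rnorm (y * z) = rnorm y * rnorm z.
Proof. by rewrite -[LHS](scalar_of_realK k) -normE normrM !normE -scalar_of_realM scalar_of_realK. Qed.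

Lemma rnorm_scalar_i_le1 : rnorm (scalar_i R k : K) <= 1.
Proof.
rewrite /rnorm; case: k => /=; first by rewrite normr0.
by rewrite expr0n /= add0r expr1n sqrtr1.
Qed.

Lemma rnorm_scalar_unit (y : K) : rnorm y != 0 -> rnorm ((sor (rnorm y))^-1 * y) = 1.
Proof.
move=> y0; have -> : (sor (rnorm y))^-1 = sor (rnorm y)^-1.
  have s0 : sor (rnorm y) != 0.
    apply: contra_neq y0 => /(congr1 (@scalar_Re R k)).
    by rewrite -(scalar_of_real0 R k) !scalar_of_realK.
  by apply: (mulfI s0); rewrite -scalar_of_realM !mulfV// scalar_of_real1.
by rewrite rnorm_mul rnorm_of_real normfV ger0_norm ?rnorm_ge0// mulVf.
Qed.

Definition parts (I : finType) (T : Type) (Y : I -> T -> K) (p : I * bool) w : R :=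
  if p.2 then scalar_Im (Y p.1 w) else scalar_Re (Y p.1 w).

Section Family.
Context d (T : measurableType d) (P : probability T R) (I : finType).
Implicit Types (Y : I -> T -> K) (c : I -> R).

Definition measurable_scalar (y : T -> K) :=
  measurable_fun setT (fun w => scalar_Re (y w)) /\ measurable_fun setT (fun w => scalar_Im (y w)).

(* Every real linear combination of the real and imaginary parts of Y is Re (\sum_i z i * Y i)
   for some scalars z. *)
Definition isotropic_family Y c :=
  (forall i, measurable_scalar (Y i)) /\
  forall z : I -> K,
    Ex P (fun w => cos (\sum_i scalar_Re (z i * Y i w))) = expR (- \sum_i c i * rnorm (z i) `^ alpha) /\
    Ex P (fun w => sin (\sum_i scalar_Re (z i * Y i w))) = 0.

Lemma measurable_parts Y : (forall i, measurable_scalar (Y i)) ->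
  forall p, measurable_fun setT (parts Y p).
Proof. by move=> mY [i []]; have [] := mY i. Qed.

(** The scalar z with Re (z y) = t(i, false) Re y + t(i, true) Im y. For real scalars [scalar_i] and
    the imaginary part are both 0, so the formula persists. *)
Definition dual_scalar (t : I * bool -> R) i : K := sor (t (i, false)) - sor (t (i, true)) * scalar_i R k.

Lemma sum_parts (t : I * bool -> R) Y w :
  \sum_p t p * parts Y p w = \sum_i scalar_Re (dual_scalar t i * Y i w).
Proof.
transitivity (\sum_i \sum_b t (i, b) * parts Y (i, b) w).
  by rewrite pair_bigA; apply: eq_bigr => -[].
apply: eq_bigr => i _; rewrite big_bool /= /parts /= addrC mulrBl scalar_ReD scalar_Re_ofM.
by rewrite -mulNr -mulNr -scalar_of_realN -mulrA scalar_Re_ofM scalar_Re_iM mulrNN.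
Qed.

Lemma isotropic_scale Y c (r : I -> K) : isotropic_family Y c ->
  (forall i, measurable_scalar (fun w => r i * Y i w)) ->
  isotropic_family (fun i w => r i * Y i w) (fun i => c i * rnorm (r i) `^ alpha).
Proof.
move=> [mY cY] mr; split => // z; have [h1 h2] := cY (fun i => z i * r i).
under eq_Ex do under eq_bigr do rewrite mulrA.
under [X in _ /\ X = _]eq_Ex do under eq_bigr do rewrite mulrA.
split; last exact: h2; apply: etrans h1 _; congr expR; congr (- _); apply: eq_bigr => i _.
by rewrite rnorm_mul powRM ?rnorm_ge0// -mulrA (mulrC (rnorm (z i) `^ _)).
Qed.

Lemma isotropic_Re Y c : isotropic_family Y c -> stable_family alpha P (fun i w => scalar_Re (Y i w)) c.
Proof.
move=> [mY cY]; split; first by move=> i; have [] := mY i.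
move=> t; have [h1 h2] := cY (fun i => sor (t i)).
have E w : \sum_i scalar_Re (sor (t i) * Y i w) = \sum_i t i * scalar_Re (Y i w).
  by apply: eq_bigr => i _; rewrite scalar_Re_ofM.
split; last exact: etrans (eq_Ex _ (fun w => congr1 sin (esym (E w)))) h2.
apply: etrans (eq_Ex _ (fun w => congr1 cos (esym (E w)))) _; apply: etrans h1 _.
by congr expR; congr (- _); apply: eq_bigr => i _; rewrite rnorm_of_real.
Qed.

(** The norm of [scalar_i] is 1 for complex scalars. For real ones it is 0, in agreement with the
    vanishing imaginary parts. *)
Lemma isotropic_Im Y c : isotropic_family Y c ->
  stable_family alpha P (fun i w => scalar_Im (Y i w)) (fun i => c i * rnorm (scalar_i R k) `^ alpha).
Proof.
move=> [mY cY]; split; first by move=> i; have [] := mY i.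
move=> t; have [h1 h2] := cY (fun i => - sor (t i) * scalar_i R k).
have E w : \sum_i scalar_Re (- sor (t i) * scalar_i R k * Y i w) = \sum_i t i * scalar_Im (Y i w).
  by apply: eq_bigr => i _; rewrite -mulrA -scalar_of_realN scalar_Re_ofM scalar_Re_iM mulrNN.
split; last exact: etrans (eq_Ex _ (fun w => congr1 sin (esym (E w)))) h2.
apply: etrans (eq_Ex _ (fun w => congr1 cos (esym (E w)))) _; apply: etrans h1 _.
congr expR; congr (- _); apply: eq_bigr => i _.
rewrite rnorm_mul -scalar_of_realN rnorm_of_real normrN powRM ?rnorm_ge0//.
by rewrite -mulrA (mulrC (`|t i| `^ _)).
Qed.

End Family.

Lemma isotropic_law (I : finType)
    d (T : measurableType d) (P : probability T R) (Y : I -> T -> K)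
    d' (T' : measurableType d') (P' : probability T' R) (Y' : I -> T' -> K)
    (c : I -> R) (C : set (coordinates R (I * bool)%type)) :
  isotropic_family P Y c -> isotropic_family P' Y' c -> measurable C ->
  P [set w | C (fun p => parts Y p w)] = P' [set w | C (fun p => parts Y' p w)].
Proof.
move=> [mY cY] [mY' cY'] mC; apply: char_fun_unique => //; try exact: measurable_parts.
move=> t.
have [c1 s1] := cY (dual_scalar t); have [c2 s2] := cY' (dual_scalar t); split.
- transitivity (Ex P (fun w => cos (\sum_i scalar_Re (dual_scalar t i * Y i w)))).
    by apply: eq_Ex => w; rewrite sum_parts.
  by rewrite c1 -c2; apply: eq_Ex => w; rewrite sum_parts.
- transitivity (Ex P (fun w => sin (\sum_i scalar_Re (dual_scalar t i * Y i w)))).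
    by apply: eq_Ex => w; rewrite sum_parts.
  apply: (etrans s1); apply: esym; apply: etrans s2.
  by apply: eq_Ex => w; rewrite sum_parts.
Qed.

Lemma isotropic_groups d (T : measurableType d) (P : probability T R) (I1 I2 : finType)
    (Y : I1 + I2 -> T -> K) (c : I1 + I2 -> R)
    (C1 : set (coordinates R (I1 * bool)%type)) (C2 : set (coordinates R (I2 * bool)%type)) :
  isotropic_family P Y c -> measurable C1 -> measurable C2 ->
  P [set w | C1 (fun p => parts (fun i => Y (inl i)) p w) /\ C2 (fun p => parts (fun i => Y (inr i)) p w)] =
  (P [set w | C1 (fun p => parts (fun i => Y (inl i)) p w)] *
   P [set w | C2 (fun p => parts (fun i => Y (inr i)) p w)])%E.
Proof.
move=> [mY cY] mC1 mC2.
pose z (t : I1 -> K) s (i : I1 + I2) : K := match i with inl i => t i | inr i => s i end.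
pose o1 (i : I1) : K := 0; pose o2 (i : I2) : K := 0.
have Re0 (y : K) : scalar_Re (0 * y) = 0.
  by rewrite mul0r -(scalar_of_real0 R k) scalar_of_realK.
have e1 t w : \sum_i scalar_Re (z t o2 i * Y i w) = \sum_i scalar_Re (t i * Y (inl i) w).
  by rewrite big_sumType /= [X in _ + X]big1 ?addr0.
have e2 t w : \sum_i scalar_Re (z o1 t i * Y i w) = \sum_i scalar_Re (t i * Y (inr i) w).
  by rewrite big_sumType /= big1 ?add0r.
have e3 t s w : \sum_i scalar_Re (z t s i * Y i w) =
    \sum_i scalar_Re (t i * Y (inl i) w) + \sum_i scalar_Re (s i * Y (inr i) w).
  by rewrite big_sumType.
have a0 : alpha != 0 by rewrite gt_eqF.
apply: independent_groups => //.
- by apply: measurable_parts => i; exact: mY.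
- by apply: measurable_parts => i; exact: mY.
- move=> t; rewrite -[RHS](cY (z (dual_scalar t) o2)).2; apply: eq_Ex => w.
  by rewrite e1 sum_parts.
- move=> t; rewrite -[RHS](cY (z o1 (dual_scalar t))).2; apply: eq_Ex => w.
  by rewrite e2 sum_parts.
- move=> t s; rewrite -[RHS](cY (z (dual_scalar t) (dual_scalar s))).2; apply: eq_Ex => w.
  by rewrite e3 !sum_parts.
- move=> t s.
  have -> : Ex P (fun w => cos (\sum_i t i * parts (fun i => Y (inl i)) i w +
      \sum_i s i * parts (fun i => Y (inr i)) i w)) =
      Ex P (fun w => cos (\sum_i scalar_Re (z (dual_scalar t) (dual_scalar s) i * Y i w))).
    by apply: eq_Ex => w; rewrite e3 !sum_parts.
  have -> : Ex P (fun w => cos (\sum_i t i * parts (fun i => Y (inl i)) i w)) =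
      Ex P (fun w => cos (\sum_i scalar_Re (z (dual_scalar t) o2 i * Y i w))).
    by apply: eq_Ex => w; rewrite e1 sum_parts.
  have -> : Ex P (fun w => cos (\sum_i s i * parts (fun i => Y (inr i)) i w)) =
      Ex P (fun w => cos (\sum_i scalar_Re (z o1 (dual_scalar s) i * Y i w))).
    by apply: eq_Ex => w; rewrite e2 sum_parts.
  rewrite !(cY _).1 -expRD !big_sumType /=; congr expR.
  under [X in _ = - (_ + X) + _]eq_bigr do rewrite rnorm0 powR0// mulr0.
  under [X in _ = _ + - (X + _)]eq_bigr do rewrite rnorm0 powR0// mulr0.
  by rewrite !big1_eq addr0 add0r opprD.
Qed.

Section Combinations.
Context (E : completeNormedModType K).
Variable a : nat -> E.
Hypothesis aP : forall x (e : R), 0 < e -> exists n, rnorm (x - a n) < e.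

Definition part_vectors (I : finType) (x : I -> E) (p : I * bool) : E :=
  if p.2 then scalar_i R k *: x p.1 else x p.1.

Definition ksum (I : finType) (x : I -> E) (y : I -> K) : E := \sum_i y i *: x i.

(** A scalar combination is a real combination of twice as many vectors, which gives access to the
    joint law of real and imaginary parts. *)
Lemma ksum_comb (I : finType) (x : I -> E) (T : Type) (Y : I -> T -> K) w :
  ksum x (Y ^~ w) = comb (part_vectors x) (fun p => parts Y p w).
Proof.
transitivity (\sum_i \sum_b sor (parts Y (i, b) w) *: part_vectors x (i, b)); last first.
  by rewrite pair_bigA; apply: eq_bigr => -[].
apply: eq_bigr => i _; rewrite big_bool /= /parts /part_vectors /= scalerA -scalerDl addrC.
by rewrite -scalar_ReIm.
Qed.

Lemma measurable_ksum (I : finType) (x : I -> E) d (T : measurableType d) (Y : I -> T -> K) :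
  (forall i, measurable_scalar (Y i)) ->
  measurable_fun setT ((fun w => ksum x (Y ^~ w)) : T -> borelType E).
Proof.
move=> mY; under eq_fun do rewrite ksum_comb.
by apply: (measurable_comb_family aP); exact: measurable_parts.
Qed.

Lemma measurable_scalar_ksum (I : finType) (x : I -> E) (B : set (borelType E)) : measurable B ->
  measurable ([set f | B (comb (part_vectors x) f)] : set (coordinates R (I * bool)%type)).
Proof.
move=> mB; rewrite -[X in measurable X]setTI.
exact: (measurable_comb aP (part_vectors x) measurableT mB).
Qed.

Lemma ksum_law (I : finType) (x : I -> E) (c : I -> R)
    d (T : measurableType d) (P : probability T R) (Y : I -> T -> K)
    d' (T' : measurableType d') (P' : probability T' R) (Y' : I -> T' -> K) :
  isotropic_family P Y c -> isotropic_family P' Y' c ->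
  same_distribution P P' (fun w => ksum x (Y ^~ w)) (fun w => ksum x (Y' ^~ w)).
Proof.
move=> fY fY' B mB; have := isotropic_law fY fY' (measurable_scalar_ksum x mB).
have E0 d0 (T0 : measurableType d0) (Y0 : I -> T0 -> K) :
    (fun w => ksum x (Y0 ^~ w)) @^-1` B = [set w | B (comb (part_vectors x) (fun p => parts Y0 p w))].
  by apply/seteqP; split => w /=; rewrite ksum_comb.
by rewrite !E0.
Qed.

Lemma ksum_independent d (T : measurableType d) (P : probability T R) (I1 I2 : finType)
    (Y : I1 + I2 -> T -> K) (c : I1 + I2 -> R) (x1 : I1 -> E) (x2 : I2 -> E)
    (B1 B2 : set (borelType E)) :
  isotropic_family P Y c -> measurable B1 -> measurable B2 ->
  P [set w | B1 (ksum x1 (fun i => Y (inl i) w)) /\ B2 (ksum x2 (fun i => Y (inr i) w))] =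
  (P [set w | B1 (ksum x1 (fun i => Y (inl i) w))] * P [set w | B2 (ksum x2 (fun i => Y (inr i) w))])%E.
Proof.
move=> fY mB1 mB2.
have := isotropic_groups fY (measurable_scalar_ksum x1 mB1) (measurable_scalar_ksum x2 mB2).
have E1 w : ksum x1 (fun i => Y (inl i) w) = comb (part_vectors x1) (fun p => parts (fun i => Y (inl i)) p w).
  exact: (ksum_comb x1 (fun i => Y (inl i))).
have E2 w : ksum x2 (fun i => Y (inr i) w) = comb (part_vectors x2) (fun p => parts (fun i => Y (inr i)) p w).
  exact: (ksum_comb x2 (fun i => Y (inr i))).
under [X in _ -> P X = _]eq_set do rewrite E1 E2.
by under [X in _ -> _ = (P X * _)%E]eq_set do rewrite E1; under [X in _ -> _ = (_ * P X)%E]eq_set do rewrite E2.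
Qed.

(** The real and imaginary parts of one isotropic variable are in general dependent, but each of the
    two families taken alone is a real stable family. The real bound is applied to both at level t /
    2, whence the factors 2 and 2^alpha. *)
Lemma ksum_tail (C : R) : 0 <= C ->
  (forall (I : finType) d' (T' : measurableType d') (P' : probability T' R) (Y : I -> T' -> R)
    (c : I -> R) (x : I -> E) (t : R), stable_family alpha P' Y c -> (forall i, 0 <= c i) -> 0 < t ->
    fine (P' [set w | t < rnorm (comb x (Y ^~ w))]) <= C * (\sum_i c i * rnorm (x i) `^ alpha) / t `^ alpha) ->
  forall (I : finType) d' (T' : measurableType d') (P' : probability T' R) (Y : I -> T' -> K)
    (c : I -> R) (x : I -> E) (t : R), isotropic_family P' Y c -> (forall i, 0 <= c i) -> 0 < t ->
    fine (P' [set w | t < rnorm (ksum x (Y ^~ w))]) <=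
      2 * C * 2 `^ alpha * (\sum_i c i * rnorm (x i) `^ alpha) / t `^ alpha.
Proof.
move=> C0 tail I d' T' P' Y c x t fY c0 t0.
have hRe := isotropic_Re fY; have hIm := isotropic_Im fY.
pose X1 w := comb x (fun i => scalar_Re (Y i w)).
pose X2 w := comb (fun i => scalar_i R k *: x i) (fun i => scalar_Im (Y i w)).
have XE w : ksum x (Y ^~ w) = X1 w + X2 w.
  rewrite /X1 /X2 /comb -big_split /=; apply: eq_bigr => i _.
  by rewrite scalerA -scalerDl -scalar_ReIm.
have mX1 : measurable_fun setT (X1 : T' -> borelType E) by apply: (measurable_comb_family aP); exact: hRe.1.
have mX2 : measurable_fun setT (X2 : T' -> borelType E) by apply: (measurable_comb_family aP); exact: hIm.1.
have mS1 : measurable [set w | t / 2 < rnorm (X1 w)].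
  by apply: measurable_set_gt; exact: measurable_rnorm.
have mS2 : measurable [set w | t / 2 < rnorm (X2 w)].
  by apply: measurable_set_gt; exact: measurable_rnorm.
have t2 : 0 < t / 2 by rewrite divr_gt0.
set s := \sum_i _.
have b1 : fine (P' [set w | t / 2 < rnorm (X1 w)]) <= C * s / (t / 2) `^ alpha by exact: tail.
have b2 : fine (P' [set w | t / 2 < rnorm (X2 w)]) <= C * s / (t / 2) `^ alpha.
  apply: le_trans (tail _ _ _ _ _ _ _ _ hIm _ t2) _.
    by move=> i; rewrite mulr_ge0// powR_ge0.
  rewrite ler_wpM2r ?invr_ge0 ?powR_ge0// ler_wpM2l//; apply: ler_sum => i _.
  rewrite -mulrA ler_wpM2l// rnormZ powRM ?rnorm_ge0// mulrA ler_piMl ?powR_ge0//.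
  have h1 : rnorm (scalar_i R k) `^ alpha <= 1.
    rewrite -(congr1 (@^~ alpha) (@powR1 R)); apply: ge0_ler_powR; rewrite ?nnegrE ?rnorm_ge0 ?(ltW alpha_gt0)//.
    exact: rnorm_scalar_i_le1.
  by rewrite mulr_ile1 ?powR_ge0.
have E2 : (t / 2) `^ alpha = t `^ alpha / 2 `^ alpha.
  rewrite powRM ?ltW// ?invr_gt0//; congr (_ * _).
  by rewrite -powR_inv1// -powRrM mulN1r powRN.
rewrite E2 invfM invrK in b1 b2.
apply: (@le_trans _ _ (C * s * ((t `^ alpha)^-1 * 2 `^ alpha) + C * s * ((t `^ alpha)^-1 * 2 `^ alpha))).
  apply: le_trans (lerD b1 b2); apply: le_trans (fine_prob_setU P' mS1 mS2).
  apply: fine_prob_le.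
  - apply: measurable_set_gt; apply: (measurable_rnorm (X := fun w => ksum x (Y ^~ w))).
    by apply: measurable_ksum; exact: fY.1.
  - exact: measurableU.
  - move=> w /=; rewrite XE => tX; have [h|h] := ltP (t / 2) (rnorm (X1 w)); [by left|right].
    by have := rnormD (X1 w) (X2 w); lra.
by rewrite le_eqVlt; apply/orP; left; apply/eqP; ring.
Qed.

End Combinations.
End IsotropicFamilies.

(** * Isotropy of stable random measures *)

Section LebesgueShift.
Context (R : realType).
Local Notation mu := (@lebesgue_measure R).

Lemma measurable_shift (c : R) : measurable_fun setT ((fun x => x + c) : measurableTypeR R -> measurableTypeR R).
Proof. by apply: measurable_funD => //; exact: measurable_cst. Qed.

Lemma lebesgue_measure_shift (c : R) (A : set (measurableTypeR R)) : measurable A ->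
  mu ((fun x => x + c) @^-1` A) = mu A.
Proof.
move=> mA; have mc := measurable_shift c.
have := @lebesgue_measure_unique R (pushforward mu (mfun_of mc)) _ A mA.
move=> -> // _ [[a b]] _ <-.
transitivity (mu `](a - c)%R, (b - c)%R]%classic); last first.
  by congr (mu _); apply/seteqP; split => x /=; rewrite !in_itv /= ltrBlDr lerBrDr.
by rewrite !lebesgue_measure_itv /= !lte_fin ltrD2r EFinN EFinN /= -!EFinD; case: ifP => // _; congr EFin; ring.
Qed.

Lemma ge0_integral_shift (c : R) (f : R -> \bar R) (D : set (measurableTypeR R)) :
  measurable D -> measurable_fun setT f -> (forall x, 0 <= f x)%E ->
  (\int[mu]_(x in (fun x => x + c)%R @^-1` D) f (x + c)%R = \int[mu]_(x in D) f x)%E.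
Proof.
move=> mD mf f0; have mc := measurable_shift c.
rewrite -(@ge0_integral_pushforward _ _ _ _ R _ mc mu D f)//; last exact: measurable_funS mf.
apply: eq_measure_integral => A mA _.
exact: (lebesgue_measure_shift c mA).
Qed.

End LebesgueShift.

Section Circle.
Context (R : realType) (alpha : R) (alpha_gt0 : 0 < alpha).
Local Notation mu := (@lebesgue_measure R).

Definition circle_const : R := \int[@circle_uniform R]_s `|s.1| `^ alpha.

Let h (x : R) : R := `|cos x| `^ alpha.

Let mh : measurable_fun setT h.
Proof.
apply: (measurableT_comp (f := fun x : R => x `^ alpha)); first exact: measurable_powR.
apply: measurableT_comp => //; apply: continuous_measurable_fun; exact: continuous_cos.
Qed.

Let Eh x : (0 <= (h x)%:E)%E. Proof. by rewrite lee_fin powR_ge0. Qed.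

Let mEh : measurable_fun setT (fun x => (h x)%:E). Proof. exact/measurable_EFinP. Qed.

Let int_co (a b c : R) : a <= b -> b <= c ->
  (\int[mu]_(x in `[a, c[) (h x)%:E = \int[mu]_(x in `[a, b[) (h x)%:E + \int[mu]_(x in `[b, c[) (h x)%:E)%E.
Proof.
move=> ab bc; rewrite -ge0_integral_setU//.
- by rewrite -itv_bndbnd_setU// bnd_simp.
- by apply: measurable_funS mEh.
- by apply/disj_setPS => x /= []; rewrite !in_itv /= => /andP[_ xb] /andP[bx _]; move: xb; rewrite ltNge bx.
Qed.

Let int_shift (a b c : R) : (forall x, h (x + c) = h x) ->
  (\int[mu]_(x in `[a, b[) (h x)%:E = \int[mu]_(x in `[(a + c)%R, (b + c)%R[) (h x)%:E)%E.
Proof.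
move=> hc; rewrite -[RHS](ge0_integral_shift c)//.
have -> : (fun x : R => x + c) @^-1` `[(a + c), (b + c)[%classic = `[a, b[%classic.
  by apply/seteqP; split => x /=; rewrite !in_itv /= lerD2r ltrD2r.
by apply: eq_integral => x _; rewrite hc.
Qed.

Let h2pi x : h (x + 2 * pi) = h x.
Proof. by rewrite /h mulr_natl cosD2pi. Qed.

(** Translation produces the integral over an interval starting at - th; the part below 0 is moved
    back by one period. Half-open intervals keep the pieces disjoint. *)
Let circle_integral_shift (th : R) : 0 <= th <= 2 * pi ->
  (\int[mu]_(x in `[0%R, (2 * pi)%R]) (h (x - th))%:E = \int[mu]_(x in `[0%R, (2 * pi)%R]) (h x)%:E)%E.
Proof.
move=> /andP[th0 th2].
have mt : measurable_fun setT (fun x : measurableTypeR R => (h (x - th))%:E).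
  by apply/measurable_EFinP; apply: (measurableT_comp mh); apply: measurable_shift.
rewrite -!integral_itv_bndo_bndc; try by apply: measurable_funS mt || apply: measurable_funS mEh.
transitivity (\int[mu]_(x in `[(- th)%R, (2 * pi - th)%R[) (h x)%:E)%E.
  rewrite -[RHS](ge0_integral_shift (- th))//.
  congr (integral _ _ _).
  by apply/seteqP; split => x /=; rewrite !in_itv /= => /andP[? ?]; apply/andP; split; lra.
rewrite (@int_co _ 0); [|by rewrite oppr_le0|by rewrite subr_ge0].
rewrite (@int_co 0 (2 * pi - th) (2 * pi)); [|by rewrite subr_ge0|lra].
rewrite addeC; congr (_ + _)%E; rewrite (@int_shift (- th) 0 _ h2pi).
by rewrite add0r addrC.
Qed.

Let circle_integral_pos : (0 < \int[mu]_(x in `[0%R, (2 * pi)%R]) (h x)%:E)%E.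
Proof.
have c1 := @cos1_gt0 R; have p2 := @pi_ge2 R.
apply: (@lt_le_trans _ _ (\int[mu]_(x in `[0%R, 1%R]) (cos 1 `^ alpha)%:E)%E).
  by rewrite integral_cst//= lebesgue_measure_itv /= lte_fin ltr01 oppr0 adde0 mule1 lte_fin powR_gt0.
apply: (@le_trans _ _ (\int[mu]_(x in `[0%R, 1%R]) (h x)%:E)%E).
  apply: ge0_le_integral => //.
  - by move=> x _; rewrite lee_fin powR_ge0.
  - by apply: measurable_funS mEh.
  - move=> x; rewrite /= in_itv /= => /andP[x0 x1]; rewrite lee_fin.
    have cx : cos 1 <= cos x.
      have [->//|xn] := eqVneq x 1.
      by apply: ltW; rewrite ltr_cos ?in_itv /=; [rewrite lt_neqAle xn|apply/andP; split; lra..].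
    apply: ge0_ler_powR; rewrite ?nnegrE ?(ltW alpha_gt0) ?(ltW c1)//.
    by rewrite (le_trans cx)// ler_norm.
apply: ge0_subset_integral => //; first by apply: measurable_funS mEh.
by move=> x /=; rewrite !in_itv /= => /andP[-> x1] /=; lra.
Qed.

Let circle_E (t1 t2 : R) :
  (\int[@circle_uniform R]_s (`|t1 * s.1 + t2 * s.2| `^ alpha)%:E =
  (2 * pi)^-1%:E * \int[mu]_(x in `[0%R, (2 * pi)%R]) (`|t1 * cos x + t2 * sin x| `^ alpha)%:E)%E.
Proof.
have mg : measurable_fun setT (fun s : measurableTypeR R * measurableTypeR R => `|t1 * s.1 + t2 * s.2| `^ alpha).
  apply: (measurableT_comp (f := fun x : R => x `^ alpha)); first exact: measurable_powR.
  apply: measurableT_comp => //; apply: measurable_funD; apply: measurable_funM => //; exact: measurable_cst.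
rewrite /circle_uniform ge0_integral_distribution//; last first.
  by apply/measurable_EFinP.
rewrite integral_uniform ?subr0//; last by move=> x; rewrite lee_fin powR_ge0.
apply/measurable_EFinP; apply: (measurableT_comp mg); exact: measurable_circle_point.
Qed.

Let polar (t1 t2 : R) : exists2 th, 0 <= th <= 2 * pi &
  forall x, `|t1 * cos x + t2 * sin x| = Num.sqrt (t1 ^+ 2 + t2 ^+ 2) * `|cos (x - th)|.
Proof.
have pp := @pi_gt0 R.
(* [acos] yields only angles with nonnegative sine; changing the sign of both coefficients preserves
   the absolute value and reaches the other half plane. *)
wlog t20 : t1 t2 / 0 <= t2.
  move=> H; have [|t20] := leP 0 t2; first exact: H.
  have [|th th0 thE] := H (- t1) (- t2); first by rewrite oppr_ge0 ltW.
  exists th => // x; move: (thE x); rewrite !sqrrN => <-.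
  by rewrite -normrN; congr (`|_|); ring.
set r := Num.sqrt _.
have s0 : 0 <= t1 ^+ 2 + t2 ^+ 2 by rewrite addr_ge0 ?sqr_ge0.
have r2 : r ^+ 2 = t1 ^+ 2 + t2 ^+ 2 by rewrite sqr_sqrtr.
have [r0|r0] := eqVneq r 0.
  exists 0; first by rewrite lexx mulr_ge0// ltW.
  have /eqP : t1 ^+ 2 + t2 ^+ 2 = 0 by rewrite -r2 r0 expr0n.
  rewrite paddr_eq0 ?sqr_ge0// !sqrf_eq0 => /andP[/eqP -> /eqP ->] x.
  by rewrite r0 !mul0r addr0 normr0.
have rp : 0 < r by rewrite lt_neqAle eq_sym r0 sqrtr_ge0.
have t1r : -1 <= t1 / r <= 1.
  rewrite -ler_norml normrM normfV (gtr0_norm rp) ler_pdivrMr// mul1r.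
  by rewrite -sqrtr_sqr ler_sqrt// lerDl sqr_ge0.
exists (acos (t1 / r)).
  by rewrite acos_ge0//= (le_trans (acos_lepi t1r))//; lra.
move=> x; rewrite cosB acosK ?in_itv// sin_acos//.
have -> : Num.sqrt (1 - (t1 / r) ^+ 2) = t2 / r.
  have -> : 1 - (t1 / r) ^+ 2 = (t2 / r) ^+ 2.
    by rewrite !expr_div_n -[1](@mulfV _ (r ^+ 2)) ?sqrf_eq0// -mulrBl r2; congr (_ / _); ring.
  by rewrite sqrtr_sqr ger0_norm// divr_ge0// ltW.
rewrite -{1}(gtr0_norm rp) -normrM; congr (`|_|).
by field.
Qed.

Let circle_fin (t1 t2 : R) :
  (\int[@circle_uniform R]_s (`|t1 * s.1 + t2 * s.2| `^ alpha)%:E =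
   ((2 * pi)^-1 * (Num.sqrt (t1 ^+ 2 + t2 ^+ 2)) `^ alpha)%:E * \int[mu]_(x in `[0%R, (2 * pi)%R]) (h x)%:E)%E.
Proof.
have [th th02 thE] := polar t1 t2; rewrite circle_E EFinM -muleA; congr (_ * _)%E.
rewrite -(circle_integral_shift th02) -ge0_integralZl//.
- by apply: eq_integral => x _; rewrite -EFinM thE /h powRM ?sqrtr_ge0.
- apply: measurable_funS (measurableT) _ _ => //.
  by apply/measurable_EFinP; apply: (measurableT_comp mh); apply: measurable_shift.
Qed.

Let total : R := fine (\int[mu]_(x in `[0%R, (2 * pi)%R]) (h x)%:E).

Let totalE : (\int[mu]_(x in `[0%R, (2 * pi)%R]) (h x)%:E)%E = total%:E.
Proof.
rewrite fineK// ge0_fin_numE; last by apply: integral_ge0 => x _; exact: Eh.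
apply: (@le_lt_trans _ _ (\int[mu]_(x in `[0%R, (2 * pi)%R]) 1%:E)%E).
  apply: ge0_le_integral => //.
  - by apply: measurable_funS mEh.
  - move=> x _; rewrite lee_fin /h -(congr1 (@^~ alpha) (@powR1 R)).
    by apply: ge0_ler_powR; rewrite ?nnegrE ?(ltW alpha_gt0)// cos_max.
by rewrite integral_cst//= mul1e lebesgue_measure_itv /=; case: ifP => _; rewrite ?ltry// -EFinD ltry.
Qed.

Let circle_constE : circle_const = (2 * pi)^-1 * total.
Proof.
rewrite /circle_const /Rintegral.
have -> : (\int[@circle_uniform R]_s (`|s.1| `^ alpha)%:E =
    \int[@circle_uniform R]_s (`|1 * s.1 + 0 * s.2| `^ alpha)%:E)%E.
  by apply: eq_integral => s _; rewrite mul1r mul0r addr0.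
by rewrite circle_fin totalE expr0n addr0 expr1n sqrtr1 (congr1 (@^~ alpha) (@powR1 R)) mulr1.
Qed.

(** In polar coordinates the linear form is the length of (t1, t2) times cos (x - th), and the
    integral over a period does not depend on th. *)
Lemma circle_isotropic (t1 t2 : R) :
  \int[@circle_uniform R]_s `|t1 * s.1 + t2 * s.2| `^ alpha =
  circle_const * (Num.sqrt (t1 ^+ 2 + t2 ^+ 2)) `^ alpha.
Proof. by rewrite circle_constE /Rintegral circle_fin totalE /= mulrAC. Qed.

Lemma circle_const_gt0 : 0 < circle_const.
Proof.
rewrite circle_constE mulr_gt0 ?invr_gt0 ?mulr_gt0 ?pi_gt0//.
by rewrite -lte_fin -totalE.
Qed.

End Circle.

Section StableMeasure.
Context (R : realType) (k : scalar_kind) (alpha : R) (alpha_gt0 : 0 < alpha).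
Context d (Omega : measurableType d) (P : probability Omega R).
Local Notation K := (scalar_field R k).
Local Notation mu := (@lebesgue_measure R).
Local Notation sor := (@scalar_of_real R k).
Local Notation fms := (@finite_measure_set R _ (measurableTypeR R) mu).

Lemma rnorm_Re (z : K) : `|scalar_Re z| <= rnorm z.
Proof.
rewrite /rnorm; case: (k) z => //= -[x y] /=.
by rewrite -sqrtr_sqr ler_sqrt ?addr_ge0 ?sqr_ge0// lerDl sqr_ge0.
Qed.

Lemma rnorm_Im (z : K) : `|scalar_Im z| <= rnorm z.
Proof.
rewrite /rnorm; case: (k) z => //=; first by move=> z; rewrite normr0 normr_ge0.
by move=> [x y] /=; rewrite -sqrtr_sqr ler_sqrt ?addr_ge0 ?sqr_ge0// lerDr sqr_ge0.
Qed.

Lemma scalar_ReM (y z : K) : scalar_Re (y * z) = scalar_Re y * scalar_Re z - scalar_Im y * scalar_Im z.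
Proof. by case: (k) y z => /= [y z|[a b] [c d0]] //=; rewrite mul0r subr0. Qed.

Lemma measurable_scalar_lipschitz (F : K -> R) : (forall x y, `|F x - F y| <= rnorm (x - y)) ->
  measurable_fun setT (F : borelType K -> R).
Proof.
move=> FL; apply: measurable_lt_const => r; apply: sub_sigma_algebra.
apply/(@open_rnorm R k K^o) => x /= xr; exists (r - F x); first by rewrite subr_gt0.
move=> y yx; have := le_lt_trans (FL y x) yx; rewrite ltr_norml => /andP[_]; lra.
Qed.

Lemma measurable_scalar_Re : measurable_fun setT (@scalar_Re R k : borelType K -> R).
Proof.
apply: measurable_scalar_lipschitz => x y; have := rnorm_Re (x - y).
by rewrite scalar_ReD -mulN1r -scalar_of_real1 -scalar_of_realN scalar_Re_ofM mulN1r.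
Qed.

Lemma measurable_scalar_Im : measurable_fun setT (@scalar_Im R k : borelType K -> R).
Proof.
apply: measurable_scalar_lipschitz => x y; have := rnorm_Im (x - y).
rewrite scalar_ImD; suff -> : scalar_Im (- y) = - scalar_Im y by [].
by case: (k) y => [y|[a b]] //=; rewrite oppr0.
Qed.

Lemma measurable_Re_dual (z : K) : measurable_fun setT ((fun y => scalar_Re (z * y)) : borelType K -> R).
Proof.
under eq_fun do rewrite scalar_ReM.
apply: measurable_funB; apply: measurable_funM; try exact: measurable_cst.
- exact: measurable_scalar_Re.
- exact: measurable_scalar_Im.
Qed.

(** The common form of the real and the complex hypothesis on M. The constant c is 1 for real
    scalars and [circle_const alpha] for complex ones. *)
Definition isotropic_measure (c : R) (M : set (measurableTypeR R) -> Omega -> K) :=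
  forall (I : finType) (A : I -> set (measurableTypeR R)), (forall i, fms (A i)) -> trivIset setT A ->
    isotropic_family alpha P (fun i => M (A i)) (fun i => c * fine (mu (A i))).

Variable M : set (measurableTypeR R) -> Omega -> K.
Hypothesis stM : stable_random_measure P mu alpha M.

Let rmM : random_measure P mu M.
Proof. by move: M stM; case: (k) => M' []. Qed.

Lemma measurable_random_measure (A : set (measurableTypeR R)) : fms A -> measurable_scalar (M A).
Proof.
move=> fA; have [/(_ A fA) mM _ _] := rmM; split.
- exact: (measurableT_comp measurable_scalar_Re mM).
- exact: (measurableT_comp measurable_scalar_Im mM).
Qed.

Let one_set : exists2 c : R, 0 < c & forall A, fms A -> forall z : K,
  Ex P (fun w => cos (scalar_Re (z * M A w))) = expR (- (c * fine (mu A) * rnorm z `^ alpha)) /\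
  Ex P (fun w => sin (scalar_Re (z * M A w))) = 0.
Proof.
clear rmM; move: M stM; rewrite /rnorm; case: (k) => M' [_ cM].
- exists 1 => // A fA z; have [h1 h2] := cM A fA z; split; last exact: h2.
  by rewrite mul1r; exact: h1.
- exists (circle_const alpha); first exact: circle_const_gt0.
  (* Re ((x + i y) w) = x Re w - y Im w, hence the frequencies x and - y. *)
  move=> A fA [x y]; have [h1 h2] := cM A fA x (- y).
  have E w : complex.Re (Complex x y * M' A w) = x * complex.Re (M' A w) + - y * complex.Im (M' A w).
    by case: (M' A w) => a b /=; ring.
  split; last by rewrite -[RHS]h2; apply: eq_Ex => w; congr sin; exact: E.
  transitivity (Ex P (fun w => cos (x * complex.Re (M' A w) + - y * complex.Im (M' A w)))).
    by apply: eq_Ex => w; congr cos; exact: E.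
  rewrite h1; congr (expR (- _)).
  by rewrite circle_isotropic// sqrrN mulrCA mulrA.
Qed.

Lemma stable_isotropic_measure : exists2 c : R, 0 < c & isotropic_measure c M.
Proof.
have [c c0 cM] := one_set; exists c => // I A fA tA; split.
  by move=> i; exact: measurable_random_measure.
move=> z; have [_ indM _] := rmM.
pose A' (j : 'I_#|I|) := A (enum_val j).
have tA' : trivIset setT A'.
  move=> i j _ _ /(tA _ _ Logic.I Logic.I); exact: enum_val_inj.
have ind' := indM _ A' (fun i => fA _) tA'.
pose Z (j : 'I_#|I|) w := scalar_Re (z (enum_val j) * M (A' j) w).
have mA' j : measurable_fun setT (M (A' j) : Omega -> borelType K).
  by have [mM _ _] := rmM; apply: mM; exact: fA.
have mZ j : measurable_fun setT (Z j).
  exact: (measurableT_comp (measurable_Re_dual (z (enum_val j))) (mA' j)).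
have indZ : mutually_independent P Z.
  move=> s B us mB.
  apply: (ind' s (fun j => (fun y => scalar_Re (z (enum_val j) * y)) @^-1` B j)) => // j.
  rewrite -[X in measurable X]setTI; exact: (measurable_Re_dual _ measurableT (mB j)).
have [h1 h2] := @independent_char_fun _ _ _ P _ Z
   (fun j => expR (- (c * fine (mu (A' j)) * rnorm (z (enum_val j)) `^ alpha))) mZ indZ
   (fun j => (cM _ (fA _) _).1) (fun j => (cM _ (fA _) _).2) _ (index_enum_uniq _).
have E w : \sum_i scalar_Re (z i * M (A i) w) = \sum_j Z j w.
  by rewrite (reindex (@enum_val I predT)) //=; apply: onW_bij; exact: enum_val_bij.
split.
- transitivity (Ex P (fun w => cos (\sum_j Z j w))); first by apply: eq_Ex => w; rewrite E.
  rewrite h1 -sumrN expR_sum (reindex (@enum_val I predT)) //=; last by apply: onW_bij; exact: enum_val_bij.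
- transitivity (Ex P (fun w => sin (\sum_j Z j w))); first by apply: eq_Ex => w; rewrite E.
  exact: h2.
Qed.

(** Additivity is postulated for infinite sequences, so finite families are padded with empty sets,
    whose M must vanish. It does, because its characteristic function is that of the constant 0. *)
Lemma random_measure0 : {ae P, forall w, M set0 w = 0}.
Proof.
have [c c0 cM] := stable_isotropic_measure.
have fms0 : fms set0 by split; rewrite ?measure0.
have unitE (i j : unit) : i = j by case: i; case: j.
have fam := cM unit (fun=> set0) (fun=> fms0) (fun i j _ _ _ => unitE i j).
have fam0 : isotropic_family alpha P (fun (_ : unit) w => 0 : K) (fun=> c * fine (mu set0)).
  split.
    move=> _; split; under eq_fun do rewrite -(scalar_of_real0 R k).
      by under eq_fun do rewrite scalar_of_realK; exact: measurable_cst.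
    by under eq_fun do rewrite scalar_Im_of_real; exact: measurable_cst.
  move=> z; have E : \sum_i scalar_Re (z i * 0) = 0 :> R.
    by rewrite big1// => i _; rewrite mulr0 -(scalar_of_real0 R k) scalar_of_realK.
  rewrite E cos0 sin0 !Ex_cst; split => //.
  by rewrite big1 ?oppr0 ?expR0// => i _; rewrite measure0 mulr0 mul0r.
have coord (p : unit * bool) : P [set w | parts (fun=> M set0) p w != 0] = 0%E.
  have mC : measurable ([set f | f p != 0] : set (coordinates R (unit * bool)%type)).
    rewrite -[X in measurable X]setTI.
    apply: (@measurable_coordinate R _ p measurableT [set x | x != 0]).
    have -> : [set x : measurableTypeR R | x != 0] = ~` [set 0].
      by apply/seteqP; split => x /=; [move/eqP|move=> ?; apply/eqP].
    by apply: measurableC; exact: measurable_set1.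
  rewrite (isotropic_law fam fam0 mC) (_ : [set w | _] = set0) ?measure0//.
  apply/seteqP; split => // w; rewrite /parts /=.
  by case: ifP => _; rewrite -(scalar_of_real0 R k) ?scalar_of_realK ?scalar_Im_of_real eqxx.
have nz (p : unit * bool) : {ae P, forall w, parts (fun=> M set0) p w = 0}.
  exists [set w | parts (fun=> M set0) p w != 0]; split => //.
  - have mp : measurable_fun setT (parts (fun=> M set0) p) by exact: (measurable_parts fam.1).
    rewrite -[X in measurable X]setTI.
    have -> : [set w | parts (fun=> M set0) p w != 0] = parts (fun=> M set0) p @^-1` ~` [set 0].
      by apply/seteqP; split => x /=; [move/eqP|move=> ?; apply/eqP].
    by apply: mp => //; apply: measurableC; exact: measurable_set1.
  - by move=> w /= ?; apply/eqP.
apply: filterS2 (nz (tt, false)) (nz (tt, true)) => w; rewrite /parts /= => h1 h2.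
by rewrite [M set0 w]scalar_ReIm h1 h2 scalar_of_real0 mul0r addr0.
Qed.

Lemma rnorm_sqrt (z : K) : rnorm z = Num.sqrt (scalar_Re z ^+ 2 + scalar_Im z ^+ 2).
Proof.
rewrite /rnorm; case: (k) z => [z|[x y]] //=.
by rewrite expr0n addr0 sqrtr_sqr.
Qed.

Lemma measurable_scalar_rnorm (y : Omega -> K) : measurable_scalar y ->
  measurable_fun setT (fun w => rnorm (y w)).
Proof.
move=> [m1 m2]; under eq_fun do rewrite rnorm_sqrt.
apply: (measurableT_comp (f := @Num.sqrt R)).
  by apply: continuous_measurable_fun; exact: sqrt_continuous.
by apply: measurable_funD; under eq_fun do rewrite expr2; exact: measurable_funM.
Qed.

Lemma measurable_scalarD (x y : Omega -> K) : measurable_scalar x -> measurable_scalar y ->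
  measurable_scalar (fun w => x w + y w).
Proof.
move=> [m1 m2] [n1 n2]; split.
- by under eq_fun do rewrite scalar_ReD; exact: measurable_funD.
- by under eq_fun do rewrite scalar_ImD; exact: measurable_funD.
Qed.

Lemma scalar_ImM (y z : K) : scalar_Im (y * z) = scalar_Re y * scalar_Im z + scalar_Im y * scalar_Re z.
Proof. by case: (k) y z => /= [y z|[a b] [c d0]] //=; rewrite mulr0 mul0r addr0. Qed.

Lemma measurable_scalarZ (r : K) (y : Omega -> K) : measurable_scalar y ->
  measurable_scalar (fun w => r * y w).
Proof.
move=> [m1 m2]; split.
- under eq_fun do rewrite scalar_ReM.
  by apply: measurable_funB; apply: measurable_funM => //; exact: measurable_cst.
- under eq_fun do rewrite scalar_ImM.
  by apply: measurable_funD; apply: measurable_funM => //; exact: measurable_cst.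
Qed.

Lemma measurable_scalar0 : measurable_scalar (fun _ : Omega => 0 : K).
Proof.
split; under eq_fun do rewrite -(scalar_of_real0 R k).
  by under eq_fun do rewrite scalar_of_realK; exact: measurable_cst.
by under eq_fun do rewrite scalar_Im_of_real; exact: measurable_cst.
Qed.

Lemma measurable_scalar_sum (I : Type) (s : seq I) (y : I -> Omega -> K) :
  (forall i, measurable_scalar (y i)) -> measurable_scalar (fun w => \sum_(i <- s) y i w).
Proof.
move=> my; elim: s => [|i s IH].
  by under eq_fun do rewrite big_nil; exact: measurable_scalar0.
by under eq_fun do rewrite big_cons; exact: measurable_scalarD.
Qed.

(** Padded with empty sets, the partial sums are almost surely constant from n on, and a constant
    sequence agrees almost surely with its limit in probability. *)
Lemma random_measure_additive (n : nat) (A : 'I_n -> set (measurableTypeR R)) :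
  (forall i, fms (A i)) -> trivIset setT A -> fms (\bigcup_i A i) ->
  {ae P, forall w, M (\bigcup_i A i) w = \sum_(i < n) M (A i) w}.
Proof.
move=> fA tA fU.
have fms0 : fms set0 by split; rewrite ?measure0.
pose A' (i : nat) := if insub i is Some j then A j else set0.
have A'E (j : 'I_n) : A' j = A j by rewrite /A' valK.
have A'0 i : (n <= i)%N -> A' i = set0 by move=> ni; rewrite /A' insubF// ltnNge ni.
have fA' i : fms (A' i) by rewrite /A'; case: insubP.
have tA' : trivIset setT A'.
  move=> i j _ _; rewrite /A'; case: insubP => [i' _ <-|_]; last by rewrite set0I => -[].
  case: insubP => [j' _ <-|_]; last by rewrite setI0 => -[].
  by move=> /(tA _ _ Logic.I Logic.I) ->.
have UE : \bigcup_i A' i = \bigcup_i A i.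
  apply/seteqP; split => x [i _].
    by rewrite /A'; case: insubP => // j _ _ Ax; exists j.
  by move=> Ax; exists i => //; rewrite A'E.
have [_ _ /(_ A' fA' tA')] := rmM; rewrite UE => /(_ fU) cA.
pose D w := \sum_(i < n) M (A i) w - M (\bigcup_i A i) w.
have mD : measurable_scalar D.
  apply: measurable_scalarD; first by apply: measurable_scalar_sum => i; exact: measurable_random_measure.
  under eq_fun do rewrite -mulN1r; apply: measurable_scalarZ; exact: measurable_random_measure.
have mrD := measurable_scalar_rnorm mD.
have D0 (e : R) : 0 < e -> P [set w | e <= rnorm (D w)] = 0%E.
  move=> e0; have [Z [mZ Z0 ZP]] := random_measure0.
  apply/eqP; rewrite eq_le measure_ge0 andbT.
  have mDN N : measurable_fun setT (fun w => rnorm (\sum_(i < N) M (A' i) w - M (\bigcup_i A i) w)).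
    apply: measurable_scalar_rnorm; apply: measurable_scalarD.
      by apply: measurable_scalar_sum => i; exact: measurable_random_measure.
    by under eq_fun do rewrite -mulN1r; apply: measurable_scalarZ; exact: measurable_random_measure.
  rewrite -(cvg_lim _ (cA e e0))//; apply: lime_ge; first exact: cvgP (cA e e0).
  near=> N.
  have nN : (n <= N)%N by near: N; exact: nbhs_infty_ge.
  have mS : measurable [set w | e <= rnorm (\sum_(i < N) M (A' i) w - M (\bigcup_i A i) w)].
    exact: measurable_set_ge.
  apply: (@le_trans _ _ (P ([set w | e <= rnorm (\sum_(i < N) M (A' i) w - M (\bigcup_i A i) w)] `|` Z))).
    apply: le_measure; rewrite ?inE; first exact: measurable_set_ge.
      exact: measurableU.
    move=> w /= eD; have [M0|M0] := pselect (M set0 w = 0); [left|by right; exact: ZP].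
    suff -> : \sum_(i < N) M (A' i) w = \sum_(i < n) M (A i) w by [].
    rewrite -(big_mkord predT (fun i => M (A' i) w)) (@big_cat_nat _ _ _ n)//= big_mkord.
    rewrite [X in _ + X]big_nat_cond [X in _ + X]big1.
      by rewrite addr0; apply: eq_bigr => i _; rewrite A'E.
    by move=> i /andP[/andP[ni _] _]; rewrite A'0.
  apply: (le_trans (measureU2 _ _ _)) => //.
  by rewrite [X in (_ + X)%E]Z0 adde0.
rewrite /prop_near1 /=; apply: (@negligibleS _ _ _ P (\bigcup_m [set w | m.+1%:R^-1 <= rnorm (D w)])).
  move=> w /= DM; have D0' : 0 < rnorm (D w).
    rewrite lt_neqAle rnorm_ge0 andbT eq_sym; apply: contra_notN DM => /eqP /rnorm_eq0 Dw.
    by apply/esym/eqP; rewrite -subr_eq0; apply/eqP.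
  have [m mD'] : exists m : nat, (rnorm (D w))^-1 < m.+1%:R.
    exists (Num.truncn (rnorm (D w))^-1).
    by have /truncn_itv/andP[_] : 0 <= (rnorm (D w))^-1 by rewrite invr_ge0 ltW.
  by exists m => //=; rewrite invf_ple ?posrE// ltW.
apply: negligible_bigcup => m; exists [set w | m.+1%:R^-1 <= rnorm (D w)]; split => //.
  exact: measurable_set_ge.
by apply: D0; rewrite invr_gt0.
Unshelve. all: by end_near. Qed.

End StableMeasure.

(** * Integrals of simple functions *)

Section AlphaNorm.
Context (R : realType) (k : scalar_kind) (E : completeNormedModType (scalar_field R k)).
Local Notation K := (scalar_field R k).
Local Notation mu := (@lebesgue_measure R).
Local Notation J := (measurableTypeR R).
Local Notation mE f := (measurable_fun setT (f : J -> borelType E)).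
Variable a : nat -> E.
Hypothesis aP : forall x (e : R), 0 < e -> exists n, rnorm (x - a n) < e.
Variables (alpha : R) (alpha_gt0 : 0 < alpha).

Definition alpha_mass (f : J -> E) : \bar R := (\int[mu]_t (rnorm (f t) `^ alpha)%:E)%E.

Lemma measurable_rnorm_powR d (T : measurableType d) (X : T -> E) (q : R) :
  measurable_fun setT (X : T -> borelType E) ->
  measurable_fun setT (fun t => (rnorm (X t) `^ q)%:E).
Proof.
move=> mX; apply/measurable_EFinP; apply: (measurableT_comp (f := fun x : R => x `^ q)).
  exact: measurable_powR.
exact: measurable_rnorm.
Qed.

(** From |x + y| <= 2 max(|x|, |y|). The constant is crude but serves alpha below and above 1
    alike. *)
Lemma rnorm_powRD (x y : E) : rnorm (x + y) `^ alpha <= 2 `^ alpha * (rnorm x `^ alpha + rnorm y `^ alpha).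
Proof.
have [xy|yx] := leP (rnorm x) (rnorm y).
- rewrite (@le_trans _ _ ((2 * rnorm y) `^ alpha))//.
    apply: ge0_ler_powR; rewrite ?nnegrE ?mulr_ge0 ?rnorm_ge0 ?(ltW alpha_gt0)//.
    by rewrite (le_trans (rnormD _ _))//; lra.
  by rewrite powRM ?rnorm_ge0// ler_wpM2l ?powR_ge0// lerDr powR_ge0.
- rewrite (@le_trans _ _ ((2 * rnorm x) `^ alpha))//.
    apply: ge0_ler_powR; rewrite ?nnegrE ?mulr_ge0 ?rnorm_ge0 ?(ltW alpha_gt0)//.
    by rewrite (le_trans (rnormD _ _))//; lra.
  by rewrite powRM ?rnorm_ge0// ler_wpM2l ?powR_ge0// lerDl powR_ge0.
Qed.

Lemma alpha_mass_ge0 f : (0 <= alpha_mass f)%E.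
Proof. by apply: integral_ge0 => t _; rewrite lee_fin powR_ge0. Qed.

Lemma alpha_massD (f g : J -> E) (r s : R) : mE f -> mE g -> (alpha_mass f <= r%:E)%E -> (alpha_mass g <= s%:E)%E ->
  (alpha_mass (fun t : J => (f t + g t)%R) <= (2 `^ alpha * (r + s))%:E)%E.
Proof.
move=> mf mg fr gs.
apply: (@le_trans _ _ (\int[mu]_t ((2 `^ alpha)%:E * ((rnorm (f t) `^ alpha)%:E + (rnorm (g t) `^ alpha)%:E)))%E).
  apply: ge0_le_integral => //.
  - by move=> t _; rewrite lee_fin powR_ge0.
  - by apply: measurable_rnorm_powR; apply: (measurable_addE aP).
  - apply: measurable_funeM; apply: emeasurable_funD; exact: measurable_rnorm_powR.
  - by move=> t _; rewrite -EFinD -EFinM lee_fin rnorm_powRD.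
rewrite ge0_integralZl//; last 2 first.
- by apply: emeasurable_funD; exact: measurable_rnorm_powR.
- by move=> t _; rewrite adde_ge0// lee_fin powR_ge0.
- rewrite EFinM lee_wpmul2l ?lee_fin ?powR_ge0// ge0_integralD//; last 4 first.
  + by move=> t _; rewrite lee_fin powR_ge0.
  + exact: measurable_rnorm_powR.
  + by move=> t _; rewrite lee_fin powR_ge0.
  + exact: measurable_rnorm_powR.
  by rewrite EFinD leeD.
Qed.

Lemma alpha_mass_le (f g : J -> E) : mE f -> mE g -> (forall t, rnorm (f t) <= rnorm (g t)) ->
  (alpha_mass f <= alpha_mass g)%E.
Proof.
move=> mf mg fg; apply: ge0_le_integral => //; try exact: measurable_rnorm_powR.
  by move=> t _; rewrite lee_fin powR_ge0.
move=> t _; rewrite lee_fin; apply: ge0_ler_powR; rewrite ?nnegrE ?rnorm_ge0 ?(ltW alpha_gt0)//.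
Qed.

Lemma alpha_mass_shift (f : J -> E) s : mE f -> alpha_mass (fun t => f (t + s)) = alpha_mass f.
Proof.
move=> mf; rewrite /alpha_mass -[RHS](ge0_integral_shift s)//.
- exact: measurable_rnorm_powR.
- by move=> x; rewrite lee_fin powR_ge0.
Qed.

Lemma alpha_mass_scale_le (f g : J -> E) (b r : R) : mE f -> mE g -> 0 <= b ->
  (forall t, rnorm (g t) <= b * rnorm (f t)) -> (alpha_mass f <= r%:E)%E ->
  (alpha_mass g <= (b `^ alpha * r)%:E)%E.
Proof.
move=> mf mg b0 gf fr.
apply: (@le_trans _ _ ((b `^ alpha)%:E * alpha_mass f)%E); last first.
  by rewrite EFinM lee_wpmul2l// lee_fin powR_ge0.
rewrite -ge0_integralZl//; last 3 first.
- exact: measurable_rnorm_powR.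
- by move=> t _; rewrite lee_fin powR_ge0.
- by rewrite lee_fin powR_ge0.
- apply: ge0_le_integral => //; try exact: measurable_rnorm_powR.
  + by move=> t _; rewrite lee_fin powR_ge0.
  + by apply: measurable_funeM; exact: measurable_rnorm_powR.
  + move=> t _; rewrite -EFinM lee_fin -powRM ?rnorm_ge0//.
    by apply: ge0_ler_powR; rewrite ?nnegrE ?mulr_ge0 ?rnorm_ge0 ?(ltW alpha_gt0).
Qed.

End AlphaNorm.

(** * Simple functions with overlapping sets, and their tails *)

Section SimpleData.
Context (R : realType) (k : scalar_kind) (E : completeNormedModType (scalar_field R k)).
Local Notation K := (scalar_field R k).
Local Notation sor := (@scalar_of_real R k).
Local Notation mu := (@lebesgue_measure R).
Local Notation J := (measurableTypeR R).
Local Notation fms := (@finite_measure_set R _ (measurableTypeR R) mu).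

(* Unlike those of simple_function, the sets may overlap: this makes sums immediate. *)
Record simple_data := SimpleData {
  sd_index : finType;
  sd_val : sd_index -> E;
  sd_set : sd_index -> set J;
  sd_fin : forall i, fms (sd_set i) }.

Implicit Types f g : simple_data.

Definition sd_eval f (t : J) : E := ksum (@sd_val f) (fun i => \1_(sd_set i) t).

Definition sd_integral (T : Type) (M : set J -> T -> K) f w : E := ksum (@sd_val f) (fun i => M (sd_set i) w).

Definition sd_of (f : simple_function mu E) : simple_data := SimpleData (@sf_val _ _ _ _ _ _ f) (@sf_fin _ _ _ _ _ _ f).

Definition sd_add f g : simple_data :=
  @SimpleData (sd_index f + sd_index g)%type
    (fun i => match i with inl i => sd_val i | inr i => sd_val i end)
    (fun i => match i with inl i => sd_set i | inr i => sd_set i end)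
    (fun i => match i with inl i => sd_fin i | inr i => sd_fin i end).

Definition sd_map (L : E -> E) f : simple_data := SimpleData (fun i => L (@sd_val f i)) (@sd_fin f).

Lemma sd_eval_add f g t : sd_eval (sd_add f g) t = sd_eval f t + sd_eval g t.
Proof. by rewrite /sd_eval /ksum big_sumType. Qed.

Lemma sd_integral_add T (M : set J -> T -> K) f g w :
  sd_integral M (sd_add f g) w = sd_integral M f w + sd_integral M g w.
Proof. by rewrite /sd_integral /ksum big_sumType. Qed.

Lemma sd_eval_map (L : {linear E -> E}) f t : sd_eval (sd_map L f) t = L (sd_eval f t).
Proof. by rewrite /sd_eval /ksum linear_sum; apply: eq_bigr => i _; rewrite linearZ. Qed.

Lemma sd_integral_map T (M : set J -> T -> K) (L : {linear E -> E}) f w :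
  sd_integral M (sd_map L f) w = L (sd_integral M f w).
Proof. by rewrite /sd_integral /ksum linear_sum; apply: eq_bigr => i _; rewrite linearZ. Qed.

Lemma indic_scalar (A : set J) t : \1_A t = sor (\1_A t) :> K.
Proof. by rewrite !indicE; case: (_ \in _); rewrite ?scalar_of_real0 ?scalar_of_real1. Qed.

Variable a : nat -> E.
Hypothesis aP : forall x (e : R), 0 < e -> exists n, rnorm (x - a n) < e.

Lemma measurable_sd_eval f : measurable_fun setT (sd_eval f : J -> borelType E).
Proof.
apply: (measurable_sumE aP) => i; under eq_fun do rewrite indic_scalar.
by apply: (measurable_scalerE aP); apply: measurable_indic; exact: (sd_fin i).1.
Qed.

Variables (alpha : R) (alpha_gt0 : 0 < alpha).

Section Atoms.
Variable f : simple_data.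
Let I := sd_index f.

(** The law of M is known on disjoint sets only, so f is rewritten over the atoms, that is, the sets
    of points that belong to the same sets of f. *)
Let signature (t : J) : {set I} := [set i | t \in @sd_set f i]%SET.

(** The empty signature is left out: its points form a set of infinite measure, on which [sd_eval f]
    vanishes. *)
Let atom (S : {set I}) : set J := [set t | signature t = S /\ S != finset.set0].

Let atom_val (S : {set I}) : E := \sum_(i in S) @sd_val f i.

Let atom_sub (S : {set I}) (i : I) : i \in S -> atom S `<=` @sd_set f i.
Proof. by move=> iS t [tS _]; move: iS; rewrite -tS inE; exact: set_mem. Qed.

Let measurable_atom S : measurable (atom S).
Proof.
have [->|S0] := eqVneq S finset.set0.
  by rewrite (_ : atom _ = set0) ?measurable0//; apply/seteqP; split => // t [_]; rewrite eqxx.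
have -> : atom S = \bigcap_(i in [set: I]) (if i \in S then @sd_set f i else ~` @sd_set f i).
  apply/seteqP; split => t /=.
    move=> [tS _] i _; case: ifPn => iS; first by apply: (atom_sub iS); split.
    by move=> ti; move: iS; rewrite -tS inE => /negP; apply; apply/mem_set.
  move=> h; split => //; apply/setP => i; rewrite inE.
  by apply/idP/idP; have := h i Logic.I; case: ifP => // _ hi; [move=> /set_mem|move=> _; apply/mem_set].
apply: fin_bigcap_measurable => // i _.
by case: ifP => _; [|apply: measurableC]; exact: (sd_fin i).1.
Qed.

Let fms_atom S : fms (atom S).
Proof.
split; first exact: measurable_atom.
have [->|/set0Pn[i iS]] := eqVneq S finset.set0.
  by rewrite (_ : atom _ = set0) ?measure0//; apply/seteqP; split => // t [_]; rewrite eqxx.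
apply: le_lt_trans (sd_fin i).2; apply: le_measure; rewrite ?inE//.
- exact: (sd_fin i).1.
- exact: atom_sub.
Qed.

Let triv_atom : trivIset setT atom.
Proof. by move=> S S' _ _ [t [[<- _] [<- _]]]. Qed.

Let eval_atom t : sd_eval f t = atom_val (signature t).
Proof.
rewrite /sd_eval /ksum /atom_val [RHS]big_mkcond; apply: eq_bigr => i _.
by rewrite inE indicE; case: (t \in _); rewrite ?scale1r ?scale0r.
Qed.

Let mass_atom : alpha_mass alpha (sd_eval f) = (\sum_S fine (mu (atom S)) * rnorm (atom_val S) `^ alpha)%:E.
Proof.
rewrite /alpha_mass.
transitivity (\int[mu]_t (\sum_S (rnorm (atom_val S) `^ alpha)%:E * (\1_(atom S) t)%:E))%E.
  apply: eq_integral => t _; rewrite eval_atom (bigD1 (signature t))//= big1; last first.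
    move=> S St; rewrite indicE memNset ?mule0//= => -[tS _].
    by move: St; rewrite tS eqxx.
  rewrite adde0; have [->|S0] := eqVneq (signature t) finset.set0.
    by rewrite /atom_val big_set0 rnorm0 powR0 ?mul0e// gt_eqF.
  by rewrite indicE mem_set ?mule1//; split.
rewrite ge0_integral_sum//; last 2 first.
- move=> S; apply: measurable_funeM; apply/measurable_EFinP; apply: measurable_indic.
  exact: measurable_atom.
- by move=> S t _; rewrite mule_ge0// lee_fin ?powR_ge0.
- rewrite -sumEFin; apply: eq_bigr => S _.
  rewrite ge0_integralZl//; last 2 first.
  + by apply/measurable_EFinP; apply: measurable_indic; exact: measurable_atom.
  + by rewrite lee_fin powR_ge0.
  rewrite (integral_indic mu measurableT (measurable_atom S)).
  rewrite setIT EFinM fineK; first by rewrite muleC.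
  by rewrite ge0_fin_numE//; exact: (fms_atom S).2.
Qed.

Context d (T : measurableType d) (P : probability T R) (M : set J -> T -> K).
Hypothesis addM : forall (n : nat) (A : 'I_n -> set J),
  (forall i, fms (A i)) -> trivIset setT A -> fms (\bigcup_i A i) ->
  {ae P, forall w, M (\bigcup_i A i) w = \sum_(i < n) M (A i) w}.

(** The union of an empty family: additivity with n = 0. *)
Let M0 : {ae P, forall w, M set0 w = 0}.
Proof.
have := @addM 0 (fun=> set0); rewrite (_ : \bigcup_i set0 = set0); last exact: bigcup0.
move=> h; have fms0 : fms set0 by split; rewrite ?measure0.
apply: filterS (h (fun=> fms0) _ fms0); first by move=> w ->; rewrite big_ord0.
by move=> [].
Qed.

Let M_atoms i : {ae P, forall w, M (@sd_set f i) w = \sum_(S : {set I} | i \in S) M (atom S) w}.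
Proof.
pose A (j : 'I_#|{set I}|) := if i \in enum_val j then atom (enum_val j) else set0.
have fms0 : fms set0 by split; rewrite ?measure0.
have fA j : fms (A j) by rewrite /A; case: ifP => _; [exact: fms_atom|].
have tA : trivIset setT A.
  move=> j j' _ _; rewrite /A; case: ifP => _; last by rewrite set0I => -[].
  case: ifP => _; last by rewrite setI0 => -[].
  by move=> /(triv_atom Logic.I Logic.I)/enum_val_inj.
have UA : \bigcup_j A j = @sd_set f i.
  apply/seteqP; split => t.
    by move=> [j _]; rewrite /A; case: ifP => // ij; exact: atom_sub.
  move=> ti; have iS : i \in signature t by rewrite inE mem_set.
  exists (enum_rank (signature t)) => //; rewrite /A enum_rankK iS; split => //.
  by apply/set0Pn; exists i.
have := addM fA tA; rewrite UA => /(_ (sd_fin i)).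
apply: filterS2 M0 => w w0 ->; rewrite [RHS]big_mkcond (reindex (@enum_val {set I} predT)) /=; last first.
  by apply: onW_bij; exact: enum_val_bij.
by apply: eq_bigr => j _; rewrite /A; case: ifP.
Qed.

Let integral_atoms : {ae P, forall w, sd_integral M f w = ksum atom_val (fun S => M (atom S) w)}.
Proof.
have : {ae P, forall w, forall i, M (@sd_set f i) w = \sum_(S : {set I} | i \in S) M (atom S) w}.
  by apply: filter_forall => i; exact: M_atoms.
apply: filterS => w h.
rewrite /sd_integral /ksum; under eq_bigr do rewrite h scaler_suml.
rewrite (exchange_big_dep xpredT)//=; apply: eq_bigr => S _.
by rewrite /atom_val scaler_sumr.
Qed.

Variables (c C : R).
Hypotheses (c_ge0 : 0 <= c) (isoM : isotropic_measure alpha P c M).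
Hypothesis tailM : forall (I : finType) d' (T' : measurableType d') (P' : probability T' R)
    (Y : I -> T' -> K) (c : I -> R) (x : I -> E) (t : R),
  isotropic_family alpha P' Y c -> (forall i, 0 <= c i) -> 0 < t ->
  fine (P' [set w | t < rnorm (ksum x (Y ^~ w))]) <= C * (\sum_i c i * rnorm (x i) `^ alpha) / t `^ alpha.

Lemma measurable_scalar_isotropic A : fms A -> measurable_scalar (M A).
Proof.
move=> fA; have t1 : trivIset [set: unit] (fun=> A) by case; case.
by have [/(_ tt)] := isoM (fun=> fA) t1.
Qed.

Lemma measurable_sd_integral : measurable_fun setT (sd_integral M f : T -> borelType E).
Proof.
apply: (@measurable_ksum _ _ _ _ aP _ _ _ _ (fun i => M (@sd_set f i))) => i.
by apply: measurable_scalar_isotropic; exact: sd_fin.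
Qed.

(** Over the atoms the integral is almost surely a combination with disjoint sets, and the sum in
    [tailM] is c times the alpha-mass of f. *)
Lemma sd_integral_tail (r t : R) : (alpha_mass alpha (sd_eval f) <= r%:E)%E -> 0 < t -> 0 <= C ->
  fine (P [set w | t < rnorm (sd_integral M f w)]) <= C * c * r / t `^ alpha.
Proof.
rewrite mass_atom lee_fin => fr t0 C0.
have iso := isoM fms_atom triv_atom.
have m1 : measurable [set w | t < rnorm (sd_integral M f w)].
  by apply: measurable_set_gt; apply: measurable_rnorm; exact: measurable_sd_integral.
have m2 : measurable [set w | t < rnorm (ksum atom_val (fun S => M (atom S) w))].
  apply: measurable_set_gt; apply: (measurable_rnorm (X := fun w => ksum atom_val (fun S => M (atom S) w))).
  apply: (@measurable_ksum _ _ _ _ aP _ _ _ _ (fun S => M (atom S))) => S.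
  by apply: measurable_scalar_isotropic; exact: fms_atom.
have [Z [mZ Z0 ZP]] := integral_atoms.
apply: (@le_trans _ _ (fine (P [set w | t < rnorm (ksum atom_val (fun S => M (atom S) w))]))).
  rewrite -[leRHS]addr0 -[X in _ + X](congr1 fine Z0) (le_trans _ (fine_prob_setU P m2 mZ))//.
  apply: fine_prob_le => //; first exact: measurableU.
  move=> w /= tw; have [h|h] := pselect (sd_integral M f w = ksum atom_val (fun S => M (atom S) w)).
    by left; rewrite -h.
  by right; exact: ZP.
apply: (le_trans (tailM _ iso _ t0)).
  by move=> S; rewrite mulr_ge0// fine_ge0.
rewrite ler_wpM2r ?invr_ge0 ?powR_ge0// -mulrA ler_wpM2l//.
under eq_bigr do rewrite -mulrA; rewrite -mulr_sumr ler_wpM2l//.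
Qed.

End Atoms.
End SimpleData.

(** * Integrals as limits in probability *)

Section StableIntegral.
Context (R : realType) (k : scalar_kind) (E : completeNormedModType (scalar_field R k)).
Local Notation K := (scalar_field R k).
Local Notation sor := (@scalar_of_real R k).
Local Notation mu := (@lebesgue_measure R).
Local Notation J := (measurableTypeR R).
Variable a : nat -> E.
Hypothesis aP : forall x (e : R), 0 < e -> exists n, rnorm (x - a n) < e.
Variables (alpha : R) (alpha_gt0 : 0 < alpha).
Context d (T : measurableType d) (P : probability T R) (M : set J -> T -> K).
Local Notation mE f := (measurable_fun setT (f : _ -> borelType E)).
Local Notation mass f := (alpha_mass alpha (f : J -> E)).
Hypothesis msdM : forall f : simple_data E, mE (sd_integral M f).
Variable C : R.
Hypothesis C_ge0 : 0 <= C.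
Hypothesis simple_tail : forall (f : simple_data E) (r t : R), (mass (sd_eval f) <= r%:E)%E -> 0 < t ->
  fine (P [set w | t < rnorm (sd_integral M f w)]) <= C * r / t `^ alpha.

Lemma prob_rnormD (X Y : T -> E) (s t : R) : mE X -> mE Y ->
  fine (P [set w | s + t < rnorm (X w + Y w)]) <=
  fine (P [set w | s < rnorm (X w)]) + fine (P [set w | t < rnorm (Y w)]).
Proof.
move=> mX mY.
have m1 : measurable [set w | s < rnorm (X w)] by apply: measurable_set_gt; exact: measurable_rnorm.
have m2 : measurable [set w | t < rnorm (Y w)] by apply: measurable_set_gt; exact: measurable_rnorm.
apply: le_trans (fine_prob_setU P m1 m2); apply: fine_prob_le.
- by apply: measurable_set_gt; apply: measurable_rnorm; exact: (measurable_addE aP).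
- exact: measurableU.
- move=> w /= h; have [h1|h1] := ltP s (rnorm (X w)); [by left|right].
  by have := rnormD (X w) (Y w); lra.
Qed.

Lemma prob_rnorm_anti (X : T -> E) (s t : R) : mE X -> s <= t ->
  fine (P [set w | t < rnorm (X w)]) <= fine (P [set w | s < rnorm (X w)]).
Proof.
move=> mX st; apply: fine_prob_le; try by apply: measurable_set_gt; exact: measurable_rnorm.
by move=> w /=; apply: le_lt_trans.
Qed.

(** A working notion of integral: one approximation for each e, close both in mass and in
    probability. It mentions neither sequences nor moments, passes easily through differences and
    linear maps, and is linked to [is_stable_integral] later. *)
Definition stab_int (f : J -> E) (X : T -> E) := [/\ mE f, mE X &
  forall e : R, 0 < e -> exists phi : simple_data E,
    (mass (fun t => sd_eval phi t - f t)%R <= e%:E)%E /\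
    fine (P [set w | e < rnorm (sd_integral M phi w - X w)]) <= e].

Lemma stab_int_simple phi : stab_int (sd_eval phi) (sd_integral M phi).
Proof.
split; [exact: (measurable_sd_eval aP)|exact: msdM|move=> e e0; exists phi; split].
- rewrite (_ : mass _ = 0%E) ?lee_fin ?ltW// /alpha_mass.
  under eq_integral do rewrite subrr rnorm0 powR0 ?gt_eqF//.
  exact: integral0.
- rewrite (_ : [set w | _] = set0) ?measure0 ?ltW//; apply/seteqP; split => // w /=.
  by rewrite subrr rnorm0 ltNge ltW.
Qed.

Let two_a : 0 < 2 `^ alpha :> R. Proof. exact: powR_gt0. Qed.

(** One factor 2^alpha in 4^alpha comes from the quasi-triangle inequality for masses, the other
    from halving the level. The error e' of the approximation is taken so small that it adds at most
    e to the bound. *)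
Lemma stab_int_tail f X (r t : R) : stab_int f X -> (mass f <= r%:E)%E -> 0 < t ->
  fine (P [set w | t < rnorm (X w)]) <= C * 4 `^ alpha * r / t `^ alpha.
Proof.
move=> [mf mX fX] fr t0; apply/ler_addgt0Pr => e e0.
have ta : 0 < t `^ alpha by exact: powR_gt0.
pose q := C * 4 `^ alpha / t `^ alpha.
have q0 : 0 <= q by rewrite divr_ge0 ?mulr_ge0 ?powR_ge0.
pose e' := Num.min (t / 2) (e / (q + 1)).
have e'0 : 0 < e' by rewrite lt_min !divr_gt0// ltr_wpDl.
have e't : e' <= t / 2 by rewrite /e' ge_min lexx.
have e'e : (q + 1) * e' <= e by rewrite mulrC -ler_pdivlMr ?ltr_wpDl// /e' ge_min lexx orbT.
have [phi [p1 p2]] := fX e' e'0.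
have mphi : (mass (sd_eval phi) <= (2 `^ alpha * (e' + r))%:E)%E.
  have -> : sd_eval phi = (fun t => (sd_eval phi t - f t) + f t) by apply/funext => s; rewrite subrK.
  apply: (alpha_massD aP) => //; apply: (measurable_subE aP) => //.
  exact: (measurable_sd_eval aP).
have t2 : 0 < t / 2 by rewrite divr_gt0.
have b1 := simple_tail mphi t2.
have b2 : fine (P [set w | t / 2 < rnorm (X w - sd_integral M phi w)]) <= e'.
  apply: le_trans p2; under eq_set do rewrite rdistC.
  by apply: (@prob_rnorm_anti (fun w => sd_integral M phi w - X w)) => //; apply: (measurable_subE aP).
have -> : [set w | t < rnorm (X w)] =
    [set w | t / 2 + t / 2 < rnorm (sd_integral M phi w + (X w - sd_integral M phi w))].
  by apply/funext => w /=; rewrite [sd_integral M phi w + _]addrC subrK -splitr.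
apply: le_trans (prob_rnormD _ _ _ _) _ => //; first exact: (measurable_subE aP).
apply: (le_trans (lerD b1 b2)).
have -> : C * (2 `^ alpha * (e' + r)) / (t / 2) `^ alpha = q * (e' + r).
  rewrite powRM ?invr_ge0 ?(ltW t0)// (_ : (2^-1) `^ alpha = (2 `^ alpha)^-1); last first.
    by rewrite -powR_inv1// -powRrM mulN1r powRN.
  rewrite /q (_ : 4 = 2 * 2 :> R); last by ring.
  by rewrite powRM//; field; rewrite !gt_eqF.
have -> : C * 4 `^ alpha * r / t `^ alpha = q * r by rewrite /q; ring.
lra.
Qed.

Lemma stab_int_sub f g X Y : stab_int f X -> stab_int g Y ->
  stab_int (fun t => f t - g t) (fun w => X w - Y w).
Proof.
move=> [mf mX fX] [mg mY gY]; split; [exact: (measurable_subE aP)|exact: (measurable_subE aP)|].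
move=> e e0; pose e' := e / (2 * 2 `^ alpha + 2).
have D0 : 0 < 2 * 2 `^ alpha + 2 by rewrite addr_gt0 ?mulr_gt0.
have e'0 : 0 < e' by rewrite divr_gt0.
have eE : e = e' * (2 * 2 `^ alpha + 2) by rewrite divfK// gt_eqF.
have e'2 : 0 < e' * 2 `^ alpha by rewrite mulr_gt0.
have [phi [p1 p2]] := fX e' e'0; have [psi [q1 q2]] := gY e' e'0.
have mphi := measurable_sd_eval aP phi; have mpsi := measurable_sd_eval aP psi.
exists (sd_add phi (sd_map (fun x => - x) psi)); split.
- have -> : (fun t => sd_eval (sd_add phi (sd_map (fun x => - x) psi)) t - (f t - g t)) =
      (fun t => (sd_eval phi t - f t) + (g t - sd_eval psi t)).
    apply/funext => t; rewrite sd_eval_add.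
    have -> : sd_eval (sd_map (fun x => - x) psi) t = - sd_eval psi t.
      by rewrite /sd_eval /ksum /= -sumrN; apply: eq_bigr => i _; rewrite scalerN.
    by rewrite opprB [g t - f t]addrC addrACA [- sd_eval psi t + _]addrC.
  have q1' : (mass (fun t => g t - sd_eval psi t)%R <= e'%:E)%E.
    apply: le_trans q1; rewrite /alpha_mass; under eq_integral do rewrite rdistC.
    exact: lexx.
  apply: le_trans (alpha_massD aP _ _ _ p1 q1') _ => //; try exact: (measurable_subE aP).
  by rewrite lee_fin eE; lra.
- have -> : [set w | e < rnorm (sd_integral M (sd_add phi (sd_map (fun x => - x) psi)) w - (X w - Y w))] =
      [set w | e < rnorm ((sd_integral M phi w - X w) + (Y w - sd_integral M psi w))].
    apply/funext => w /=; rewrite sd_integral_add.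
    have -> : sd_integral M (sd_map (fun x => - x) psi) w = - sd_integral M psi w.
      by rewrite /sd_integral /ksum /= -sumrN; apply: eq_bigr => i _; rewrite scalerN.
    by rewrite opprB [Y w - X w]addrC addrACA [- sd_integral M psi w + _]addrC.
  have q2' : fine (P [set w | e' < rnorm (Y w - sd_integral M psi w)]) <= e'.
    by under eq_set do rewrite rdistC.
  have m1 : mE (fun w => sd_integral M phi w - X w) by exact: (measurable_subE aP).
  have m2 : mE (fun w => Y w - sd_integral M psi w) by exact: (measurable_subE aP).
  apply: (@le_trans _ _ (e' + e')); last by rewrite eE; lra.
  apply: (le_trans _ (lerD p2 q2')); apply: (le_trans _ (prob_rnormD _ _ m1 m2)).
  by apply: (@prob_rnorm_anti (fun w => (sd_integral M phi w - X w) + (Y w - sd_integral M psi w)));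
    [exact: (measurable_addE aP)|rewrite eE; lra].
Qed.

Lemma stab_int_map (L : {linear E -> E}) (b : R) f X : 0 < b -> continuous L ->
  (forall x, rnorm (L x) <= b * rnorm x) ->
  stab_int f X -> stab_int (fun t => L (f t)) (fun w => L (X w)).
Proof.
move=> b0 cL bL [mf mX fX].
have mLf : mE (fun t => L (f t)) by exact: (measurable_contE cL).
have mLX : mE (fun w => L (X w)) by exact: (measurable_contE cL).
split => // e e0; pose e' := Num.min e (Num.min (e / b) (e / b `^ alpha)).
have ba : 0 < b `^ alpha by exact: powR_gt0.
have e'0 : 0 < e' by rewrite !lt_min e0 !divr_gt0.
have [phi [p1 p2]] := fX e' e'0; exists (sd_map L phi).
have mphi := measurable_sd_eval aP phi.
split.
- apply: le_trans (alpha_mass_scale_le alpha_gt0 _ _ (ltW b0) _ p1) _.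
  + exact: (measurable_subE aP).
  + by apply: (measurable_subE aP) => //; exact: (measurable_sd_eval aP).
  + by move=> t; rewrite sd_eval_map -linearB.
  + by rewrite lee_fin mulrC -ler_pdivlMr// /e' !ge_min lexx !orbT.
- apply: le_trans (le_trans p2 _); last by rewrite /e' ge_min lexx.
  apply: fine_prob_le.
  + by apply: measurable_set_gt; apply: measurable_rnorm; exact: (measurable_subE aP).
  + by apply: measurable_set_gt; apply: measurable_rnorm; exact: (measurable_subE aP).
  + move=> w /=; rewrite sd_integral_map -linearB => h.
    have h2 := lt_le_trans h (bL _); rewrite mulrC -ltr_pdivrMr// in h2.
    by apply: le_lt_trans h2; rewrite /e' !ge_min lexx !orbT.
Qed.

Section Existence.
Variable f : J -> E.
Hypothesis mf : mE f.
Variable phi : nat -> simple_data E.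
Let eta n : R := 1 / (2 ^ n.+1)%:R.
(** The mass for which [simple_tail], after the loss in the quasi-triangle inequality, bounds the
    probability of a jump above eta n by eta n. The summand in C + 1 keeps the inverse meaningful
    when C = 0. *)
Let small n : R := ((C + 1) * 2 `^ alpha * 2)^-1 * (eta n `^ alpha * eta n).
Hypothesis phiP : forall n, (mass (fun t => sd_eval (phi n) t - f t)%R <= (small n)%:E)%E.

Let eta_gt0 n : 0 < eta n. Proof. by rewrite divr_gt0// ltr0n expn_gt0. Qed.

Let eta_le n : eta n.+1 <= eta n.
Proof. by rewrite ler_pM2l// lef_pV2 ?posrE ?ltr0n ?expn_gt0// ler_nat leq_pexp2l. Qed.

Let eta_half n : eta n = eta n.+1 + eta n.+1.
Proof. by rewrite /eta [in RHS]expnS natrM; field; rewrite pnatr_eq0 expn_eq0. Qed.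

Let eta_le1 n : eta n <= 1.
Proof. by rewrite ler_pdivrMr ?ltr0n ?expn_gt0// mul1r ler1n expn_gt0. Qed.

Let cst_gt0 : 0 < (C + 1) * 2 `^ alpha * 2.
Proof. by rewrite !mulr_gt0// ltr_wpDl. Qed.

Let small_anti n : small n.+1 <= small n.
Proof.
rewrite ler_pM2l ?invr_gt0//; apply: ler_pM; rewrite ?powR_ge0 ?(ltW (eta_gt0 _))//.
by apply: ge0_ler_powR; rewrite ?nnegrE ?(ltW alpha_gt0) ?(ltW (eta_gt0 _)).
Qed.

Let small_le n : small n <= eta n.
Proof.
rewrite /small mulrA ler_piMl ?(ltW (eta_gt0 _))//.
have h1 : ((C + 1) * 2 `^ alpha * 2)^-1 <= 1.
  rewrite invf_le1//.
  have : 1 <= 2 `^ alpha :> R.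
    by rewrite -[leLHS](powRr0 2); apply: ler_powR; rewrite ?ler1n// ltW.
  have := C_ge0; nra.
have h2 : eta n `^ alpha <= 1.
  rewrite -(congr1 (@^~ alpha) (@powR1 R)).
  by apply: ge0_ler_powR; rewrite ?nnegrE ?(ltW alpha_gt0) ?(ltW (eta_gt0 _)) ?eta_le1.
by rewrite mulr_ile1 ?powR_ge0// invr_ge0 ltW.
Qed.

Let Y n w := sd_integral M (phi n) w.

Let mY n : mE (Y n). Proof. exact: msdM. Qed.

Let jump n := [set w | eta n < rnorm (Y n.+1 w - Y n w)].

Let measurable_jump n : measurable (jump n).
Proof. by apply: measurable_set_gt; apply: measurable_rnorm; exact: (measurable_subE aP). Qed.

Let prob_jump n : (P (jump n) <= (eta n)%:E)%E.
Proof.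
rewrite -(fineK (probability_fin P (measurable_jump n))) lee_fin.
pose psi := sd_add (phi n.+1) (sd_map (fun x => - x) (phi n)).
have mphi m := measurable_sd_eval aP (phi m).
have E1 (t : J) : sd_eval psi t = (sd_eval (phi n.+1) t - f t) + (f t - sd_eval (phi n) t).
  rewrite sd_eval_add addrA subrK; congr (_ + _).
  by rewrite /sd_eval /ksum /= -sumrN; apply: eq_bigr => i _; rewrite scalerN.
have E2 w : sd_integral M psi w = Y n.+1 w - Y n w.
  rewrite sd_integral_add; congr (_ + _).
  by rewrite /Y /sd_integral /ksum /= -sumrN; apply: eq_bigr => i _; rewrite scalerN.
have h1 : (mass (fun t => f t - sd_eval (phi n) t)%R <= (small n)%:E)%E.
  apply: le_trans (phiP n); rewrite /alpha_mass; under eq_integral do rewrite rdistC.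
  exact: lexx.
have h : (mass (sd_eval psi) <= (2 `^ alpha * (small n + small n))%:E)%E.
  have -> : sd_eval psi = (fun t => (sd_eval (phi n.+1) t - f t) + (f t - sd_eval (phi n) t)).
    by apply/funext => t; exact: E1.
  apply: (alpha_massD aP) => //; try exact: (measurable_subE aP).
  by apply: le_trans (phiP n.+1) _; rewrite lee_fin.
have := simple_tail h (eta_gt0 n); under eq_set do rewrite E2.
move=> /le_trans; apply; rewrite ler_pdivrMr ?powR_gt0// /small.
set u := eta n; set v := 2 `^ alpha; set z := u `^ alpha.
have -> : C * (v * (((C + 1) * v * 2)^-1 * (z * u) + ((C + 1) * v * 2)^-1 * (z * u))) = C / (C + 1) * (u * z).
  by field; rewrite !gt_eqF// ltr_wpDl.
rewrite ler_piMl ?mulr_ge0 ?powR_ge0 ?(ltW (eta_gt0 _))//.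
by rewrite ler_pdivrMr ?ltr_wpDl// mul1r lerDl.
Qed.

(** The Borel-Cantelli argument made explicit: off this set the approximations move by at most eta m
    at each step m >= n, and its probability is at most 2 eta n. *)
Let late n := \bigcup_i jump (n + i)%N.

Let measurable_late n : measurable (late n).
Proof. by apply: bigcup_measurable => i _; exact: measurable_jump. Qed.

Let prob_late n : fine (P (late n)) <= eta n + eta n.
Proof.
rewrite -lee_fin fineK ?probability_fin//.
apply: (le_trans (measure_sigma_subadditive P (fun i => measurable_jump (n + i)) (measurable_late n) (fun x => id))).
have E0 : eta n + eta n = ((2 ^ n)%:R)^-1.
  by rewrite /eta expnS natrM; field; rewrite pnatr_eq0 expn_eq0.
rewrite E0; apply: le_trans (epsilon_trick0 xpredT _); last by rewrite invr_ge0.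
apply: lee_nneseries => // i _; apply: (le_trans (prob_jump _)).
by rewrite lee_fin /eta div1r -addnS expnD natrM invfM.
Qed.

(** The bound telescopes because eta m = 2 eta (m + 1), hence 2 eta m - 2 eta (m + 1) = eta m. *)
Let late_cauchy n w m p : ~ late n w -> (n <= m)%N ->
  rnorm (Y (m + p) w - Y m w) <= (eta m + eta m) - (eta (m + p)%N + eta (m + p)%N).
Proof.
move=> nl nm; elim: p => [|p IH]; first by rewrite addn0 !subrr rnorm0.
have h : rnorm (Y (m + p).+1 w - Y (m + p) w) <= eta (m + p).
  rewrite leNgt; apply/negP => h; apply: nl; exists (m - n + p)%N => //.
  by rewrite addnA subnKC.
rewrite addnS; have := rdist_triangle (Y (m + p).+1 w) (Y (m + p) w) (Y m w).
have := eta_half (m + p); lra.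
Qed.

Let eta_small (e : R) : 0 < e -> exists n, forall m, (n <= m)%N -> eta m + eta m < e.
Proof.
move=> e0; exists (Num.truncn e^-1).+1 => m nm.
have E0 : eta m + eta m = ((2 ^ m)%:R)^-1.
  by rewrite /eta expnS natrM; field; rewrite pnatr_eq0 expn_eq0.
rewrite E0 invf_plt ?posrE ?ltr0n ?expn_gt0//.
have /truncn_itv/andP[_ h] : 0 <= e^-1 by rewrite invr_ge0 ltW.
by apply: (lt_le_trans h); rewrite ler_nat (leq_trans nm)// ltnW// ltn_expl.
Qed.

Let late_anti n m : (n <= m)%N -> late m `<=` late n.
Proof.
by move=> nm w [i _ h]; exists (m - n + i)%N => //; rewrite addnA subnKC.
Qed.

Let bad := \bigcap_n late n.

Let limit_ex w : exists l, ~ bad w -> (fun n => rnorm (Y n w - l)) @ \oo --> (0 : R).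
Proof.
have [wb|wb] := pselect (bad w); first by exists 0.
have [n nl] : exists n, ~ late n w by apply/existsNP => h; apply: wb => n _; exact: h.
have [|l hl] := @rnorm_complete _ _ E (fun n => Y n w); last by exists l.
move=> e e0; have [N hN] := eta_small e0.
exists (maxn n N).
have main m p : (maxn n N <= m)%N -> rnorm (Y (m + p) w - Y m w) < e.
  rewrite geq_max => /andP[nm Nm]; apply: le_lt_trans (hN m Nm).
  apply: (le_trans (late_cauchy _ nl nm)).
  by have := eta_gt0 (m + p); lra.
move=> m p hm hp; case/orP: (leq_total m p) => mp.
  by rewrite rdistC -(subnKC mp); exact: main.
by rewrite -(subnKC mp); exact: main.
Qed.

(** On the null set [bad] the value is 0, so that [limit] is a pointwise limit everywhere of
    measurable maps. *)
Let limit w : E := if w \in bad then 0 else projT1 (cid (limit_ex w)).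

Let limit_cvg w : ~ bad w -> (fun n => rnorm (Y n w - limit w)) @ \oo --> (0 : R).
Proof.
move=> wb; rewrite /limit memNset//; exact: (projT2 (cid (limit_ex w)) wb).
Qed.

Let measurable_bad : measurable bad.
Proof. by apply: bigcap_measurable => // n _; exact: measurable_late. Qed.

Let measurable_limit : mE limit.
Proof.
apply: (measurable_limE aP (X := fun n w => if w \in bad then 0 else Y n w)).
  move=> n; apply: measurable_fun_ifT => //; try exact: measurable_cst.
  apply: (measurable_fun_bool true); rewrite setTI.
  rewrite (_ : _ @^-1` _ = bad)//; apply/seteqP; split => w /=; first exact: set_mem.
  exact: mem_set.
move=> w; have [wb|wb] := pselect (bad w).
  by rewrite /limit mem_set//; under eq_fun do rewrite subrr rnorm0; exact: cvg_cst.
by rewrite memNset//; exact: limit_cvg.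
Qed.

Let limit_close n w : ~ late n w -> rnorm (Y n w - limit w) <= eta n + eta n.
Proof.
move=> nl; have wb : ~ bad w by move=> /(_ n Logic.I).
apply/ler_addgt0Pr => e e0; have /cvgrPdist_le/(_ e e0)[N _ hN] := limit_cvg wb.
have := hN (maxn n N) (leq_maxr _ _); rewrite /= sub0r normrN ger0_norm ?rnorm_ge0// => h.
have := late_cauchy (maxn n N - n) nl (leqnn n); rewrite subnKC ?leq_maxl// => h2.
have := rdist_triangle (Y n w) (Y (maxn n N) w) (limit w); rewrite [rnorm (Y n w - Y _ w)]rdistC.
have := eta_gt0 (maxn n N); lra.
Qed.

Lemma stab_int_cvg : exists X, stab_int f X.
Proof.
exists limit; split => // e e0; have [n hn] := eta_small e0; exists (phi n).
have en := hn n (leqnn n); have e1 := eta_gt0 n; split.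
  by apply: (le_trans (phiP n)); rewrite lee_fin (le_trans (small_le n))//; lra.
apply: (@le_trans _ _ (fine (P (late n)))); last by apply: (le_trans (prob_late n)); exact: ltW.
apply: fine_prob_le => //.
  by apply: measurable_set_gt; apply: measurable_rnorm; exact: (measurable_subE aP).
move=> w /= h; apply: contrapT => nl; have := limit_close nl; rewrite /Y; lra.
Qed.

End Existence.

Lemma stab_int_exists f : mE f ->
  (forall e : R, 0 < e -> exists phi : simple_data E, (mass (fun t => sd_eval phi t - f t)%R <= e%:E)%E) ->
  exists X, stab_int f X.
Proof.
move=> mf happ.
pose small n := ((C + 1) * 2 `^ alpha * 2)^-1 * ((1 / (2 ^ n.+1)%:R) `^ alpha * (1 / (2 ^ n.+1)%:R)) : R.
have s0 n : 0 < small n.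
  have h : 0 < 1 / (2 ^ n.+1)%:R :> R by rewrite divr_gt0// ltr0n expn_gt0.
  by rewrite mulr_gt0 ?mulr_gt0 ?powR_gt0// invr_gt0 !mulr_gt0// ltr_wpDl.
have [phi phiP] := choice (fun n => happ _ (s0 n)).
exact: (@stab_int_cvg f mf phi).
Qed.

(** The layer-cake formula over the levels s 2^j; q < alpha makes the ratio 2^(q - alpha) of the
    geometric series smaller than 1. The cut-off s is free: chosen first, it makes s^q small, and a
    small D then makes the other term small. *)
Lemma tail_moment (X : T -> E) (D q s : R) : mE X -> 0 <= D -> 0 < q < alpha -> 0 < s ->
  (forall t, 0 < t -> fine (P [set w | t < rnorm (X w)]) <= D / t `^ alpha) ->
  (\int[P]_w (rnorm (X w) `^ q)%:E <=
   (s `^ q + D * s `^ (q - alpha) * 2 `^ q / (1 - 2 `^ (q - alpha)))%:E)%E.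
Proof.
move=> mX D0 /andP[q0 qa] s0 tX.
pose rho : R := 2 `^ (q - alpha).
have rho0 : 0 < rho by exact: powR_gt0.
have rho1 : rho < 1.
  have l2 : 0 < ln 2 :> R by apply: ln_gt0; rewrite ltr1n.
  have h : (q - alpha) * ln 2 < 0 by rewrite nmulr_rlt0// subr_lt0.
  by rewrite /rho /powR pnatr_eq0 /= -[ltRHS]expR0 ltr_expR.
have p2 j : (2 ^ j)%:R = 2 `^ j%:R :> R by rewrite natrX powR_mulrn.
pose b j : R := (s * (2 ^ j.+1)%:R) `^ q.
have b0 j : 0 <= b j by exact: powR_ge0.
pose S j := [set w | s * (2 ^ j)%:R < rnorm (X w)].
have mS j : measurable (S j) by apply: measurable_set_gt; exact: measurable_rnorm.
have mt j : measurable_fun setT (fun w => (b j * \1_(S j) w)%:E).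
  by apply/measurable_EFinP; apply: measurable_funM; [exact: measurable_cst|exact: measurable_indic].
have t0 j w : (0 <= (b j * \1_(S j) w)%:E)%E by rewrite lee_fin mulr_ge0.
have bP j : b j * fine (P (S j)) <= D * s `^ (q - alpha) * 2 `^ q * rho ^+ j.
  have sj : 0 < s * (2 ^ j)%:R by rewrite mulr_gt0// ltr0n expn_gt0.
  apply: (le_trans (ler_wpM2l (b0 j) (tX _ sj))).
  have -> : b j = 2 `^ q * (s * (2 ^ j)%:R) `^ q.
    by rewrite -powRM ?ler0n ?(ltW sj)// /b expnS natrM mulrCA.
  rewrite /rho -powR_mulrn ?powR_ge0// -powRrM [(q - alpha) * _]mulrC powRrM -p2.
  have -> : D * s `^ (q - alpha) * 2 `^ q * (2 ^ j)%:R `^ (q - alpha) =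
      D * 2 `^ q * (s * (2 ^ j)%:R) `^ (q - alpha) by rewrite powRM ?(ltW s0)//; ring.
  have -> : (s * (2 ^ j)%:R) `^ (q - alpha) = (s * (2 ^ j)%:R) `^ q / (s * (2 ^ j)%:R) `^ alpha.
    by rewrite powRD ?powRN//; apply/implyP => _; rewrite gt_eqF.
  by rewrite le_eqVlt; apply/orP; left; apply/eqP; ring.
pose G := (fun w => (s `^ q)%:E + \sum_(j <oo) (b j * \1_(S j) w)%:E)%E.
have mser : measurable_fun setT (fun w => \sum_(j <oo) (b j * \1_(S j) w)%:E)%E.
  by apply: ge0_emeasurable_sum => // j w _ _.
apply: (@le_trans _ _ (\int[P]_w G w)%E).
  apply: ge0_le_integral => //.
  - by move=> w _; rewrite lee_fin powR_ge0.
  - exact: measurable_rnorm_powR.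
  - by apply: emeasurable_funD => //; exact: measurable_cst.
  - move=> w _; rewrite /G; have [Xs|Xs] := leP (rnorm (X w)) s.
      apply: (@le_trans _ _ (s `^ q)%:E); last by apply: leeDl; exact: nneseries_ge0.
      by rewrite lee_fin; apply: ge0_ler_powR; rewrite ?nnegrE ?rnorm_ge0 ?(ltW s0) ?(ltW q0).
    have ex : exists j, rnorm (X w) <= s * (2 ^ j.+1)%:R.
      exists (Num.truncn (rnorm (X w) / s)); rewrite mulrC -ler_pdivrMr//.
      have /truncn_itv/andP[_ h] : 0 <= rnorm (X w) / s by rewrite divr_ge0 ?rnorm_ge0 ?ltW.
      by apply: (le_trans (ltW h)); rewrite ler_nat ltnW// ltn_expl.
    have [j jX jmin] := ex_minnP ex.
    have Sj : S j w.
      rewrite /S /=; case: j jX jmin => [|j] jX jmin; first by rewrite expn0 mulr1.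
      by rewrite ltNge; apply/negP => /jmin; rewrite ltnn.
    apply: (@le_trans _ _ (\sum_(j <oo) (b j * \1_(S j) w)%:E)%E); last first.
      by apply: leeDr; rewrite lee_fin powR_ge0.
    apply: (@le_trans _ _ (b j * \1_(S j) w)%:E).
      rewrite indicE mem_set// mulr1 lee_fin.
      by apply: ge0_ler_powR; rewrite ?nnegrE ?rnorm_ge0 ?(ltW q0)// mulr_ge0// ltW.
    apply: (le_trans _ (nneseries_lim_ge j.+1 _)) => //.
    by rewrite big_nat_recr//= leeDr// sume_ge0.
rewrite ge0_integralD//; [|by move=> w _; rewrite ?lee_fin ?powR_ge0//; apply: nneseries_ge0..].
have -> : (\int[P]_w (s `^ q)%:E = (s `^ q)%:E)%E.
  rewrite integral_cst//; apply: etrans (congr1 (fun x => ((s `^ q)%:E * x)%E) (probability_setT P)) _.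
  exact: mule1.
rewrite EFinD leeD2l// integral_nneseries//.
apply: lime_le; first by apply: is_cvg_nneseries => j _ _; apply: integral_ge0.
apply: nearW => n.
have -> : (\sum_(0 <= j < n) \int[P]_w (b j * \1_(S j) w)%:E = (\sum_(0 <= j < n) b j * fine (P (S j)))%:E)%E.
  rewrite -sumEFin; apply: eq_bigr => j _; under eq_integral do rewrite EFinM.
  rewrite ge0_integralZl//; last 2 first.
  + by apply/measurable_EFinP; exact: measurable_indic.
  + by rewrite lee_fin.
  by rewrite (integral_indic P measurableT (mS j)) setIT EFinM fineK ?probability_fin.
rewrite lee_fin; apply: (@le_trans _ _ (D * s `^ (q - alpha) * 2 `^ q * \sum_(0 <= j < n) rho ^+ j)).
  by rewrite mulr_sumr; apply: ler_sum => j _; exact: bP.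
rewrite ler_wpM2l ?mulr_ge0 ?powR_ge0//.
have geo : (1 - rho) * \sum_(0 <= j < n) rho ^+ j = 1 - rho ^+ n.
  elim: n => [|n IH]; first by rewrite big_nil mulr0 expr0 subrr.
  by rewrite big_nat_recr//= mulrDr IH exprSr; ring.
by rewrite -[leRHS]mul1r ler_pdivlMr ?subr_gt0// mulrC geo lerBlDr lerDl exprn_ge0// ltW.
Qed.

End StableIntegral.

(** * Existence of the integral *)

Section SimpleApproximation.
Context (R : realType) (k : scalar_kind) (E : completeNormedModType (scalar_field R k)).
Local Notation K := (scalar_field R k).
Local Notation mu := (@lebesgue_measure R).
Local Notation J := (measurableTypeR R).
Variable a : nat -> E.
Hypothesis aP : forall x (e : R), 0 < e -> exists n, rnorm (x - a n) < e.
Variables (alpha : R) (alpha_gt0 : 0 < alpha) (f : J -> E).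
Hypothesis mf : measurable_fun setT (f : J -> borelType E).
Hypothesis ff : (alpha_mass alpha f < +oo)%E.

(** Because 0 heads the list, the nearest candidate is never farther from f t than 0 is. This yields
    the dominating function for convergence in mass. *)
Let b n : E := if n is m.+1 then a m else 0.

Let nearest (n i : nat) : set J := [set t | `|t| <= n%:R /\
  forall j : 'I_n.+1, rnorm (f t - b i) <= rnorm (f t - b j)].

Let measurable_ball0 (n : nat) : measurable [set t : J | `|t| <= n%:R].
Proof. by apply: (@measurable_set_le _ _ _ (fun t : J => `|t|)); exact: normr_measurable. Qed.

Let measurable_nearest n i : measurable (nearest n i).
Proof.
have -> : nearest n i = [set t : J | `|t| <= n%:R] `&`
    \bigcap_(j in [set: 'I_n.+1]) [set t | rnorm (f t - b i) - rnorm (f t - b j) <= 0].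
  apply/seteqP; split => t /= [tn h]; split => //.
    by move=> j _ /=; rewrite subr_le0; exact: h.
  by move=> j; have := h j Logic.I; rewrite /= subr_le0.
apply: measurableI => //; apply: fin_bigcap_measurable => // j _.
apply: measurable_set_le; apply: measurable_funB; exact: (measurable_rnormB (b _) mf).
Qed.

(** Ties between nearest candidates go to the smallest index, which makes the sets disjoint. *)
Let cell n (i : 'I_n.+1) := seqDU (nearest n) i.

Let cell_sub n i : @cell n i `<=` nearest n i.
Proof. exact: subDsetl. Qed.

Let fms_cell n i : finite_measure_set mu (@cell n i).
Proof.
split; first by apply: seqDU_measurable.
apply: (@le_lt_trans _ _ (mu `[(- n%:R)%R, n%:R]%classic)).
  apply: le_measure; rewrite ?inE//.
    by apply: seqDU_measurable.
  by move=> t /cell_sub[+ _]; rewrite /= in_itv /= ler_norml.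
by rewrite lebesgue_measure_itv /=; case: ifP => _; rewrite ?ltry// -EFinD ltry.
Qed.

Let triv_cell n : trivIset setT (@cell n).
Proof. by move=> i j _ _ /(@trivIset_seqDU _ (nearest n) _ _ Logic.I Logic.I) /val_inj. Qed.

Let cell_ex n t : `|t| <= n%:R -> exists i, @cell n i t.
Proof.
move=> tn; pose i0 := [arg min_(i < (ord0 : 'I_n.+1)) rnorm (f t - b i)]%O.
have ni0 : nearest n i0 t.
  by split => // j; rewrite /i0; case: Order.TotalTheory.arg_minP => // i _ /(_ j isT).
have ex : exists i, (i <= n)%N && `[<nearest n i t>] by exists i0; rewrite -ltnS ltn_ord; apply/asboolP.
have [i /andP[ile /asboolP ni] imin] := ex_minnP ex.
exists (Ordinal (ile : (i < n.+1)%N)); split => //=; rewrite -bigcup_mkord => -[j /= ji nj].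
have : (i <= j)%N by apply: imin; rewrite (leq_trans (ltnW ji) ile)/=; apply/asboolP.
by rewrite leqNgt ji.
Qed.

Let approx n : simple_function mu E := SimpleFunction (fun i => b i) (@fms_cell n) (@triv_cell n).

Let eval_cell n i t : @cell n i t -> sf_eval (approx n) t = b i.
Proof.
move=> ti; rewrite /sf_eval (bigD1 i)//= big1 ?addr0; first by rewrite indicE mem_set// scale1r.
move=> j ji; rewrite indicE memNset ?scale0r// => tj.
by move: ji; rewrite (@triv_cell n j i Logic.I Logic.I) ?eqxx//; exists t.
Qed.

Let eval_out n t : n%:R < `|t| -> sf_eval (approx n) t = 0.
Proof.
move=> tn; rewrite /sf_eval big1// => i _; rewrite indicE memNset ?scale0r// => /cell_sub[].
by rewrite leNgt tn.
Qed.

Let approx_close n t (j : 'I_n.+1) : `|t| <= n%:R ->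
  rnorm (sf_eval (approx n) t - f t) <= rnorm (f t - b j).
Proof. by move=> /cell_ex[i ti]; rewrite (eval_cell ti) rdistC; have [_ ] := cell_sub ti. Qed.

Let approx_dom n t : rnorm (sf_eval (approx n) t - f t) <= rnorm (f t).
Proof.
have [tn|tn] := leP `|t| n%:R; last by rewrite eval_out// sub0r rnormN.
by have := approx_close ord0 tn; rewrite /= subr0.
Qed.

Let measurable_approx n : measurable_fun setT (sf_eval (approx n) : J -> borelType E).
Proof. exact: (measurable_sd_eval aP (sd_of (approx n))). Qed.

(** The bound on the supports is recorded for mixing, where far shifts must become disjoint from the
    original sets. *)
Lemma simple_approximation : exists phi : nat -> simple_function mu E,
  (fun n => alpha_mass alpha (fun t : J => (sf_eval (phi n) t - f t)%R)) @ \oo --> 0%E /\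
  forall n j t, @sf_set _ _ _ _ _ _ (phi n) j t -> `|t| <= n%:R.
Proof.
exists approx; split; last by move=> n j t /cell_sub[].
pose F n (t : J) := (rnorm (sf_eval (approx n) t - f t) `^ alpha)%:E.
pose G (t : J) := (rnorm (f t) `^ alpha)%:E.
have mF n : measurable_fun setT (F n).
  by apply: measurable_rnorm_powR; exact: (measurable_subE aP).
have F0 : {ae mu, forall t, setT t -> F ^~ t @ \oo --> 0%E}.
  apply: aeW => t _; apply/fine_cvgP; split; first exact: nearW.
  apply/cvgr0Pnorm_le => e e0.
  pose r := e `^ alpha^-1; have r0 : 0 < r by exact: powR_gt0.
  have [j hj] := aP (f t) r0.
  near=> n; rewrite /= ger0_norm ?powR_ge0//.
  have jn : (j.+1 < n.+1)%N by rewrite ltnS; near: n; exact: nbhs_infty_gt.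
  have tn : `|t| <= n%:R by near: n; exact: nbhs_infty_ger.
  have -> : e = r `^ alpha by rewrite /r -powRrM mulVf ?powRr1 ?gt_eqF// ltW.
  apply: ge0_ler_powR; rewrite ?nnegrE ?rnorm_ge0 ?(ltW r0) ?(ltW alpha_gt0)//.
  by apply: (le_trans (approx_close (Ordinal jn) tn)); rewrite /= ltW.
have iG : mu.-integrable setT G.
  apply/integrableP; split; first exact: measurable_rnorm_powR.
  by under eq_integral do rewrite gee0_abs ?lee_fin ?powR_ge0//.
have FG : {ae mu, forall t n, setT t -> (`|F n t| <= G t)%E}.
  apply: aeW => t n _; rewrite gee0_abs ?lee_fin ?powR_ge0//.
  by apply: ge0_ler_powR; rewrite ?nnegrE ?rnorm_ge0 ?(ltW alpha_gt0).
have [_ _] := dominated_convergence measurableT mF (measurable_cst 0%E) F0 iG FG.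
by rewrite integral0.
Unshelve. all: by end_near. Qed.

End SimpleApproximation.

Lemma ereal_cvg0P (R : realType) (u : nat -> \bar R) : (forall n, (0 <= u n)%E) ->
  u @ \oo --> 0%E <-> forall e : R, 0 < e -> \forall n \near \oo, (u n <= e%:E)%E.
Proof.
move=> u0; split=> [ucvg e e0|h].
  have : nbhs 0%E [set y : \bar R | (y < e%:E)%E].
    by apply: open_nbhs_nbhs; split; [exact: open_ereal_lt_ereal|rewrite /= lte_fin].
  by move=> /ucvg h; near=> n; apply: ltW; near: n; exact: h.
apply/fine_cvgP; split.
  have := h 1 ltr01; apply: filterS => n un.
  by rewrite ge0_fin_numE// (le_lt_trans un)// ltry.
apply/cvgr0Pnorm_le => e e0; have := h e e0; apply: filterS => n un /=.
have fu : u n \is a fin_num by rewrite ge0_fin_numE// (le_lt_trans un)// ltry.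
by rewrite ger0_norm ?fine_ge0// -lee_fin fineK.
Unshelve. all: by end_near. Qed.

Section IntegralExists.
Context (R : realType) (k : scalar_kind) (E : completeNormedModType (scalar_field R k)).
Local Notation K := (scalar_field R k).
Local Notation mu := (@lebesgue_measure R).
Local Notation J := (measurableTypeR R).
Variable a : nat -> E.
Hypothesis aP : forall x (e : R), 0 < e -> exists n, rnorm (x - a n) < e.
Variables (alpha : R) (alpha_gt0 : 0 < alpha).
Context d (T : measurableType d) (P : probability T R) (M : set J -> T -> K).
Local Notation mE f := (measurable_fun setT (f : _ -> borelType E)).
Hypothesis msdM : forall f : simple_data E, mE (sd_integral M f).
Variable C : R.
Hypothesis C_ge0 : 0 <= C.
Hypothesis simple_tail : forall (f : simple_data E) (r t : R), (alpha_mass alpha (sd_eval f) <= r%:E)%E -> 0 < t ->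
  fine (P [set w | t < rnorm (sd_integral M f w)]) <= C * r / t `^ alpha.

(** [stab_int_tail] bounds the tail of the error with a constant proportional to the mass of phi n -
    f, and [tail_moment] turns this into moments. The cut-off s uses one half of e, the small mass
    the other half. *)
Lemma stab_int_is_stable_integral (f : J -> E) (v : {RV P >-> borelType E}) :
  stab_int alpha P M f v -> is_stable_integral mu alpha M f v.
Proof.
move=> fv phi phif q /andP[q0 qa].
have mass_near := (ereal_cvg0P (fun n => alpha_mass_ge0 _ _)).1 phif.
apply/ereal_cvg0P.
  by move=> n; apply: integral_ge0 => w _; rewrite lee_fin powR_ge0.
move=> e e0; pose s := (e / 2) `^ q^-1; have s0 : 0 < s by rewrite powR_gt0// divr_gt0.
pose B := C * 4 `^ alpha * s `^ (q - alpha) * 2 `^ q / (1 - 2 `^ (q - alpha)).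
have rho1 : 2 `^ (q - alpha) < 1 :> R.
  have l2 : 0 < ln 2 :> R by apply: ln_gt0; rewrite ltr1n.
  have h : (q - alpha) * ln 2 < 0 by rewrite nmulr_rlt0// subr_lt0.
  by rewrite /powR pnatr_eq0 /= -[ltRHS]expR0 ltr_expR.
have B0 : 0 <= B by rewrite divr_ge0 ?mulr_ge0 ?powR_ge0// subr_ge0 ltW.
have r0 : 0 < e / 2 / (B + 1) by rewrite !divr_gt0// ltr_wpDl.
have := mass_near _ r0; apply: filterS => n hn.
have st := stab_int_sub aP alpha_gt0 msdM (stab_int_simple aP alpha_gt0 P msdM (sd_of (phi n))) fv.
have [mfn mX _] := st.
have D0 : 0 <= C * 4 `^ alpha * (e / 2 / (B + 1)) by apply: mulr_ge0; [apply: mulr_ge0; rewrite ?powR_ge0|exact: ltW].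
have tl t : 0 < t -> fine (P [set w | t < rnorm (sd_integral M (sd_of (phi n)) w - v w)]) <=
    C * 4 `^ alpha * (e / 2 / (B + 1)) / t `^ alpha.
  by move=> t0; exact: (stab_int_tail aP alpha_gt0 msdM C_ge0 simple_tail st hn t0).
have q1 : 0 < q < alpha by rewrite q0.
have := tail_moment mX D0 q1 s0 tl.
move=> /le_trans; apply.
rewrite lee_fin /s -powRrM mulVf ?gt_eqF// powRr1 ?divr_ge0 ?(ltW e0)//.
have -> : C * 4 `^ alpha * (e / 2 / (B + 1)) * ((e / 2) `^ q^-1) `^ (q - alpha) * 2 `^ q / (1 - 2 `^ (q - alpha)) =
    B * (e / 2 / (B + 1)) by rewrite /B /s; ring.
suff : B * (e / 2 / (B + 1)) <= e / 2 by lra.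
by rewrite mulrA ler_pdivrMr ?ltr_wpDl// mulrC ler_wpM2l ?divr_ge0 ?(ltW e0)// lerDl.
Qed.

(** Markov's inequality with the single exponent q = alpha / 2. *)
Lemma is_stable_integral_stab_int (f : J -> E) (v : {RV P >-> borelType E}) :
  mE f -> (alpha_mass alpha f < +oo)%E -> is_stable_integral mu alpha M f v -> stab_int alpha P M f v.
Proof.
move=> mf ff vf; split; [exact: mf|exact: measurable_funPT|].
move=> e e0; have [phi [phif _]] := simple_approximation aP alpha_gt0 mf ff.
have q0 : 0 < alpha / 2 by rewrite divr_gt0.
have := vf phi phif (alpha / 2); rewrite q0 /= ltr_pdivrMr// ltr_pMr ?ltr1n// => /(_ isT) cq.
have mass_near := (ereal_cvg0P (fun n => alpha_mass_ge0 _ _)).1 phif e e0.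
have eq0 : 0 < e * e `^ (alpha / 2) by rewrite mulr_gt0 ?powR_gt0.
have q_near : \forall n \near \oo, (\int[P]_w (rnorm (sf_integral M (phi n) w - (v w : E)) `^ (alpha / 2))%:E <=
    (e * e `^ (alpha / 2))%:E)%E.
  by apply: (ereal_cvg0P _).1 cq _ eq0 => n; apply: integral_ge0 => w _; rewrite lee_fin powR_ge0.
have [N _ hN] := filterI mass_near q_near; have [h1 h2] := hN N (leqnn N).
exists (sd_of (phi N)); split; first exact: h1.
have mX : mE (fun w => sd_integral M (sd_of (phi N)) w - v w).
  by apply: (measurable_subE aP) => //; exact: (measurable_funPT v).
have mS : measurable [set w | e < rnorm (sd_integral M (sd_of (phi N)) w - v w)].
  by apply: measurable_set_gt; exact: measurable_rnorm.
have ea : 0 < e `^ (alpha / 2) by exact: powR_gt0.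
rewrite -(ler_pM2l ea) [leRHS]mulrC -lee_fin EFinM fineK ?probability_fin//.
apply: le_trans h2; rewrite -[X in (_ * P X)%E]setIT -(integral_indic P measurableT mS) -ge0_integralZl//; last 2 first.
- by apply/measurable_EFinP; exact: measurable_indic.
- by rewrite lee_fin ltW.
apply: ge0_le_integral => //.
- by move=> w _; rewrite mule_ge0// lee_fin ltW.
- by apply: measurable_funeM; apply/measurable_EFinP; exact: measurable_indic.
- exact: measurable_rnorm_powR.
- move=> w _; rewrite indicE; case: (boolP (w \in _)) => [/set_mem /= h|_].
    by rewrite mule1 lee_fin; apply: ge0_ler_powR; rewrite ?nnegrE ?rnorm_ge0 ?(ltW q0) ?(ltW e0)// ltW.
  by rewrite mule0 lee_fin powR_ge0.
Qed.

(** [stable_integral] picks a limit if there is one and is 0 otherwise, so a limit has to be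
    constructed before anything is known about the value. *)
Lemma stable_integral_stab_int (f : J -> E) : mE f -> (alpha_mass alpha f < +oo)%E ->
  stab_int alpha P M f (stable_integral P mu alpha M f).
Proof.
move=> mf ff; apply: is_stable_integral_stab_int => //.
have happ (e : R) : 0 < e -> exists phi : simple_data E, (alpha_mass alpha (fun t : J => (sd_eval phi t - f t)%R) <= e%:E)%E.
  have [phi [phif _]] := simple_approximation aP alpha_gt0 mf ff.
  move=> e0; have [N _ hN] := (ereal_cvg0P (fun n => alpha_mass_ge0 _ _)).1 phif e e0.
  by exists (sd_of (phi N)); exact: (hN N (leqnn N)).
have [X fX] := stab_int_exists aP alpha_gt0 msdM C_ge0 simple_tail mf happ.
rewrite /stable_integral; apply: (@xgetPex _ _ [set v | is_stable_integral mu alpha M f v]).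
have [_ mX _] := fX; exists (mfun_of mX); exact: stab_int_is_stable_integral.
Qed.

End IntegralExists.

(** * Invariance, mixing and stability *)

Section LawTransfer.
Context (R : realType).

Lemma same_law_Ex dD (D : measurableType dD)
    d (T : measurableType d) (P : probability T R) d' (T' : measurableType d') (P' : probability T' R)
    (X : T -> D) (X' : T' -> D) (h : D -> R) :
  measurable_fun setT X -> measurable_fun setT X' -> bounded_measurable h ->
  (forall B, measurable B -> P (X @^-1` B) = P' (X' @^-1` B)) ->
  Ex P (fun w => h (X w)) = Ex P' (fun w => h (X' w)).
Proof.
move=> mX mX' [mh [c hc]] XX'.
have E0 d0 (T0 : measurableType d0) (P0 : probability T0 R) (X0 : T0 -> D) (mX0 : measurable_fun setT X0) :
    (Ex P0 (fun w => h (X0 w)))%:E = (\int[distribution P0 (mfun_of mX0)]_y (h y)%:E)%E.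
  have b0 : bounded_measurable (fun w => h (X0 w)) by apply: bdm_comp => //; exists c.
  rewrite (Ex_EFin P0 b0) integral_distribution//; first exact/measurable_EFinP.
  exact: (bdm_integrable P0 b0).
apply: EFin_inj; rewrite (E0 _ _ _ _ mX) (E0 _ _ _ _ mX').
by apply: eq_measure_integral => B mB _; exact: XX'.
Qed.

(** Both joint laws are the product of the marginals, and these agree. *)
Lemma indep_law d1 (D1 : measurableType d1) d2 (D2 : measurableType d2)
    d (T : measurableType d) (P : probability T R) d' (T' : measurableType d') (P' : probability T' R)
    (X : T -> D1) (Y : T -> D2) (X' : T' -> D1) (Y' : T' -> D2) :
  measurable_fun setT X -> measurable_fun setT Y ->
  measurable_fun setT X' -> measurable_fun setT Y' ->
  (forall B, measurable B -> P (X @^-1` B) = P' (X' @^-1` B)) ->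
  (forall B, measurable B -> P (Y @^-1` B) = P' (Y' @^-1` B)) ->
  (forall B1 B2, measurable B1 -> measurable B2 ->
     P (X @^-1` B1 `&` Y @^-1` B2) = (P (X @^-1` B1) * P (Y @^-1` B2))%E) ->
  (forall B1 B2, measurable B1 -> measurable B2 ->
     P' (X' @^-1` B1 `&` Y' @^-1` B2) = (P' (X' @^-1` B1) * P' (Y' @^-1` B2))%E) ->
  forall C : set (D1 * D2), measurable C -> P [set w | C (X w, Y w)] = P' [set w | C (X' w, Y' w)].
Proof.
move=> mX mY mX' mY' XX' YY' iXY iXY' C mC.
have mXY := measurable_fun_pair mX mY; have mXY' := measurable_fun_pair mX' mY'.
pose m1 := distribution P (mfun_of mX); pose m2 := distribution P (mfun_of mY).
have h1 := @product_measure_unique _ _ _ _ R m1 m2 (distribution P (mfun_of mXY)) _ C mC.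
have h2 := @product_measure_unique _ _ _ _ R m1 m2 (distribution P' (mfun_of mXY')) _ C mC.
transitivity ((m1 \x m2)%E C); last apply: h2; first (symmetry; apply: h1).
- by move=> A B mA mB; exact: iXY.
- move=> A B mA mB; apply: etrans (iXY' A B mA mB) _.
  by rewrite -(XX' A mA) -(YY' B mB).
Qed.

Lemma prod_prob_fst d1 (T1 : measurableType d1) d2 (T2 : measurableType d2)
    (P1 : probability T1 R) (P2 : probability T2 R) (A : set T1) : measurable A ->
  prod_prob P1 P2 [set w | A w.1] = P1 A.
Proof.
move=> mA; rewrite (_ : [set w | A w.1] = [set w | A w.1 /\ setT w.2]).
  rewrite prod_prob_setX//; apply: etrans (congr1 (fun x => (P1 A * x)%E) (probability_setT P2)) _.
  exact: mule1.
by apply/seteqP; split => w //= [].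
Qed.

Lemma prod_prob_snd d1 (T1 : measurableType d1) d2 (T2 : measurableType d2)
    (P1 : probability T1 R) (P2 : probability T2 R) (A : set T2) : measurable A ->
  prod_prob P1 P2 [set w | A w.2] = P2 A.
Proof.
move=> mA; rewrite (_ : [set w | A w.2] = [set w | setT w.1 /\ A w.2]).
  rewrite prod_prob_setX//; apply: etrans (congr1 (fun x => (x * P2 A)%E) (probability_setT P1)) _.
  exact: mul1e.
by apply/seteqP; split => w //= [].
Qed.

End LawTransfer.

(** * Laws under limits in probability *)

Section LimitLaws.
Context (R : realType) (k : scalar_kind) (E : completeNormedModType (scalar_field R k)).
Local Notation mE f := (measurable_fun setT (f : _ -> borelType E)).
Variable a : nat -> E.
Hypothesis aP : forall x (e : R), 0 < e -> exists n, rnorm (x - a n) < e.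

Lemma lipschitz_near d (T : measurableType d) (P : probability T R) (X Y : T -> E) F L (e : R) :
  lipschitz01 L F -> mE X -> mE Y -> 0 < e ->
  fine (P [set w | e < rnorm (Y w - X w)]) <= e ->
  Ex P (fun w => `|F (X w) - F (Y w)|) <= (2 * `|L| + 1) * e.
Proof.
move=> FL mX mY e0 h.
have FL' : lipschitz01 `|L| F.
  have [F01 FL'] := FL; split => // x y; apply: (le_trans (FL' x y)).
  by rewrite ler_wpM2r ?rnorm_ge0// ler_norm.
have mXY : measurable_fun setT (fun w => rnorm (X w - Y w)).
  by apply: measurable_rnorm; exact: (measurable_subE aP).
(* Level 2 e instead of e, because [lipschitz_close] uses a non-strict inequality and the hypothesis
   a strict one. *)
have e2 : 0 <= 2 * e by rewrite mulr_ge0// ltW.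
apply: (le_trans (lipschitz_close P FL' mX mY mXY _ e2)) => //.
suff : fine (P [set w | 2 * e <= rnorm (X w - Y w)]) <= e by lra.
apply: le_trans h; apply: fine_prob_le.
- exact: measurable_set_ge.
- by apply: measurable_set_gt; apply: measurable_rnorm; exact: (measurable_subE aP).
- by move=> w /=; rewrite rdistC; apply: lt_le_trans; lra.
Qed.

Lemma dist_mul01 (x y x' y' : R) : 0 <= x <= 1 -> 0 <= y <= 1 -> 0 <= x' <= 1 -> 0 <= y' <= 1 ->
  `|x * y - x' * y'| <= `|x - x'| + `|y - y'|.
Proof.
move=> /andP[x0 x1] /andP[y0 y1] /andP[x'0 x'1] /andP[y'0 y'1].
have -> : x * y - x' * y' = (x - x') * y + x' * (y - y') by ring.
rewrite (le_trans (ler_normD _ _))// !normrM (ger0_norm y0) (ger0_norm x'0) lerD//.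
  by rewrite ler_piMr.
by rewrite ler_piMl.
Qed.

Lemma normr_ExB d (T : measurableType d) (P : probability T R) (f g : T -> R) :
  bounded_measurable f -> bounded_measurable g -> `|Ex P f - Ex P g| <= Ex P (fun w => `|f w - g w|).
Proof. by move=> bf bg; rewrite -(ExB P bf bg); apply: normr_Ex; exact: bdmB. Qed.

(** The device by which identities in law are reduced to simple functions: they need only hold for
    variables close in probability to the given ones. *)
Lemma limit_law d (T : measurableType d) (P : probability T R)
    d' (T' : measurableType d') (P' : probability T' R) (X : T -> E) (X' : T' -> E) :
  mE X -> mE X' ->
  (forall e : R, 0 < e -> exists Y Y', [/\ mE Y, mE Y', same_distribution P P' Y Y',
     fine (P [set w | e < rnorm (Y w - X w)]) <= e & fine (P' [set w | e < rnorm (Y' w - X' w)]) <= e]) ->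
  same_distribution P P' X X'.
Proof.
move=> mX mX' h; apply: lipschitz_law => // F L FL.
apply/eqP; rewrite -subr_eq0 -normr_le0; apply/ler_addgt0Pr => eps eps0; rewrite add0r.
pose e := eps / (2 * (2 * `|L| + 1)).
have L0 := normr_ge0 L.
have D0 : 0 < 2 * (2 * `|L| + 1) by lra.
have e0 : 0 < e by rewrite divr_gt0.
have [Y [Y' [mY mY' YY' hY hY']]] := h e e0.
have bX := bdm_lipschitz01 FL mX; have bY := bdm_lipschitz01 FL mY.
have bX' := bdm_lipschitz01 FL mX'; have bY' := bdm_lipschitz01 FL mY'.
have E0 : Ex P (fun w => F (Y w)) = Ex P' (fun w => F (Y' w)).
  apply: (same_law_Ex (D := borelType E) (h := F)) => //.
  exact: (@bdm_lipschitz01 _ _ _ _ (borelType E) id F L FL (@measurable_id _ _ _)).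
have h1 := le_trans (normr_ExB P bX bY) (lipschitz_near FL mX mY e0 hY).
have h2 := le_trans (normr_ExB P' bX' bY') (lipschitz_near FL mX' mY' e0 hY').
have eE : (2 * `|L| + 1) * e = eps / 2 by rewrite /e; field; rewrite gt_eqF//; lra.
rewrite eE in h1 h2; move: h1 h2; rewrite E0 !ler_norml => /andP[? ?] /andP[? ?].
by apply/andP; split; lra.
Qed.

End LimitLaws.

Section ProductIsotropic.
Context (R : realType) (k : scalar_kind) (alpha : R).
Local Notation K := (scalar_field R k).

Lemma prod_isotropic (I : finType) d (T : measurableType d) (P : probability T R) (Y : I -> T -> K) (c : I -> R)
    d' (T' : measurableType d') (P' : probability T' R) (Y' : I -> T' -> K) (c' : I -> R) :
  isotropic_family alpha P Y c -> isotropic_family alpha P' Y' c' ->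
  isotropic_family alpha (prod_prob P P') (fun i w => Y i w.1 + Y' i w.2) (fun i => c i + c' i).
Proof.
move=> [mY cY] [mY' cY']; split.
  move=> i; have [m1 m2] := mY i; have [m1' m2'] := mY' i; split.
  - by under eq_fun do rewrite scalar_ReD; apply: measurable_funD;
      [apply: (measurableT_comp m1)|apply: (measurableT_comp m1')].
  - by under eq_fun do rewrite scalar_ImD; apply: measurable_funD;
      [apply: (measurableT_comp m2)|apply: (measurableT_comp m2')].
move=> z; pose U w := \sum_i scalar_Re (z i * Y i w); pose V w := \sum_i scalar_Re (z i * Y' i w).
have mU : measurable_fun setT U.
  by apply: measurable_sum => i; exact: (measurable_scalarZ (z i) (mY i)).1.
have mV : measurable_fun setT V.
  by apply: measurable_sum => i; exact: (measurable_scalarZ (z i) (mY' i)).1.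
have UV (w : T * T') : \sum_i scalar_Re (z i * (Y i w.1 + Y' i w.2)) = U w.1 + V w.2.
  by rewrite -big_split; apply: eq_bigr => i _; rewrite mulrDr scalar_ReD.
have [cU sU] : Ex P (fun w => cos (U w)) = _ /\ Ex P (fun w => sin (U w)) = 0 := cY z.
have [cV sV] : Ex P' (fun w => cos (V w)) = _ /\ Ex P' (fun w => sin (V w)) = 0 := cY' z.
have bcU := bdm_cos mU; have bsU := bdm_sin mU; have bcV := bdm_cos mV; have bsV := bdm_sin mV.
have bprod (f : T -> R) (g : T' -> R) : bounded_measurable f -> bounded_measurable g ->
    bounded_measurable (fun w : T * T' => f w.1 * g w.2).
  move=> [mf [e fe]] [mg [e' ge]]; apply: bdmM.
    by split; [exact: measurableT_comp|exists e => w].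
  by split; [exact: measurableT_comp|exists e' => w].
split.
- transitivity (Ex (prod_prob P P') (fun w => cos (U w.1) * cos (V w.2) - sin (U w.1) * sin (V w.2))).
    by apply: eq_Ex => w; rewrite UV cosD.
  rewrite (ExB _ (bprod _ _ bcU bcV) (bprod _ _ bsU bsV)) (Ex_prod P P' bcU bcV) (Ex_prod P P' bsU bsV).
  rewrite sU cU cV mul0r subr0 -expRD -opprD -big_split; congr (expR (- _)).
  by apply: eq_bigr => i _; rewrite mulrDl.
- transitivity (Ex (prod_prob P P') (fun w => sin (U w.1) * cos (V w.2) + cos (U w.1) * sin (V w.2))).
    by apply: eq_Ex => w; rewrite UV sinD.
  rewrite (ExD _ (bprod _ _ bsU bcV) (bprod _ _ bcU bsV)) (Ex_prod P P' bsU bcV) (Ex_prod P P' bcU bsV).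
  by rewrite sU sV mul0r mulr0 addr0.
Qed.

End ProductIsotropic.

Section StableLaws.
Context (R : realType) (k : scalar_kind) (E : completeNormedModType (scalar_field R k)).
Local Notation K := (scalar_field R k).
Local Notation sor := (@scalar_of_real R k).
Local Notation mu := (@lebesgue_measure R).
Local Notation J := (measurableTypeR R).
Local Notation mE f := (measurable_fun setT (f : _ -> borelType E)).
Local Notation fms := (@finite_measure_set R _ (measurableTypeR R) mu).
Variable a : nat -> E.
Hypothesis aP : forall x (e : R), 0 < e -> exists n, rnorm (x - a n) < e.
Variables (alpha : R) (alpha_gt0 : 0 < alpha).
Context d (T : measurableType d) (P : probability T R) (M : set J -> T -> K).
Hypothesis msdM : forall f : simple_data E, mE (sd_integral M f).
Variable C : R.
Hypothesis C_ge0 : 0 <= C.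
Hypothesis simple_tail : forall (f : simple_data E) (r t : R), (alpha_mass alpha (sd_eval f) <= r%:E)%E -> 0 < t ->
  fine (P [set w | t < rnorm (sd_integral M f w)]) <= C * r / t `^ alpha.
Variable c : R.
Hypotheses (c_gt0 : 0 < c) (isoM : isotropic_measure alpha P c M).
Local Notation mass := (alpha_mass alpha).
Local Notation stab := (stab_int alpha P M).

(** If the error has mass [mesh e], then [stab_int_tail] at level e bounds its probability by e. *)
Definition mesh (e : R) := Num.min e (e * e `^ alpha / (C * 4 `^ alpha + 1)).

Let D_ge0 : 0 <= C * 4 `^ alpha. Proof. by rewrite mulr_ge0 ?powR_ge0. Qed.

Lemma mesh_gt0 e : 0 < e -> 0 < mesh e.
Proof. by move=> e0; rewrite lt_min e0 divr_gt0 ?mulr_gt0 ?powR_gt0// ltr_wpDl. Qed.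

Lemma simple_close (f : J -> E) X (phi : simple_data E) e : stab f X -> 0 < e ->
  (mass (fun t : J => (sd_eval phi t - f t)%R) <= (mesh e)%:E)%E ->
  fine (P [set w | e < rnorm (sd_integral M phi w - X w)]) <= e.
Proof.
move=> fX e0 hphi; have ea : 0 < e `^ alpha by exact: powR_gt0.
have st := stab_int_sub aP alpha_gt0 msdM (stab_int_simple aP alpha_gt0 P msdM phi) fX.
apply: (le_trans (stab_int_tail aP alpha_gt0 msdM C_ge0 simple_tail st hphi e0)).
rewrite ler_pdivrMr//; have : mesh e <= e * e `^ alpha / (C * 4 `^ alpha + 1) by rewrite ge_min lexx orbT.
rewrite ler_pdivlMr ?ltr_wpDl//; have := mesh_gt0 e0; have := D_ge0; nra.
Qed.

Lemma disjoint_approx (f : J -> E) e : mE f -> (mass f < +oo)%E -> 0 < e ->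
  exists (phi : simple_function mu E) (n : nat),
    (forall j t, @sf_set _ _ _ _ _ _ phi j t -> `|t| <= n%:R) /\
    (mass (fun t : J => (sf_eval phi t - f t)%R) <= e%:E)%E.
Proof.
move=> mf ff e0; have [phi [phif bphi]] := simple_approximation aP alpha_gt0 mf ff.
have [N _ hN] := (ereal_cvg0P (fun n => alpha_mass_ge0 _ _)).1 phif e e0.
by exists (phi N), N; split; [exact: bphi|exact: (hN N (leqnn N))].
Qed.

Lemma isotropic_sf (phi : simple_function mu E) :
  isotropic_family alpha P (fun j => M (@sf_set _ _ _ _ _ _ phi j))
    (fun j => c * fine (mu (@sf_set _ _ _ _ _ _ phi j))).
Proof. by apply: isoM; [exact: sf_fin|exact: sf_disj]. Qed.

Let fms_shift s (A : set J) : fms A -> fms ((fun t => t - s) @^-1` A).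
Proof.
move=> [mA fA]; split; last first.
  by apply: le_lt_trans fA; rewrite le_eqVlt; apply/orP; left; apply/eqP; exact: lebesgue_measure_shift.
by rewrite -[X in measurable X]setTI; exact: (measurable_shift (- s) measurableT mA).
Qed.

Definition sf_shift (s : R) (phi : simple_function mu E) : simple_data E :=
  SimpleData (@sf_val _ _ _ _ _ _ phi) (fun j => fms_shift s (@sf_fin _ _ _ _ _ _ phi j)).

(** Shifted sets stay disjoint and keep their measures, and these data determine the law of the
    integral. *)
Lemma sf_shift_law s phi : same_distribution P P (sf_integral M phi) (sd_integral M (sf_shift s phi)).
Proof.
have tS : trivIset setT (@sd_set _ _ _ (sf_shift s phi)).
  by move=> i j _ _ [t [/= ti tj]]; apply: (@sf_disj _ _ _ _ _ _ phi i j Logic.I Logic.I); exists (t - s).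
have h := isoM (@sd_fin _ _ _ (sf_shift s phi)) tS.
have cE : (fun j => c * fine (mu (@sd_set _ _ _ (sf_shift s phi) j))) =
    (fun j => c * fine (mu (@sf_set _ _ _ _ _ _ phi j))).
  apply/funext => j; congr (_ * fine _).
  exact: (lebesgue_measure_shift (- s) (@sf_fin _ _ _ _ _ _ phi j).1).
rewrite cE in h.
exact: (ksum_law aP (@sf_val _ _ _ _ _ _ phi) (isotropic_sf phi) h).
Qed.

Lemma shift_close (f : J -> E) phi s e Xs : mE f -> 0 < e -> stab (fun t => f (t - s)) Xs ->
  (mass (fun t : J => (sf_eval phi t - f t)%R) <= (mesh e)%:E)%E ->
  fine (P [set w | e < rnorm (sd_integral M (sf_shift s phi) w - Xs w)]) <= e.
Proof.
move=> mf e0 fXs hphi; apply: (simple_close fXs e0).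
apply: le_trans hphi.
rewrite -(@alpha_mass_shift _ _ _ alpha (fun t => sf_eval phi t - f t) (- s))//.
by apply: (measurable_subE aP) => //; exact: (measurable_sd_eval aP (sd_of phi)).
Qed.

Lemma shift_law (f : J -> E) X s Xs : (mass f < +oo)%E -> stab f X ->
  stab (fun t => f (t - s)) Xs -> same_distribution P P X Xs.
Proof.
move=> ff fX fXs; have [mf mX _] := fX; have [_ mXs _] := fXs.
apply: (limit_law aP) => // e e0.
have [phi [n [_ hphi]]] := disjoint_approx mf ff (mesh_gt0 e0).
exists (sf_integral M phi), (sd_integral M (sf_shift s phi)); split.
- exact: (msdM (sd_of phi)).
- exact: msdM.
- exact: sf_shift_law.
- exact: (simple_close (phi := sd_of phi) fX e0 hphi).
- exact: (shift_close mf e0 fXs hphi).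
Qed.

(** All sets lie in [-n, n], so after a shift by more than 2 n they are disjoint from the original
    ones, and the two families form one disjoint family. *)
Lemma shift_independent (phi : simple_function mu E) (n : nat) (s : R) :
  (forall j t, @sf_set _ _ _ _ _ _ phi j t -> `|t| <= n%:R) -> 2 * n%:R < s ->
  forall B1 B2 : set (borelType E), measurable B1 -> measurable B2 ->
  P ((sf_integral M phi) @^-1` B1 `&` (sd_integral M (sf_shift s phi)) @^-1` B2) =
  (P ((sf_integral M phi) @^-1` B1) * P ((sd_integral M (sf_shift s phi)) @^-1` B2))%E.
Proof.
move=> bphi ns B1 B2 mB1 mB2.
pose I := 'I_(sf_size phi).
pose A (i : I + I) : set J := match i with
  | inl i => @sf_set _ _ _ _ _ _ phi i | inr i => (fun t => t - s) @^-1` @sf_set _ _ _ _ _ _ phi i end.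
have fA i : fms (A i) by case: i => i; [|apply: fms_shift]; exact: sf_fin.
have far (i j : I) t : @sf_set _ _ _ _ _ _ phi i t -> @sf_set _ _ _ _ _ _ phi j (t - s) -> False.
  by move=> /bphi; rewrite ler_norml => /andP[? ?] /bphi; rewrite ler_norml => /andP[? ?]; lra.
have tA : trivIset setT A.
  move=> [i|i] [j|j] _ _ [t [/= ti tj]].
  - by congr inl; apply: (@sf_disj _ _ _ _ _ _ phi i j Logic.I Logic.I); exists t.
  - by case: (far i j t).
  - by case: (far j i t).
  - by congr inr; apply: (@sf_disj _ _ _ _ _ _ phi i j Logic.I Logic.I); exists (t - s).
have := ksum_independent alpha_gt0 aP (@sf_val _ _ _ _ _ _ phi) (@sf_val _ _ _ _ _ _ phi) (isoM fA tA) mB1 mB2.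
exact.
Qed.

Lemma mixing_lipschitz (f : J -> E) X F G LF LG (eps : R) : (mass f < +oo)%E -> stab f X ->
  lipschitz01 LF F -> lipschitz01 LG G -> 0 < eps ->
  exists S, forall s Xs, S < s -> stab (fun t => f (t - s)) Xs ->
    `|Ex P (fun w => F (X w) * G (Xs w)) - Ex P (fun w => F (X w)) * Ex P (fun w => G (X w))| <= eps.
Proof.
move=> ff fX FL GL eps0; have [mf mX _] := fX.
(* H e = eps / 2 is the cost of replacing the integrals by simple ones in both test functions. It is
   paid twice, in the joint expectation and in the product of expectations. *)
pose H := (2 * `|LF| + 1) + (2 * `|LG| + 1).
have H0 : 0 < H by have := normr_ge0 LF; have := normr_ge0 LG; rewrite /H; lra.
pose e := eps / 2 / H; have e0 : 0 < e by rewrite !divr_gt0.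
have eE : H * e = eps / 2 by rewrite /e mulrC divfK// gt_eqF.
have [phi [n [bphi hphi]]] := disjoint_approx mf ff (mesh_gt0 e0).
exists (2 * n%:R) => s Xs ns fXs; have [_ mXs _] := fXs.
pose Y := sf_integral M phi; pose Ys := sd_integral M (sf_shift s phi).
have mY : mE Y by exact: (msdM (sd_of phi)).
have mYs : mE Ys by exact: msdM.
have XY := simple_close (phi := sd_of phi) fX e0 hphi.
have XsYs := shift_close mf e0 fXs hphi.
have bdF (Z : T -> E) (mZ : mE Z) : bounded_measurable (fun w => F (Z w)) := bdm_lipschitz01 FL mZ.
have bdG (Z : T -> E) (mZ : mE Z) : bounded_measurable (fun w => G (Z w)) := bdm_lipschitz01 GL mZ.
have n01 (Q : E -> R) (LQ : R) (QL : lipschitz01 LQ Q) x : 0 <= Q x <= 1 by have [] := QL.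
have E1 : Ex P (fun w => F (Y w) * G (Ys w)) = Ex P (fun w => F (Y w)) * Ex P (fun w => G (Y w)).
  have mfst : measurable_fun setT (fun w : T * T => Y w.1 : borelType E) by apply: (measurableT_comp mY).
  have msnd : measurable_fun setT (fun w : T * T => Y w.2 : borelType E) by apply: (measurableT_comp mY).
  have mpre (B : set (borelType E)) : measurable B -> measurable (Y @^-1` B).
    by move=> mB; rewrite -[X in measurable X]setTI; exact: mY.
  have law := @indep_law R _ (borelType E) _ (borelType E) _ _ P _ _ (prod_prob P P) Y Ys
    (fun w => Y w.1) (fun w => Y w.2) mY mYs mfst msnd _ _ (shift_independent bphi ns) _.
  have mYY : measurable_fun setT (fun w => (Y w, Ys w) : borelType E * borelType E).
    exact: measurable_fun_pair.
  have mYY' : measurable_fun setT (fun w : T * T => (Y w.1, Y w.2) : borelType E * borelType E).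
    exact: measurable_fun_pair.
  have bh : bounded_measurable (fun p : borelType E * borelType E => F p.1 * G p.2).
    apply: bdmM.
      exact: (@bdm_lipschitz01 _ _ _ _ (borelType E * borelType E)%type fst F _ FL (@measurable_fst _ _ _ _)).
    exact: (@bdm_lipschitz01 _ _ _ _ (borelType E * borelType E)%type snd G _ GL (@measurable_snd _ _ _ _)).
  have -> : Ex P (fun w => F (Y w) * G (Ys w)) = Ex (prod_prob P P) (fun w => F (Y w.1) * G (Y w.2)).
    apply: (same_law_Ex mYY mYY' bh) => B mB; apply: law => //.
    - by move=> B' mB'; rewrite -(prod_prob_fst P P (mpre _ mB')).
    - by move=> B' mB'; rewrite -(sf_shift_law s phi mB') -(prod_prob_snd P P (mpre _ mB')).
    - move=> B1 B2 mB1 mB2.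
      apply: etrans (prod_prob_setX P P (mpre _ mB1) (mpre _ mB2)) _; congr (_ * _)%E.
        exact: esym (prod_prob_fst P P (mpre _ mB1)).
      exact: esym (prod_prob_snd P P (mpre _ mB2)).
  by rewrite (Ex_prod P P (bdF _ mY) (bdG _ mY)).
have Ex01 (Q : E -> R) (LQ : R) (QL : lipschitz01 LQ Q) (Z : T -> E) (mZ : mE Z) : 0 <= Ex P (fun w => Q (Z w)) <= 1.
  have bQ := bdm_lipschitz01 QL mZ; apply/andP; split.
    by rewrite -(Ex_cst P 0); apply: le_Ex => //; [exact: bdm_cst|move=> w; have /andP[] := n01 _ _ QL (Z w)].
  by rewrite -(Ex_cst P 1); apply: le_Ex => //; [exact: bdm_cst|move=> w; have /andP[] := n01 _ _ QL (Z w)].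
have c1 : `|Ex P (fun w => F (X w) * G (Xs w)) - Ex P (fun w => F (Y w) * G (Ys w))| <= H * e.
  have b1 := bdmM (bdF _ mX) (bdG _ mXs); have b2 := bdmM (bdF _ mY) (bdG _ mYs).
  have d1 := bdm_norm (bdmB (bdF _ mX) (bdF _ mY)); have d2 := bdm_norm (bdmB (bdG _ mXs) (bdG _ mYs)).
  apply: (le_trans (normr_ExB P b1 b2)).
  apply: (@le_trans _ _ (Ex P (fun w => `|F (X w) - F (Y w)| + `|G (Xs w) - G (Ys w)|))).
    apply: le_Ex; [by apply: bdm_norm; exact: bdmB|exact: bdmD|].
    by move=> w; apply: dist_mul01; [exact: (n01 _ _ FL)|exact: (n01 _ _ GL)|exact: (n01 _ _ FL)|exact: (n01 _ _ GL)].
  rewrite (ExD P d1 d2) /H mulrDl; apply: lerD.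
    exact: (lipschitz_near aP FL mX mY e0 XY).
  exact: (lipschitz_near aP GL mXs mYs e0 XsYs).
have c2 : `|Ex P (fun w => F (X w)) * Ex P (fun w => G (X w)) -
    Ex P (fun w => F (Y w)) * Ex P (fun w => G (Y w))| <= H * e.
  apply: (le_trans (dist_mul01 (Ex01 _ _ FL _ mX) (Ex01 _ _ GL _ mX) (Ex01 _ _ FL _ mY) (Ex01 _ _ GL _ mY))).
  rewrite /H mulrDl; apply: lerD.
    exact: (le_trans (normr_ExB P (bdF _ mX) (bdF _ mY)) (lipschitz_near aP FL mX mY e0 XY)).
  exact: (le_trans (normr_ExB P (bdG _ mX) (bdG _ mY)) (lipschitz_near aP GL mX mY e0 XY)).
rewrite -E1 distrC in c2; rewrite eE in c1 c2.
have := lerD c1 c2; rewrite -splitr; apply: le_trans.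
by apply: le_trans (ler_normD _ _); rewrite addrA subrK.
Qed.

Let ksumZ (I : finType) (x : I -> E) (z : K) (y : I -> K) : ksum x (fun i => z * y i) = z *: ksum x y.
Proof. by rewrite /ksum scaler_sumr; apply: eq_bigr => i _; rewrite scalerA. Qed.

Let ksumD (I : finType) (x : I -> E) (y y' : I -> K) : ksum x (fun i => y i + y' i) = ksum x y + ksum x y'.
Proof. by rewrite /ksum -big_split; apply: eq_bigr => i _; rewrite scalerDl. Qed.

(** Multiplication by z changes the exponents c m(A) only by the factor |z|^alpha = 1. The scalar -1
    gives the symmetry of v, and general z rotates the support. *)
Lemma rotation_law (f : J -> E) X (z : K) : (mass f < +oo)%E -> stab f X -> rnorm z = 1 ->
  same_distribution P P X (fun w => z *: X w).
Proof.
move=> ff fX z1; have [mf mX _] := fX.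
apply: (limit_law aP) => //; first exact: measurable_scaleE.
move=> e e0; have [phi [n [_ hphi]]] := disjoint_approx mf ff (mesh_gt0 e0).
have mY : mE (sf_integral M phi) by exact: (msdM (sd_of phi)).
have hY := simple_close (phi := sd_of phi) fX e0 hphi.
exists (sf_integral M phi), (fun w => z *: sf_integral M phi w); split => //.
- exact: measurable_scaleE.
- have iso := isotropic_sf phi.
  have iso' := isotropic_scale iso (fun i => measurable_scalarZ z (iso.1 i)).
  have cE : (fun j => c * fine (mu (@sf_set _ _ _ _ _ _ phi j)) * rnorm z `^ alpha) =
      (fun j => c * fine (mu (@sf_set _ _ _ _ _ _ phi j))).
    by apply/funext => j; rewrite z1 (congr1 (@^~ alpha) (@powR1 R)) mulr1.
  rewrite cE in iso'.
  have := ksum_law aP (@sf_val _ _ _ _ _ _ phi) iso iso'.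
  rewrite (_ : (fun w => ksum _ (fun i => z * _)) = (fun w => z *: sf_integral M phi w)) //.
  by apply/funext => w; rewrite ksumZ.
- have -> // : [set w | e < rnorm (z *: sf_integral M phi w - z *: X w)] =
      [set w | e < rnorm (sf_integral M phi w - X w)].
  by apply/funext => w /=; rewrite -scalerBr rnormZ z1 mul1r.
Qed.

Let prod_close (X1 X2 : T -> E) (s1 s2 e : R) : mE X1 -> mE X2 -> 0 <= s1 -> 0 <= s2 -> s1 + s2 <= e ->
  fine (P [set w | s1 < rnorm (X1 w)]) + fine (P [set w | s2 < rnorm (X2 w)]) <= e ->
  fine (prod_prob P P [set w | e < rnorm (X1 w.1 + X2 w.2)]) <= e.
Proof.
move=> m1 m2 s10 s20 s12 h.
have m1' : mE (fun w : T * T => X1 w.1) by apply: (measurableT_comp m1).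
have m2' : mE (fun w : T * T => X2 w.2) by apply: (measurableT_comp m2).
have mS1 : measurable [set w | s1 < rnorm (X1 w)] by apply: measurable_set_gt; exact: measurable_rnorm.
have mS2 : measurable [set w | s2 < rnorm (X2 w)] by apply: measurable_set_gt; exact: measurable_rnorm.
have h1 := prob_rnormD aP (prod_prob P P) s1 s2 m1' m2'.
have mm : mE (fun w : T * T => X1 w.1 + X2 w.2) by exact: (measurable_addE aP).
apply: (le_trans (prob_rnorm_anti (prod_prob P P) mm s12)).
apply: (le_trans h1); apply: le_trans h; apply: lerD.
  by rewrite le_eqVlt; apply/orP; left; apply/eqP; congr fine; exact: (prod_prob_fst P P mS1).
by rewrite le_eqVlt; apply/orP; left; apply/eqP; congr fine; exact: (prod_prob_snd P P mS2).
Qed.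

(** The two independent copies are the coordinates of the product space. Their exponents add up to
    p^alpha + q^alpha, which is the alpha-th power of the scalar on the right. *)
Lemma stability_law (f : J -> E) X (p q : R) : (mass f < +oo)%E -> stab f X -> 0 < p -> 0 < q ->
  same_distribution (prod_prob P P) P (fun w => sor p *: X w.1 + sor q *: X w.2)
    (fun w => sor ((p `^ alpha + q `^ alpha) `^ alpha^-1) *: X w).
Proof.
move=> ff fX p0 q0; have [mf mX _] := fX.
set r := (_ + _) `^ _.
have r0 : 0 < r by rewrite powR_gt0// addr_gt0// powR_gt0.
have ra : r `^ alpha = p `^ alpha + q `^ alpha.
  by rewrite /r -powRrM mulVf ?gt_eqF// powRr1// addr_ge0// powR_ge0.
have mprod (Z : T -> E) : mE Z -> mE (fun w : T * T => sor p *: Z w.1 + sor q *: Z w.2).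
  move=> mZ; apply: (measurable_addE aP); apply: measurable_scaleE.
    by apply: (measurableT_comp mZ).
  by apply: (measurableT_comp mZ).
apply: (limit_law aP); [exact: mprod|exact: measurable_scaleE|move=> e e0].
(* The terms p, q and r pay for the scaling of the error levels, and 2 for the two exceptional
   events, each of probability at most e'. *)
pose e' := e / (p + q + r + 2).
have D0 : 0 < p + q + r + 2 by lra.
have e'0 : 0 < e' by rewrite divr_gt0.
have eE : e = e' * (p + q + r + 2) by rewrite divfK// gt_eqF.
have [phi [n [_ hphi]]] := disjoint_approx mf ff (mesh_gt0 e'0).
pose Y := sf_integral M phi.
have mY : mE Y by exact: (msdM (sd_of phi)).
have hY : fine (P [set w | e' < rnorm (Y w - X w)]) <= e' := simple_close (phi := sd_of phi) fX e'0 hphi.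
have scaled (s : R) : 0 < s -> fine (P [set w | s * e' < rnorm (sor s *: (Y w - X w))]) <= e'.
  move=> s0; apply: le_trans hY; rewrite le_eqVlt; apply/orP; left; apply/eqP; congr (fine (P _)).
  by apply/funext => w /=; rewrite rnormZr gtr0_norm// ltr_pM2l.
have mYX : mE (fun w => Y w - X w) by exact: (measurable_subE aP).
exists (fun w => sor p *: Y w.1 + sor q *: Y w.2), (fun w => sor r *: Y w); split.
- exact: mprod.
- exact: measurable_scaleE.
- have iso := isotropic_sf phi.
  have isoZ s := isotropic_scale iso (fun i => measurable_scalarZ (sor s) (iso.1 i)).
  have iso1 := prod_isotropic (isoZ p) (isoZ q); have iso2 := isoZ r.
  have cE : (fun j => c * fine (mu (@sf_set _ _ _ _ _ _ phi j)) * rnorm (sor p : K) `^ alpha +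
      c * fine (mu (@sf_set _ _ _ _ _ _ phi j)) * rnorm (sor q : K) `^ alpha) =
      (fun j => c * fine (mu (@sf_set _ _ _ _ _ _ phi j)) * rnorm (sor r : K) `^ alpha).
    by apply/funext => j; rewrite !rnorm_of_real !gtr0_norm// ra mulrDr.
  rewrite cE in iso1.
  have := ksum_law aP (@sf_val _ _ _ _ _ _ phi) iso1 iso2.
  have -> : (fun w => ksum (@sf_val _ _ _ _ _ _ phi) (fun i => sor r * M (@sf_set _ _ _ _ _ _ phi i) w)) =
      (fun w => sor r *: Y w) by apply/funext => w; rewrite ksumZ.
  have -> // : (fun w : T * T => ksum (@sf_val _ _ _ _ _ _ phi) (fun i => sor p * M (@sf_set _ _ _ _ _ _ phi i) w.1 +
      sor q * M (@sf_set _ _ _ _ _ _ phi i) w.2)) = (fun w => sor p *: Y w.1 + sor q *: Y w.2).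
  by apply/funext => w; rewrite ksumD !ksumZ.
- have -> : [set w : T * T | e < rnorm (sor p *: Y w.1 + sor q *: Y w.2 - (sor p *: X w.1 + sor q *: X w.2))] =
      [set w | e < rnorm (sor p *: (Y w.1 - X w.1) + sor q *: (Y w.2 - X w.2))].
    by apply/funext => w /=; rewrite !scalerBr opprD addrACA.
  apply: (@prod_close (fun w => sor p *: (Y w - X w)) (fun w => sor q *: (Y w - X w)) (p * e') (q * e')).
  + exact: measurable_scaleE.
  + exact: measurable_scaleE.
  + by rewrite mulr_ge0// ltW.
  + by rewrite mulr_ge0// ltW.
  + by rewrite eE; nra.
  + by apply: (le_trans (lerD (scaled _ p0) (scaled _ q0))); rewrite eE; nra.
- have -> : [set w | e < rnorm (sor r *: Y w - sor r *: X w)] = [set w | e < rnorm (sor r *: (Y w - X w))].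
    by apply/funext => w /=; rewrite scalerBr.
  apply: (@le_trans _ _ e'); last by rewrite eE; nra.
  apply: le_trans (scaled _ r0); apply: prob_rnorm_anti; first exact: measurable_scaleE.
  by rewrite eE; nra.
Qed.

Definition restrict_fun (B : set J) (f : J -> E) (t : J) : E := (\1_B t : K) *: f t.

Let fms_restrict (B A : set J) : measurable B -> fms A -> fms (A `&` B).
Proof.
move=> mB [mA fA]; split; first exact: measurableI.
by apply: le_lt_trans fA; apply: le_measure; rewrite ?inE//; exact: measurableI.
Qed.

Definition sf_restrict (B : set J) (mB : measurable B) (phi : simple_function mu E) : simple_data E :=
  SimpleData (@sf_val _ _ _ _ _ _ phi) (fun j => fms_restrict mB (@sf_fin _ _ _ _ _ _ phi j)).

Lemma sf_restrict_eval B (mB : measurable B) phi t :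
  sd_eval (sf_restrict mB phi) t = restrict_fun B (sf_eval phi) t.
Proof.
rewrite /sd_eval /ksum /restrict_fun /sf_eval scaler_sumr; apply: eq_bigr => j _ /=.
rewrite scalerA; congr (_ *: _); rewrite !indicE in_setI.
by case: (t \in B); case: (t \in _); rewrite /= ?mulr1 ?mulr0.
Qed.

Lemma measurable_restrict_fun (B : set J) (f : J -> E) : measurable B -> mE f -> mE (restrict_fun B f).
Proof.
move=> mB mf; have -> : restrict_fun B f = (fun t => if t \in B then f t else 0).
  by apply/funext => t; rewrite /restrict_fun indicE; case: (_ \in _); rewrite ?scale1r ?scale0r.
apply: measurable_fun_ifT => //; try exact: measurable_cst.
apply: (measurable_fun_bool true); rewrite setTI (_ : _ @^-1` _ = B)//.
by apply/seteqP; split => w /=; [exact: set_mem|exact: mem_set].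
Qed.

Lemma restrict_fun_le (B : set J) (f : J -> E) t : rnorm (restrict_fun B f t) <= rnorm (f t).
Proof.
by rewrite /restrict_fun indicE; case: (_ \in _); rewrite ?scale1r// scale0r rnorm0 rnorm_ge0.
Qed.

Lemma restrict_close (f : J -> E) B (mB : measurable B) phi X e : mE f -> stab (restrict_fun B f) X -> 0 < e ->
  (mass (fun t : J => (sf_eval phi t - f t)%R) <= (mesh e)%:E)%E ->
  fine (P [set w | e < rnorm (sd_integral M (sf_restrict mB phi) w - X w)]) <= e.
Proof.
move=> mf fX e0 hphi; have [mfB _ _] := fX; apply: (simple_close fX e0); apply: le_trans hphi.
apply: (alpha_mass_le alpha_gt0).
- by apply: (measurable_subE aP) => //; exact: (measurable_sd_eval aP).
- by apply: (measurable_subE aP) => //; exact: (measurable_sd_eval aP (sd_of phi)).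
- move=> t; rewrite sf_restrict_eval (_ : _ - _ = restrict_fun B (fun t => sf_eval phi t - f t) t).
    exact: restrict_fun_le.
  by rewrite /restrict_fun scalerBr.
Qed.

(** Each set of a simple function is cut by B into two parts whose measures add up, so M of the set
    has the law of the sum of M of the parts taken on independent factors. *)
Lemma split_law (f : J -> E) (B : set J) X Y Z : measurable B -> (mass f < +oo)%E -> stab f X ->
  stab (restrict_fun B f) Y -> stab (restrict_fun (~` B) f) Z ->
  same_distribution P (prod_prob P P) X (fun w => Y w.1 + Z w.2).
Proof.
move=> mB ff fX fY fZ; have mB' : measurable (~` B) by exact: measurableC.
have [mf mX _] := fX; have [_ mY _] := fY; have [_ mZ _] := fZ.
have mprod (Y' Z' : T -> E) : mE Y' -> mE Z' -> mE (fun w : T * T => Y' w.1 + Z' w.2).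
  move=> m1 m2; apply: (measurable_addE aP).
    by apply: (measurableT_comp m1).
  by apply: (measurableT_comp m2).
apply: (limit_law aP); [exact: mX|exact: mprod|move=> e e0].
have e20 : 0 < e / 2 by rewrite divr_gt0.
have m0 : 0 < Num.min (mesh e) (mesh (e / 2)) by rewrite lt_min !mesh_gt0.
have [phi [n [_ hphi]]] := disjoint_approx mf ff m0.
have h1 : (mass (fun t : J => (sf_eval phi t - f t)%R) <= (mesh e)%:E)%E.
  by apply: (le_trans hphi); rewrite lee_fin ge_min lexx.
have h2 : (mass (fun t : J => (sf_eval phi t - f t)%R) <= (mesh (e / 2))%:E)%E.
  by apply: (le_trans hphi); rewrite lee_fin ge_min lexx orbT.
pose Y1 := sd_integral M (sf_restrict mB phi); pose Z1 := sd_integral M (sf_restrict mB' phi).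
exists (sf_integral M phi), (fun w => Y1 w.1 + Z1 w.2); split.
- exact: (msdM (sd_of phi)).
- by apply: mprod; exact: msdM.
- have trivB (B0 : set J) : trivIset setT (fun j => @sf_set _ _ _ _ _ _ phi j `&` B0).
    by move=> i j _ _ [t [[ti _] [tj _]]]; apply: (@sf_disj _ _ _ _ _ _ phi i j Logic.I Logic.I); exists t.
  have iso := isotropic_sf phi.
  have iso1 := isoM (fun j => fms_restrict mB (@sf_fin _ _ _ _ _ _ phi j)) (trivB B).
  have iso2 := isoM (fun j => fms_restrict mB' (@sf_fin _ _ _ _ _ _ phi j)) (trivB (~` B)).
  have iso3 := prod_isotropic iso1 iso2.
  have cE : (fun j => c * fine (mu (@sf_set _ _ _ _ _ _ phi j `&` B)) +
       c * fine (mu (@sf_set _ _ _ _ _ _ phi j `&` ~` B))) =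
      (fun j => c * fine (mu (@sf_set _ _ _ _ _ _ phi j))).
    apply/funext => j; rewrite -mulrDr; congr (_ * _).
    have [mA fA] := @sf_fin _ _ _ _ _ _ phi j.
    have [mAB fAB] := fms_restrict mB (@sf_fin _ _ _ _ _ _ phi j).
    have [mAB' fAB'] := fms_restrict mB' (@sf_fin _ _ _ _ _ _ phi j).
    rewrite -fineD ?ge0_fin_numE//; congr fine.
    rewrite -measureU//; first by rewrite -setIUr setUv setIT.
    by rewrite setIACA setICr setI0.
  rewrite cE in iso3.
  have := ksum_law aP (@sf_val _ _ _ _ _ _ phi) iso iso3.
  have -> // : (fun w : T * T => ksum (@sf_val _ _ _ _ _ _ phi) (fun i => M (@sf_set _ _ _ _ _ _ phi i `&` B) w.1 +
      M (@sf_set _ _ _ _ _ _ phi i `&` ~` B) w.2)) = (fun w => Y1 w.1 + Z1 w.2).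
  by apply/funext => w; rewrite ksumD.
- exact: (simple_close (phi := sd_of phi) fX e0 h1).
- have -> : [set w : T * T | e < rnorm (Y1 w.1 + Z1 w.2 - (Y w.1 + Z w.2))] =
      [set w | e < rnorm ((Y1 w.1 - Y w.1) + (Z1 w.2 - Z w.2))].
    by apply/funext => w /=; rewrite opprD addrACA.
  apply: (@prod_close (fun w => Y1 w - Y w) (fun w => Z1 w - Z w) (e / 2) (e / 2)).
  + by apply: (measurable_subE aP) => //; exact: msdM.
  + by apply: (measurable_subE aP) => //; exact: msdM.
  + exact: ltW.
  + exact: ltW.
  + by rewrite -splitr.
  + have c1 := @restrict_close f B mB phi Y (e / 2) mf fY e20 h2.
    have c2 := @restrict_close f (~` B) mB' phi Z (e / 2) mf fZ e20 h2.
    by rewrite [leRHS]splitr; exact: (lerD c1 c2).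
Qed.

End StableLaws.

(** * Tails of stable variables *)

Section NullBalls.
Context (R : realType) (k : scalar_kind) (E : completeNormedModType (scalar_field R k)).
Variable a : nat -> E.
Hypothesis aP : forall x (e : R), 0 < e -> exists n, rnorm (x - a n) < e.
Context d (T : measurableType d) (m : {measure set T -> \bar R}) (X : T -> E).
Hypothesis mX : measurable_fun setT (X : T -> borelType E).

Let ballX n j := [set w | rnorm (X w - a n) < j.+1%:R^-1].

(** Off this set every ball around X w has positive measure. It is null because the dense sequence
    and the radii 1/(j+1) make the union countable. It serves for random vectors, to find points of
    their support, and for u under Lebesgue measure, to find its essential values. *)
Definition null_balls := \bigcup_n \bigcup_j [set w | m (ballX n j) = 0%E /\ ballX n j w].

Let measurable_ballX n j : measurable (ballX n j).
Proof. by apply: measurable_set_lt; exact: (measurable_rnormB _ mX). Qed.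

Let pieceE n j : [set w | m (ballX n j) = 0%E /\ ballX n j w] = ballX n j /\ m (ballX n j) = 0%E \/
  [set w | m (ballX n j) = 0%E /\ ballX n j w] = set0.
Proof.
have [h|h] := pselect (m (ballX n j) = 0%E); [left|right].
  by split => //; apply/seteqP; split => w // [].
by apply/seteqP; split => w // [].
Qed.

Lemma measurable_null_balls : measurable null_balls.
Proof.
apply: bigcup_measurable => n _; apply: bigcup_measurable => j _.
by case: (pieceE n j) => [[-> _]|->].
Qed.

Lemma null_balls_null : m null_balls = 0%E.
Proof.
apply: (measure_negligible measurable_null_balls).
apply: negligible_bigcup => n; apply: negligible_bigcup => j.
case: (pieceE n j) => [[-> h]|->]; last exact: negligible_set0.
by exists (ballX n j); split.
Qed.

Lemma notin_null_balls w (e : R) : ~ null_balls w -> 0 < e ->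
  (0 < m [set w' | (rnorm (X w' - X w) < e)%R])%E.
Proof.
move=> wN e0; rewrite lt_neqAle measure_ge0 andbT eq_sym; apply/eqP => h.
pose j := Num.truncn (2 / e).
have j2 : j.+1%:R^-1 < e / 2.
  rewrite invf_plt ?posrE ?divr_gt0// invf_div.
  by have /truncn_itv/andP[_] : 0 <= 2 / e by rewrite divr_ge0 ?ltW.
have [n hn] : exists n, rnorm (X w - a n) < j.+1%:R^-1 by apply: aP; rewrite invr_gt0.
apply: wN; exists n => //; exists j => //; split => //.
apply/eqP; rewrite -measure_le0 -h; apply: le_measure; rewrite ?inE//.
  by apply: measurable_set_lt; exact: (measurable_rnormB _ mX).
move=> w'; rewrite /ballX /= => hw'; apply: (le_lt_trans (rdist_triangle (X w') (a n) (X w))).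
by rewrite [e]splitr ltrD// ?(lt_trans hw')// rdistC (lt_trans hn).
Qed.

End NullBalls.

Section TailsFromBelow.
Context (R : realType).

Lemma normr_sin_le (x : R) : `|sin x| <= `|x|.
Proof.
wlog x0 : x / 0 < x.
  move=> H; have [x0|x0|<-] := ltgtP 0 x; [exact: H| |by rewrite sin0 normr0].
  by rewrite -(normrN x) -(normrN (sin x)) -sinN; apply: H; rewrite oppr_gt0.
have [c _] : exists2 c, c \in `]0, x[%R & sin x - sin 0 = cos c * (x - 0).
  apply: (@MVT R sin cos 0 x x0).
  by apply: continuous_subspaceT => y; exact: continuous_sin.
rewrite sin0 !subr0 => ->; rewrite normrM ler_piMl//; exact: cos_max.
Qed.

Lemma one_sub_cos_le (x : R) : 1 - cos x <= x ^+ 2 / 2.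
Proof.
have -> : 1 - cos x = 2 * sin (x / 2) ^+ 2.
  by rewrite {1}[x]splitr cosD -!expr2 cos2sin2; ring.
have : sin (x / 2) ^+ 2 <= (x / 2) ^+ 2.
  rewrite -(real_normK (num_real (sin _))) -(real_normK (num_real (x / 2))).
  by rewrite lerXn2r ?nnegrE// normr_sin_le.
by lra.
Qed.

Context d (T : measurableType d) (P : probability T R) (alpha b : R) (th : T -> R).
Hypothesis mth : measurable_fun setT th.
Hypotheses (alpha_gt0 : 0 < alpha) (b_gt0 : 0 < b).
Hypothesis char_th : forall t, Ex P (fun w => cos (t * th w)) = expR (- (b * `|t| `^ alpha)).

Let tail r := [set w | r < `|th w|].

Let measurable_tail r : measurable (tail r).
Proof. by apply: measurable_set_gt; exact: measurableT_comp. Qed.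

Let one_sub_char t (g : T -> R) : bounded_measurable g ->
  (forall w, 1 - cos (t * th w) <= g w) -> 1 - expR (- (b * `|t| `^ alpha)) <= Ex P g.
Proof.
move=> bg h.
have bc : bounded_measurable (fun w => cos (t * th w)).
  by apply: bdm_cos; apply: measurable_funM => //; exact: measurable_cst.
have b1 : bounded_measurable (fun _ : T => 1 : R) by exact: bdm_cst.
rewrite -char_th -{1}(Ex_cst P 1) -(ExB P b1 bc); apply: le_Ex => //.
exact: bdmB.
Qed.

Let expR_le_inv (y : R) : 0 <= y -> expR (- y) <= (1 + y)^-1.
Proof.
by move=> y0; rewrite expRN lef_pV2 ?posrE ?expR_gt0 ?ltr_wpDr// expR_ge1Dx.
Qed.

(** At t = 1/q the characteristic function is exp (-1) <= 1/2. As 1 - cos is at most 1/8 where |th|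
    <= q/2 and at most 2 elsewhere, |th| > q/2 has probability at least 3/16, while for L = q/2 the
    left side is 1/8. *)
Lemma tail_lower_bound : exists2 L : R, 0 < L & 2 `^ (- alpha) / 8 * b / L `^ alpha < fine (P (tail L)).
Proof.
pose q := b `^ alpha^-1; have q0 : 0 < q by exact: powR_gt0.
have qa : q `^ alpha = b by rewrite /q -powRrM mulVf ?gt_eqF// powRr1// ltW.
exists (q / 2); first by rewrite divr_gt0.
have -> : 2 `^ (- alpha) / 8 * b / (q / 2) `^ alpha = 8^-1.
  rewrite powRM ?(ltW q0)// qa (_ : (2^-1) `^ alpha = 2 `^ (- alpha)); last first.
    by rewrite -powR_inv1// -powRrM mulN1r.
  by field; rewrite !gt_eqF// powR_gt0.
rewrite ltNge; apply/negP => h.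
have bi : bounded_measurable (\1_(tail (q / 2)) : T -> R) by exact: bdm_indic.
have b8 : bounded_measurable (fun _ : T => 8^-1 : R) by exact: bdm_cst.
have b2 := bdmZ 2 bi; have bg := bdmD b8 b2.
have := @one_sub_char q^-1 _ bg _.
have -> : b * `|q^-1| `^ alpha = 1.
  by rewrite ger0_norm ?invr_ge0 ?(ltW q0)// -powR_inv1 ?(ltW q0)// -powRrM mulN1r powRN qa mulfV// gt_eqF.
rewrite (ExD P b8 b2) Ex_cst (ExZ P 2 bi) Ex_indic// => main.
have e1 : expR (- 1) <= 2^-1 :> R by have := expR_le_inv ler01; rewrite (_ : 1 + 1 = 2 :> R)//; ring.
have : 1 - expR (- 1) <= 8^-1 + 2 * fine (P (tail (q / 2))).
  apply: main => w; rewrite indicE; case: (boolP (w \in _)) => [_|/negP wn].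
    by have := cos_geN1 (q^-1 * th w); rewrite mulr1; lra.
  rewrite mulr0 addr0; apply: (le_trans (one_sub_cos_le _)).
  have hw : `|th w| <= q / 2 by rewrite leNgt; apply/negP => ?; apply: wn; exact: mem_set.
  have : `|q^-1 * th w| <= 2^-1 by rewrite normrM gtr0_norm ?invr_gt0// ler_pdivrMl.
  rewrite ler_norml => /andP[? ?]; nra.
lra.
Qed.

Hypothesis alpha_lt2 : alpha < 2.

(** The growth factor, from one dyadic level to the next, of a second moment truncated there; it
    exceeds 1 because alpha < 2. *)
Let rho : R := 4 * 2 `^ (- alpha).

Let rho_gt1 : 1 < rho.
Proof.
have l2 : 0 < ln 2 :> R by apply: ln_gt0; rewrite ltr1n.
rewrite /rho /powR pnatr_eq0 /=.
have -> : 4 = expR (2 * ln 2) :> R.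
  by rewrite mulr_natl mulr2n expRD lnK ?posrE//; ring.
rewrite -expRD -[ltLHS]expR0 ltr_expR.
have -> : 2 * ln 2 + - alpha * ln 2 = (2 - alpha) * ln 2 :> R by ring.
by rewrite mulr_gt0// subr_gt0.
Qed.

(** Chosen so that the coefficient 2 heavy_const (1 + 1/(rho - 1)) found below is 1/4, less than the
    1/2 enforced by the characteristic function. *)
Definition heavy_const : R := (8 * (1 + (rho - 1)^-1))^-1.

Lemma heavy_const_gt0 : 0 < heavy_const.
Proof. by rewrite invr_gt0 mulr_gt0// ltr_wpDr// invr_ge0 subr_ge0 ltW. Qed.

Let sq_le (L0 : R) N w : 0 < L0 -> `|th w| <= L0 * 2 ^+ N ->
  th w ^+ 2 <= L0 ^+ 2 + \sum_(j < N) L0 ^+ 2 * 4 ^+ j.+1 * \1_(tail (L0 * 2 ^+ j)) w.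
Proof.
move=> L00; elim: N => [|N IH] h.
  rewrite big_ord0 addr0 expr0 mulr1 in h *.
  by rewrite -(real_normK (num_real (th w))) lerXn2r ?nnegrE// ltW.
have pos j : 0 <= L0 ^+ 2 * 4 ^+ j.+1 * \1_(tail (L0 * 2 ^+ j)) w :> R.
  by rewrite !mulr_ge0 ?exprn_ge0// ltW.
rewrite big_ord_recr /= addrA; have [h'|h'] := leP `|th w| (L0 * 2 ^+ N).
  by rewrite (le_trans (IH h'))// lerDl.
rewrite ler_wpDl ?addr_ge0 ?sumr_ge0 ?exprn_ge0 ?(ltW L00)//.
rewrite indicE mem_set// mulr1 -(real_normK (num_real (th w))).
have -> : L0 ^+ 2 * 4 ^+ N.+1 = (L0 * 2 ^+ N.+1) ^+ 2.
  by rewrite exprMn -!exprM mulnC exprM (_ : 2 ^+ 2 = 4)// expr2 -natrM.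
by rewrite lerXn2r ?nnegrE ?mulr_ge0 ?exprn_ge0 ?(ltW L00).
Qed.

(** If all tails beyond L0 were lighter, the truncated second moments at the levels L0 2^N would be
    geometric sums dominated by their last term. At t = 1/(L0 2^N) this gives 1 - E cos (t th) <=
    beta s^N / 4 + 4^-N / 2, whereas the exact value is at least beta s^N / 2 for large N; and 4^-N
    = s^N rho^-N is of smaller order. *)
Lemma heavy_tail (L0 : R) : 0 < L0 ->
  exists2 L : R, L0 <= L & heavy_const * b / L `^ alpha < fine (P (tail L)).
Proof.
move=> L00; apply: contrapT => /forall2NP hyp.
have small L : L0 <= L -> fine (P (tail L)) <= heavy_const * b / L `^ alpha.
  by move=> hL; case: (hyp L) => // /negP; rewrite -leNgt.
pose beta := b * L0 `^ (- alpha); have beta0 : 0 < beta by rewrite mulr_gt0// powR_gt0.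
pose s : R := 2 `^ (- alpha); have s0 : 0 < s by exact: powR_gt0.
have sj j : heavy_const * b / (L0 * 2 ^+ j) `^ alpha = heavy_const * beta * s ^+ j.
  rewrite powRM ?exprn_ge0 ?(ltW L00)// invfM /beta powRN.
  have -> : ((2 ^+ j) `^ alpha)^-1 = s ^+ j.
    by rewrite -[2 ^+ j]powR_mulrn// -powRrM -powRN /s -[RHS]powR_mulrn ?powR_ge0// -powRrM mulNr mulrC.
  by ring.
have tj j : fine (P (tail (L0 * 2 ^+ j))) <= heavy_const * beta * s ^+ j.
  by rewrite -sj; apply: small; rewrite ler_peMr ?(ltW L00)// exprn_ege1// ler1n.
have geo N : \sum_(j < N) rho ^+ j <= rho ^+ N / (rho - 1).
  rewrite ler_pdivlMr ?subr_gt0// mulrC -subrX1 gerBl//.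
have main N : 1 - expR (- (beta * s ^+ N)) <=
    (4 ^+ N)^-1 / 2 + 2 * heavy_const * beta * s ^+ N * (1 + (rho - 1)^-1).
  pose t := (L0 * 2 ^+ N)^-1.
  have t0 : 0 < t by rewrite invr_gt0 mulr_gt0// exprn_gt0.
  have tE : b * `|t| `^ alpha = beta * s ^+ N.
    rewrite gtr0_norm// /t -powR_inv1 ?mulr_ge0 ?exprn_ge0 ?(ltW L00)// -powRrM mulN1r powRN.
    have := sj N; rewrite -!mulrA => /(mulfI (lt0r_neq0 heavy_const_gt0)) ->; ring.
  have bi r : bounded_measurable (\1_(tail r) : T -> R) by exact: bdm_indic.
  pose S n w := \sum_(j < n) L0 ^+ 2 * 4 ^+ j.+1 * \1_(tail (L0 * 2 ^+ j)) w.
  have bS n : bounded_measurable (S n).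
    rewrite /S; elim: n => [|n IH]; first by under eq_fun do rewrite big_ord0; exact: bdm_cst.
    by under eq_fun do rewrite big_ord_recr /=; apply: bdmD => //; exact: bdmZ.
  have ES n : Ex P (S n) = \sum_(j < n) L0 ^+ 2 * 4 ^+ j.+1 * fine (P (tail (L0 * 2 ^+ j))).
    elim: n => [|n IH]; first by rewrite big_ord0 -(Ex_cst P 0); apply: eq_Ex => w; rewrite /S big_ord0.
    rewrite big_ord_recr /= -IH -Ex_indic// -(ExZ P _ (bi _)) -(ExD P (bS n) (bdmZ _ (bi _))).
    by apply: eq_Ex => w; rewrite /S big_ord_recr.
  have bL : bounded_measurable (fun _ : T => L0 ^+ 2) by exact: bdm_cst.
  have bLS := bdmD bL (bS N); have bZ := bdmZ (t ^+ 2 / 2) bLS; have bI := bdmZ 2 (bi (L0 * 2 ^+ N)).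
  have h := one_sub_char (bdmD bZ bI); rewrite -tE; apply: (le_trans (h _ _)).
    move=> w; have [hw|hw] := leP `|th w| (L0 * 2 ^+ N).
      apply: (le_trans (one_sub_cos_le _)).
      have hS : th w ^+ 2 <= L0 ^+ 2 + S N w := sq_le L00 hw.
      have i0 : 0 <= \1_(tail (L0 * 2 ^+ N)) w :> R by [].
      rewrite exprMn; have := ler_wpM2l (sqr_ge0 t) hS; lra.
    rewrite ler_wpDl//.
      apply: mulr_ge0; first by rewrite divr_ge0 ?sqr_ge0.
      apply: addr_ge0; [exact: sqr_ge0|apply: sumr_ge0 => j _].
      by rewrite !mulr_ge0 ?exprn_ge0 ?(ltW L00)//.
    rewrite indicE mem_set// mulr1; have := cos_geN1 (t * th w); lra.
  rewrite (ExD P bZ bI) (ExZ P _ bLS) (ExZ P 2 (bi _)) (ExD P bL (bS N)) Ex_cst ES Ex_indic//.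
  have t2 : t ^+ 2 * L0 ^+ 2 = (4 ^+ N)^-1.
    rewrite /t exprVn exprMn -exprM mulnC exprM (_ : 2 ^+ 2 = 4); last by rewrite expr2 -natrM.
    by field; rewrite !expf_neq0 ?gt_eqF.
  have sumE : \sum_(j < N) L0 ^+ 2 * 4 ^+ j.+1 * fine (P (tail (L0 * 2 ^+ j))) <=
      L0 ^+ 2 * (4 * (heavy_const * beta) * (rho ^+ N / (rho - 1))).
    apply: (@le_trans _ _ (\sum_(j < N) L0 ^+ 2 * (4 * (heavy_const * beta) * rho ^+ j))).
      apply: ler_sum => j _; rewrite -mulrA ler_wpM2l ?sqr_ge0//.
      have -> : 4 * (heavy_const * beta) * rho ^+ j = 4 ^+ j.+1 * (heavy_const * beta * s ^+ j).
        by rewrite /rho exprMn exprS; ring.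
      by rewrite ler_wpM2l ?exprn_ge0.
    rewrite -mulr_sumr -mulr_sumr ler_wpM2l ?sqr_ge0// ler_wpM2l ?geo//.
    by apply: mulr_ge0 => //; apply: mulr_ge0; apply: ltW => //; exact: heavy_const_gt0.
  have r4 : (4 ^+ N)^-1 * rho ^+ N = s ^+ N.
    by rewrite /rho exprMn mulrA mulVf ?mul1r// expf_neq0.
  have h1 : t ^+ 2 / 2 * (L0 ^+ 2 + \sum_(j < N) L0 ^+ 2 * 4 ^+ j.+1 * fine (P (tail (L0 * 2 ^+ j)))) <=
      (4 ^+ N)^-1 / 2 + 2 * heavy_const * beta * s ^+ N * (rho - 1)^-1.
    rewrite -[s ^+ N]r4 -t2.
    apply: (@le_trans _ _ (t ^+ 2 / 2 * (L0 ^+ 2 + L0 ^+ 2 * (4 * (heavy_const * beta) * (rho ^+ N / (rho - 1)))))).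
      by apply: ler_wpM2l; [rewrite divr_ge0 ?sqr_ge0|rewrite lerD2l].
    rewrite le_eqVlt; apply/orP; left; apply/eqP; move: rho rho_gt1 => r r1.
    by field; rewrite subr_eq0 gt_eqF.
  have h2 := tj N; lra.
have s1 : s < 1.
  have l2 : 0 < ln 2 :> R by apply: ln_gt0; rewrite ltr1n.
  by rewrite /s /powR pnatr_eq0 /= -[ltRHS]expR0 ltr_expR mulNr oppr_lt0 mulr_gt0.
have r1 : rho^-1 < 1 by rewrite invf_lt1// (lt_trans ltr01).
have r0 : 0 < rho^-1 by rewrite invr_gt0 (lt_trans ltr01).
have cs : (fun n => s ^+ n) @ \oo --> (0 : R) by apply: cvg_expr; rewrite gtr0_norm.
have cr : (fun n => rho^-1 ^+ n) @ \oo --> (0 : R) by apply: cvg_expr; rewrite gtr0_norm.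
have bi0 : 0 < beta^-1 by rewrite invr_gt0.
have b20 : 0 < beta / 2 by rewrite divr_gt0.
have [N _ hN] := filterI ((cvgr0Pnorm_lt _).1 cs _ bi0) ((cvgr0Pnorm_lt _).1 cr _ b20).
have [h1 h2] := hN N (leqnn N); rewrite /= !ger0_norm ?exprn_ge0 ?(ltW s0) ?(ltW r0)// in h1 h2.
have sN : 0 < s ^+ N by exact: exprn_gt0.
have y1 : beta * s ^+ N <= 1 by rewrite -ler_pdivlMl// mulr1 ltW.
have y0 : 0 < beta * s ^+ N by rewrite mulr_gt0.
have m := main N.
have e1 : 2 * heavy_const * beta * s ^+ N * (1 + (rho - 1)^-1) = beta * s ^+ N / 4.
  have q0 : 1 + (rho - 1)^-1 != 0 by rewrite gt_eqF// ltr_wpDr// invr_ge0 subr_ge0 ltW.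
  by rewrite /heavy_const; move: q0; set q := 1 + _ => q0; field.
have e2 : (4 ^+ N)^-1 = s ^+ N * rho^-1 ^+ N.
  have ->  : s ^+ N = (4 ^+ N)^-1 * rho ^+ N by rewrite /rho exprMn mulrA mulVf ?mul1r// expf_neq0.
  by rewrite -mulrA -exprMn mulfV ?expr1n ?mulr1// gt_eqF// (lt_trans ltr01).
have e3 : 1 - expR (- (beta * s ^+ N)) >= beta * s ^+ N / 2.
  have := expR_le_inv (ltW y0); set y := beta * s ^+ N in y0 y1 *.
  have : (1 + y)^-1 <= 1 - y / 2.
    rewrite -div1r ler_pdivrMr ?ltr_wpDr ?(ltW y0)//; nra.
  lra.
have e4 : s ^+ N * rho^-1 ^+ N < s ^+ N * (beta / 2) by rewrite ltr_pM2l.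
rewrite e1 e2 in m; lra.
Qed.

End TailsFromBelow.

(** * The support *)

Section Support.
Context (R : realType) (k : scalar_kind) (E : completeNormedModType (scalar_field R k)).
Local Notation K := (scalar_field R k).
Local Notation sor := (@scalar_of_real R k).
Local Notation mu := (@lebesgue_measure R).
Local Notation J := (measurableTypeR R).
Local Notation mE f := (measurable_fun setT (f : _ -> borelType E)).
Local Notation fms := (@finite_measure_set R _ (measurableTypeR R) mu).
Variable a : nat -> E.
Hypothesis aP : forall x (e : R), 0 < e -> exists n, rnorm (x - a n) < e.
Variables (alpha : R) (alpha_gt0 : 0 < alpha).
Context d (T : measurableType d) (P : probability T R) (M : set J -> T -> K).
Hypothesis msdM : forall f : simple_data E, mE (sd_integral M f).
Variable C : R.
Hypothesis C_ge0 : 0 <= C.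
Hypothesis simple_tail : forall (f : simple_data E) (r t : R), (alpha_mass alpha (sd_eval f) <= r%:E)%E -> 0 < t ->
  fine (P [set w | t < rnorm (sd_integral M f w)]) <= C * r / t `^ alpha.
Variable c : R.
Hypotheses (c_gt0 : 0 < c) (isoM : isotropic_measure alpha P c M).
Local Notation mass := (alpha_mass alpha).
Local Notation stab := (stab_int alpha P M).

Definition supp (X : T -> E) (x : E) := forall e : R, 0 < e -> 0 < fine (P [set w | rnorm (X w - x) < e]).

Let open_ball_measurable (x : E) (e : R) : measurable ([set y | rnorm (y - x) < e] : set (borelType E)).
Proof. by apply: sub_sigma_algebra; exact: open_rball. Qed.

Let measurable_near (X : T -> E) x e : mE X -> measurable [set w | rnorm (X w - x) < e].
Proof. by move=> mX; apply: measurable_set_lt; exact: (measurable_rnormB x mX). Qed.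

(** Outside the null balls X takes its values in the support. This converts estimates of
    probabilities into actual points of the support. *)
Lemma supp_event X (A : set T) : mE X -> measurable A -> 0 < fine (P A) -> exists2 w, A w & supp X (X w).
Proof.
move=> mX mA PA; apply: contrapT => /forall2NP h.
have : P A = 0%E.
  apply: (subset_measure0 (B := null_balls a P X)) => //.
  - exact: measurable_null_balls.
  - move=> w Aw; apply: contrapT => wN; case: (h w) => //; apply => e e0.
    by rewrite -lte_fin fineK ?probability_fin//; [exact: (notin_null_balls aP)|exact: measurable_near].
  - exact: null_balls_null.
by move=> P0; move: PA; rewrite P0 ltxx.
Qed.

Lemma supp_closed X x : mE X -> (forall e : R, 0 < e -> exists2 y, supp X y & rnorm (y - x) < e) -> supp X x.
Proof.
move=> mX h e e0; have e2 : 0 < e / 2 by rewrite divr_gt0.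
have [y sy yx] := h _ e2; apply: (lt_le_trans (sy _ e2)); apply: fine_prob_le; try exact: measurable_near.
move=> w /= wy; apply: (le_lt_trans (rdist_triangle (X w) y x)); lra.
Qed.

Variables (f : J -> E) (X : T -> E).
Hypotheses (ff : (mass f < +oo)%E) (fX : stab f X).

Let mX : mE X. Proof. by case: fX. Qed.

Let sorV (r : R) : r != 0 -> sor r^-1 * sor r = 1.
Proof. by move=> r0; rewrite -scalar_of_realM mulVf// scalar_of_real1. Qed.

Lemma supp_comb (p q : R) x y : 0 < p -> 0 < q -> supp X x -> supp X y ->
  supp X (sor ((p `^ alpha + q `^ alpha) `^ alpha^-1)^-1 *: (sor p *: x + sor q *: y)).
Proof.
move=> p0 q0 sx sy e e0; have law := stability_law aP alpha_gt0 msdM C_ge0 simple_tail isoM ff fX p0 q0.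
set r := (_ + _) `^ _ in law *.
have r0 : 0 < r by rewrite powR_gt0// addr_gt0// powR_gt0.
pose z := sor p *: x + sor q *: y.
have -> : [set w | rnorm (X w - sor r^-1 *: z) < e] = (fun w => sor r *: X w) @^-1` [set y | rnorm (y - z) < r * e].
  apply/funext => w /=; have zE : z = sor r *: (sor r^-1 *: z).
    by rewrite scalerA mulrC sorV ?scale1r// gt_eqF.
  by rewrite [in RHS]zE -scalerBr rnormZr gtr0_norm// ltr_pM2l.
rewrite -(law _ (open_ball_measurable z (r * e))).
pose e' := r * e / (p + q); have e'0 : 0 < e' by rewrite divr_gt0 ?mulr_gt0// addr_gt0.
have eE : r * e = e' * (p + q) by rewrite divfK// gt_eqF// addr_gt0.
have m1 := measurable_near x e' mX; have m2 := measurable_near y e' mX.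
apply: (@lt_le_trans _ _ (fine (prod_prob P P [set w | rnorm (X w.1 - x) < e' /\ rnorm (X w.2 - y) < e']))).
  have -> := prod_prob_setX P P m1 m2.
  by rewrite fineM ?probability_fin// mulr_gt0//; [exact: sx|exact: sy].
apply: fine_prob_le.
- have -> : [set w : T * T | rnorm (X w.1 - x) < e' /\ rnorm (X w.2 - y) < e'] =
    [set w | rnorm (X w - x) < e'] `*` [set w | rnorm (X w - y) < e'] by apply/seteqP; split => w.
  exact: measurableX.
- have mp : mE (fun w : T * T => sor p *: X w.1 + sor q *: X w.2).
    apply: (measurable_addE aP); apply: measurable_scaleE.
      by apply: (measurableT_comp mX).
    by apply: (measurableT_comp mX).
  by apply: measurable_set_lt; exact: (measurable_rnormB z mp).
- move=> w /= [h1 h2]; rewrite /z opprD addrACA -!scalerBr.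
  apply: (le_lt_trans (rnormD _ _)); rewrite !rnormZr !gtr0_norm//.
  have -> : r * e = p * e' + q * e' by rewrite eE; ring.
  by apply: ltrD; rewrite ltr_pM2l.
Qed.

Lemma supp_rotate (z : K) x : rnorm z = 1 -> supp X x -> supp X (z *: x).
Proof.
move=> z1 sx e e0.
have law := rotation_law aP alpha_gt0 msdM C_ge0 simple_tail isoM ff fX z1.
have := law _ (open_ball_measurable (z *: x) e) => lawE.
have -> : fine (P [set w | rnorm (X w - z *: x) < e]) = fine (P [set w | rnorm (z *: X w - z *: x) < e]).
  by congr fine; exact: lawE.
apply: (lt_le_trans (sx e e0)); rewrite le_eqVlt; apply/orP; left; apply/eqP; congr (fine (P _)).
by apply/funext => w /=; rewrite -scalerBr rnormZ z1 mul1r.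
Qed.

(** Some x lies in the support, by symmetry - x does too, and combining them with equal weights
    gives 0. *)
Lemma supp0 : supp X 0.
Proof.
have PT : 0 < fine (P setT) by rewrite fine_prob_setT.
have [w _ sw] := supp_event mX measurableT PT.
have sN : supp X (- X w).
  rewrite -scaleN1r; apply: supp_rotate => //.
  by rewrite -scalar_of_real1 -scalar_of_realN rnorm_of_real normrN normr1.
have := supp_comb ltr01 ltr01 sw sN.
by rewrite scalar_of_real1 !scale1r subrr scaler0.
Qed.

(** Combine x with 0, with a second weight q such that r^alpha + q^alpha = 1. *)
Lemma supp_shrink (r : R) x : 0 < r <= 1 -> supp X x -> supp X (sor r *: x).
Proof.
move=> /andP[r0 r1] sx; have [->|rn] := eqVneq r 1; first by rewrite scalar_of_real1 scale1r.
have rl : r < 1 by rewrite lt_neqAle rn.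
have ra : r `^ alpha < 1.
  rewrite -[ltRHS](congr1 (@^~ alpha) (@powR1 R)).
  by apply: gt0_ltr_powR; rewrite ?nnegrE ?(ltW r0).
pose q := (1 - r `^ alpha) `^ alpha^-1.
have q0 : 0 < q by rewrite powR_gt0// subr_gt0.
have qa : q `^ alpha = 1 - r `^ alpha by rewrite /q -powRrM mulVf ?gt_eqF// powRr1// subr_ge0 ltW.
have := supp_comb r0 q0 sx supp0.
rewrite qa addrC subrK (congr1 (@^~ alpha^-1) (@powR1 R)) invr1 scalar_of_real1 scale1r scaler0 addr0.
exact.
Qed.

(** Combining x with itself multiplies it by g = 2^(1 - 1/alpha), which exceeds 1 exactly when alpha
    > 1. Powers of g pass any r, and shrinking does the rest. *)
Lemma supp_cone (r : R) x : 1 < alpha -> 0 < r -> supp X x -> supp X (sor r *: x).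
Proof.
move=> a1 r0 sx; pose g : R := 2 / 2 `^ alpha^-1.
have g1 : 1 < g.
  rewrite /g ltr_pdivlMr ?powR_gt0// mul1r -[ltRHS](powRr1 (a := 2))//.
  have l2 : 0 < ln 2 :> R by apply: ln_gt0; rewrite ltr1n.
  by rewrite /powR pnatr_eq0 /= ltr_expR ltr_pM2r// invf_lt1.
have step n : supp X (sor (g ^+ n) *: x).
  elim: n => [|n IH]; first by rewrite expr0 scalar_of_real1 scale1r.
  have := supp_comb ltr01 ltr01 IH IH.
  rewrite scalar_of_real1 !scale1r (congr1 (@^~ alpha) (@powR1 R)).
  have -> : 1 + 1 = 2 :> R by ring.
  rewrite -scalerDl -scalar_of_realD scalerA -scalar_of_realM.
  suff -> : (2 `^ alpha^-1)^-1 * (g ^+ n + g ^+ n) = g ^+ n.+1 by [].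
  by rewrite exprSr; set h := g ^+ n; rewrite /g; ring.
have [n hn] : exists n, r <= g ^+ n.
  have g0 : 0 < g by rewrite (lt_trans ltr01).
  have cg : (fun n => g^-1 ^+ n) @ \oo --> (0 : R).
    by apply: cvg_expr; rewrite gtr0_norm ?invr_gt0// invf_lt1.
  have ri : 0 < r^-1 by rewrite invr_gt0.
  have [n _ hn] := (cvgr0Pnorm_lt _).1 cg _ ri; exists n.
  have := hn n (leqnn n); rewrite /= ger0_norm ?exprn_ge0 ?invr_ge0 ?(ltW g0)// exprVn.
  by rewrite ltf_pV2 ?posrE ?exprn_gt0// => /ltW.
have gn : 0 < g ^+ n by rewrite (lt_le_trans r0).
have := @supp_shrink (r / g ^+ n) _ _ (step n).
rewrite scalerA -scalar_of_realM divfK ?gt_eqF//; apply.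
by rewrite divr_gt0//= ler_pdivrMr// mul1r.
Qed.

Lemma supp_scale (z : K) x : 1 < alpha \/ rnorm z <= 1 -> supp X x -> supp X (z *: x).
Proof.
move=> hz sx; have [z0|z0] := eqVneq (rnorm z) 0.
  by rewrite (rnorm_eq0 z0) scale0r; exact: supp0.
have zp : 0 < rnorm z by rewrite lt_neqAle eq_sym z0 rnorm_ge0.
have -> : z *: x = sor (rnorm z) *: (((sor (rnorm z))^-1 * z) *: x).
  rewrite scalerA mulrA mulfV ?mul1r//.
  by apply: contra_neq z0 => /(congr1 (@scalar_Re R k)); rewrite -(scalar_of_real0 R k) !scalar_of_realK.
have srot := supp_rotate (rnorm_scalar_unit z0) sx.
by case: hz => hz; [exact: supp_cone|apply: supp_shrink; rewrite ?zp].
Qed.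

Lemma supp_split (B : set J) Y Z y z : measurable B -> stab (restrict_fun B f) Y ->
  stab (restrict_fun (~` B) f) Z -> supp Y y -> supp Z z -> supp X (y + z).
Proof.
move=> mB fY fZ sy sz e e0; have [_ mY _] := fY; have [_ mZ _] := fZ.
have law := split_law aP alpha_gt0 msdM C_ge0 simple_tail isoM mB ff fX fY fZ.
have -> : fine (P [set w | rnorm (X w - (y + z)) < e]) =
    fine (prod_prob P P [set w | rnorm (Y w.1 + Z w.2 - (y + z)) < e]).
  by congr fine; exact: (law _ (open_ball_measurable (y + z) e)).
have e20 : 0 < e / 2 by rewrite divr_gt0.
have m1 := measurable_near y (e / 2) mY; have m2 := measurable_near z (e / 2) mZ.
apply: (@lt_le_trans _ _ (fine (prod_prob P P [set w | rnorm (Y w.1 - y) < e / 2 /\ rnorm (Z w.2 - z) < e / 2]))).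
  have -> := prod_prob_setX P P m1 m2.
  by rewrite fineM ?probability_fin// mulr_gt0//; [exact: sy|exact: sz].
apply: fine_prob_le.
- have -> : [set w : T * T | rnorm (Y w.1 - y) < e / 2 /\ rnorm (Z w.2 - z) < e / 2] =
    [set w | rnorm (Y w - y) < e / 2] `*` [set w | rnorm (Z w - z) < e / 2] by apply/seteqP; split => w.
  exact: measurableX.
- have mp : mE (fun w : T * T => Y w.1 + Z w.2).
    by apply: (measurable_addE aP); [apply: (measurableT_comp mY)|apply: (measurableT_comp mZ)].
  by apply: measurable_set_lt; exact: (measurable_rnormB (y + z) mp).
- move=> w /= [h1 h2]; rewrite opprD addrACA; apply: (le_lt_trans (rnormD _ _)); lra.
Qed.

End Support.

(** * Multiples of essential values of u, and full support *)

Section FullSupport.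
Context (R : realType) (k : scalar_kind) (E : completeNormedModType (scalar_field R k)).
Local Notation K := (scalar_field R k).
Local Notation sor := (@scalar_of_real R k).
Local Notation mu := (@lebesgue_measure R).
Local Notation J := (measurableTypeR R).
Local Notation mE f := (measurable_fun setT (f : _ -> borelType E)).
Local Notation fms := (@finite_measure_set R _ (measurableTypeR R) mu).
Variable a : nat -> E.
Hypothesis aP : forall x (e : R), 0 < e -> exists n, rnorm (x - a n) < e.
Variables (alpha : R) (alpha_gt0 : 0 < alpha).
Context d (T : measurableType d) (P : probability T R) (M : set J -> T -> K).
Hypothesis msdM : forall f : simple_data E, mE (sd_integral M f).
Variable C : R.
Hypothesis C_ge0 : 0 <= C.
Hypothesis simple_tail : forall (f : simple_data E) (r t : R), (alpha_mass alpha (sd_eval f) <= r%:E)%E -> 0 < t ->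
  fine (P [set w | t < rnorm (sd_integral M f w)]) <= C * r / t `^ alpha.
Variable c : R.
Hypotheses (c_gt0 : 0 < c) (isoM : isotropic_measure alpha P c M).
Local Notation mass := (alpha_mass alpha).
Local Notation stab := (stab_int alpha P M).
Local Notation supp := (supp P).

Lemma stab_exists (f : J -> E) : mE f -> (mass f < +oo)%E -> exists X, stab f X.
Proof.
move=> mf ff; apply: (stab_int_exists aP alpha_gt0 msdM C_ge0 simple_tail mf) => e e0.
have [phi [n [_ hphi]]] := disjoint_approx aP alpha_gt0 mf ff e0.
by exists (sd_of phi).
Qed.

Variables (f : J -> E) (X : T -> E).
Hypotheses (ff : (mass f < +oo)%E) (fX : stab f X).

Let mf : mE f. Proof. by case: fX. Qed.
Let mX : mE X. Proof. by case: fX. Qed.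

Lemma restrict_mass (B : set J) : measurable B -> (mass (restrict_fun B f) < +oo)%E.
Proof.
move=> mB; apply: le_lt_trans ff; apply: (alpha_mass_le alpha_gt0) => //.
- exact: measurable_restrict_fun.
- by move=> t; exact: restrict_fun_le.
Qed.

(** By hypothesis M(B) exceeds L more often than the error of replacing f by y on B exceeds L', so
    with positive probability M(B) is large and the error is not. The integral over the complement
    of B is independent and contributes 0, a point of its support. *)
Lemma supp_direction (B : set J) (y : E) (eta L L' : R) : fms B -> 0 < L' -> 0 <= eta ->
  (forall t, B t -> rnorm (f t - y) <= eta) ->
  C * 4 `^ alpha * (eta `^ alpha * fine (mu B)) / L' `^ alpha < fine (P [set w | L < `|scalar_Re (M B w)|]) ->
  exists (z : K) (v : E), [/\ supp X (z *: y + v), L < rnorm z & rnorm v <= L'].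
Proof.
move=> fB L'0 eta0 By hP; have [mB finB] := fB; have mB' : measurable (~` B) by exact: measurableC.
have [Y fY] := stab_exists (measurable_restrict_fun mB mf) (restrict_mass mB).
have [Z fZ] := stab_exists (measurable_restrict_fun mB' mf) (restrict_mass mB').
have [_ mY _] := fY.
pose phi : simple_data E := SimpleData (fun _ : 'I_1 => y) (fun=> fB).
have evalE t : sd_eval phi t = restrict_fun B (fun=> y) t by rewrite /sd_eval /ksum big_ord1.
have intE w : sd_integral M phi w = M B w *: y by rewrite /sd_integral /ksum big_ord1.
have fW := stab_int_sub aP alpha_gt0 msdM fY (stab_int_simple aP alpha_gt0 P msdM phi).
have [mfW mW _] := fW.
have massW : (mass (fun t : J => (restrict_fun B f t - sd_eval phi t)%R) <= (eta `^ alpha * fine (mu B))%:E)%E.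
  apply: (@le_trans _ _ (\int[mu]_t ((eta `^ alpha)%:E * (\1_B t)%:E))%E).
    apply: ge0_le_integral => //.
    - by move=> t _; rewrite lee_fin powR_ge0.
    - exact: measurable_rnorm_powR.
    - by apply: measurable_funeM; apply/measurable_EFinP; exact: measurable_indic.
    - move=> t _; rewrite evalE /restrict_fun -scalerBr -EFinM lee_fin indicE [in leRHS]indicE.
      case: (boolP (t \in B)) => [/set_mem tB|_].
        by rewrite scale1r mulr1; apply: ge0_ler_powR; rewrite ?nnegrE ?rnorm_ge0 ?(ltW alpha_gt0)// By.
      by rewrite scale0r rnorm0 powR0 ?gt_eqF// mulr0.
  rewrite ge0_integralZl//; last 2 first.
  - by apply/measurable_EFinP; exact: measurable_indic.
  - by rewrite lee_fin powR_ge0.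
  by rewrite integral_indic// setIT EFinM fineK// ge0_fin_numE.
have tailW := stab_int_tail aP alpha_gt0 msdM C_ge0 simple_tail fW massW L'0.
have triv1 : trivIset setT (fun _ : 'I_1 => B) by move=> i j _ _ _; rewrite (ord1 i) (ord1 j).
have [mM _] := isoM (fun _ : 'I_1 => fB) triv1.
have mS1 : measurable [set w | L < `|scalar_Re (M B w)|].
  by apply: measurable_set_gt; apply: measurableT_comp => //; exact: (mM ord0).1.
pose W w := Y w - sd_integral M phi w.
have mS2 : measurable [set w | L' < rnorm (W w)] by apply: measurable_set_gt; exact: measurable_rnorm.
pose A := [set w | L < `|scalar_Re (M B w)|] `&` ~` [set w | L' < rnorm (W w)].
have mA : measurable A by apply: measurableI => //; exact: measurableC.
have PA : 0 < fine (P A).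
  have : fine (P [set w | L < `|scalar_Re (M B w)|]) <= fine (P A) + fine (P [set w | L' < rnorm (W w)]).
    apply: le_trans (fine_prob_setU P mA mS2); apply: fine_prob_le => //; first exact: measurableU.
    move=> w hw; have [h|h] := pselect (L' < rnorm (W w)); [by right|by left].
  move: tailW hP; rewrite /W; set q := fine (P A); lra.
have [w [Aw1 Aw2] sw] := supp_event aP mY mA PA.
exists (M B w), (W w); split.
- have -> : M B w *: y + W w = Y w + 0 by rewrite addr0 /W intE addrC subrK.
  apply: (supp_split aP alpha_gt0 msdM C_ge0 simple_tail isoM ff fX mB fY fZ sw).
  exact: (supp0 aP alpha_gt0 msdM C_ge0 simple_tail isoM (restrict_mass mB') fZ).
- exact: (lt_le_trans Aw1 (rnorm_Re _)).
- by rewrite leNgt; apply/negP.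
Qed.

Let tail_const : R := if 1 < alpha then 2 `^ (- alpha) / 8 else heavy_const alpha.

Let tail_const_gt0 : 0 < tail_const.
Proof.
rewrite /tail_const; case: ifPn => [_|]; first by apply: divr_gt0 => //; exact: powR_gt0.
by rewrite -leNgt => a1; apply: heavy_const_gt0; rewrite (le_lt_trans a1)// ltr1n.
Qed.

(** Both lower bounds in a common form: either alpha > 1, and multiples in the support are
    unrestricted, or L can be taken as large as desired. *)
Let big_tail (B : set J) : fms B -> 0 < fine (mu B) -> forall L0 : R, 0 < L0 ->
  exists L, [/\ 0 < L, 1 < alpha \/ L0 <= L &
    tail_const * (c * fine (mu B)) / L `^ alpha < fine (P [set w | L < `|scalar_Re (M B w)|])].
Proof.
move=> fB B0 L0 L00.
have b0 : 0 < c * fine (mu B) by rewrite mulr_gt0.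
have triv1 : trivIset setT (fun _ : 'I_1 => B) by move=> i j _ _ _; rewrite (ord1 i) (ord1 j).
have [mM cM] := isoM (fun _ : 'I_1 => fB) triv1.
have char t : Ex P (fun w => cos (t * scalar_Re (M B w))) = expR (- (c * fine (mu B) * `|t| `^ alpha)).
  have [h _] := cM (fun=> sor t).
  transitivity (Ex P (fun w => cos (\sum_(i < 1) scalar_Re (sor t * M B w)))).
    by apply: eq_Ex => w; rewrite big_ord1 scalar_Re_ofM.
  by rewrite h big_ord1 rnorm_of_real.
have mRe := (mM ord0).1; rewrite /tail_const.
have [a1|a1] := ltP 1 alpha.
- have [L Lp hL] := tail_lower_bound mRe alpha_gt0 b0 char.
  by exists L; split => //; left.
- have a2 : alpha < 2 by rewrite (le_lt_trans a1)// ltr1n.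
  have [L Lp hL] := heavy_tail mRe alpha_gt0 b0 char a2 L00.
  by exists L; split => //; [exact: lt_le_trans Lp|right].
Qed.

Lemma supp_line (y : E) (z : K) : (forall e : R, 0 < e -> (0 < mu [set t | (rnorm (f t - y) < e)%R])%E) ->
  supp X (z *: y).
Proof.
move=> good.
have [z0|z0] := eqVneq (rnorm z) 0.
  rewrite (rnorm_eq0 z0) scale0r.
  exact: (supp0 aP alpha_gt0 msdM C_ge0 simple_tail isoM ff fX).
have zp : 0 < rnorm z by rewrite lt_neqAle eq_sym z0 rnorm_ge0.
apply: supp_closed => // e e0.
(* An error v of norm at most q |z'| has norm at most q |z| = e / 2 after multiplication by z /
   z'. *)
pose q := e / (2 * rnorm z); have q0 : 0 < q by rewrite divr_gt0 ?mulr_gt0.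
have D0 : 0 <= C * 4 `^ alpha by rewrite mulr_ge0 ?powR_ge0.
(* The error tail at level q L is compared with the tail of M(B) at level L. The factors m(B) and
   L^alpha cancel, so r, and hence eta, can be fixed before B and L are known. *)
pose r := tail_const * c * q `^ alpha / (C * 4 `^ alpha + 1).
have r0 : 0 < r.
  by apply: divr_gt0; [apply: mulr_gt0; [exact: mulr_gt0|exact: powR_gt0]|exact: ltr_wpDl].
pose eta := r `^ alpha^-1; have eta0 : 0 < eta by exact: powR_gt0.
have etaE : eta `^ alpha = r by rewrite /eta -powRrM mulVf ?gt_eqF// powRr1// ltW.
pose B n : set J := [set t | rnorm (f t - y) < eta] `&` `[(- n%:R), n%:R]%classic.
have mball : measurable [set t | rnorm (f t - y) < eta] by apply: measurable_set_lt; exact: (measurable_rnormB y mf).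
have fB n : fms (B n).
  split; first exact: measurableI.
  apply: (@le_lt_trans _ _ (mu `[(- n%:R)%R, n%:R]%classic)).
    apply: le_measure; rewrite ?inE//; first exact: measurableI.
    by move=> t [_].
  by rewrite lebesgue_measure_itv /=; case: ifP => _; rewrite ?ltry// -EFinD ltry.
have [n Bn] : exists n, 0 < fine (mu (B n)).
  apply: contrapT => /forallNP h.
  have B0 n : mu (B n) = 0%E.
    have : 0 <= fine (mu (B n)) by exact: fine_ge0.
    rewrite le_eqVlt => /orP[/eqP h0|]; last by move=> /h.
    by rewrite -(@fineK _ (mu (B n))) -?h0// ge0_fin_numE//; exact: (fB n).2.
  have := good eta eta0; suff -> : mu [set t | rnorm (f t - y) < eta] = 0%E by rewrite ltxx.
  apply: (measure_negligible mball).
  apply: (@negligibleS _ _ _ mu (\bigcup_n B n)).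
    move=> t /= ty; exists (Num.truncn `|t|).+1 => //; split => //=.
    rewrite in_itv /= -ler_norml.
    by have /truncn_itv/andP[_ /ltW] := normr_ge0 t.
  apply: (@negligible_bigcup _ _ _ mu B) => n.
  by have [mBn _] := fB n; exists (B n); split; [exact: mBn|exact: B0|].
have [L [L0 hL tL]] := big_tail (fB n) Bn zp.
have qL0 : 0 < q * L by rewrite mulr_gt0.
have [|z' [v [sv zL vL]]] := @supp_direction (B n) y eta L (q * L) (fB n) qL0 (ltW eta0) (fun t h => ltW h.1).
  apply: le_lt_trans tL; rewrite powRM ?(ltW q0) ?(ltW L0)// etaE.
  have qa : 0 < q `^ alpha by exact: powR_gt0.
  have La : 0 < L `^ alpha by exact: powR_gt0.
  rewrite [leLHS](_ : _ = C * 4 `^ alpha * (r * fine (mu (B n))) / q `^ alpha / L `^ alpha); last first.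
    by move: qa La; set u1 := q `^ alpha; set u2 := L `^ alpha => qa La; field; rewrite !gt_eqF.
  rewrite ler_wpM2r ?invr_ge0 ?(ltW La)// ler_pdivrMr//.
  have -> : C * 4 `^ alpha * (r * fine (mu (B n))) = (C * 4 `^ alpha * r) * fine (mu (B n)) by ring.
  have -> : tail_const * (c * fine (mu (B n))) * q `^ alpha = (tail_const * c * q `^ alpha) * fine (mu (B n)) by ring.
  rewrite ler_wpM2r ?(ltW Bn)// /r mulrA ler_pdivrMr ?ltr_wpDl// mulrC ler_wpM2l ?lerDl//.
  by rewrite !mulr_ge0 ?(ltW tail_const_gt0) ?(ltW c_gt0) ?(ltW qa).
have z'p : 0 < rnorm z' by rewrite (lt_trans L0).
have z'0 : z' != 0 by apply: contraTneq z'p => ->; rewrite rnorm0 ltxx.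
have zz : rnorm (z / z') * rnorm z' = rnorm z by rewrite -rnorm_mul divfK.
have sE : (z / z') *: (z' *: y + v) = z *: y + (z / z') *: v by rewrite scalerDr scalerA divfK.
exists (z *: y + (z / z') *: v).
  rewrite -sE; apply: (supp_scale aP alpha_gt0 msdM C_ge0 simple_tail isoM ff fX) => //.
  (* When only shrinking is allowed, L >= |z| ensures |z / z'| <= 1. *)
  case: hL => hL; [by left|right].
  by rewrite -(ler_pM2r z'p) zz mul1r (le_trans hL)// ltW.
rewrite addrC addKr rnormZ.
apply: (@le_lt_trans _ _ (rnorm (z / z') * (q * rnorm z'))).
  by rewrite ler_wpM2l ?rnorm_ge0// (le_trans vL)// ler_pM2l// ltW.
have -> : rnorm (z / z') * (q * rnorm z') = e / 2 by rewrite mulrCA zz /q; field; rewrite gt_eqF.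
lra.
Qed.

(** The density hypothesis is applied to the null set of those t for which u t is not an essential
    value of u; for all other t every multiple of u t is in the support. *)
Lemma supp_total :
  (forall N : set J, measurable N -> mu N = 0%E -> dense (linear_span [set f t | t in ~` N])) ->
  forall x, supp X x.
Proof.
move=> hd x; pose N := null_balls a mu f.
have mN : measurable N by exact: measurable_null_balls.
have good t (z : K) : ~ N t -> supp X (z *: f t).
  by move=> Nt; apply: supp_line => e e0; exact: (notin_null_balls aP).
(* With p = q = 1, [supp_comb] divides a sum by g. Since all multiples are available, the
   coefficients are multiplied by g beforehand. *)
pose g : R := 2 `^ alpha^-1; have g0 : 0 < g by exact: powR_gt0.
have span n (z : 'I_n -> K) (y : 'I_n -> E) : (forall i, [set f t | t in ~` N] (y i)) ->
    supp X (\sum_(i < n) z i *: y i).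
  elim: n z y => [|n IH] z y hy.
    by rewrite big_ord0; exact: (supp0 aP alpha_gt0 msdM C_ge0 simple_tail isoM ff fX).
  have s1 : supp X (\sum_(i < n) (sor g * z (widen_ord (leqnSn n) i)) *: y (widen_ord (leqnSn n) i)).
    exact: (IH (fun i => sor g * z (widen_ord (leqnSn n) i)) (fun i => y (widen_ord (leqnSn n) i))).
  have s2 : supp X ((sor g * z ord_max) *: y ord_max).
    by have [t Nt <-] := hy ord_max; exact: good.
  have := supp_comb aP alpha_gt0 msdM C_ge0 simple_tail isoM ff fX ltr01 ltr01 s1 s2.
  rewrite (congr1 (@^~ alpha) (@powR1 R)) scalar_of_real1 !scale1r.
  have -> : 1 + 1 = 2 :> R by ring.
  rewrite -/g big_ord_recr /=.
  under eq_bigr do rewrite -scalerA; rewrite -scaler_sumr -[(sor g * _) *: _]scalerA -scalerDr scalerA.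
  by rewrite -scalar_of_realM mulVf ?gt_eqF// scalar_of_real1 scale1r.
apply: supp_closed => // e e0.
have [|y [yx [n [z [w [hw yE]]]]]] := hd N mN (null_balls_null a mu mf) [set y | rnorm (y - x) < e] _ (open_rball x e).
  by exists x; rewrite /= subrr rnorm0.
by exists y => //; rewrite yE; exact: span.
Qed.

End FullSupport.

(** * The theorem *)

Section UnitIntervals.
Context (R : realType) (k : scalar_kind) (alpha : R) (alpha_gt0 : 0 < alpha).
Context d (Omega : measurableType d) (P : probability Omega R).
Local Notation K := (scalar_field R k).
Local Notation mu := (@lebesgue_measure R).
Variable M : set (measurableTypeR R) -> Omega -> K.
Hypothesis stM : stable_random_measure P mu alpha M.

(** Stable type gives information only where an independent stable sequence exists. Real parts of M
    on disjoint unit intervals, normalized by c^(-1/alpha), provide one on Omega. *)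
Lemma iid_stable_sequence : exists theta : nat -> Omega -> R,
  [/\ forall n, measurable_fun setT (theta n), mutually_independent P theta &
    forall n t, expectation_expi P (fun w => t * theta n w) = (expR (- `|t| `^ alpha))%:C%C].
Proof.
have [c c0 isoM] := stable_isotropic_measure alpha_gt0 stM.
have [_ indM _] : random_measure P mu M by move: M stM {isoM}; case: (k) => M' [].
pose A (n : nat) : set (measurableTypeR R) := `[n%:R, n.+1%:R[%classic.
have muA n : mu (A n) = 1%E.
  by rewrite /A lebesgue_measure_itv /= lte_fin ltr_nat ltnSn -EFinD -[n.+1%:R]natr1 addrAC subrr add0r.
have fA n : finite_measure_set mu (A n) by split; [exact: measurable_itv|apply: (eq_ind_r (fun x => (x < +oo)%E) _ (muA n)); exact: ltry].
have tA n : trivIset setT (fun i : 'I_n => A i).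
  move=> i j _ _ [t []]; rewrite /A /= !in_itv /= => /andP[i1 i2] /andP[j1 j2].
  apply/val_inj/eqP; rewrite eqn_leq -ltnS -(ltnS j).
  by rewrite -!(ltr_nat R) (le_lt_trans i1 j2) (le_lt_trans j1 i2).
pose s := c `^ (- alpha^-1); have s0 : 0 < s by exact: powR_gt0.
have sa : s `^ alpha = c^-1.
  by rewrite /s -powRrM mulNr mulVf ?gt_eqF// -[in RHS]powR_inv1// ltW.
have mM n := measurable_random_measure stM (fA n).
exists (fun n w => s * scalar_Re (M (A n) w)); split.
- by move=> n; apply: measurable_funM; [exact: measurable_cst|exact: (mM n).1].
(* Independence of M is stated for families over ordinals, so the list r is moved into ['I_N] with N
   above all its entries. *)
- move=> r B ur mB; pose N := (\max_(i <- r) i).+1.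
  have rN i : i \in r -> (i < N)%N by move=> ir; rewrite ltnS; exact: leq_bigmax_seq.
  pose r' := pmap (insub : nat -> option 'I_N) r.
  have r'E : map val r' = r.
    rewrite /r' (pmap_filter (@insubK _ _ 'I_N)); apply/all_filterP/allP => i /rN iN.
    by rewrite insubT.
  have ur' : uniq r' by rewrite -(map_inj_uniq val_inj) r'E.
  pose B' (i : 'I_N) : set (borelType K) := [set y | B i (s * scalar_Re y)].
  have mB' i : measurable (B' i).
    rewrite -[X in measurable X]setTI.
    have mm : measurable_fun setT ((fun y => s * scalar_Re y) : borelType K -> measurableTypeR R).
      by apply: measurable_funM; [exact: measurable_cst|exact: measurable_scalar_Re].
    exact: (mm measurableT _ (mB i)).
  have := indM N _ (fun i => fA i) (tA N) r' B' ur' mB'.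
  by rewrite -[in X in _ -> X]r'E !big_map.
- move=> n t; have t1 : trivIset setT (fun _ : 'I_1 => A n) by move=> i j _ _ _; rewrite (ord1 i) (ord1 j).
  have [_ /(_ (fun=> scalar_of_real k (t * s)))[h1 h2]] := isoM _ _ (fun _ : 'I_1 => fA n) t1.
  have E w : \sum_(i < 1) scalar_Re (scalar_of_real k (t * s) * M (A n) w) = t * (s * scalar_Re (M (A n) w)).
    by rewrite big_ord1 scalar_Re_ofM mulrA.
  rewrite /expectation_expi; congr Complex.
  + transitivity (Ex P (fun w => cos (\sum_(i < 1) scalar_Re (scalar_of_real k (t * s) * M (A n) w)))).
      by apply: eq_Ex => w; rewrite E.
    apply: etrans h1 _; rewrite big_ord1 muA mulr1 rnorm_of_real normrM powRM// (gtr0_norm s0) sa.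
    by rewrite mulrCA mulfV ?mulr1// gt_eqF.
  + transitivity (Ex P (fun w => sin (\sum_(i < 1) scalar_Re (scalar_of_real k (t * s) * M (A n) w)))).
      by apply: eq_Ex => w; rewrite E.
    exact: h2.
Qed.

End UnitIntervals.

Theorem theorem3p1 (R : realType) (k : scalar_kind)
  (E : completeNormedModType (scalar_field R k)) (alpha : R)
  (d : measure_display) (Omega : measurableType d) (P : probability Omega R)
  (T : R -> {linear E -> E}) (u : R -> E)
  (M : set (measurableTypeR R) -> Omega -> scalar_field R k) :
  0 < alpha <= 2 ->
  separable_space E ->
  infinite_dimensional E ->
  stable_type alpha E ->
  C0_semigroup T ->
  in_Lspace (@lebesgue_measure R) alpha u ->
  (forall t s : R, 0 <= s -> T s (u t) = u (t - s)) ->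
  (forall N : set (measurableTypeR R), measurable N ->
     lebesgue_measure N = 0%E ->
     dense (linear_span [set u t | t in ~` N])) ->
  stable_random_measure P (@lebesgue_measure R) alpha M ->
  let v := stable_integral P (@lebesgue_measure R) alpha M u in
  [/\ invariant_measure T (distribution P v),
      strongly_mixing T (distribution P v),
      full_support (distribution P v)
    & symmetric_stable_vector alpha v].
Proof.
move=> /andP[alpha_gt0 alpha_le2] sepE _ stE [contT _ _ _] [mu_u fin_u] Tu dense_u stM v.
have [a aP] := separable_dense_seq sepE.
have [c c0 isoM] := stable_isotropic_measure alpha_gt0 stM.
have addM := random_measure_additive alpha_gt0 stM.
have [theta [mth indth charth]] := iid_stable_sequence alpha_gt0 stM.
have [C0 C0_gt0 wt] := weak_tail aP alpha_gt0 stE mth indth charth.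
pose C := 2 * C0 * 2 `^ alpha * c.
have C1 : 0 <= 2 * C0 * 2 `^ alpha by rewrite !mulr_ge0 ?powR_ge0// ltW.
have C_ge0 : 0 <= C by rewrite mulr_ge0// ltW.
have tailM := ksum_tail alpha_gt0 aP (ltW C0_gt0) wt.
have msdM (f : simple_data E) := measurable_sd_integral aP f isoM.
have stail (f : simple_data E) (r t : R) (fr : (alpha_mass alpha (sd_eval f) <= r%:E)%E) (t0 : 0 < t) :
    fine (P [set w | t < rnorm (sd_integral M f w)]) <= C * r / t `^ alpha.
  exact: (sd_integral_tail aP alpha_gt0 addM (ltW c0) isoM tailM fr t0 C1).
have fv : stab_int alpha P M u v := stable_integral_stab_int aP alpha_gt0 msdM C_ge0 stail mu_u fin_u.
have [_ mv _] := fv.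
have Tv s : 0 <= s -> stab_int alpha P M (fun t => u (t - s)) (fun w => T s (v w)).
  move=> s0; have [b b0 Tb] := linear_bounded (contT s s0).
  have -> : (fun t => u (t - s)) = (fun t => T s (u t)) by apply/funext => t; rewrite Tu.
  exact: (stab_int_map aP alpha_gt0 msdM b0 (contT s s0) Tb fv).
have inv : invariant_measure T (distribution P v).
  by move=> A s mA s0; have := shift_law aP alpha_gt0 msdM C_ge0 stail isoM fin_u fv (Tv s s0) mA.
split => //.
- split => // A B mA mB.
  pose J s := fine (P (v @^-1` A `&` (fun w => T s (v w)) @^-1` B)).
  have mTv s : 0 <= s -> measurable_fun setT ((fun w => T s (v w)) : Omega -> borelType E).
    by move=> s0; have [_ h _] := Tv s s0.
  have mvA : measurable (v @^-1` A) by rewrite -[X in measurable X]setTI; exact: (mv measurableT _ mA).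
  have mvB : measurable (v @^-1` B) by rewrite -[X in measurable X]setTI; exact: (mv measurableT _ mB).
  have mTB s : 0 <= s -> measurable ((fun w => T s (v w)) @^-1` B).
    by move=> s0; rewrite -[X in measurable X]setTI; exact: (mTv s s0 measurableT _ mB).
  (* For s < 0 nothing is known of [T s], and the event may fail to be measurable; the limit only
     sees large s. *)
  have JE : \forall s \near +oo%R, (J s)%:E = distribution P v (A `&` T s @^-1` B).
    near=> s; rewrite /J fineK//; apply: probability_fin; apply: measurableI => //.
    by apply: mTB; near: s; exact: nbhs_pinfty_ge.
  apply: (cvg_trans (near_eq_cvg JE)).
  have -> : (distribution P v A * distribution P v B)%E =
      (fine (P (v @^-1` A)) * fine (P (v @^-1` B)))%:E by rewrite EFinM !fineK ?probability_fin.
  apply: cvg_EFin; first exact: nearW.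
  (* Five errors: two for passing from indicators to test functions in the joint probability, two
     more in the product, and one for mixing on test functions. *)
  apply/cvgrPdist_le => e e0; pose dl := e / 5; have dl0 : 0 < dl by rewrite divr_gt0.
  have [LF [F [_ FL hF]]] := lipschitz_L1_dense P mv mA dl0.
  have [LG [G [_ GL hG]]] := lipschitz_L1_dense P mv mB dl0.
  have [S hS] := mixing_lipschitz aP alpha_gt0 msdM C_ge0 stail isoM fin_u fv FL GL dl0.
  near=> s.
  have s0 : 0 <= s by near: s; exact: nbhs_pinfty_ge.
  have Ss : S < s by near: s; apply: nbhs_pinfty_gt; exact: num_real.
  have bF (Z : Omega -> E) (mZ : measurable_fun setT (Z : Omega -> borelType E)) :
    bounded_measurable (fun w => F (Z w)) := bdm_lipschitz01 FL mZ.
  have bG (Z : Omega -> E) (mZ : measurable_fun setT (Z : Omega -> borelType E)) :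
    bounded_measurable (fun w => G (Z w)) := bdm_lipschitz01 GL mZ.
  have bA (Z : Omega -> E) (mZ : measurable_fun setT (Z : Omega -> borelType E)) :
    bounded_measurable (fun w => \1_A (Z w) : R) := bdm_indic_comp R mA mZ.
  have bB (Z : Omega -> E) (mZ : measurable_fun setT (Z : Omega -> borelType E)) :
    bounded_measurable (fun w => \1_B (Z w) : R) := bdm_indic_comp R mB mZ.
  (* By invariance, G approximates the indicator of B as well at [T s (v w)] as at [v w]. *)
  have hG' : Ex P (fun w => `|\1_B (T s (v w)) - G (T s (v w))|) <= dl.
    apply: le_trans hG; rewrite le_eqVlt; apply/orP; left; apply/eqP.
    apply: (@same_law_Ex R _ (borelType E) _ _ P _ _ P _ _ (fun y => `|\1_B y - G y|) (mTv s s0) mv).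
      apply: bdm_norm; apply: bdmB; first exact: bdm_indic.
      exact: (@bdm_lipschitz01 _ _ _ _ (borelType E) id G LG GL (@measurable_id _ _ _)).
    by move=> B' mB'; exact: (inv B' s mB' s0).
  have JEx : J s = Ex P (fun w => \1_A (v w) * \1_B (T s (v w))).
    rewrite /J -Ex_indic//; last by apply: measurableI => //; exact: mTB.
    by apply: eq_Ex => w; rewrite !indicE in_setI -natrM mulnb; congr (_%:R).
  have PA : fine (P (v @^-1` A)) = Ex P (fun w => \1_A (v w)) by rewrite -Ex_indic.
  have PB : fine (P (v @^-1` B)) = Ex P (fun w => \1_B (v w)) by rewrite -Ex_indic.
  have i01 (D : set E) x : 0 <= (\1_D x : R) <= 1.
    by rewrite indicE; case: (_ \in _); rewrite ?lexx ?ler01.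
  have [F01 _] := FL; have [G01 _] := GL.
  have Ex01 (f : Omega -> R) : bounded_measurable f -> (forall w, 0 <= f w <= 1) -> 0 <= Ex P f <= 1.
    move=> bf f01; apply/andP; split.
      by rewrite -(Ex_cst P 0); apply: le_Ex => //; [exact: bdm_cst|move=> w; have /andP[] := f01 w].
    by rewrite -(Ex_cst P 1); apply: le_Ex => //; [exact: bdm_cst|move=> w; have /andP[] := f01 w].
  have c1 : `|J s - Ex P (fun w => F (v w) * G (T s (v w)))| <= dl + dl.
    rewrite JEx; have b1 := bdmM (bA _ mv) (bB _ (mTv s s0)); have b2 := bdmM (bF _ mv) (bG _ (mTv s s0)).
    have d1 := bdm_norm (bdmB (bA _ mv) (bF _ mv)); have d2 := bdm_norm (bdmB (bB _ (mTv s s0)) (bG _ (mTv s s0))).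
    apply: (le_trans (normr_ExB P b1 b2)); apply: (le_trans _ (lerD hF hG')).
    rewrite -(ExD P d1 d2); apply: le_Ex; [by apply: bdm_norm; exact: bdmB|exact: bdmD|].
    by move=> w; exact: dist_mul01.
  have c2 := hS s _ Ss (Tv s s0).
  have c3 : `|Ex P (fun w => F (v w)) * Ex P (fun w => G (v w)) -
      fine (P (v @^-1` A)) * fine (P (v @^-1` B))| <= dl + dl.
    have eA := Ex01 _ (bA _ mv) (fun w => i01 A (v w)); have eB := Ex01 _ (bB _ mv) (fun w => i01 B (v w)).
    have eF := Ex01 _ (bF _ mv) (fun w => F01 (v w)); have eG := Ex01 _ (bG _ mv) (fun w => G01 (v w)).
    rewrite PA PB distrC; apply: (le_trans (dist_mul01 eA eB eF eG)); apply: lerD.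
      by apply: le_trans hF; exact: (normr_ExB P (bA _ mv) (bF _ mv)).
    by apply: le_trans hG; exact: (normr_ExB P (bB _ mv) (bG _ mv)).
  have eE : e = dl + dl + dl + (dl + dl) by rewrite /dl; field.
  rewrite distrC eE; apply: (le_trans _ (lerD (lerD c1 c2) c3)).
  apply: le_trans (lerD (ler_normD _ _) (lexx _)); apply: le_trans (ler_normD _ _).
  by rewrite subrKA subrKA /comp.
- move=> U oU [x Ux]; have [e e0 eU] := (open_rnorm U).1 oU x Ux.
  have := supp_total aP alpha_gt0 msdM C_ge0 stail c0 isoM fin_u fv dense_u x e0.
  have mU : measurable (U : set (borelType E)) by exact: sub_sigma_algebra.
  have mvU : measurable (v @^-1` U) by rewrite -[X in measurable X]setTI; exact: mv.
  have mball : measurable [set w | rnorm ((v w : E) - x) < e].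
    by apply: measurable_set_lt; exact: (measurable_rnormB x mv).
  rewrite -lte_fin fineK ?probability_fin// => /lt_le_trans; apply.
  by apply: le_measure; rewrite ?inE// => w /=; exact: eU.
split.
(* The law is strictly stable, so the translation vector is 0. The given copies live on an arbitrary
   space, but by independence their joint law is that of the two coordinates of Omega x Omega, where
   [stability_law] applies. *)
- move=> p q p0 q0; exists 0 => d' O' P' X' indX X'v B mB.
  have -> : (fun w => 0 + scalar_of_real k ((p `^ alpha + q `^ alpha) `^ alpha^-1) *: (v w : E)) =
      (fun w => scalar_of_real k ((p `^ alpha + q `^ alpha) `^ alpha^-1) *: (v w : E)).
    by apply/funext => w; rewrite add0r.
  rewrite -(stability_law aP alpha_gt0 msdM C_ge0 stail isoM fin_u fv p0 q0 mB).
  pose D : set (borelType E * borelType E) :=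
    (fun y => scalar_of_real k p *: (y.1 : E) + scalar_of_real k q *: (y.2 : E)) @^-1` B.
  have mD : measurable D.
    have mm : measurable_fun setT ((fun y : borelType E * borelType E =>
        scalar_of_real k p *: (y.1 : E) + scalar_of_real k q *: (y.2 : E)) : _ -> borelType E).
      by apply: (measurable_addE aP); apply: measurable_scaleE; [exact: measurable_fst|exact: measurable_snd].
    by rewrite -[X in measurable X]setTI; exact: (mm measurableT _ mB).
  have mX i : measurable_fun setT (X' i : O' -> borelType E) by exact: measurable_funPT.
  have m1 : measurable_fun setT (fun w : Omega * Omega => v w.1 : borelType E) by apply: (measurableT_comp mv).
  have m2 : measurable_fun setT (fun w : Omega * Omega => v w.2 : borelType E) by apply: (measurableT_comp mv).
  have mpre (B' : set (borelType E)) : measurable B' -> measurable (v @^-1` B').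
    by move=> mB'; rewrite -[X in measurable X]setTI; exact: (mv measurableT _ mB').
  have := @indep_law R _ (borelType E) _ (borelType E) _ _ P' _ _ (prod_prob P P) (X' false) (X' true)
    (fun w => v w.1) (fun w => v w.2) (mX false) (mX true) m1 m2 _ _ _ _ D mD; apply.
  + by move=> B' mB'; rewrite (X'v false B' mB') -(prod_prob_fst P P (mpre _ mB')).
  + by move=> B' mB'; rewrite (X'v true B' mB') -(prod_prob_snd P P (mpre _ mB')).
  + move=> B1 B2 mB1 mB2.
    have := indX [:: false; true] (fun i => if i then B2 else B1) isT (fun i => ltac:(by case: i)).
    by rewrite !big_cons !big_nil setIT mule1.
  + move=> B1 B2 mB1 mB2; apply: etrans (prod_prob_setX P P (mpre _ mB1) (mpre _ mB2)) _.
    congr (_ * _)%E; first exact: esym (prod_prob_fst P P (mpre _ mB1)).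
    exact: esym (prod_prob_snd P P (mpre _ mB2)).
- have n1 : rnorm (-1 : scalar_field R k) = 1.
    by rewrite -scalar_of_real1 -scalar_of_realN rnorm_of_real normrN normr1.
  have := rotation_law aP alpha_gt0 msdM C_ge0 stail isoM fin_u fv n1.
  by under [X in same_distribution _ _ _ X]eq_fun do rewrite scaleN1r.
Unshelve. all: by end_near. Qed.
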